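(* (a) Let $G$ be a connected finite-dimensional Lie group, let $\widetilde{LG}$ be a disjoint commutative central extension of $LG$ equipped with a multiplicative fusion product $\lambda$, and let $\widetilde{\Omega G}$ be its restriction to $\Omega G$. Then the strict homomorphism of diffeological crossed modules $$X^{\mathrm W}(\widetilde{\Omega G},\lambda)\longrightarrow X(\widetilde{\Omega G})$$ given by the inclusions $\widetilde{\Omega_{(0,\pi)}G}^{\mathrm{dflg}}\hookrightarrow\widetilde{\Omega_{(0,\pi)}G}$ and $P_eG_{\mathrm{si}}\hookrightarrow P_eG$ is a weak equivalence of diffeological crossed modules. (b) Let $G$ be a compact, connected, simple, simply connected Lie group, let $k\in\mathbb{Z}$, and let $\widetilde{\Omega G}$ be a central extension of $\Omega G$ of level $k$. Then the pair $(\tilde r,\mathrm{rep})$ is a strict homomorphism of crossed modules of Fréchet Lie groups $$X(\widetilde{\Omega G})\longrightarrow X^{\mathrm{BCSS}}(G,k)$$ and is a weak equivalence.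
   Context: **Paths and loops.** A smooth map is flat at a point if all its derivatives of all orders $\ge1$ vanish there. $S^1=\mathbb{R}/2\pi\mathbb{Z}$, $LG=C^\infty(S^1,G)$; $\Omega G\subset LG$ consists of loops $\gamma$ with $\gamma(0)=e$ that are flat at $0$. For $I\subset S^1$, $L_IG=\{\gamma\in LG\mid\gamma(s)=e\text{ for }s\notin I\}$ and $\Omega_IG=L_IG\cap\Omega G$. $P_eG$ is the Fréchet Lie group of smooth paths $\gamma:[0,\pi]\to G$ with $\gamma(0)=e$, flat at both endpoints. For paths $\gamma_1,\gamma_2$ with common endpoints, $\gamma_1\cup\gamma_2$ is the loop equal to $\gamma_1(s)$ on $[0,\pi]$ and $\gamma_2(2\pi-s)$ on $[\pi,2\pi]$. **Central extensions.** A central extension of a Fréchet Lie group $H$ is an exact sequence $1\to \mathrm{U}(1)\to\widetilde H\xrightarrow{\pi}H\to 1$ of Lie groups with $\mathrm{U}(1)$ central such that $\widetilde H$ is a smooth principal $\mathrm{U}(1)$-bundle over $H$; $\widetilde K:=\pi^{-1}(K)$ for $K\subset H$. A central extension of $LG$ (resp. $\Omega G$) is disjoint commutative if $\widetilde{L_IG},\widetilde{L_JG}$ (resp. $\widetilde{\Omega_IG},\widetilde{\Omega_JG}$) commute elementwise for all disjoint $I,J\subset S^1$. If $G$ is semisimple and simply connected, all central extensions of $\Omega G$ are disjoint commutative. **Crossed modules.** A crossed module of Fréchet Lie (or diffeological) groups is a smooth homomorphism $t:H\to K$ with a smooth action $\alpha$ of $K$ on $H$ by group homomorphisms such that $t(\alpha_g(h))=g\,t(h)g^{-1}$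 and $\alpha_{t(h)}(k)=hkh^{-1}$. A strict homomorphism $(t:H\to K,\alpha)\to(t':H'\to K',\alpha')$ is a pair of smooth homomorphisms $F_1:H\to H'$, $F_0:K\to K'$ with $t'F_1=F_0t$ and $F_1(\alpha_g(h))=\alpha'_{F_0(g)}(F_1(h))$. It is a weak equivalence if the associated butterfly is reversible, i.e. the complex $$H\xrightarrow{\kappa}H'\rtimes K\xrightarrow{j}K',\qquad \kappa(h)=(F_1(h)^{-1},t(h)),\quad j(h',g)=t'(h')F_0(g),$$ where $K$ acts on $H'$ by $\alpha'$ through $F_0$, is a short exact sequence of groups exhibiting $H'\rtimes K$ as a (locally trivial) principal $H$-bundle over $K'$, in the respective category. **The crossed module $X(\widetilde{\Omega G})$.** For a disjoint commutative $\widetilde{\Omega G}$, it is $t:\widetilde{\Omega_{(0,\pi)}G}\to P_eG$, $t(\Phi)=\pi(\Phi)|_{[0,\pi]}$, with action $\alpha_\gamma(\Phi)=\widetilde{\gamma\cup\gamma}\,\Phi\,(\widetilde{\gamma\cup\gamma})^{-1}$, where $\widetilde{\gamma\cup\gamma}\in\widetilde{\Omega G}$ is any lift of $\gamma\cup\gamma$. **The crossed module $X^{\mathrm W}(\widetilde{\Omega G},\lambda)$.** Fréchet manifolds are regarded as diffeological spaces. $P_eG_{\mathrm{si}}$ is the diffeological group of smooth paths $[0,\pi]\to G$ starting at $e$ with sitting instants (constant near both endpoints); $P_eG_{\mathrm{si}}^{[k]}$ is the $k$-fold fibre product over endpoint evaluation to $G$. A fusion product on $\widetilde{LG}$ is a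 bundle morphism $\lambda:\mathrm{pr}_{12}^*\cup^*\widetilde{LG}\otimes\mathrm{pr}_{23}^*\cup^*\widetilde{LG}\to\mathrm{pr}_{13}^*\cup^*\widetilde{LG}$ of principal $\mathrm{U}(1)$-bundles over $P_eG_{\mathrm{si}}^{[3]}$, associative over $P_eG_{\mathrm{si}}^{[4]}$; it is multiplicative if it is a group homomorphism. Such $\lambda$ determines a unique smooth group homomorphism $i:P_eG_{\mathrm{si}}\to\widetilde{LG}$ with $\pi(i(\gamma))=\gamma\cup\gamma$ that is neutral with respect to $\lambda$. Let $\widetilde{\Omega G}^{\mathrm{dflg}}=P_eG_{\mathrm{si}}^{[2]}\times_{LG}\widetilde{LG}$ (fibre product along $\cup$), $s(\gamma_1,\gamma_2,\Phi)=\gamma_2$, $t(\gamma_1,\gamma_2,\Phi)=\gamma_1$, and $\widetilde{\Omega_{(0,\pi)}G}^{\mathrm{dflg}}=\ker(s)$. Then $X^{\mathrm W}(\widetilde{\Omega G},\lambda)$ is $t:\widetilde{\Omega_{(0,\pi)}G}^{\mathrm{dflg}}\to P_eG_{\mathrm{si}}$ with action $(\gamma,\Phi)\mapsto i(\gamma)\,\Phi\, i(\gamma)^{-1}$. **The crossed module $X^{\mathrm{BCSS}}(G,k)$** (Baez–Crans–Stevenson–Schreiber). Let $G$ be compact, connected, simple, simply connected with Lie algebra $\mathfrak g$. $P_eG^{\mathrm{BCSS}}\subset C^\infty([0,2\pi],G)$ is the Fréchet Lie group of smooth paths starting at $e$ (no flatness), and $\Omega G^{\mathrm{BCSS}}\subset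 P_eG^{\mathrm{BCSS}}$ the subgroup of closed paths. Let $b_1$ be the positive definite invariant symmetric bilinear form on $\mathfrak g$ normalized so that the left-invariant 2-form on $\Omega G^{\mathrm{BCSS}}$ defined by $(X,Y)\mapsto\int_0^{2\pi}b_1(X,Y')\,d\theta$ has group of periods exactly $2\pi\mathbb{Z}$. $\widetilde{\Omega G}^{\mathrm{BCSS}}$ is the (unique up to isomorphism) central extension of $\Omega G^{\mathrm{BCSS}}$ whose Lie algebra is $\Omega\mathfrak g\oplus\mathbb{R}$ with bracket $[(X,a),(Y,b)]=([X,Y],\omega_k(X,Y))$, $\omega_k(X,Y)=k\int_0^{2\pi}b_1(X,Y')\,d\theta$. The crossed module is $t^{\mathrm{BCSS}}:\widetilde{\Omega G}^{\mathrm{BCSS}}\to P_eG^{\mathrm{BCSS}}$ (projection followed by inclusion), with $\alpha^{\mathrm{BCSS}}$ the smooth action of $P_eG^{\mathrm{BCSS}}$ by automorphisms of $\widetilde{\Omega G}^{\mathrm{BCSS}}$, trivial on $\mathrm{U}(1)$, covering pointwise conjugation on $\Omega G^{\mathrm{BCSS}}$, whose infinitesimal action is $p\cdot(\ell,c)=\bigl([p,\ell],\,k\int_0^{2\pi}b_1(p,\ell')\,d\theta\bigr)$ for $p$ in the Lie algebra of $P_eG^{\mathrm{BCSS}}$ and $(\ell,c)\in\Omega\mathfrak g\oplus\mathbb{R}$. **The comparison maps in (b).** $\mathrm{rep}:P_eG\to P_eG^{\mathrm{BCSS}}$, $\mathrm{rep}(\gamma)(x)=\gamma(x/2)$; $r:\Omega_{(0,\pi)}G\to\Omega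 G^{\mathrm{BCSS}}$, $r(\eta)=\mathrm{rep}(\eta|_{[0,\pi]})$. That $\widetilde{\Omega G}$ has level $k$ means that its restriction to $\Omega_{(0,\pi)}G$ is identified with the pullback central extension $r^*\widetilde{\Omega G}^{\mathrm{BCSS}}$; then $\tilde r:\widetilde{\Omega_{(0,\pi)}G}\to\widetilde{\Omega G}^{\mathrm{BCSS}}$ is the induced map covering $r$. *)

(* Defs.v *)
From HB Require Import structures.
From mathcomp Require Import all_boot all_order all_algebra.
From mathcomp Require Import all_classical all_reals all_analysis.
From mathcomp Require Import zify ring lra.
From mathcomp.real_closed Require Import complex.

Set Implicit Arguments.
Unset Strict Implicit.
Unset Printing Implicit Defensive.

Import Order.TTheory GRing.Theory Num.Theory numFieldNormedType.Exports.

Local Open Scope ring_scope.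
Local Open Scope classical_set_scope.

Section CalculusLemmas.
Context {R : realType}.

Lemma diff_epsP (V W : normedModType R) (f : V -> W) (x : V) (df : V -> W) :
  (f \o shift x = cst (f x) + df +o_ (0 : V) id) <->
  (forall e : R, 0 < e ->
     \forall h \near (0 : V), `|f (h + x) - f x - df h| <= e * `|h|).
Proof.
split.
  move=> /eqaddoP E e e0; have := E e e0; apply: filterS => h.
  by rewrite /= !fctE /cst opprD addrA.
move=> E; apply/eqaddoP => e e0; apply: filterS (E e e0) => h.
by rewrite /= !fctE /cst opprD addrA.
Qed.

Lemma near_eq_diff (V W : normedModType R) (f g : V -> W) (x : V) :
  (\forall y \near x, f y = g y) -> differentiable f x ->
  differentiable g x /\ ('d g x = 'd f x :> (V -> W)).
Proof.
move=> fg df.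
have fgx : f x = g x by exact: nbhs_singleton fg.
have E : g \o shift x = cst (g x) + 'd f x +o_ (0 : V) id.
  apply/diff_epsP => e e0.
  have /diff_epsP/(_ e e0) := diff_locally df.
  have fg0 : \forall h \near (0 : V), f (h + x) = g (h + x).
    by move: fg; rewrite (near_shift 0 x); apply: filterS => h /=; rewrite subr0.
  by apply: filterS2 fg0 => h ->; rewrite fgx.
have c : continuous ('d f x) by exact: diff_continuous.
have dE := diff_unique c E.
split; last exact: dE.
by apply/diff_locallyP; rewrite dE; exact: (conj c E).
Qed.
End CalculusLemmas.

Section Smooth.
Context {R : realType}.

(* C^n on U: for n > 0, Frechet differentiable on U with all the directional
   derivatives x |-> 'd f x v of class C^(n-1). Only used with V of finite
   dimension, where this is the usual notion. *)
Fixpoint Cn (V W : normedModType R) (n : nat) (U : set V) (f : V -> W) : Prop :=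
  if n is m.+1 then
    (forall x, U x -> differentiable f x) /\
    (forall v, Cn m U (fun x => 'd f x v))
  else forall x, U x -> {for x, continuous f}.

Definition Cinf (V W : normedModType R) (U : set V) (f : V -> W) : Prop :=
  forall n, Cn n U f.

Context {V : normedModType R}.
Implicit Types W : normedModType R.

Lemma CnS W n (U : set V) (f : V -> W) : Cn n.+1 U f -> Cn n U f.
Proof.
elim: n f => [|n IH] f [fd fD].
  by move=> x /fd; exact: differentiable_continuous.
by split => // v; exact/IH.
Qed.

Lemma Cn_sub W n (U U' : set V) (f : V -> W) : U' `<=` U -> Cn n U f -> Cn n U' f.
Proof.
move=> sU; elim: n f => [|n IH] f /=; first by move=> fc x /sU; exact: fc.
by move=> [fd fD]; split=> [x /sU /fd //|v]; exact: IH.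
Qed.

Lemma Cn_loc W n (U : set V) (f : V -> W) :
  (forall x, U x -> exists2 U' : set V, U' x & Cn n U' f) -> Cn n U f.
Proof.
elim: n f => [|n IH] f H /=; first by move=> x /H[U' U'x]; exact.
split=> [x /H[U' U'x [+ _]]|v]; first exact.
by apply: IH => x /H[U' U'x [_ /(_ v)]] ?; exists U'.
Qed.

Lemma Cn_eq W n (U : set V) (f g : V -> W) : open U ->
  (forall x, U x -> f x = g x) -> Cn n U f -> Cn n U g.
Proof.
move=> oU; elim: n f g => [|n IH] f g fg /=.
  move=> fc x Ux; have := fc x Ux; rewrite /prop_for /continuous_at -(fg x Ux).
  apply: cvg_trans; apply: near_eq_cvg.
  by apply: filterS (open_nbhs_nbhs (conj oU Ux)) => y /fg.
move=> [fd fD].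
have N x : U x -> \forall y \near x, f y = g y.
  by move=> Ux; apply: filterS (open_nbhs_nbhs (conj oU Ux)) => y /fg.
split=> [x Ux|v]; first by have [] := near_eq_diff (N x Ux) (fd x Ux).
apply: IH (fD v) => x Ux.
have [_ dE] := near_eq_diff (N x Ux) (fd x Ux).
exact: esym (congr1 (fun h : V -> W => h v) dE).
Qed.

Lemma Cn_cst W n (U : set V) (c : W) : Cn n U (cst c).
Proof.
elim: n c => [|n IH] c /=; first by move=> x _; exact: cst_continuous.
split=> [x _|v]; first exact: differentiable_cst.
by rewrite (_ : (fun _ => _) = cst 0) //; apply/funext => x /=; rewrite diff_cst.
Qed.

Lemma Cn_lin W n (U : set V) (f : {linear V -> W}) : continuous f -> Cn n U f.
Proof.
case: n => [|n] fc /=; first by move=> x _; exact: fc.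
split=> [x _|v]; first exact: linear_differentiable.
rewrite (_ : (fun _ => _) = cst (f v)); first exact: Cn_cst.
by apply/funext => x; rewrite diff_lin.
Qed.

Lemma CnD W n (U : set V) (f g : V -> W) :
  open U -> Cn n U f -> Cn n U g -> Cn n U (f \+ g).
Proof.
move=> oU; elim: n f g => [|n IH] f g /=.
  by move=> fc gc x Ux; apply: continuousD; [exact: fc|exact: gc].
move=> [fd fD] [gd gD]; split=> [x Ux|v].
  by apply: differentiableD; [exact: fd|exact: gd].
apply: Cn_eq (IH _ _ (fD v) (gD v)) => // x Ux.
exact: esym (congr1 (fun h : V -> W => h v) (diffD (fd x Ux) (gd x Ux))).
Qed.

Lemma Cn_sum W n (U : set V) m (f : 'I_m -> V -> W) :
  open U -> (forall i, Cn n U (f i)) -> Cn n U (fun x => \sum_(i < m) f i x).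
Proof.
move=> oU; elim: m f => [|m IH] f H.
  rewrite (_ : (fun _ => _) = cst 0); first exact: Cn_cst.
  by apply/funext => x; rewrite big_ord0.
rewrite (_ : (fun _ => _) =
  (fun x => \sum_(i < m) f (widen_ord (leqnSn m) i) x) \+ f ord_max).
  by apply: CnD => //; apply: IH.
by apply/funext => x; rewrite big_ord_recr.
Qed.

Lemma is_diffZf W (a : V -> R) (f : V -> W) x :
  differentiable a x -> differentiable f x ->
  differentiable (fun y => a y *: f y) x /\
  ('d (fun y => a y *: f y) x = (fun v => 'd a x v *: f x + a x *: 'd f x v) :> (V -> W)).
Proof.
move=> da df.
have bl : bilinear_for (GRing.Scale.Law.clone _ _ *:%R _)
    (GRing.Scale.Law.clone _ _ *:%R _) (fun (k : R) (w : W) => k *: w).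
  by split=> [u'|u] c y z /=; [rewrite scalerDl scalerA|rewrite scalerDr !scalerA mulrC].
pose blM := bilinear_isBilinear.Build R R W W _ _ _ bl.
pose b : {bilinear R -> W -> W} := HB.pack (fun (k : R) (w : W) => k *: w) blM.
have bc : continuous (fun p : R * W => b p.1 p.2) by exact: scale_continuous.
have dp := differentiable_pair da df.
have db := differentiable_bilin (a x, f x) bc.
split; first exact: (differentiable_comp dp db).
have -> := diff_comp dp db.
apply/funext => v.
transitivity ((fun q : R * W => b (a x) q.2 + b q.1 (f x)) ('d (fun y => (a y, f y)) x v)).
  have E1 := congr1 (fun h : R * W -> W => h ('d (fun y => (a y, f y)) x v)) (diff_bilin (a x, f x) bc).
  rewrite /= in E1 *. by rewrite -E1.
have E2 := congr1 (fun h : V -> R * W => h v) (diff_pair da df).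
by rewrite E2; exact: addrC.
Qed.

Lemma CnZ W n (U : set V) (a : V -> R) (f : V -> W) :
  open U -> Cn n U a -> Cn n U f -> Cn n U (fun x => a x *: f x).
Proof.
move=> oU; elim: n a f => [|n IH] a f.
  by move=> ac fc x Ux; apply: continuousZ; [exact: ac|exact: fc].
move=> aC fC; have [ad aD] := aC; have [fd fD] := fC; split=> [x Ux|v].
  by have [] := is_diffZf (ad x Ux) (fd x Ux).
have aC' := CnS aC; have fC' := CnS fC.
apply: Cn_eq (CnD oU (IH _ _ (aD v) fC') (IH _ _ aC' (fD v))) => // x Ux.
have [_ dE] := is_diffZf (ad x Ux) (fd x Ux).
exact: esym (congr1 (fun h : V -> W => h v) dE).
Qed.

End Smooth.

Section Post.
Context {R : realType} {V W W' : normedModType R}.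
Lemma Cn_post n (U : set V) (L : {linear W -> W'}) (f : V -> W) :
  open U -> continuous L -> Cn n U f -> Cn n U (fun x => L (f x)).
Proof.
move=> oU Lc; elim: n f => [|n IH] f.
  by move=> fc x Ux; apply: (@continuous_comp _ _ _ f L); [exact: fc|exact: Lc].
move=> [fd fD]; split=> [x Ux|v].
  by apply: (@differentiable_comp _ _ _ _ f L); [exact: fd|exact: linear_differentiable].
have E x : U x -> L ('d f x v) = 'd (fun x => L (f x)) x v.
  move=> Ux; rewrite (@diff_comp _ _ _ _ f L) ?diff_lin//; first exact: fd.
  exact: linear_differentiable.
exact: Cn_eq E (IH _ (fD v)).
Qed.
End Post.

Section Coord.
Context {R : realType}.
Definition coordlin_fun m n (i : 'I_m) (j : 'I_n) (M : 'M[R]_(m, n)) : R := M i j.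
Lemma coordlin_linear m n i j : linear (@coordlin_fun m n i j).
Proof. by move=> a u v; rewrite /coordlin_fun !mxE. Qed.
HB.instance Definition _ m n i j := GRing.isLinear.Build R 'M[R]_(m, n) R _
  (@coordlin_fun m n i j) (@coordlin_linear m n i j).
Definition coordlin m n i j : {linear 'M[R]_(m, n) -> R} := @coordlin_fun m n i j.
End Coord.

Section Comp.
Context {R : realType} {V W : normedModType R} {m : nat}.

Lemma Cn_comp n (U : set V) (O : set 'rV[R]_m) (g : V -> 'rV[R]_m) (f : 'rV[R]_m -> W) :
  open U -> (forall x, U x -> O (g x)) -> Cn n U g -> Cn n O f -> Cn n U (f \o g).
Proof.
move=> oU gO; elim: n f g gO => [|n IH] f g gO.
  by move=> gc fc x Ux; apply: continuous_comp; [exact: gc|exact/fc/gO].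
move=> gC fC; have [gd gD] := gC; have [fd fD] := fC; split=> [x Ux|v].
  by apply: differentiable_comp; [exact: gd|exact/fd/gO].
have gC' := CnS gC.
have C (i : 'I_m) : Cn n U (fun x => ('d g x v) ord0 i : R).
  exact: (Cn_post oU (L := coordlin ord0 i) (@coord_continuous _ _ _ ord0 i) (gD v)).
have E x : 'd f (g x) ('d g x v) =
    \sum_(i < m) ('d g x v) ord0 i *: 'd f (g x) (delta_mx ord0 i).
  rewrite {1}(row_sum_delta ('d g x v)) linear_sum.
  by apply: eq_bigr => i _; rewrite linearZ.
have S : Cn n U (fun x => \sum_(i < m) ('d g x v) ord0 i *: 'd f (g x) (delta_mx ord0 i)).
  apply: Cn_sum => // i; apply: CnZ => //.
  exact: (IH (fun y => 'd f y (delta_mx ord0 i)) g gO gC' (fD _)).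
apply: Cn_eq S => // x Ux.
rewrite -E; have dE := diff_comp (gd x Ux) (fd _ (gO x Ux)).
exact: esym (congr1 (fun h : V -> W => h v) dE).
Qed.
End Comp.

Section Derive1n.
Context {R : realType}.
Implicit Types (V : normedModType R) (W : set R).

Lemma Cinf_derive1 V W (f : R -> V) : open W -> Cinf W f -> Cinf W (derive1 f).
Proof.
move=> oW fC n; have [fd fD] := fC n.+1.
apply: Cn_eq (fD 1) => // x Wx.
by rewrite -derive1E'//; exact: fd.
Qed.

Lemma derive1n_eq V W (f g : R -> V) k : open W ->
  (forall x, W x -> f x = g x) -> forall x, W x -> (derive1n (k) f) x = (derive1n (k) g) x.
Proof.
move=> oW; elim: k f g => [|k IH] f g fg x Wx; first exact: fg.
rewrite !derive1Sn; apply: IH => // y Wy; rewrite !derive1E; apply: near_eq_derive.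
by apply: filterS (open_nbhs_nbhs (conj oW Wy)) => z /fg.
Qed.

Lemma Cinf_diff V W (f : R -> V) x : Cinf W f -> W x -> differentiable f x.
Proof. by move=> fC Wx; have [+ _] := fC 1%N; exact. Qed.

Lemma derive1nD V W (f g : R -> V) k : open W -> Cinf W f -> Cinf W g ->
  forall x, W x -> (derive1n (k) (f \+ g)) x = (derive1n (k) f) x + (derive1n (k) g) x.
Proof.
move=> oW; elim: k f g => [|k IH] f g fC gC x Wx; first by [].
rewrite !derive1Sn -IH//; [|exact: Cinf_derive1..].
apply: (derive1n_eq _ oW) => // y Wy; rewrite /= !derive1E deriveD//.
  by apply: diff_derivable; exact: Cinf_diff fC Wy.
by apply: diff_derivable; exact: Cinf_diff gC Wy.
Qed.

Lemma derive1n_sum V W m (f : 'I_m -> R -> V) k : open W -> (forall i, Cinf W (f i)) ->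
  forall x, W x -> (derive1n (k) (fun s => \sum_(i < m) f i s)) x = \sum_(i < m) (derive1n (k) (f i)) x.
Proof.
move=> oW; elim: m f => [|m IH] f fC x Wx.
  rewrite big_ord0 (_ : (fun _ => _) = cst 0); last by apply/funext => s; rewrite big_ord0.
  elim: k => [//|k IHk]; rewrite derive1Sn (_ : (derive1 (cst 0)) = cst 0) //.
  by apply/funext => s; rewrite derive1_cst.
rewrite big_ord_recr /= -(IH (fun i => f (widen_ord (leqnSn m) i)))//.
rewrite -(derive1nD _ oW)//; last by move=> n; apply: Cn_sum => // i; exact: fC.
by apply: (derive1n_eq _ oW) => // s _; rewrite big_ord_recr.
Qed.

Lemma derive1n_lin V V' W (L : {linear V -> V'}) (f : R -> V) k : open W ->
  continuous L -> Cinf W f -> forall x, W x -> (derive1n (k) (fun s => L (f s))) x = L ((derive1n (k) f) x).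
Proof.
move=> oW Lc; elim: k f => [|k IH] f fC x Wx; first by [].
rewrite !derive1Sn -IH//; last exact: Cinf_derive1.
apply: (derive1n_eq _ oW) => // y Wy.
have fd := Cinf_diff fC Wy; have Ld := linear_differentiable (f y) Lc.
rewrite derive1E' ?derive1E'//; last exact: (differentiable_comp fd Ld).
have dE := congr1 (fun h : R -> V' => h 1) (diff_comp fd Ld).
by rewrite [LHS]dE/= diff_lin.
Qed.

Lemma derive1n_Z0 V W (h : R -> R) (a : R -> V) k t : open W -> W t ->
  Cinf W h -> Cinf W a -> (forall j, (derive1n (j) h) t = 0) ->
  (derive1n (k) (fun s => h s *: a s)) t = 0.
Proof.
move=> oW Wt; elim: k h a => [|k IH] h a hC aC h0.
  by have /= -> := h0 0%N; rewrite scale0r.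
have h'C := Cinf_derive1 oW hC; have a'C := Cinf_derive1 oW aC.
have C1 : Cinf W (fun s => (derive1 h) s *: a s) by move=> n; exact: CnZ.
have C2 : Cinf W (fun s => h s *: (derive1 a) s) by move=> n; exact: CnZ.
rewrite derive1Sn -[RHS]addr0 -{1}(IH _ _ h'C aC) => [|j]; last by rewrite -derive1Sn.
rewrite -(IH _ _ hC a'C)// -(derive1nD _ oW)//.
apply: (derive1n_eq _ oW) => // y Wy.
have hd := Cinf_diff hC Wy; have ad := Cinf_diff aC Wy.
have [d dE] := is_diffZf hd ad.
rewrite /= derive1E'//.
have := congr1 (fun h : R -> V => h 1) dE => /= ->.
by rewrite !derive1E'.
Qed.

Lemma flat_comp V W m (O : set 'rV[R]_m) (F : 'rV[R]_m -> V) (z : R -> 'rV[R]_m) k t :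
  open W -> W t -> (forall s, W s -> O (z s)) -> Cinf W z -> Cinf O F ->
  (forall j, (derive1n (j.+1) z) t = 0) -> (derive1n (k.+1) (F \o z)) t = 0.
Proof.
move=> oW Wt zO zC FC z0; have z'C := Cinf_derive1 oW zC.
have cC (i : 'I_m) : Cinf W (fun s => ((derive1 z) s) ord0 i : R).
  move=> n; exact: (Cn_post (L := coordlin ord0 i) oW (@coord_continuous _ _ _ ord0 i) (z'C n)).
have aC (i : 'I_m) : Cinf W (fun s => 'd F (z s) (delta_mx ord0 i)).
  move=> n; have [_ /(_ (delta_mx ord0 i)) FD] := FC n.+1.
  exact: (Cn_comp oW zO (zC n) FD).
pose S s := \sum_(i < m) ((derive1 z) s) ord0 i *: 'd F (z s) (delta_mx ord0 i).
rewrite derive1Sn (derive1n_eq (g := S) k oW)//.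
  rewrite (derive1n_sum _ oW)//; last by move=> i n; apply: CnZ => //; [exact: cC|exact: aC].
  rewrite big1// => i _; apply: (derive1n_Z0 k oW) => // j.
  have := derive1n_lin (L := coordlin ord0 i) j oW (@coord_continuous _ _ _ ord0 i) z'C Wt.
  by rewrite /= => ->; rewrite -derive1Sn z0 linear0.
move=> s Ws; have zd := Cinf_diff zC Ws.
have [/(_ _ (zO s Ws)) Fd _] := FC 1%N.
rewrite derive1E'; last exact: (differentiable_comp zd Fd).
have dE := congr1 (fun h : R -> V => h 1) (diff_comp zd Fd).
rewrite [LHS]dE /= /S (derive1E' zd) {1}(row_sum_delta ('d z s 1)) linear_sum.
by apply: eq_bigr => i _; rewrite linearZ.
Qed.
End Derive1n.

(* Diffeological spaces. A plot is a total function whose restriction to the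
   open set U is the parametrization; its values outside U are irrelevant
   (plot_local applied with V = U).

   Frechet manifolds are handled through their underlying diffeological space,
   whose plots are the smooth maps from open subsets of R^n. This embeds
   Frechet manifolds as a full subcategory of diffeological spaces, and the
   D-topology (Dopen below) of a Frechet manifold is its manifold topology, so
   that smooth maps, submanifolds and locally trivial bundles mean the same
   thing on both sides. For C^oo(M, G) with M compact, possibly with boundary,
   this is the functional diffeology (cmap below). *)
HB.mixin Record isDiffeological (R : realType) (X : Type) := {
  plot : forall n, set 'rV[R]_n -> ('rV[R]_n -> X) -> Prop;
  plot_open : forall n U p, plot n U p -> open U;
  plot_cst : forall n U x, open U -> plot n U (cst x);
  plot_local : forall n U p, open U ->
    (forall u, U u -> exists V q,
       [/\ V u, plot n V q & forall v, U v -> V v -> p v = q v]) ->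
    plot n U p;
  plot_comp : forall m n U V p (g : 'rV[R]_m -> 'rV[R]_n), plot n U p ->
    open V -> Cinf V g -> (forall v, V v -> U (g v)) -> plot m V (p \o g)
}.
#[short(type="diffType")]
HB.structure Definition Diffeological (R : realType) :=
  {X of isDiffeological R X}.
Arguments plot {R s n} U p.
Arguments plot_open {R s n} [U p].
Arguments plot_cst {R s n} [U] x.
Arguments plot_local {R s n} [U p].
Arguments plot_comp {R s m n} [U V p g].

HB.mixin Record Diffeological_isDiffGroup (R : realType) X
    of Diffeological R X & Group X := {
  plotM : forall n U (p q : 'rV[R]_n -> X), plot U p -> plot U q ->
    plot U (fun u => p u * q u)%g;
  plotV : forall n U (p : 'rV[R]_n -> X), plot U p -> plot U (fun u => (p u)^-1)%g
}.
#[short(type="diffGroupType")]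
HB.structure Definition DiffGroup (R : realType) :=
  {X of Diffeological R X & Group X & Diffeological_isDiffGroup R X}.

Section Basics.
Context {R : realType}.
Implicit Types X Y Z : diffType R.

Definition smooth X Y (f : X -> Y) :=
  forall n (U : set 'rV[R]_n) p, plot U p -> plot U (f \o p).

Definition smooth_on X Y (A : set X) (f : X -> Y) :=
  forall n (U : set 'rV[R]_n) p, plot U p -> (forall u, U u -> A (p u)) ->
  plot U (f \o p).

Definition Dopen X (A : set X) :=
  forall n (U : set 'rV[R]_n) p, plot U p -> open (U `&` p @^-1` A).

Lemma Cinf_id n (U : set 'rV[R]_n) : Cinf U (fun u : 'rV[R]_n => u).
Proof. by move=> k; apply: (@Cn_lin _ _ _ k U idfun) => x; exact: cvg_id. Qed.

Lemma plot_sub X n (U V : set 'rV[R]_n) (p : 'rV[R]_n -> X) :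
  open V -> V `<=` U -> plot U p -> plot V p.
Proof. by move=> oV VU /plot_comp; apply => //; exact: Cinf_id. Qed.

Lemma plot_eq X n (U : set 'rV[R]_n) (p q : 'rV[R]_n -> X) :
  (forall u, U u -> p u = q u) -> plot U p -> plot U q.
Proof.
move=> pq Up; apply: plot_local => [|u Uu]; first exact: plot_open Up.
by exists U, p; split => // v Uv _; rewrite pq.
Qed.

Lemma smooth_cst X Y (y : Y) : smooth (fun _ : X => y).
Proof. by move=> n U p /plot_open oU; exact: plot_cst. Qed.

Lemma smooth_id X : smooth (fun x : X => x). Proof. by []. Qed.

Lemma smooth_comp X Y Z (f : X -> Y) (g : Y -> Z) :
  smooth f -> smooth g -> smooth (fun x => g (f x)).
Proof. by move=> sf sg n U p /sf/sg. Qed.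

Lemma open_preim m n (V : set 'rV[R]_m) (U : set 'rV[R]_n) (g : 'rV[R]_m -> 'rV[R]_n) :
  open V -> open U -> Cinf V g -> open (V `&` g @^-1` U).
Proof.
move=> oV oU gC; rewrite openE => v [Vv Uv].
apply: filterI; first exact: open_nbhs_nbhs.
have gc := gC 0%N v Vv; apply: gc; exact: open_nbhs_nbhs.
Qed.
End Basics.

Section Euclid.
Context {R : realType} {W : normedModType R}.
Definition euplot n (U : set 'rV[R]_n) (p : 'rV[R]_n -> W) := open U /\ Cinf U p.
Lemma euplot_open n (U : set 'rV[R]_n) p : euplot U p -> open U.
Proof. by case. Qed.
Lemma euplot_cst n (U : set 'rV[R]_n) x : open U -> euplot U (cst x).
Proof. by split=> // k; exact: Cn_cst. Qed.
Lemma euplot_local n (U : set 'rV[R]_n) p : open U ->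
    (forall u, U u -> exists V q,
       [/\ V u, euplot V q & forall v, U v -> V v -> p v = q v]) ->
    euplot U p.
Proof.
move=> oU H; split=> // k; apply: Cn_loc => u Uu.
have [V [q [Vu [oV qC] pq]]] := H u Uu; exists (U `&` V) => //.
apply: (@Cn_eq _ _ _ _ _ q); first exact: openI.
  by move=> v [Uv Vv]; rewrite pq.
by apply: Cn_sub (qC k) => v [].
Qed.
Lemma euplot_comp m n (U : set 'rV[R]_n) (V : set 'rV[R]_m) p (g : 'rV[R]_m -> 'rV[R]_n) :
  euplot U p -> open V -> Cinf V g -> (forall v, V v -> U (g v)) -> euplot V (p \o g).
Proof. by move=> [oU pC] oV gC gU; split=> // k; exact: Cn_comp gU (gC k) (pC k). Qed.
End Euclid.

HB.instance Definition _ (R : realType) := isDiffeological.Build R (Real.sort R)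
  (@euplot_open R R) (@euplot_cst R R) (@euplot_local R R) (@euplot_comp R R).
HB.instance Definition _ (R : realType) m n := isDiffeological.Build R 'M[R]_(m, n)
  (@euplot_open R _) (@euplot_cst R _) (@euplot_local R _) (@euplot_comp R _).

Section Product.
Context {R : realType} (X Y : diffType R).
Definition prod_plot n (U : set 'rV[R]_n) (p : 'rV[R]_n -> X * Y) :=
  plot U (fst \o p) /\ plot U (snd \o p).
Lemma prod_plot_open n (U : set 'rV[R]_n) p : prod_plot U p -> open U.
Proof. by case=> /plot_open. Qed.
Lemma prod_plot_cst n (U : set 'rV[R]_n) x : open U -> prod_plot U (cst x).
Proof. by split; exact: plot_cst. Qed.
Lemma prod_plot_local n (U : set 'rV[R]_n) p : open U ->
    (forall u, U u -> exists V q,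
       [/\ V u, prod_plot V q & forall v, U v -> V v -> p v = q v]) ->
    prod_plot U p.
Proof.
move=> oU H; split; apply: plot_local => // u /H[V [q [Vu [q1 q2] pq]]].
  by exists V, (fst \o q); split => // v Uv Vv /=; rewrite pq.
by exists V, (snd \o q); split => // v Uv Vv /=; rewrite pq.
Qed.
Lemma prod_plot_comp m n (U : set 'rV[R]_n) (V : set 'rV[R]_m) p (g : 'rV[R]_m -> 'rV[R]_n) :
  prod_plot U p -> open V -> Cinf V g -> (forall v, V v -> U (g v)) -> prod_plot V (p \o g).
Proof.
by move=> [p1 p2] oV gC gU; split; [exact: plot_comp p1 _ _ _|exact: plot_comp p2 _ _ _].
Qed.
HB.instance Definition _ := isDiffeological.Build R (X * Y)%type
  prod_plot_open prod_plot_cst prod_plot_local prod_plot_comp.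
End Product.

Section ProductGroup.
Context {R : realType} (X Y : diffGroupType R).
Lemma prod_plotM n (U : set 'rV[R]_n) (p q : 'rV[R]_n -> X * Y) :
  plot U p -> plot U q -> plot U (fun u => p u * q u)%g.
Proof. by move=> [p1 p2] [q1 q2]; split; exact: plotM. Qed.
Lemma prod_plotV n (U : set 'rV[R]_n) (p : 'rV[R]_n -> X * Y) :
  plot U p -> plot U (fun u => (p u)^-1)%g.
Proof. by move=> [p1 p2]; split; exact: plotV. Qed.
HB.instance Definition _ := Diffeological_isDiffGroup.Build R (X * Y)%type
  prod_plotM prod_plotV.
End ProductGroup.

(* The subset diffeology. On a closed interval of R it gives the usual smooth
   functions of a manifold with boundary (those that extend smoothly). *)
Section Subspace.
Context {R : realType} (X : diffType R) (A : X -> Prop).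
Definition sub_plot n (U : set 'rV[R]_n) (p : 'rV[R]_n -> {x | A x}) :=
  plot U (fun u => sval (p u)).
Lemma sub_plot_open n (U : set 'rV[R]_n) p : sub_plot U p -> open U.
Proof. exact: plot_open. Qed.
Lemma sub_plot_cst n (U : set 'rV[R]_n) x : open U -> sub_plot U (cst x).
Proof. exact: plot_cst. Qed.
Lemma sub_plot_local n (U : set 'rV[R]_n) p : open U ->
    (forall u, U u -> exists V q,
       [/\ V u, sub_plot V q & forall v, U v -> V v -> p v = q v]) ->
    sub_plot U p.
Proof.
move=> oU H; apply: plot_local => // u /H[V [q [Vu Vq pq]]].
by exists V, (fun v => sval (q v)); split => // v Uv Vv; rewrite pq.
Qed.
Lemma sub_plot_comp m n (U : set 'rV[R]_n) (V : set 'rV[R]_m) p (g : 'rV[R]_m -> 'rV[R]_n) :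
  sub_plot U p -> open V -> Cinf V g -> (forall v, V v -> U (g v)) -> sub_plot V (p \o g).
Proof. exact: plot_comp. Qed.
HB.instance Definition _ := isDiffeological.Build R {x : X | A x}
  sub_plot_open sub_plot_cst sub_plot_local sub_plot_comp.
Lemma smooth_sval : smooth (fun x : {x : X | A x} => sval x).
Proof. by []. Qed.
End Subspace.

Section MappingSpace.
Context {R : realType}.
Record cmap (X Y : diffType R) := CMap {
  cmap_fun :> X -> Y;
  cmap_smooth : smooth cmap_fun
}.
Lemma cmapP (X Y : diffType R) (f g : cmap X Y) : (forall x, f x = g x) -> f = g.
Proof.
case: f g => [f fs] [g gs] /= /funext fg; rewrite fg in fs *.
by congr CMap; exact: Prop_irrelevance.
Qed.
Context (X Y : diffType R).
HB.instance Definition _ := gen_eqMixin (cmap X Y).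
HB.instance Definition _ := gen_choiceMixin (cmap X Y).
Definition cmap_plot n (U : set 'rV[R]_n) (c : 'rV[R]_n -> cmap X Y) :=
  open U /\ forall m (V : set 'rV[R]_m) (a : 'rV[R]_m -> 'rV[R]_n) b,
    open V -> Cinf V a -> (forall v, V v -> U (a v)) -> plot V b ->
    plot V (fun v => c (a v) (b v)).
Lemma cmap_plot_open n (U : set 'rV[R]_n) p : cmap_plot U p -> open U.
Proof. by case. Qed.
Lemma cmap_plot_cst n (U : set 'rV[R]_n) x : open U -> cmap_plot U (cst x).
Proof. by split=> // m V a b _ _ _ Vb; exact: cmap_smooth. Qed.
Lemma cmap_plot_local n (U : set 'rV[R]_n) p : open U ->
    (forall u, U u -> exists V q,
       [/\ V u, cmap_plot V q & forall v, U v -> V v -> p v = q v]) ->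
    cmap_plot U p.
Proof.
move=> oU H; split => // m V a b oV aC aU Vb; apply: plot_local => // v Vv.
have [V' [q [V'v [oV' Hq] pq]]] := H _ (aU v Vv).
have oW := open_preim oV oV' aC.
exists (V `&` a @^-1` V'), (fun v => q (a v) (b v)); split => //.
  apply: Hq => //; last by apply: plot_sub Vb => // w [].
    by move=> k; apply: Cn_sub (aC k) => w [].
  by move=> w [].
by move=> w Vw [_ V'w]; rewrite pq//; exact: aU.
Qed.
Lemma cmap_plot_comp m n (U : set 'rV[R]_n) (V : set 'rV[R]_m) p (g : 'rV[R]_m -> 'rV[R]_n) :
  cmap_plot U p -> open V -> Cinf V g -> (forall v, V v -> U (g v)) -> cmap_plot V (p \o g).
Proof.
move=> [oU Hp] oV gC gU; split => // k W a b oW aC aV Wb.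
apply: (Hp _ _ (g \o a)) => //; last by move=> w Ww; exact/gU/aV.
by move=> l; exact: Cn_comp aV (aC l) (gC l).
Qed.
HB.instance Definition _ := isDiffeological.Build R (cmap X Y)
  cmap_plot_open cmap_plot_cst cmap_plot_local cmap_plot_comp.
End MappingSpace.

Section MappingGroup.
Context {R : realType} (X : diffType R) (G : diffGroupType R).
Lemma smoothM (f g : X -> G) : smooth f -> smooth g -> smooth (fun x => f x * g x)%g.
Proof. by move=> sf sg n U p Up; apply: plotM; [exact: sf|exact: sg]. Qed.
Lemma smoothV (f : X -> G) : smooth f -> smooth (fun x => (f x)^-1)%g.
Proof. by move=> sf n U p Up; apply: plotV; exact: sf. Qed.
Definition cmap_one : cmap X G := CMap (@smooth_cst R X G 1%g).
Definition cmap_mul (f g : cmap X G) := CMap (smoothM (cmap_smooth f) (cmap_smooth g)).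
Definition cmap_inv (f : cmap X G) := CMap (smoothV (cmap_smooth f)).
Lemma cmap_mulA : associative cmap_mul.
Proof. by move=> f g h; apply: cmapP => x /=; rewrite mulgA. Qed.
Lemma cmap_mul1 : left_id cmap_one cmap_mul.
Proof. by move=> f; apply: cmapP => x /=; rewrite mul1g. Qed.
Lemma cmap_mulr1 : right_id cmap_one cmap_mul.
Proof. by move=> f; apply: cmapP => x /=; rewrite mulg1. Qed.
Lemma cmap_mulV : left_inverse cmap_one cmap_inv cmap_mul.
Proof. by move=> f; apply: cmapP => x /=; rewrite mulVg. Qed.
Lemma cmap_mulrV : right_inverse cmap_one cmap_inv cmap_mul.
Proof. by move=> f; apply: cmapP => x /=; rewrite mulgV. Qed.
HB.instance Definition _ := isGroup.Build (cmap X G)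
  cmap_mulA cmap_mul1 cmap_mulr1 cmap_mulV cmap_mulrV.
Lemma cmap_plotM n (U : set 'rV[R]_n) (p q : 'rV[R]_n -> cmap X G) :
  plot U p -> plot U q -> plot U (fun u => p u * q u)%g.
Proof.
move=> [oU Hp] [_ Hq]; split => // m V a b oV aC aU Vb.
by apply: plotM; [exact: Hp|exact: Hq].
Qed.
Lemma cmap_plotV n (U : set 'rV[R]_n) (p : 'rV[R]_n -> cmap X G) :
  plot U p -> plot U (fun u => (p u)^-1)%g.
Proof.
by move=> [oU Hp]; split => // m V a b oV aC aU Vb; apply: plotV; exact: Hp.
Qed.
HB.instance Definition _ := Diffeological_isDiffGroup.Build R (cmap X G)
  cmap_plotM cmap_plotV.
End MappingGroup.

Section Subgroup.
Context {R : realType}.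
(* Subgroups carry the subset diffeology. *)
Record subgroup (E : diffGroupType R) := Subgroup {
  sg_set :> E -> Prop;
  sg1 : sg_set 1%g;
  sgM : forall x y, sg_set x -> sg_set y -> sg_set (x * y)%g;
  sgV : forall x, sg_set x -> sg_set (x^-1)%g
}.
Context (E : diffGroupType R) (K : subgroup E).
Record sub_of := SubOf { sgval :> E; sgvalP : K sgval }.
Lemma sub_ofP (x y : sub_of) : sgval x = sgval y -> x = y.
Proof.
case: x y => [x Kx] [y Ky] /= xy; rewrite xy in Kx *.
by congr SubOf; exact: Prop_irrelevance.
Qed.
HB.instance Definition _ := gen_eqMixin sub_of.
HB.instance Definition _ := gen_choiceMixin sub_of.
Definition sub_one := SubOf (sg1 K).
Definition sub_mul (x y : sub_of) := SubOf (sgM (sgvalP x) (sgvalP y)).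
Definition sub_inv (x : sub_of) := SubOf (sgV (sgvalP x)).
Lemma sub_mulA : associative sub_mul.
Proof. by move=> f g h; apply: sub_ofP; rewrite /= mulgA. Qed.
Lemma sub_mul1 : left_id sub_one sub_mul.
Proof. by move=> f; apply: sub_ofP; rewrite /= mul1g. Qed.
Lemma sub_mulr1 : right_id sub_one sub_mul.
Proof. by move=> f; apply: sub_ofP; rewrite /= mulg1. Qed.
Lemma sub_mulV : left_inverse sub_one sub_inv sub_mul.
Proof. by move=> f; apply: sub_ofP; rewrite /= mulVg. Qed.
Lemma sub_mulrV : right_inverse sub_one sub_inv sub_mul.
Proof. by move=> f; apply: sub_ofP; rewrite /= mulgV. Qed.
HB.instance Definition _ := isGroup.Build sub_of
  sub_mulA sub_mul1 sub_mulr1 sub_mulV sub_mulrV.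
Definition sg_plot n (U : set 'rV[R]_n) (p : 'rV[R]_n -> sub_of) :=
  plot U (fun u => sgval (p u)).
Lemma sg_plot_open n (U : set 'rV[R]_n) p : sg_plot U p -> open U.
Proof. exact: plot_open. Qed.
Lemma sg_plot_cst n (U : set 'rV[R]_n) x : open U -> sg_plot U (cst x).
Proof. exact: plot_cst. Qed.
Lemma sg_plot_local n (U : set 'rV[R]_n) p : open U ->
    (forall u, U u -> exists V q,
       [/\ V u, sg_plot V q & forall v, U v -> V v -> p v = q v]) ->
    sg_plot U p.
Proof.
move=> oU H; apply: plot_local => // u /H[V [q [Vu Vq pq]]].
by exists V, (fun v => sgval (q v)); split => // v Uv Vv; rewrite pq.
Qed.
Lemma sg_plot_comp m n (U : set 'rV[R]_n) (V : set 'rV[R]_m) p (g : 'rV[R]_m -> 'rV[R]_n) :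
  sg_plot U p -> open V -> Cinf V g -> (forall v, V v -> U (g v)) -> sg_plot V (p \o g).
Proof. exact: plot_comp. Qed.
HB.instance Definition _ := isDiffeological.Build R sub_of
  sg_plot_open sg_plot_cst sg_plot_local sg_plot_comp.
Lemma sg_plotM n (U : set 'rV[R]_n) (p q : 'rV[R]_n -> sub_of) :
  plot U p -> plot U q -> plot U (fun u => p u * q u)%g.
Proof. exact: plotM. Qed.
Lemma sg_plotV n (U : set 'rV[R]_n) (p : 'rV[R]_n -> sub_of) :
  plot U p -> plot U (fun u => (p u)^-1)%g.
Proof. exact: plotV. Qed.
HB.instance Definition _ := Diffeological_isDiffGroup.Build R sub_of
  sg_plotM sg_plotV.
End Subgroup.

Section U1.
Context {R : realType}.
Record U1 := MkU1 { u1val :> R[i]; u1valP : `|u1val| = 1 }.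
Lemma U1P (x y : U1) : u1val x = u1val y -> x = y.
Proof.
case: x y => [x xP] [y yP] /= xy; rewrite xy in xP *.
by congr MkU1; exact: Prop_irrelevance.
Qed.
HB.instance Definition _ := gen_eqMixin U1.
HB.instance Definition _ := gen_choiceMixin U1.
Lemma U1_neq0 (x : U1) : u1val x != 0.
Proof. by rewrite -normr_gt0 u1valP ltr01. Qed.
Definition U1_one := MkU1 (@normr1 R[i]).
Lemma U1_mulP (x y : U1) : `|u1val x * u1val y| = 1.
Proof. by rewrite normrM !u1valP mulr1. Qed.
Lemma U1_invP (x : U1) : `|(u1val x)^-1| = 1.
Proof. by rewrite normfV u1valP invr1. Qed.
Definition U1_mul x y := MkU1 (U1_mulP x y).
Definition U1_inv x := MkU1 (U1_invP x).
Lemma U1_mulA : associative U1_mul.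
Proof. by move=> x y z; apply: U1P; rewrite /= mulrA. Qed.
Lemma U1_mul1 : left_id U1_one U1_mul.
Proof. by move=> x; apply: U1P; rewrite /= mul1r. Qed.
Lemma U1_mulr1 : right_id U1_one U1_mul.
Proof. by move=> x; apply: U1P; rewrite /= mulr1. Qed.
Lemma U1_mulV : left_inverse U1_one U1_inv U1_mul.
Proof. by move=> x; apply: U1P; rewrite /= mulVf// U1_neq0. Qed.
Lemma U1_mulrV : right_inverse U1_one U1_inv U1_mul.
Proof. by move=> x; apply: U1P; rewrite /= divff// U1_neq0. Qed.
HB.instance Definition _ := isGroup.Build U1
  U1_mulA U1_mul1 U1_mulr1 U1_mulV U1_mulrV.

Lemma U1_sum (x : U1) : complex.Re x ^+ 2 + complex.Im x ^+ 2 = 1.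
Proof.
apply: (@complexI R); rewrite add_Re2_Im2 u1valP expr1n; exact: rmorph1.
Qed.

Definition U1_plot n (U : set 'rV[R]_n) (p : 'rV[R]_n -> U1) :=
  plot U (fun u => complex.Re (p u) : R) /\ plot U (fun u => complex.Im (p u) : R).
Lemma U1_plot_open n (U : set 'rV[R]_n) p : U1_plot U p -> open U.
Proof. by case=> /plot_open. Qed.
Lemma U1_plot_cst n (U : set 'rV[R]_n) x : open U -> U1_plot U (cst x).
Proof. by split; exact: plot_cst. Qed.
Lemma U1_plot_local n (U : set 'rV[R]_n) p : open U ->
    (forall u, U u -> exists V q,
       [/\ V u, U1_plot V q & forall v, U v -> V v -> p v = q v]) ->
    U1_plot U p.
Proof.
move=> oU H; split; apply: plot_local => // u /H[V [q [Vu [q1 q2] pq]]].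
  by exists V, (fun v => complex.Re (q v)); split => // v Uv Vv /=; rewrite pq.
by exists V, (fun v => complex.Im (q v)); split => // v Uv Vv /=; rewrite pq.
Qed.
Lemma U1_plot_comp m n (U : set 'rV[R]_n) (V : set 'rV[R]_m) p (g : 'rV[R]_m -> 'rV[R]_n) :
  U1_plot U p -> open V -> Cinf V g -> (forall v, V v -> U (g v)) -> U1_plot V (p \o g).
Proof.
by move=> [p1 p2] oV gC gU; split; [exact: plot_comp p1 _ _ _|exact: plot_comp p2 _ _ _].
Qed.
HB.instance Definition _ := isDiffeological.Build R U1
  U1_plot_open U1_plot_cst U1_plot_local U1_plot_comp.

Lemma plotRM n (U : set 'rV[R]_n) (f g : 'rV[R]_n -> R) :
  plot U f -> plot U g -> plot U (fun u => f u * g u).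
Proof. by move=> [oU fC] [_ gC]; split=> // k; exact: (CnZ oU (fC k) (gC k)). Qed.
Lemma plotRD n (U : set 'rV[R]_n) (f g : 'rV[R]_n -> R) :
  plot U f -> plot U g -> plot U (fun u => f u + g u).
Proof. by move=> [oU fC] [_ gC]; split=> // k; exact: (CnD oU (fC k) (gC k)). Qed.
Lemma plotRN n (U : set 'rV[R]_n) (f : 'rV[R]_n -> R) :
  plot U f -> plot U (fun u => - f u).
Proof.
move=> fC; have := plotRM (plot_cst (-1 : R) (plot_open fC)) fC.
by apply: plot_eq => u _; rewrite mulN1r.
Qed.
Lemma U1_ReM (x y : U1) : complex.Re (x * y)%g =
  complex.Re x * complex.Re y + - (complex.Im x * complex.Im y).
Proof. by case: x y => [[a b] ?] [[c d] ?]. Qed.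
Lemma U1_ImM (x y : U1) : complex.Im (x * y)%g =
  complex.Re x * complex.Im y + complex.Im x * complex.Re y.
Proof. by case: x y => [[a b] ?] [[c d] ?]. Qed.
Lemma U1_ReV (x : U1) : complex.Re (x^-1)%g = complex.Re x.
Proof.
by have := U1_sum x; case: x => [[a b] xP] /= E; rewrite /= E divr1.
Qed.
Lemma U1_ImV (x : U1) : complex.Im (x^-1)%g = - complex.Im x.
Proof.
by have := U1_sum x; case: x => [[a b] xP] /= E; rewrite /= E divr1.
Qed.
Lemma U1_plotM n (U : set 'rV[R]_n) (p q : 'rV[R]_n -> U1) :
  plot U p -> plot U q -> plot U (fun u => p u * q u)%g.
Proof.
move=> [p1 p2] [q1 q2]; split.
  apply: (plot_eq (fun u _ => esym (U1_ReM (p u) (q u)))).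
  by apply: plotRD; [exact: plotRM|apply: plotRN; exact: plotRM].
apply: (plot_eq (fun u _ => esym (U1_ImM (p u) (q u)))).
by apply: plotRD; exact: plotRM.
Qed.
Lemma U1_plotV n (U : set 'rV[R]_n) (p : 'rV[R]_n -> U1) :
  plot U p -> plot U (fun u => (p u)^-1)%g.
Proof.
move=> [p1 p2]; split; first exact: (plot_eq (fun u _ => esym (U1_ReV (p u)))).
apply: (plot_eq (fun u _ => esym (U1_ImV (p u)))); exact: plotRN.
Qed.
HB.instance Definition _ := Diffeological_isDiffGroup.Build R U1 U1_plotM U1_plotV.

Lemma cis_norm (s : R) : `|(cos s +i* sin s)%C| = 1.
Proof. by rewrite normc_def /= cos2Dsin2 sqrtr1. Qed.
Definition cis (s : R) : U1 := MkU1 (cis_norm s).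
End U1.
Arguments U1 : clear implicits.

(* X with its D-topology, the finest topology making all the plots continuous. *)
Definition Dtop (R : realType) (X : diffType R) : Type := X.

Section Dtopology.
Context {R : realType} (X : diffType R).
HB.instance Definition _ := gen_eqMixin (Dtop X).
HB.instance Definition _ := gen_choiceMixin (Dtop X).
Definition Dop : set_system (Dtop X) := [set A | Dopen (A : set X)].
Lemma DopT : Dop setT.
Proof. by move=> n U p Up; rewrite preimage_setT setIT; exact: plot_open Up. Qed.
Lemma DopI : setI_closed Dop.
Proof.
move=> A B oA oB n U p Up; rewrite preimage_setI -(setIid U) setIACA.
by apply: openI; [exact: oA|exact: oB].
Qed.
Lemma Dop_bigU (I : Type) (f : I -> set (Dtop X)) :
  (forall i, Dop (f i)) -> Dop (\bigcup_i f i).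
Proof.
move=> of_ n U p Up; rewrite preimage_bigcup setI_bigcupr.
by apply: bigcup_open => i _; exact: of_.
Qed.
HB.instance Definition _ := isOpenTopological.Build (Dtop X) DopT DopI Dop_bigU.
End Dtopology.

Section Chart.
Context {R : realType} {X : diffType R}.
(* A local diffeomorphism of the D-open set U onto the open set phi @` U of R^n,
   with inverse psi. *)
Definition chart n (U : set X) (phi : X -> 'rV[R]_n) (psi : 'rV[R]_n -> X) : Prop :=
  [/\ Dopen U, smooth_on U phi, plot (phi @` U) psi & forall x, U x -> psi (phi x) = x].
End Chart.

(* Finite-dimensional Lie groups: diffeological groups that are manifolds. *)
HB.mixin Record DiffGroup_isLie (R : realType) G of DiffGroup R G := {
  ldim : nat;
  lie_chart : forall x : G, exists (U : set G) (phi : G -> 'rV[R]_ldim) psi,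
    chart U phi psi /\ U x;
  lie_hausdorff : hausdorff_space (Dtop G);
  lie_second_countable : @second_countable (Dtop G)
}.
#[short(type="lieType")]
HB.structure Definition Lie (R : realType) := {G of DiffGroup R G & DiffGroup_isLie R G}.

Arguments ldim {R} s.

Section CurveLemmas.
Context {R : realType}.
Implicit Type X : diffType R.

Definition line_emb (s : R) : 'rV[R]_1 := s *: const_mx 1.
Lemma line_emb_linear : linear line_emb.
Proof. by move=> a u v; rewrite /line_emb scalerDl scalerA. Qed.
HB.instance Definition _ := GRing.isLinear.Build R R 'rV[R]_1 _ line_emb line_emb_linear.
Lemma line_emb_cont : continuous line_emb.
Proof. exact: scalel_continuous. Qed.
Lemma line_embE s : line_emb s ord0 ord0 = s.
Proof. by rewrite !mxE mulr1. Qed.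

Lemma plot_coord n (U : set 'rV[R]_n) i : open U -> plot U (fun u : 'rV[R]_n => u ord0 i : R).
Proof.
move=> oU; split=> // k.
exact: (Cn_lin (f := coordlin ord0 i) k U (@coord_continuous _ _ _ ord0 i)).
Qed.

Lemma plot_line X (f : R -> X) : smooth f ->
  plot setT (fun u : 'rV[R]_1 => f (u ord0 ord0)).
Proof. by move=> sf; apply: (sf 1 setT (fun u => u ord0 ord0)); exact: plot_coord openT. Qed.

Lemma open_curve X (f : R -> X) (U : set X) : smooth f -> Dopen U -> open (f @^-1` U).
Proof.
move=> sf oU; have := oU _ _ _ (plot_line sf); rewrite setTI => o1.
have := (continuousP (line_emb : R -> _)).1 line_emb_cont _ o1.
by congr open; apply/seteqP; split=> s /=; rewrite line_embE.
Qed.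

Lemma Cinf_curve X V n (f : R -> X) (U : set X) (phi : X -> 'rV[R]_n) :
  smooth f -> Dopen U -> smooth_on U phi -> open V -> V `<=` f @^-1` U -> Cinf V (phi \o f).
Proof.
move=> sf oU sphi oV VU k.
have o1 : open (setT `&` (fun u : 'rV[R]_1 => f (u ord0 ord0)) @^-1` U).
  exact: oU (plot_line sf).
have [_ pC] := sphi _ _ _ (plot_sub o1 (@subsetT _ _) (plot_line sf)) (fun u H => H.2).
have eC : Cn k V line_emb by apply: Cn_lin; exact: line_emb_cont.
apply: Cn_eq (Cn_comp oV _ eC (pC k)) => //.
  by move=> s Vs; rewrite /= line_embE.
by move=> s Vs; split=> //=; rewrite line_embE; exact: VU.
Qed.

Lemma Cinf_coord (V : normedModType R) (U : set V) n (f : V -> 'rV[R]_n) : open U ->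
  (forall j, Cinf U (fun x => f x ord0 j : R)) -> Cinf U f.
Proof.
move=> oU H k.
have S : Cn k U (fun x => \sum_(j < n) f x ord0 j *: (delta_mx ord0 j : 'rV[R]_n)).
  by apply: Cn_sum => // j; apply: CnZ => //; [exact: H|exact: Cn_cst].
by apply: Cn_eq S => // x Ux; rewrite -row_sum_delta.
Qed.

Lemma derive1n_coord n (W : set R) (f : R -> 'rV[R]_n) k j t : open W -> W t -> Cinf W f ->
  derive1n k (fun s => f s ord0 j : R) t = derive1n k f t ord0 j.
Proof.
move=> oW Wt fC.
exact: (derive1n_lin (L := coordlin ord0 j) k oW (@coord_continuous _ _ _ ord0 j) fC Wt).
Qed.
Lemma Cinf_derive1n (V : normedModType R) W (f : R -> V) k : open W -> Cinf W f ->
  Cinf W (derive1n k f).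
Proof.
by move=> oW fC; elim: k => [//|k IH]; rewrite derive1nS; exact: Cinf_derive1.
Qed.
End CurveLemmas.

Section Flat.
Context {R : realType} {X : diffType R}.
(* All the derivatives of order >= 1 vanish, read in any chart around f t. *)
Definition flat_at (f : R -> X) (t : R) :=
  forall n (U : set X) (phi : X -> 'rV[R]_n) psi, chart U phi psi -> U (f t) ->
  forall k, derive1n k.+1 (phi \o f) t = 0.

Lemma derive1n_cst (V : normedModType R) (c : V) k t : derive1n k.+1 (cst c : R -> V) t = 0.
Proof.
elim: k c => [|k IH] c; first by rewrite derive1n1 derive1_cst.
rewrite derive1Sn (_ : derive1 (cst c) = cst 0); first exact: IH.
by apply/funext => s; rewrite derive1_cst.
Qed.

Lemma flat_locally_constant (f : R -> X) (t : R) (W : set R) : open W -> W t ->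
  (forall s, W s -> f s = f t) -> flat_at f t.
Proof.
move=> oW Wt fc n U phi psi _ _ k.
rewrite (derive1n_eq (g := cst (phi (f t))) k.+1 oW)//; first exact: derive1n_cst.
by move=> s Ws; rewrite /= fc.
Qed.

Lemma flat_const_right (f : R -> X) (t e : R) : smooth f -> 0 < e ->
  (forall s, t < s < t + e -> f s = f t) -> flat_at f t.
Proof.
move=> sf e0 fc n U phi psi [oU sphi _ _] Ut k.
set W := f @^-1` U; have oW : open W by exact: open_curve.
have hC : Cinf W (phi \o f) by exact: (Cinf_curve sf oU sphi oW).
have dC := Cinf_derive1n k.+1 oW hC.
have cont : {for t, continuous (derive1n k.+1 (phi \o f))} := dC 0%N t Ut.
apply/eqP; apply: contrapT => /negP d0.
have N : \forall s \near t, derive1n k.+1 (phi \o f) s != 0.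
  exact: (cvgr_neq0 _ cont d0).
have : \forall s \near t^'+, derive1n k.+1 (phi \o f) s != 0 /\ (t < s < t + e).
  have N' : \forall s \near t^'+, derive1n k.+1 (phi \o f) s != 0 by exact: cvg_within N.
  near=> s; split; first by near: s; exact: N'.
  apply/andP; split; near: s; first exact: nbhs_right_gt.
  by apply: nbhs_right_lt; rewrite ltrDl.
move=> /filter_ex [s [+ st]].
have oI : open [set r : R | t < r < t + e] by rewrite -[X in open X]set_itvoo; exact: itv_open.
have fE r : t < r < t + e -> (phi \o f) r = cst (phi (f t)) r by move=> rt; rewrite /= fc.
have -> := derive1n_eq (W := [set r : R | t < r < t + e]) k.+1 oI fE st.
by rewrite derive1n_cst eqxx.
Unshelve. all: by end_near. Qed.
End Flat.

Section FlatGroup.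
Context {R : realType} {G : lieType R}.

Lemma flat_div (f g : R -> G) t : smooth f -> smooth g -> flat_at f t -> flat_at g t ->
  flat_at (fun s => f s * (g s)^-1)%g t.
Proof.
move=> sf sg ff fg n U phi psi ch Ut k; have [oU sphi _ _] := ch.
have [U1 [phi1 [psi1 [ch1 U1t]]]] := lie_chart (f t).
have [U2 [phi2 [psi2 [ch2 U2t]]]] := lie_chart (g t).
have [oU1 sphi1 Ppsi1 K1] := ch1; have [oU2 sphi2 Ppsi2 K2] := ch2.
have sq : smooth (fun s => f s * (g s)^-1)%g by apply: smoothM => //; exact: smoothV.
pose W := (f @^-1` U1 `&` g @^-1` U2) `&` (fun s => f s * (g s)^-1)%g @^-1` U.
have oW : open W by apply: openI; [apply: openI|]; exact: open_curve.
have Wt : W t by [].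
pose d := ldim G.
pose z (s : R) : 'rV[R]_(d + d) := row_mx (phi1 (f s)) (phi2 (g s)).
have C1 : Cinf W (phi1 \o f) by apply: (Cinf_curve sf oU1 sphi1 oW) => s [[]].
have C2 : Cinf W (phi2 \o g) by apply: (Cinf_curve sg oU2 sphi2 oW) => s [[]].
have zC : Cinf W z.
  apply: Cinf_coord => // j l; case: (split_ordP j) => i ->.
    rewrite (_ : (fun _ => _) = (fun s => (phi1 \o f) s ord0 i)).
      exact: (Cn_post (L := coordlin ord0 i) oW (@coord_continuous _ _ _ ord0 i) (C1 l)).
    by apply/funext => s; rewrite row_mxEl.
  rewrite (_ : (fun _ => _) = (fun s => (phi2 \o g) s ord0 i)).
    exact: (Cn_post (L := coordlin ord0 i) oW (@coord_continuous _ _ _ ord0 i) (C2 l)).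
  by apply/funext => s; rewrite row_mxEr.
have z0 j : derive1n j.+1 z t = 0.
  apply/rowP => l; rewrite -(derive1n_coord j.+1 l oW Wt zC) [RHS]mxE.
  case: (split_ordP l) => i ->.
    rewrite (_ : (fun _ => _) = (fun s => (phi1 \o f) s ord0 i)).
      by rewrite (derive1n_coord j.+1 i oW Wt C1) (ff _ _ _ _ ch1 U1t) mxE.
    by apply/funext => s; rewrite row_mxEl.
  rewrite (_ : (fun _ => _) = (fun s => (phi2 \o g) s ord0 i)).
    by rewrite (derive1n_coord j.+1 i oW Wt C2) (fg _ _ _ _ ch2 U2t) mxE.
  by apply/funext => s; rewrite row_mxEr.
pose q (y : 'rV[R]_(d + d)) := (psi1 (lsubmx y) * (psi2 (rsubmx y))^-1)%g.
have lC (A : set 'rV[R]_(d + d)) : open A -> Cinf A (fun y : 'rV[R]_(d + d) => lsubmx y).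
  move=> oA; apply: Cinf_coord => // i l.
  rewrite (_ : (fun _ => _) = coordlin ord0 (lshift d i)).
    by apply: Cn_lin; exact: coord_continuous.
  by apply/funext => y; rewrite mxE.
have rC (A : set 'rV[R]_(d + d)) : open A -> Cinf A (fun y : 'rV[R]_(d + d) => rsubmx y).
  move=> oA; apply: Cinf_coord => // i l.
  rewrite (_ : (fun _ => _) = coordlin ord0 (rshift d i)).
    by apply: Cn_lin; exact: coord_continuous.
  by apply/funext => y; rewrite mxE.
pose O' := (setT `&` (fun y : 'rV[R]_(d + d) => lsubmx y) @^-1` (phi1 @` U1)) `&`
           (setT `&` (fun y : 'rV[R]_(d + d) => rsubmx y) @^-1` (phi2 @` U2)).
have oO' : open O'.
  apply: openI; apply: open_preim; try exact: openT.
  - exact: plot_open Ppsi1.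
  - exact: lC openT.
  - exact: plot_open Ppsi2.
  - exact: rC openT.
have Pq : plot O' q.
  apply: plotM.
    by apply: (plot_comp Ppsi1) => //; [exact: lC|move=> y [[]]].
  by apply: plotV; apply: (plot_comp Ppsi2) => //; [exact: rC|move=> y [_ []]].
pose O := O' `&` q @^-1` U.
have oO : open O by exact: oU Pq.
have [_ FC] : plot O (phi \o q).
  by apply: sphi => [|y []//]; apply: plot_sub Pq => // y [].
have qz s : W s -> q (z s) = (f s * (g s)^-1)%g.
  by move=> [[? ?] ?]; rewrite /q /z row_mxKl row_mxKr K1// K2.
have zO s : W s -> O (z s).
  move=> Ws; split; last by rewrite /= qz//; case: Ws.
  have [[U1s U2s] _] := Ws.
  split; split=> //=; rewrite ?row_mxKl ?row_mxKr; first by exists (f s).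
  by exists (g s).
rewrite (derive1n_eq (g := (phi \o q) \o z) k.+1 oW)//.
  exact: flat_comp k _ oW Wt zO zC FC z0.
by move=> s Ws; rewrite /= qz.
Qed.

Lemma flat_cst (g : G) t : flat_at (fun=> g) t.
Proof. exact: (flat_locally_constant (W := setT) openT). Qed.

Lemma flatV (f : R -> G) t : smooth f -> flat_at f t -> flat_at (fun s => (f s)^-1)%g t.
Proof.
move=> sf ff; have := flat_div (@smooth_cst R R G 1%g) sf (@flat_cst 1%g t) ff.
by rewrite (_ : (fun _ => _) = (fun s => (f s)^-1)%g)//; apply/funext => s; rewrite mul1g.
Qed.

Lemma flatM (f g : R -> G) t : smooth f -> smooth g -> flat_at f t -> flat_at g t ->
  flat_at (fun s => f s * g s)%g t.
Proof.
move=> sf sg ff fg; have := flat_div sf (smoothV sg) ff (flatV sg fg).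
by rewrite (_ : (fun _ => _) = (fun s => f s * g s)%g)//; apply/funext => s; rewrite invgK.
Qed.
End FlatGroup.

Section Homs.
Context {R : realType}.
Record diffHom (E F : diffGroupType R) := DiffHom {
  dh_fun :> E -> F;
  dh_smooth : smooth dh_fun;
  dhM : forall x y, dh_fun (x * y)%g = (dh_fun x * dh_fun y)%g
}.
Context {E F : diffGroupType R} (f : diffHom E F).
Lemma dh1 : f 1%g = 1%g.
Proof. by apply: (mulgI (f 1)%g); rewrite -dhM !mulg1. Qed.
Lemma dhV x : f (x^-1)%g = ((f x)^-1)%g.
Proof. by apply: (mulgI (f x)); rewrite -dhM !mulgV dh1. Qed.

Lemma preim_sg1 (K : subgroup F) : K (f 1%g). Proof. by rewrite dh1; exact: sg1. Qed.
Lemma preim_sgM (K : subgroup F) x y : K (f x) -> K (f y) -> K (f (x * y)%g).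
Proof. by rewrite dhM; exact: sgM. Qed.
Lemma preim_sgV (K : subgroup F) x : K (f x) -> K (f (x^-1)%g).
Proof. by rewrite dhV; exact: sgV. Qed.
Definition preim_sg (K : subgroup F) : subgroup E :=
  @Subgroup R E (fun x => K (f x)) (preim_sg1 K) (@preim_sgM K) (@preim_sgV K).

Lemma ker_sg1 : f 1%g = 1%g. Proof. exact: dh1. Qed.
Lemma ker_sgM x y : f x = 1%g -> f y = 1%g -> f (x * y)%g = 1%g.
Proof. by rewrite dhM => -> ->; rewrite mulg1. Qed.
Lemma ker_sgV x : f x = 1%g -> f (x^-1)%g = 1%g.
Proof. by rewrite dhV => ->; rewrite invg1. Qed.
Definition ker_sg : subgroup E :=
  @Subgroup R E (fun x => f x = 1%g) ker_sg1 ker_sgM ker_sgV.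

Definition preim_hom_fun (K : subgroup F) (x : sub_of (preim_sg K)) : sub_of K :=
  SubOf (sgvalP x : K (f (sgval x))).
Lemma preim_hom_smooth K : smooth (@preim_hom_fun K).
Proof. by move=> n U p Up; exact: dh_smooth. Qed.
Lemma preim_homM K x y :
  @preim_hom_fun K (x * y)%g = (@preim_hom_fun K x * @preim_hom_fun K y)%g.
Proof. by apply: sub_ofP; rewrite /= dhM. Qed.
Definition preim_hom K : diffHom (sub_of (preim_sg K)) (sub_of K) :=
  DiffHom (@preim_hom_smooth K) (@preim_homM K).
End Homs.

Section PathsLoops.
Context {R : realType} (G : lieType R).

Definition segment (a : R) := {x : R | 0 <= x <= a}.
Definition gpath (a : R) := cmap (segment a) G.

(* The circle R/2piZ: loops are 2pi-periodic functions on R, and subsets of the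
   circle are 2pi-periodic subsets of R. *)
Definition periodic (f : R -> G) := forall s, f (s + pi *+ 2) = f s.
Definition periodic_set (I : set R) := forall s, I (s + pi *+ 2) <-> I s.
Lemma loop_sg1 : periodic (1%g : cmap R G). Proof. by []. Qed.
Lemma loop_sgM (f g : cmap R G) : periodic f -> periodic g -> periodic (f * g)%g.
Proof. by move=> fp gp s /=; rewrite fp gp. Qed.
Lemma loop_sgV (f : cmap R G) : periodic f -> periodic (f^-1)%g.
Proof. by move=> fp s /=; rewrite fp. Qed.
Definition loop_sg : subgroup (cmap R G) :=
  @Subgroup R (cmap R G) (fun f : cmap R G => periodic f) loop_sg1 loop_sgM loop_sgV.
Definition LG : diffGroupType R := sub_of loop_sg.
Definition ev (f : LG) : cmap R G := sgval (f : sub_of loop_sg).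

Lemma evM (f g : LG) s : ev (f * g)%g s = (ev f s * ev g s)%g. Proof. by []. Qed.
Lemma evV (f : LG) s : ev (f^-1)%g s = ((ev f s)^-1)%g. Proof. by []. Qed.
Lemma ev1 s : ev 1%g s = 1%g. Proof. by []. Qed.

Definition in_L (I : set R) (f : LG) := forall s, ~ I s -> ev f s = 1%g.

Definition isOmega (f : LG) := ev f 0 = 1%g /\ flat_at (ev f) 0.
Lemma Omega_sg1 : isOmega 1%g. Proof. by split=> //; exact: flat_cst. Qed.
Lemma Omega_sgM (f g : LG) : isOmega f -> isOmega g -> isOmega (f * g)%g.
Proof.
move=> [f0 ff] [g0 fg]; split; first by rewrite evM f0 g0 mulg1.
by apply: flatM => //; exact: cmap_smooth.
Qed.
Lemma Omega_sgV (f : LG) : isOmega f -> isOmega (f^-1)%g.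
Proof.
move=> [f0 ff]; split; first by rewrite evV f0 invg1.
by apply: flatV => //; exact: cmap_smooth.
Qed.
Definition Omega_sg : subgroup LG :=
  @Subgroup R LG (fun f : LG => isOmega f) Omega_sg1 Omega_sgM Omega_sgV.
Definition OmegaG : diffGroupType R := sub_of Omega_sg.
Definition oloop (f : OmegaG) : LG := sgval (f : sub_of Omega_sg).

Definition arc0pi : set R := [set s | exists m : int, 0 < s + (pi *+ 2) *~ m < pi].

Lemma half_sg1 : in_L arc0pi (oloop 1%g). Proof. by []. Qed.
Lemma half_sgM (f g : OmegaG) : in_L arc0pi (oloop f) -> in_L arc0pi (oloop g) ->
  in_L arc0pi (oloop (f * g)%g).
Proof. by move=> f0 g0 s Hs; rewrite evM f0// g0// mulg1. Qed.
Lemma half_sgV (f : OmegaG) : in_L arc0pi (oloop f) -> in_L arc0pi (oloop (f^-1)%g).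
Proof. by move=> f0 s Hs; rewrite evV f0// invg1. Qed.
Definition half_sg : subgroup OmegaG := @Subgroup R OmegaG
  (fun f : OmegaG => in_L arc0pi (oloop f)) half_sg1 half_sgM half_sgV.

Definition starts_at_1 a (g : gpath a) := forall x : segment a, sval x = 0 -> g x = 1%g.
Definition ends_at_1 a (g : gpath a) := forall x : segment a, sval x = a -> g x = 1%g.
(* The derivatives at an endpoint of the interval are those of an extension. *)
Definition path_flat_at a (g : gpath a) (t : R) := exists f : R -> G,
  [/\ smooth f, forall x : segment a, f (sval x) = g x & flat_at f t].
Definition isPe (g : gpath pi) :=
  [/\ starts_at_1 g, path_flat_at g 0 & path_flat_at g pi].
Lemma Pe_sg1 : isPe 1%g.
Proof. by split => //; exists (fun=> 1%g); split=> //; [exact: smooth_cst|exact: flat_cst|exact: smooth_cst|exact: flat_cst]. Qed.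
Lemma path_flatM a (f g : gpath a) t : path_flat_at f t -> path_flat_at g t ->
  path_flat_at (f * g)%g t.
Proof.
move=> [f' [sf ef ff]] [g' [sg eg fg]]; exists (fun s => f' s * g' s)%g; split.
- exact: smoothM.
- by move=> x; rewrite ef eg.
- exact: flatM.
Qed.
Lemma path_flatV a (f : gpath a) t : path_flat_at f t -> path_flat_at (f^-1)%g t.
Proof.
move=> [f' [sf ef ff]]; exists (fun s => (f' s)^-1)%g; split.
- exact: smoothV.
- by move=> x; rewrite ef.
- exact: flatV.
Qed.
Lemma Pe_sgM (f g : gpath pi) : isPe f -> isPe g -> isPe (f * g)%g.
Proof.
move=> [f1 f2 f3] [g1 g2 g3]; split; [|exact: path_flatM|exact: path_flatM].
by move=> x x0 /=; rewrite f1// g1// mulg1.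
Qed.
Lemma Pe_sgV (f : gpath pi) : isPe f -> isPe (f^-1)%g.
Proof.
move=> [f1 f2 f3]; split; [|exact: path_flatV|exact: path_flatV].
by move=> x x0 /=; rewrite f1// invg1.
Qed.
Definition Pe_sg : subgroup (gpath pi) :=
  @Subgroup R (gpath pi) (fun g : gpath pi => isPe g) Pe_sg1 Pe_sgM Pe_sgV.
Definition PeG : diffGroupType R := sub_of Pe_sg.
Definition pe_path (g : PeG) : gpath pi := sgval (g : sub_of Pe_sg).

Definition sitting a (g : gpath a) := exists e : R, [/\ 0 < e,
  forall x y : segment a, sval x <= e -> sval y <= e -> g x = g y &
  forall x y : segment a, a - e <= sval x -> a - e <= sval y -> g x = g y].
Definition isPsi (g : gpath pi) := starts_at_1 g /\ sitting g.
Lemma Psi_sg1 : isPsi 1%g. Proof. by split=> //; exists 1; split. Qed.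
Lemma Psi_sgM (f g : gpath pi) : isPsi f -> isPsi g -> isPsi (f * g)%g.
Proof.
move=> [f1 [e [e0 f2 f3]]] [g1 [d [d0 g2 g3]]]; split.
  by move=> x x0 /=; rewrite f1// g1// mulg1.
exists (Num.min e d); split; first by rewrite lt_min e0.
  by move=> x y; rewrite !le_min => /andP[? ?] /andP[? ?] /=; rewrite (f2 x y)// (g2 x y).
have H (z : R) : pi - Num.min e d <= z -> pi - e <= z /\ pi - d <= z.
  move=> zh; split; apply: le_trans zh; rewrite lerB// ge_min lexx ?orbT//.
by move=> x y /H[? ?] /H[? ?] /=; rewrite (f3 x y)// (g3 x y).
Qed.
Lemma Psi_sgV (f : gpath pi) : isPsi f -> isPsi (f^-1)%g.
Proof.
move=> [f1 [e [e0 f2 f3]]]; split; first by move=> x x0 /=; rewrite f1// invg1.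
exists e; split => // x y ? ? /=; first by rewrite (f2 x y).
by rewrite (f3 x y).
Qed.
Definition Psi_sg : subgroup (gpath pi) :=
  @Subgroup R (gpath pi) (fun g : gpath pi => isPsi g) Psi_sg1 Psi_sgM Psi_sgV.
Definition PeG_si : diffGroupType R := sub_of Psi_sg.
Definition psi_path (g : PeG_si) : gpath pi := sgval (g : sub_of Psi_sg).

(* f is the loop g1 \cup g2. As f is 2pi-periodic, this determines f. *)
Definition is_cup (g1 g2 : gpath pi) (f : LG) :=
  (forall x : segment pi, ev f (sval x) = g1 x) /\
  (forall x : segment pi, ev f (pi *+ 2 - sval x) = g2 x).
Lemma is_cup1 : is_cup 1%g 1%g 1%g. Proof. by []. Qed.
Lemma is_cupM g1 g2 f h1 h2 k : is_cup g1 g2 f -> is_cup h1 h2 k ->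
  is_cup (g1 * h1)%g (g2 * h2)%g (f * k)%g.
Proof.
by move=> [a b] [c d]; split=> x; rewrite evM; [rewrite a c|rewrite b d].
Qed.
Lemma is_cupV g1 g2 f : is_cup g1 g2 f -> is_cup (g1^-1)%g (g2^-1)%g (f^-1)%g.
Proof. by move=> [a b]; split=> x; rewrite evV; [rewrite a|rewrite b]. Qed.

Lemma restr_smooth a (f : LG) : smooth (fun x : segment a => ev f (sval x)).
Proof.
move=> n U p Up; have Up' : plot U (fun u => sval (p u) : R) by exact: Up.
exact: (cmap_smooth (ev f) Up').
Qed.
Definition restr a (f : LG) : gpath a := CMap (@restr_smooth a f).
End PathsLoops.

Section CrossedModules.
Context {R : realType}.

Record xmod_data := XMod {
  xH : diffGroupType R;
  xK : diffGroupType R;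
  xt : xH -> xK;
  xact : xK -> xH -> xH
}.

Definition smooth_hom (E F : diffGroupType R) (f : E -> F) :=
  smooth f /\ forall x y, f (x * y)%g = (f x * f y)%g.

Record crossed_module (X : xmod_data) : Prop := {
  xm_t : smooth_hom (@xt X);
  xm_smooth : smooth (fun z : xK X * xH X => xact z.1 z.2);
  xm_act1 : forall h : xH X, xact 1%g h = h;
  xm_actM : forall (g g' : xK X) (h : xH X), xact (g * g')%g h = xact g (xact g' h);
  xm_morph : forall (g : xK X) (h h' : xH X), xact g (h * h')%g = (xact g h * xact g h')%g;
  xm_equiv : forall (g : xK X) (h : xH X), xt (xact g h) = (g * xt h * g^-1)%g;
  xm_peiffer : forall h k : xH X, xact (xt h) k = (h * k * h^-1)%g
}.

Record strict_hom (X Y : xmod_data) (F1 : xH X -> xH Y) (F0 : xK X -> xK Y) : Prop := {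
  sh1 : smooth_hom F1;
  sh0 : smooth_hom F0;
  sh_t : forall h, xt (F1 h) = F0 (xt h);
  sh_act : forall g h, F1 (xact g h) = xact (F0 g) (F1 h)
}.

(* The pullback of p : P -> X along f : V -> X is S-equivariantly diffeomorphic
   to V * S over V: (v, s) |-> (v, phi (v, s)) has the inverse
   (v, y) |-> (v, psi (v, y)) on the fibre product. *)
Definition trivial_over (S : diffGroupType R) (P V X : diffType R)
    (act : P -> S -> P) (p : P -> X) (f : V -> X) :=
  exists (phi : V * S -> P) (psi : V * P -> S),
    [/\ smooth phi,
        smooth_on [set z : V * P | f z.1 = p z.2] psi,
        forall v s, p (phi (v, s)) = f v,
        forall v s s', phi (v, (s * s')%g) = act (phi (v, s)) s' &
        (forall v s, psi (v, phi (v, s)) = s) /\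
        (forall v y, f v = p y -> phi (v, psi (v, y)) = y)].

Record principal_bundle (S : diffGroupType R) (P X : diffType R)
    (act : P -> S -> P) (p : P -> X) : Prop := {
  pb_proj : smooth p;
  pb_act : smooth (fun z : P * S => act z.1 z.2);
  pb_act1 : forall y, act y 1%g = y;
  pb_actM : forall y s s', act y (s * s')%g = act (act y s) s';
  pb_fibre : forall y s, p (act y s) = p y;
  pb_triv : forall x : X, exists U : set X, [/\ Dopen U, U x &
    trivial_over act p (fun y : {y : X | U y} => sval y)]
}.

(* sdmul is the product of the semidirect product H' >< K, with K acting
   through F0. *)
Section Butterfly.
Variables (X Y : xmod_data) (F1 : xH X -> xH Y) (F0 : xK X -> xK Y).
Definition sdmul (z w : xH Y * xK X) : xH Y * xK X :=
  ((z.1 * xact (F0 z.2) w.1)%g, (z.2 * w.2)%g).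
Definition bkappa (h : xH X) : xH Y * xK X := ((F1 h)^-1%g, xt h).
Definition bj (z : xH Y * xK X) : xK Y := (xt z.1 * F0 z.2)%g.
Record weak_equivalence : Prop := {
  we_kappaM : forall h h', bkappa (h * h')%g = sdmul (bkappa h) (bkappa h');
  we_jM : forall z w, bj (sdmul z w) = (bj z * bj w)%g;
  we_inj : injective bkappa;
  we_exact : forall z, bj z = 1%g <-> exists h, z = bkappa h;
  we_surj : forall k, exists z, bj z = k;
  we_bundle : principal_bundle (fun z h => sdmul z (bkappa h)) bj
}.
End Butterfly.

Record centralExt (H : diffGroupType R) := CentralExt {
  ce_tot :> diffGroupType R;
  ce_inc : diffHom (U1 R) ce_tot;
  ce_proj : diffHom ce_tot H;
  ce_inj : injective ce_inc;
  ce_exact : forall x, ce_proj x = 1%g <-> exists z, x = ce_inc z;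
  ce_surj : forall h, exists x, ce_proj x = h;
  ce_central : forall z x, (ce_inc z * x)%g = (x * ce_inc z)%g;
  ce_bundle : principal_bundle (fun x z => x * ce_inc z)%g ce_proj
}.
End CrossedModules.
Arguments xmod_data : clear implicits.

Section Loops2.
Context {R : realType} (G : lieType R).
Notation LG := (LG G). Notation OmegaG := (OmegaG G).

Definition disjoint_commutative (E : centralExt LG) :=
  forall I J : set R, periodic_set I -> periodic_set J -> I `&` J = set0 ->
  forall Phi Psi : E, in_L I (ce_proj E Phi) -> in_L J (ce_proj E Psi) ->
  (Phi * Psi)%g = (Psi * Phi)%g.

Section XOmega.
Variables (E : diffGroupType R) (p : diffHom E OmegaG).
(* The part of the extension over loops supported in (0, pi). *)
Definition Ehalf : diffGroupType R := sub_of (preim_sg p (half_sg G)).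
Definition eh_val (Phi : Ehalf) : E := sgval (Phi : sub_of (preim_sg p (half_sg G))).
(* Any lift of the loop g \cup g. Two lifts differ by a central element, so the
   action below does not depend on the choice; the default value 1 is not used
   since g \cup g is smooth and the projection is onto. *)
Definition lift_double (g : PeG G) : E :=
  xget 1%g [set Phi | is_cup (pe_path g) (pe_path g) (oloop (p Phi))].
Lemma half_conj (Psi : E) (Phi : Ehalf) :
  preim_sg p (half_sg G) (Psi * eh_val Phi * Psi^-1)%g.
Proof.
move=> s Hs; have E1 : ev (oloop (p (eh_val Phi))) s = 1%g := sgvalP Phi s Hs.
have E0 : ev (oloop (p (Psi * eh_val Phi * Psi^-1)%g)) s =
  (ev (oloop (p Psi)) s * ev (oloop (p (eh_val Phi))) s * (ev (oloop (p Psi)) s)^-1)%g.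
  by rewrite !dhM dhV.
by rewrite E0 E1 mulg1 mulgV.
Qed.
Definition X_act (g : PeG G) (Phi : Ehalf) : Ehalf := SubOf (half_conj (lift_double g) Phi).

Lemma not_arc (s : R) : pi <= s <= pi *+ 2 -> ~ arc0pi s.
Proof.
move=> /andP[s1 s2] [m /andP[m1 m2]].
have p0 : 0 < (pi : R) by exact: pi_gt0.
have [m0|m0] := lerP 0 m.
  have : 0 <= (pi *+ 2 : R) *~ m by rewrite mulrz_ge0// mulrn_wge0// ltW.
  by move: m2; lra.
have : (pi *+ 2 : R) *~ m <= - (pi *+ 2).
  have m1' : (m <= -1)%R by lia.
  by rewrite -mulrN1z; apply: ler_wpMz2l => //; rewrite mulrn_wge0// ltW.
by move: m1; lra.
Qed.
Lemma restr_half_isPe (Phi : Ehalf) : Pe_sg G (restr pi (oloop (p (eh_val Phi)))).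
Proof.
have Ph s : ~ arc0pi s -> ev (oloop (p (eh_val Phi))) s = 1%g := sgvalP Phi s.
have [l0 lf] := sgvalP (p (eh_val Phi)).
have p0 : 0 < (pi : R) by exact: pi_gt0.
split.
- by move=> x x0; rewrite /= x0.
- by exists (ev (oloop (p (eh_val Phi)))); split=> //; exact: cmap_smooth.
exists (ev (oloop (p (eh_val Phi)))); split=> //; first exact: cmap_smooth.
apply: (@flat_const_right _ _ _ pi pi) => //; first exact: cmap_smooth.
move=> s /andP[s1 s2]; rewrite !Ph//; apply: not_arc; first by lra.
by rewrite ltW//=; lra.
Qed.
Definition X_t (Phi : Ehalf) : PeG G := SubOf (restr_half_isPe Phi).
Definition X_Omega : xmod_data R := XMod X_t X_act.
End XOmega.
End Loops2.

Section SittingPaths.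
Context {R : realType} (G : lieType R).
Let p0 : 0 < (pi : R) := pi_gt0 R.

Lemma clampP (s : R) : 0 <= Num.min (Num.max s 0) (pi : R) <= pi.
Proof. by rewrite le_min le_max lexx orbT (ltW p0) ge_min lexx orbT. Qed.
Definition clamp (s : R) : segment (pi : R) := exist (fun x : R => is_true (0 <= x <= pi)) _ (clampP s).
Lemma sval_clamp s : 0 <= s <= (pi : R) -> sval (clamp s) = s.
Proof. by move=> /andP[s0 s1]; rewrite /= (max_idPl s0) (min_idPl s1). Qed.
Lemma clamp_sval (x : segment (pi : R)) : clamp (sval x) = x.
Proof.
apply: (eq_sig_hprop (fun y : R => @Prop_irrelevance _)); exact: sval_clamp (svalP x).
Qed.

Lemma clamp_le (e s : R) : 0 <= e -> s <= e -> sval (clamp s) <= e.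
Proof. by move=> e0 se; rewrite /= ge_min ge_max se e0. Qed.
Lemma clamp_ge (e s : R) : 0 <= e -> pi - e <= s -> pi - e <= sval (clamp s).
Proof. by move=> e0 se; rewrite /= le_min le_max se gerBl e0. Qed.

Lemma sitting_smooth (g : gpath G pi) : sitting g -> smooth (fun s : R => g (clamp s)).
Proof.
move=> [e [e0 ga gb]] n U r Ur; have [oU rC] := Ur.
have oP (A : set R) : open A -> open (U `&` r @^-1` A).
  move=> oA; rewrite openE => v [Uv Av]; apply: filterI; first exact: open_nbhs_nbhs.
  by apply: (rC 0%N v Uv); exact: open_nbhs_nbhs.
apply: plot_local => // u Uu.
have [ue|ue] := ltrP (r u) e.
  have oV := oP _ (@open_lt R (e)).
  exists (U `&` r @^-1` [set y | y < e]), (cst (g (clamp 0))); split=> //.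
    exact: plot_cst.
  by move=> v Uv [_ /= v1]; apply: ga; apply: clamp_le; rewrite ?ltW.
have [ue'|ue'] := ltrP (pi - e) (r u).
  have oV := oP _ (@open_gt R (pi - e)).
  exists (U `&` r @^-1` [set y | pi - e < y]), (cst (g (clamp pi))); split=> //.
    exact: plot_cst.
  by move=> v Uv [_ /= v1]; apply: gb; apply: clamp_ge; rewrite ?gerBl ?ltW.
have oV := oP _ (openI (@open_gt R (0)) (@open_lt R (pi))).
exists (U `&` r @^-1` ([set y | 0 < y] `&` [set y | y < (pi : R)])), (fun v => g (clamp (r v))).
split=> //.
  split=> //; split=> /=; first exact: lt_le_trans ue.
  by rewrite (le_lt_trans ue')// gtrBl.
have rP : plot (U `&` r @^-1` ([set y | 0 < y] `&` [set y | y < (pi : R)])) r.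
  by apply: plot_sub Ur => // v [].
have cP : plot (U `&` r @^-1` ([set y | 0 < y] `&` [set y | y < (pi : R)]))
    (fun v => sval (clamp (r v)) : R).
  apply: plot_eq rP => v [_ [/= v1 v2]].
  by rewrite -[LHS]sval_clamp// (ltW v1) (ltW v2).
exact: (cmap_smooth g (cP : plot _ (fun v => clamp (r v)))).
Qed.

Lemma psi_isPe (g : PeG_si G) : Pe_sg G (psi_path g).
Proof.
have [g1 gs] := sgvalP g; rewrite -/(psi_path g) in g1 gs.
have sm := sitting_smooth gs; have [e [e0 ga gb]] := gs.
split=> //; exists (fun s => psi_path g (clamp s)); split=> //.
- by move=> x; rewrite clamp_sval.
- apply: (flat_locally_constant (W := [set y | y < e])) => //.
  by move=> s /= se; apply: ga; apply: clamp_le; rewrite ?ltW.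
- by move=> x; rewrite clamp_sval.
- apply: (flat_locally_constant (W := [set y | pi - e < y])) => //.
    by rewrite /= gtrBl.
  by move=> s /= se; apply: gb; apply: clamp_ge; rewrite ?gerBl ?ltW.
Qed.
Definition incl0 (g : PeG_si G) : PeG G := SubOf (psi_isPe g).
End SittingPaths.

Section Waldorf.
Context {R : realType} (G : lieType R) (E : centralExt (LG G)).
Notation P := (PeG_si G).
Let p0 : 0 < (pi : R) := pi_gt0 R.

Definition same_end (g1 g2 : P) :=
  forall x : segment (pi : R), sval x = pi -> psi_path g1 x = psi_path g2 x.
(* Phi lies in the fibre over (g1, g2) of the pullback of E along
   \cup : PeG_si^[2] -> LG. *)
Definition lies_over (g1 g2 : P) (Phi : E) :=
  same_end g1 g2 /\ is_cup (psi_path g1) (psi_path g2) (ce_proj E Phi).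

Definition fusion_dom : set (P * P * P * E * E) :=
  [set z | lies_over z.1.1.1.1 z.1.1.1.2 z.1.2 /\ lies_over z.1.1.1.2 z.1.1.2 z.2].

(* A morphism out of the tensor product of two U(1)-bundles is the same as a
   smooth fibrewise map that is U(1)-equivariant in each argument. *)
Record fusion_product (lam : P -> P -> P -> E -> E -> E) : Prop := {
  fus_smooth : smooth_on fusion_dom
    (fun z => lam z.1.1.1.1 z.1.1.1.2 z.1.1.2 z.1.2 z.2);
  fus_over : forall g1 g2 g3 Phi Psi, lies_over g1 g2 Phi -> lies_over g2 g3 Psi ->
    lies_over g1 g3 (lam g1 g2 g3 Phi Psi);
  fus_equiv : forall g1 g2 g3 Phi Psi z w, lies_over g1 g2 Phi -> lies_over g2 g3 Psi ->
    lam g1 g2 g3 (Phi * ce_inc E z)%g (Psi * ce_inc E w)%g =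
    (lam g1 g2 g3 Phi Psi * ce_inc E (z * w)%g)%g;
  fus_assoc : forall g1 g2 g3 g4 Phi Psi Xi,
    lies_over g1 g2 Phi -> lies_over g2 g3 Psi -> lies_over g3 g4 Xi ->
    lam g1 g3 g4 (lam g1 g2 g3 Phi Psi) Xi = lam g1 g2 g4 Phi (lam g2 g3 g4 Psi Xi)
}.
Definition multiplicative_fusion (lam : P -> P -> P -> E -> E -> E) :=
  forall g1 g2 g3 Phi Psi h1 h2 h3 Phi' Psi',
  lies_over g1 g2 Phi -> lies_over g2 g3 Psi -> lies_over h1 h2 Phi' -> lies_over h2 h3 Psi' ->
  lam (g1 * h1)%g (g2 * h2)%g (g3 * h3)%g (Phi * Phi')%g (Psi * Psi')%g =
  (lam g1 g2 g3 Phi Psi * lam h1 h2 h3 Phi' Psi')%g.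

Definition neutral_for (lam : P -> P -> P -> E -> E -> E) (i : P -> E) :=
  forall g1 g2 Phi, lies_over g1 g2 Phi ->
  lam g1 g1 g2 (i g1) Phi = Phi /\ lam g1 g2 g2 Phi (i g2) = Phi.

Definition doubles (i : P -> E) := forall g, is_cup (psi_path g) (psi_path g) (ce_proj E (i g)).

Definition dflg_set (z : P * P * E) := lies_over z.1.1 z.1.2 z.2.
Lemma dflg1 : dflg_set 1%g.
Proof. by split=> //; rewrite dh1; exact: is_cup1. Qed.
Lemma dflgM z w : dflg_set z -> dflg_set w -> dflg_set (z * w)%g.
Proof.
move=> [a b] [c d]; split; first by move=> x xp /=; rewrite a// c.
by rewrite dhM; exact: is_cupM.
Qed.
Lemma dflgV z : dflg_set z -> dflg_set (z^-1)%g.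
Proof.
move=> [a b]; split; first by move=> x xp /=; rewrite a.
by rewrite dhV; exact: is_cupV.
Qed.
Definition dflg_sg : subgroup (P * P * E)%type :=
  @Subgroup R (P * P * E)%type (fun z => dflg_set z) dflg1 dflgM dflgV.
Definition dflg := sub_of dflg_sg.

Lemma dflg_s_smooth : smooth (fun z : dflg => (sgval z).1.2).
Proof. by move=> n U q [[]]. Qed.
Definition dflg_s : diffHom dflg P := DiffHom dflg_s_smooth (fun x y => erefl).
Lemma dflg_t_smooth : smooth (fun z : dflg => (sgval z).1.1).
Proof. by move=> n U q [[]]. Qed.
Definition dflg_t : diffHom dflg P := DiffHom dflg_t_smooth (fun x y => erefl).

Definition dflg_half := sub_of (ker_sg dflg_s).

(* The action is conjugation by (g, g, i g), i.e. (g1, 1, Phi) is sent to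
   (g g1 g^-1, 1, i(g) Phi i(g)^-1). *)
Section XW.
Variables (i : diffHom P E) (hi : doubles i).
Lemma dflg_idP (g : P) : dflg_sg (g, g, i g). Proof. by split=> //; exact: hi. Qed.
Definition dflg_id (g : P) : dflg := SubOf (dflg_idP g).
Lemma dflg_conjP (g : P) (z : dflg_half) :
  ker_sg dflg_s (dflg_id g * sgval z * (dflg_id g)^-1)%g.
Proof.
have zs : dflg_s (sgval z) = 1%g := sgvalP z.
by rewrite -[sg_set _ _]/(dflg_s _ = 1%g) !dhM dhV zs mulg1 mulgV.
Qed.
Definition XW_act (g : P) (z : dflg_half) : dflg_half := SubOf (dflg_conjP g z).
Definition XW_t (z : dflg_half) : P := dflg_t (sgval z).
Definition X_W : xmod_data R := @XMod R (dflg_half : diffGroupType R) P XW_t XW_act.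
End XW.

Definition OmegaE : diffGroupType R := sub_of (preim_sg (ce_proj E) (Omega_sg G)).
Definition OmegaE_proj : diffHom OmegaE (OmegaG G) := preim_hom (ce_proj E) (Omega_sg G).

Lemma ev_period (f : LG G) (s : R) (m : int) : ev f (s + (pi *+ 2) *~ m) = ev f s.
Proof.
have per (r : R) : ev f (r + pi *+ 2) = ev f r := sgvalP f r.
have pern (n : nat) (r : R) : ev f (r + (pi *+ 2) *+ n) = ev f r.
  by elim: n => [|n IH]; rewrite ?mulr0n ?addr0// mulrSr addrA per IH.
case: m => n; first exact: pern.
have := pern n.+1 (s - (pi *+ 2) *+ n.+1); rewrite subrK => ->.
by rewrite NegzE mulrNz.
Qed.

Section Incl1.
Variable (z : dflg_half).
Let Phi : E := (sgval (sgval z)).2.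
Let f : LG G := ce_proj E Phi.
Let g : P := (sgval (sgval z)).1.1.
Lemma half_cup : is_cup (psi_path g) 1%g f.
Proof.
have [_ H] := sgvalP (sgval z); have zs : dflg_s (sgval z) = 1%g := sgvalP z.
have zs' : (sgval (sgval z)).1.2 = 1%g := zs.
by rewrite zs' in H.
Qed.
Lemma half_cup_l (x : segment (pi : R)) : ev f (sval x) = psi_path g x.
Proof. by case: half_cup => + _; exact. Qed.
Lemma half_cup_r (s : R) : 0 <= s <= pi -> ev f (pi *+ 2 - s) = 1%g.
Proof. by move=> sP; case: half_cup => _ /(_ (exist _ s sP)). Qed.
Lemma half_cup_r' (s : R) : - pi <= s <= 0 -> ev f s = 1%g.
Proof.
move=> /andP[s1 s2]; rewrite -(ev_period f s 1) mulr1z -[s]opprK addrC half_cup_r//.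
by apply/andP; lra.
Qed.
Lemma half_Omega : isOmega f.
Proof.
have [g1 [e [e0 ga gb]]] := sgvalP g; rewrite -/(psi_path g) in g1 ga gb.
have z0 : 0 <= (0 : R) <= pi by rewrite lexx ltW.
have f0 : ev f 0 = 1%g by rewrite [LHS](half_cup_l (exist (fun x : R => is_true (0 <= x <= pi)) 0 z0)) g1.
split=> //; apply: (flat_locally_constant (W := [set s | - pi < s < Num.min e pi])).
- by rewrite -[X in open X]set_itvoo; exact: itv_open.
- by rewrite /= lt_min e0 oppr_lt0 p0.
move=> s /andP[s1]; rewrite lt_min => /andP[s2 s3]; rewrite f0.
have [s0|s0] := lerP s 0; first by rewrite half_cup_r'// (ltW s1).
have sP : 0 <= s <= pi by rewrite !ltW.
rewrite [LHS](half_cup_l (exist (fun x : R => is_true (0 <= x <= pi)) s sP)).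
by rewrite (ga _ (exist _ 0 z0)) ?g1//= ltW.
Qed.
Lemma half_arc : in_L arc0pi f.
Proof.
move=> s Hs; pose m := Num.floor (s / (pi *+ 2)).
have tp0 : 0 < (pi *+ 2 : R) by rewrite mulrn_wgt0.
have [m1 m2] : (pi *+ 2) *~ m <= s /\ s < (pi *+ 2) *~ m + pi *+ 2.
  have := floor_itv (s / (pi *+ 2)) => /andP[].
  rewrite -/m ler_pdivlMr// ltr_pdivrMr// intrD mulrDl mul1r !mulrzl.
  by move=> ? ?; split.
rewrite -(ev_period f s (- m)) mulrNz.
set r := s - _; have r0 : 0 <= r by rewrite /r; lra.
have r1 : r < pi *+ 2 by rewrite /r; lra.
have [rp|rp] := ltrP r pi.
  have [re|re] := eqVneq r 0; first by rewrite re; case: half_Omega.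
  by exfalso; apply: Hs; exists (- m); rewrite mulrNz -/r rp andbT lt_def re.
have -> : r = pi *+ 2 - (pi *+ 2 - r) by lra.
by apply: half_cup_r; apply/andP; lra.
Qed.
End Incl1.

Lemma incl1_P1 (z : dflg_half) :
  preim_sg (ce_proj E) (Omega_sg G) (sgval (sgval z)).2.
Proof. exact: half_Omega. Qed.
Lemma incl1_P2 (z : dflg_half) :
  preim_sg OmegaE_proj (half_sg G) (SubOf (incl1_P1 z) : OmegaE).
Proof. exact: half_arc. Qed.
Definition incl1 (z : dflg_half) : Ehalf OmegaE_proj := SubOf (incl1_P2 z).
End Waldorf.

Section Pullback.
Context {R : realType} {A B F : diffGroupType R} (f : diffHom A F) (g : diffHom B F).
Definition pullback_set (z : A * B) := f z.1 = g z.2.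
Lemma pullback1 : pullback_set 1%g. Proof. by rewrite /pullback_set !dh1. Qed.
Lemma pullbackM z w : pullback_set z -> pullback_set w -> pullback_set (z * w)%g.
Proof. by rewrite /pullback_set !dhM => -> ->. Qed.
Lemma pullbackV z : pullback_set z -> pullback_set (z^-1)%g.
Proof. by rewrite /pullback_set !dhV => ->. Qed.
Definition pullback_sg : subgroup (A * B)%type :=
  @Subgroup R (A * B)%type (fun z => pullback_set z) pullback1 pullbackM pullbackV.
End Pullback.

Section BCSSspaces.
Context {R : realType} (G : lieType R).
Let p0 : 0 < (pi : R) := pi_gt0 R.

Lemma PB1 : starts_at_1 (1%g : gpath G (pi *+ 2)). Proof. by []. Qed.
Lemma PBM (f g : gpath G (pi *+ 2)) : starts_at_1 f -> starts_at_1 g -> starts_at_1 (f * g)%g.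
Proof. by move=> f1 g1 x x0 /=; rewrite f1// g1// mulg1. Qed.
Lemma PBV (f : gpath G (pi *+ 2)) : starts_at_1 f -> starts_at_1 (f^-1)%g.
Proof. by move=> f1 x x0 /=; rewrite f1// invg1. Qed.
Definition PB_sg : subgroup (gpath G (pi *+ 2)) :=
  @Subgroup R (gpath G (pi *+ 2)) (fun g : gpath G (pi *+ 2) => starts_at_1 g) PB1 PBM PBV.
Definition PeG_B : diffGroupType R := sub_of PB_sg.
Definition pb_path (g : PeG_B) : gpath G (pi *+ 2) := sgval (g : sub_of PB_sg).

Lemma OB1 : ends_at_1 (pb_path 1%g). Proof. by []. Qed.
Lemma OBM (f g : PeG_B) : ends_at_1 (pb_path f) -> ends_at_1 (pb_path g) ->
  ends_at_1 (pb_path (f * g)%g).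
Proof. by move=> f1 g1 x x0; rewrite [LHS]/= -/(pb_path f) -/(pb_path g) f1// g1// mulg1. Qed.
Lemma OBV (f : PeG_B) : ends_at_1 (pb_path f) -> ends_at_1 (pb_path (f^-1)%g).
Proof. by move=> f1 x x0; rewrite [LHS]/= -/(pb_path f) f1// invg1. Qed.
Definition OB_sg : subgroup PeG_B :=
  @Subgroup R PeG_B (fun g : PeG_B => ends_at_1 (pb_path g)) OB1 OBM OBV.
Definition OmegaG_B : diffGroupType R := sub_of OB_sg.
Definition ob_path (g : OmegaG_B) : PeG_B := sgval (g : sub_of OB_sg).

Lemma halvedP (x : segment (pi *+ 2 : R)) : 0 <= sval x / 2 <= pi.
Proof. by case: x => x /= /andP[x0 x1]; apply/andP; move: x1; rewrite mulr2n; lra. Qed.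
Definition halved (x : segment (pi *+ 2 : R)) : segment (pi : R) :=
  exist (fun y : R => is_true (0 <= y <= pi)) _ (halvedP x).
Lemma halved_smooth : smooth halved.
Proof.
move=> n U q Uq; have Uq' : plot U (fun u => sval (q u) : R) by exact: Uq.
exact: plotRM Uq' (plot_cst (2^-1 : R) (plot_open Uq')).
Qed.
Definition reparam (g : gpath G pi) : gpath G (pi *+ 2) :=
  CMap (smooth_comp halved_smooth (cmap_smooth g)).
Lemma reparam_smooth : smooth reparam.
Proof.
move=> n U q [oU Hq]; split=> // m V a b oV aC aU Vb.
by apply: (Hq m V a (fun v => halved (b v))) => //; exact: halved_smooth.
Qed.

Lemma rep_P (g : PeG G) : PB_sg (reparam (pe_path g)).
Proof.
have [g1 _ _] := sgvalP g; rewrite -/(pe_path g) in g1.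
by move=> x x0; rewrite /= g1//= x0 mul0r.
Qed.
Definition rep (g : PeG G) : PeG_B := SubOf (rep_P g).

Lemma rmap_P1 (f : sub_of (half_sg G)) : PB_sg (reparam (restr pi (oloop (sgval f)))).
Proof.
have [f0 _] := sgvalP (sgval f).
by move=> x x0; rewrite /= x0 mul0r.
Qed.
Lemma rmap_P2 (f : sub_of (half_sg G)) : OB_sg (SubOf (rmap_P1 f) : PeG_B).
Proof.
have fh s : ~ arc0pi s -> ev (oloop (sgval f)) s = 1%g := sgvalP f s.
move=> x x0; rewrite [LHS]/= fh// x0; apply: not_arc.
have := p0; by move=> q0; apply/andP; rewrite mulr2n; lra.
Qed.
Definition rmap_fun (f : sub_of (half_sg G)) : OmegaG_B := SubOf (rmap_P2 f).
Lemma rmap_smooth : smooth rmap_fun.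
Proof.
move=> n U q [oU Hq]; apply: (@reparam_smooth n U (fun u => restr pi (oloop (sgval (q u))))).
split=> // m V a b oV aC aU Vb.
have Vb' : plot V (fun v => sval (b v) : R) by exact: Vb.
exact: (Hq m V a (fun v => sval (b v) : R)).
Qed.
Lemma rmapM (f g : sub_of (half_sg G)) : rmap_fun (f * g)%g = (rmap_fun f * rmap_fun g)%g.
Proof. by apply: sub_ofP; apply: sub_ofP; apply: cmapP. Qed.
Definition rmap : diffHom (sub_of (half_sg G)) OmegaG_B := DiffHom rmap_smooth rmapM.

(* An isomorphism of central extensions from the restriction of E to
   Omega_(0,pi) G to the pullback of EB along r. *)
Record level_iso (E : centralExt (OmegaG G)) (EB : centralExt OmegaG_B) := {
  lv_fun : diffHom (Ehalf (ce_proj E)) (sub_of (pullback_sg rmap (ce_proj EB)));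
  lv_inv : diffHom (sub_of (pullback_sg rmap (ce_proj EB))) (Ehalf (ce_proj E));
  lv_funK : cancel lv_fun lv_inv;
  lv_invK : cancel lv_inv lv_fun;
  lv_cover : forall Phi, (sgval (lv_fun Phi)).1 = preim_hom (ce_proj E) (half_sg G) Phi;
  lv_U1 : forall Phi z, eh_val Phi = ce_inc E z -> (sgval (lv_fun Phi)).2 = ce_inc EB z
}.
Definition rtilde E EB (L : level_iso E EB) (Phi : Ehalf (ce_proj E)) : EB :=
  (sgval (lv_fun L Phi)).2.
End BCSSspaces.

Section LieAlgebra.
Context {R : realType} (G : lieType R).
Notation d := (ldim G).

(* A chart at the identity identifies the Lie algebra T_1 G with R^d. *)
Record id_chart := IdChart {
  ic_dom : set G;
  ic_phi : G -> 'rV[R]_d;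
  ic_psi : 'rV[R]_d -> G;
  ic_chart : chart ic_dom ic_phi ic_psi;
  ic_1 : ic_dom 1%g;
  ic_0 : ic_phi 1%g = 0
}.
Variable C : id_chart.
(* The tangent vector at s = 0 of a curve through 1, and the bracket
   [u, v] = d/ds Ad_(exp su) v at s = 0. *)
Definition vel (c : R -> G) : 'rV[R]_d := derive1 (ic_phi C \o c) 0.
Definition lie_br (u v : 'rV[R]_d) : 'rV[R]_d :=
  derive1 (fun s => vel (fun t =>
    (ic_psi C (s *: u) * ic_psi C (t *: v) * (ic_psi C (s *: u))^-1)%g)) 0.

Definition simple_lie := (exists u v, lie_br u v <> 0) /\
  forall A : 'M[R]_d, (forall x y : 'rV[R]_d, (y <= A)%MS -> (lie_br x y <= A)%MS) ->
    A = 0 \/ row_full A.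

Definition form (b : 'M[R]_d) (u v : 'rV[R]_d) : R := (u *m b *m v^T) ord0 ord0.

(* Extension by 0, so that derive1 makes sense; the derivative is junk only at
   the two endpoints. *)
Definition zero_ext a (X : segment a -> 'rV[R]_d) (s : R) : 'rV[R]_d :=
  match pselect (0 <= s <= a) with
  | left h => X (exist (fun x : R => is_true (0 <= x <= a)) s h)
  | right _ => 0
  end.
Definition omega (b : 'M[R]_d) (X Y : segment (pi *+ 2) -> 'rV[R]_d) : R :=
  (\int[lebesgue_measure]_(s in `[0%R, (pi *+ 2)%R])
     form b (zero_ext X s) (derive1 (zero_ext Y) s))%R.

Definition pvel (c : R -> PeG_B G) (x : segment (pi *+ 2)) : 'rV[R]_d :=
  vel (fun s => pb_path (c s) x).
Definition lvel (c : R -> OmegaG_B G) (x : segment (pi *+ 2)) : 'rV[R]_d :=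
  pvel (fun s => ob_path (c s)) x.

(* Smooth singular 2-simplices of Omega G. A smooth map on the standard simplex
   {x, y >= 0, x + y <= 1} is represented by a smooth extension to the plane;
   only its restriction to the simplex is used. The periods of the
   left-invariant 2-form omega b are its integrals over smooth 2-cycles. *)
Definition sing_simplex := cmap (R * R)%type (OmegaG_B G).
Definition sing_chain := seq (int * sing_simplex).
Definition is_face (f e : R -> OmegaG_B G) : int :=
  `[< forall t : R, 0 <= t <= 1 -> f t = e t >]%:R.
(* The coefficient of the 1-simplex e in the boundary of z. *)
Definition boundary_coef (z : sing_chain) (e : R -> OmegaG_B G) : int :=
  \sum_(c <- z) c.1 * (is_face (fun t => c.2 (1 - t, t)) e
    - is_face (fun t => c.2 (0, t)) e + is_face (fun t => c.2 (t, 0)) e).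
Definition is_cycle (z : sing_chain) := forall e, boundary_coef z e = 0.
Definition simplex_int (b : 'M[R]_d) (c : sing_simplex) : R :=
  (\int[lebesgue_measure]_(x in `[0%R, 1%R]) \int[lebesgue_measure]_(y in `[0%R, (1 - x)%R])
     omega b (lvel (fun s => (c (x, y))^-1 * c (x + s, y))%g)
             (lvel (fun s => (c (x, y))^-1 * c (x, y + s))%g))%R.
Definition periods (b : 'M[R]_d) : set R :=
  [set r | exists z : sing_chain, is_cycle z /\ r = \sum_(c <- z) c.1%:~R * simplex_int b c.2].

Record basic_form (b : 'M[R]_d) : Prop := {
  bf_sym : forall u v, form b u v = form b v u;
  bf_pos : forall u, u != 0 -> 0 < form b u u;
  bf_inv : forall x y z, form b (lie_br x y) z = form b x (lie_br y z);
  bf_per : periods b = [set r | exists m : int, r = (pi *+ 2) *~ m]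
}.

Definition curve_at_1 (E : diffGroupType R) (c : R -> E) := smooth c /\ c 0 = 1%g.
(* Equality of the tangent vectors at s = 0 of two curves through 1. *)
Definition tangent_at_1 (E : diffGroupType R) (c c' : R -> E) :=
  forall (U : set E) (u : E -> R), Dopen U -> U 1%g -> smooth_on U u ->
  derive1 (u \o c : R -> R) 0 = derive1 (u \o c' : R -> R) 0.
Definition Omega_g (X : segment (pi *+ 2) -> 'rV[R]_d) :=
  smooth X /\ forall x, sval x = 0 \/ sval x = pi *+ 2 -> X x = 0.

(* The Lie algebra of E is Omega g + R with the bracket of the cocycle k omega b.
   The tangent vector of a curve c through 1 in E corresponds to
   (lvel (ce_proj E \o c), cen c): this is well defined and injective on T_1 E
   (la_tangent), onto Omega g + R (la_surj), linear and smooth; it restricts to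
   the standard identification of the Lie algebra of U(1) with R (la_center);
   the bracket of the tangent vectors of c and c' is the derivative at s = 0 of
   Ad_(c s) applied to the tangent vector of c'. Derivatives in Omega g are
   taken pointwise. *)
Record lie_algebra_ext (b : 'M[R]_d) (k : int) (E : centralExt (OmegaG_B G))
    (cen : (R -> E) -> R) : Prop := {
  la_tangent : forall c c' : R -> E, curve_at_1 c -> curve_at_1 c' ->
    (lvel (ce_proj E \o c) = lvel (ce_proj E \o c') /\ cen c = cen c') <->
    tangent_at_1 c c';
  la_surj : forall X a, Omega_g X -> exists c : R -> E,
    [/\ curve_at_1 c, lvel (ce_proj E \o c) = X & cen c = a];
  la_add : forall c c' : R -> E, curve_at_1 c -> curve_at_1 c' ->
    cen (fun s => c s * c' s)%g = cen c + cen c';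
  la_scale : forall (c : R -> E) r, curve_at_1 c -> cen (fun s => c (r * s)) = r * cen c;
  la_smooth : forall n (U : set 'rV[R]_n) (c : 'rV[R]_n -> cmap R E), plot U c ->
    (forall u, U u -> c u 0 = 1%g) -> Cinf U (fun u => cen (c u));
  la_center : cen (fun s => ce_inc E (cis s)) = 1;
  la_bracket : forall c c' : R -> E, curve_at_1 c -> curve_at_1 c' ->
    (forall x, is_derive (0 : R) 1
      (fun s => lvel (ce_proj E \o (fun t => c s * c' t * (c s)^-1)%g) x)
      (lie_br (lvel (ce_proj E \o c) x) (lvel (ce_proj E \o c') x))) /\
    is_derive (0 : R) 1 (fun s => cen (fun t => c s * c' t * (c s)^-1)%g)
      (k%:~R * omega b (lvel (ce_proj E \o c)) (lvel (ce_proj E \o c')))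
}.

(* ba_inf is the infinitesimal action: the derivative at s = 0 of the action of
   P s on the tangent vector of c. *)
Record bcss_action (b : 'M[R]_d) (k : int) (E : centralExt (OmegaG_B G))
    (cen : (R -> E) -> R) (al : PeG_B G -> E -> E) : Prop := {
  ba_smooth : smooth (fun z : PeG_B G * E => al z.1 z.2);
  ba_act1 : forall x, al 1%g x = x;
  ba_actM : forall g h x, al (g * h)%g x = al g (al h x);
  ba_morph : forall g x y, al g (x * y)%g = (al g x * al g y)%g;
  ba_U1 : forall g z, al g (ce_inc E z) = ce_inc E z;
  ba_cover : forall g x, ob_path (ce_proj E (al g x)) = (g * ob_path (ce_proj E x) * g^-1)%g;
  ba_inf : forall (P : R -> PeG_B G) (c : R -> E), curve_at_1 P -> curve_at_1 c ->
    (forall x, is_derive (0 : R) 1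
      (fun s => lvel (ce_proj E \o (fun t => al (P s) (c t))) x)
      (lie_br (pvel P x) (lvel (ce_proj E \o c) x))) /\
    is_derive (0 : R) 1 (fun s => cen (fun t => al (P s) (c t)))
      (k%:~R * omega b (pvel P) (lvel (ce_proj E \o c)))
}.

Definition X_BCSS (E : centralExt (OmegaG_B G)) (al : PeG_B G -> E -> E) : xmod_data R :=
  @XMod R E (PeG_B G) (fun x => ob_path (ce_proj E x)) al.
End LieAlgebra.
Arguments id_chart {R} G.

Definition simply_connected (R : realType) (T : topologicalType) :=
  (forall x y : T, exists f : R -> T,
    [/\ {within `[0%R, 1%R], continuous f}, f 0 = x & f 1 = y]) /\
  forall f : R -> T, {within `[0%R, 1%R], continuous f} -> f 0 = f 1 ->
  exists H : R * R -> T,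
    [/\ {within `[0%R, 1%R] `*` `[0%R, 1%R], continuous H},
        forall t, 0 <= t <= 1 -> H (0, t) = f t,
        forall t, 0 <= t <= 1 -> H (1, t) = f 0 &
        forall s, 0 <= s <= 1 -> H (s, 0) = f 0 /\ H (s, 1) = f 0].

(* Main.v *)
Require Import Defs.
From HB Require Import structures.
From mathcomp Require Import all_boot all_order all_algebra.
From mathcomp Require Import all_classical all_reals all_analysis.
From mathcomp Require Import zify ring lra.
From mathcomp.real_closed Require Import complex.

Set Implicit Arguments.
Unset Strict Implicit.
Unset Printing Implicit Defensive.

Import Order.TTheory GRing.Theory Num.Theory numFieldNormedType.Exports.

Local Open Scope ring_scope.
Local Open Scope classical_set_scope.

(** A strict homomorphism of crossed modules is a weak equivalence as soon as [j] has
    smooth local sections and [kappa] has a smooth inverse on the kernel of [j]. In (a) and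
    (b) the sections come from reparametrizing a path [k] by a map that is constant near the
    end points: this gives a path [g] of the smaller kind with the end point of [k], and
    [k g^-1] is a loop, which lifts locally to the central extension.

    A path flat at its end points extends smoothly by constants, jointly in parameters,
    because a function vanishing for [x <= 0] is smooth once its pullback along
    [x |-> x^2] is smooth and flat at [0].

    In (b) the Peiffer identities and the equivariance of [rtilde] each say that a smooth
    character of a loop group with values in U(1) is trivial. As [G] is simply connected,
    loops are products of end points of smooth curves through 1, so a character with
    vanishing derivative at 1 is trivial. The derivative of a character depends on the
    velocity only, since curves with equal velocity lift to tangent curves of the central
    extension; it is invariant under conjugation by constant group elements, and as the Lie
    algebra is simple its velocities are sums of terms [Ad b v - v]. For the BCSS crossed
    module, the derivatives prescribed for the action and for conjugation agree. *)

(** * Smoothness across a hyperplane *)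

(** A plot of the segment [[0, pi]] is a smooth function with values in it, so near the end point 0
    a path may be composed with [x ^+ 2] but not with [x]; this dictates the square map. Flatness is
    given for each single path, while the extension has to be smooth in the parameters as well.
    Mixed derivatives at the boundary are not computed one by one: a smooth function that is
    O(|x|^N) for every N passes this property on to its derivatives in all directions, by
    interpolation with its bounded second derivatives.

    In (b) the Lie algebra of the extension is accessible only through curves, so characters are
    differentiated along curves through 1. The level isomorphism says nothing about lifts of loops
    outside (0, pi); the commutation behind the Peiffer identity of [X_Omega] is itself the
    triviality of a character, the commutator with a fixed lift. A character of half loops is a
    priori invariant only under conjugation by half loops, and a constant other than 1 is none;
    hence loops supported away from the ends are treated first, where a half loop can take the role
    of the constant. *)

Section NormedLines.
Context {R : realType} {V : normedModType R}.

Lemma near_normP (z0 : V) (P : V -> Prop) :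
  (\forall z \near z0, P z) <-> exists2 r : R, 0 < r & forall z, `|z - z0| < r -> P z.
Proof.
split=> [/nbhs_normP[r r0 H]|[r r0 H]].
  by exists r => // z zr; apply: H; rewrite /ball_/= distrC.
by apply/nbhs_normP; exists r => // z; rewrite /ball_/= distrC; exact: H.
Qed.

Lemma norm_lt_near (z u : V) (r : R) : `|z - u| < r -> \forall y \near z, `|y - u| < r.
Proof.
move=> zr; apply/near_normP; exists (r - `|z - u|); first by rewrite subr_gt0.
move=> y; rewrite ltrBrDr; apply: le_lt_trans.
by rewrite -{1}(subrK z y) -addrA ler_normD.
Qed.

Lemma line_diff (W : normedModType R) (f : V -> W) (z v : V) (t : R) :
  differentiable f (z + t *: v) ->
  differentiable (fun s : R => f (z + s *: v)) t /\
  'd (fun s : R => f (z + s *: v)) t 1 = 'd f (z + t *: v) v.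
Proof.
move=> fd; pose g := cst z + ( *:%R^~ v) : R -> V.
have gE : is_diff t g (cst 0 + ( *:%R^~ v)) by exact: is_diffD.
have gd : differentiable g t by case: gE.
have fd' : differentiable f (g t) by [].
split; first exact: (differentiable_comp gd fd').
have /(congr1 (fun h : R -> W => h 1)) /= := diff_comp gd fd'.
have -> : 'd g t = cst 0 + ( *:%R^~ v) :> (R -> V) by exact: diff_val.
by rewrite /= fctE /cst add0r scale1r.
Qed.

Lemma line_derive (W : normedModType R) (f : V -> W) (y z v : V) (t : R) :
  z + t *: v = y -> differentiable f y ->
  is_derive t 1 (fun s : R => f (z + s *: v)) ('d f y v).
Proof.
move=> <- fd; have [d1 d2] := line_diff fd.
apply: DeriveDef; first exact: diff_derivable.
by rewrite -d2; exact: deriveE.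
Qed.

Lemma quadratic_diff0 (f : V -> R) (z : V) (C : R) : f z = 0 -> (\forall y \near z, `|f y| <= C * `|y - z| ^+ 2) ->
  differentiable f z /\ ('d f z = cst 0 :> (V -> R)).
Proof.
move=> fz /near_normP[r r0 H].
have E : f \o shift z = cst (f z) + (cst 0 : V -> R) +o_ (0 : V) id.
  apply/diff_epsP => a a0.
  apply/near_normP; exists (Num.min r (a / (`|C| + 1))).
    by rewrite lt_min r0 divr_gt0// ltr_wpDl.
  move=> h; rewrite subr0 lt_min => /andP[hr ha].
  rewrite fz subr0 /cst subr0.
  have := H (h + z); rewrite addrK => /(_ hr) /le_trans; apply.
  rewrite expr2 mulrA ler_wpM2r//.
  move: ha; rewrite ltr_pdivlMr ?ltr_wpDl// => /ltW; apply: le_trans.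
  rewrite mulrC ler_wpM2l// (le_trans (ler_norm C))// lerDl//.
have c : continuous (cst 0 : V -> R) by exact: cst_continuous.
pose L : {linear V -> R} := \0.
have cL : continuous L by exact: cst_continuous.
have dE : 'd f z = L :> (V -> R) := @diff_unique _ _ _ f L z cL E.
by split => //; apply/diff_locallyP; rewrite dE; exact: (conj cL E).
Qed.

Lemma derive_near_unique (W : normedModType R) (f g : R -> W) (a : R) (df dg : W) :
  is_derive a 1 f df -> is_derive a 1 g dg -> (\forall t \near a, f t = g t) -> df = dg.
Proof. by move=> [_ <-] [_ <-]; exact: near_eq_derive. Qed.

Lemma is_derive_pow (f : R -> R) (a df : R) n : is_derive a 1 f df ->
  is_derive a 1 (fun t => f t ^+ n) (n%:R * f a ^+ n.-1 * df).
Proof.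
move=> D; have -> : (fun t => f t ^+ n) = f ^+ n; last exact: (is_derive_eq (is_deriveX n D)).
apply/funext => t; elim: n => [|n IH]; first by rewrite !expr0.
by rewrite !exprS IH.
Qed.

Lemma seg_mvt (f : V -> R) (z v : V) :
  (forall t : R, 0 <= t <= 1 -> differentiable f (z + t *: v)) ->
  exists2 t : R, 0 <= t <= 1 & f (z + v) - f z = 'd f (z + t *: v) v.
Proof.
move=> fd; pose g (s : R) := f (z + s *: v).
have D (t : R) : 0 <= t <= 1 -> is_derive t 1 g ('d f (z + t *: v) v).
  by move=> t01; exact: line_derive (fd _ t01).
have D' (t : R) : t \in `]0, 1[%R -> is_derive t 1 g ('d f (z + t *: v) v).
  by rewrite in_itv/= => /andP[t0 t1]; apply: D; rewrite !ltW.
have C : {within `[0, 1], continuous g}.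
  apply: continuous_in_subspaceT => t; rewrite inE/= in_itv/= => t01.
  by apply/differentiable_continuous/derivable1_diffP; case: (D t t01).
have [t] := MVT_segment ler01 D' C; rewrite in_itv/= => t01.
by rewrite subr0 mulr1 /g scale1r scale0r addr0 => E; exists t.
Qed.
End NormedLines.

Section Decay.
Context {R : realType} {m : nat} (i : 'I_m).
Notation V := 'rV[R]_m.
Notation l := (coordlin (R := R) (ord0 : 'I_1) i).
Let e : V := delta_mx ord0 i.
Implicit Types (O : set V) (f k : V -> R).

Lemma coordE (z : V) : l z = z ord0 i. Proof. by []. Qed.
Lemma coord_norm (z : V) : `|l z| <= `|z|.
Proof.
rewrite -[leRHS]/(mx_norm z) mx_normrE.
exact: (le_bigmax 0 (fun j : 'I_1 * 'I_m => `|z j.1 j.2|) (ord0, i)).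
Qed.
Lemma coordD (x y : V) : l (x + y) = l x + l y. Proof. exact: linearD. Qed.
Lemma coordB (x y : V) : l (x - y) = l x - l y. Proof. exact: linearB. Qed.
Lemma coordZ (c : R) (x : V) : l (c *: x) = c * l x. Proof. exact: linearZ. Qed.
Lemma diffZ_dir f (z v : V) (c : R) : 'd f z (c *: v) = c * 'd f z v.
Proof. exact: linearZ. Qed.
Lemma coord_cont : continuous l. Proof. exact: coord_continuous. Qed.
Lemma coord_delta : l e = 1. Proof. by rewrite coordE mxE !eqxx. Qed.

Lemma coord_gt_near (z : V) (a : R) : a < l z -> \forall y \near z, a < l y.
Proof.
by move=> az; have c : {for z, continuous l} := @coord_cont z; exact: (cvgr_gt _ c _ az).
Qed.
Lemma coord_lt_near (z : V) (a : R) : l z < a -> \forall y \near z, l y < a.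
Proof.
by move=> az; have c : {for z, continuous l} := @coord_cont z; exact: (cvgr_lt _ c _ az).
Qed.
Lemma coord_gt_open (a : R) : open [set z : V | a < l z].
Proof. by rewrite openE => z; exact: coord_gt_near. Qed.
Lemma coord_lt_open (a : R) : open [set z : V | l z < a].
Proof. by rewrite openE => z; exact: coord_lt_near. Qed.

(** The constant serves a full neighbourhood of a point of the hyperplane, so the estimate survives
    moving along the hyperplane; a separate bound on each normal line would not control tangential
    derivatives. *)
Definition decays O k N := forall z0, O z0 -> l z0 = 0 ->
  exists C, \forall z \near z0, `|k z| <= C * `|l z| ^+ N.

Lemma Cinf_dir (W : normedModType R) O (f : V -> W) v : Cinf O f -> Cinf O (fun x => 'd f x v).
Proof. by move=> fC n; have [_] := fC n.+1; exact. Qed.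
Lemma Cinf_differentiable (W : normedModType R) O (f : V -> W) x : Cinf O f -> O x -> differentiable f x.
Proof. by move=> fC Ox; have [+ _] := fC 1%N; exact. Qed.
Lemma Cinf_continuous (W : normedModType R) O (f : V -> W) x : Cinf O f -> O x -> {for x, continuous f}.
Proof. by move=> fC; exact: (fC 0%N). Qed.

Lemma bounded_near_pt (f : V -> R) z0 : {for z0, continuous f} ->
  \forall z \near z0, `|f z| <= `|f z0| + 1.
Proof.
move=> /cvgrPdist_lt/(_ 1 ltr01); apply: filterS => z.
rewrite distrC => h; rewrite -(subrK (f z0) (f z)).
by rewrite (le_trans (ler_normD _ _))// addrC lerD2l ltW.
Qed.

(** The mean value theorem on the normal segment from the foot of [z] on the hyperplane to [z] gains
    one factor [l z], since [|l|] on that segment is at most [|l z|]. *)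
Lemma decaysS O k N : open O -> Cinf O k -> (forall z, O z -> l z = 0 -> k z = 0) ->
  decays O (fun z => 'd k z e) N -> decays O k N.+1.
Proof.
move=> oO kC k0 H z0 Oz0 lz0; have [C] := H z0 Oz0 lz0.
have := open_nbhs_nbhs (conj oO Oz0).
move=> /filterI{}H /H/near_normP[r r0 {}H]; exists C.
have c : {for z0, continuous l} by exact: coord_cont.
have r1 : 0 < r / 2 / (1 + `|e|) by rewrite !divr_gt0// ltr_wpDr.
move/cvgrPdist_lt/(_ _ r1): c; rewrite lz0 => c.
have r2 : \forall z \near z0, `|z - z0| < r / 2.
  by apply/near_normP; exists (r / 2) => //; rewrite divr_gt0.
apply: filterS2 c r2 => z; rewrite sub0r normrN => lz zz0.
set w := z - l z *: e.
have lw : l w = 0 by rewrite coordB coordZ coord_delta mulr1 subrr.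
have wB (t : R) : 0 <= t <= 1 -> `|w + t *: (l z *: e) - z0| < r.
  move=> /andP[t0 t1].
  have -> : w + t *: (l z *: e) - z0 = (z - z0) + ((t - 1) * l z) *: e.
    by rewrite /w mulrBl mul1r scalerBl scalerA -!addrA; congr (_ + _); rewrite addrC -!addrA addrC -addrA; congr (_ + _); rewrite addrC.
  rewrite (le_lt_trans (ler_normD _ _))// (splitr r) ltr_leD//.
  rewrite normrZ normrM -mulrA.
  have t1' : `|t - 1| <= 1 by rewrite ler_norml; apply/andP; lra.
  rewrite (le_trans (ler_piMl _ t1'))// ?mulr_ge0//.
  move: lz; rewrite ltr_pdivlMr ?ltr_wpDr// => /ltW; apply: le_trans.
  by rewrite ler_wpM2l// lerDr.
have [t t01] := seg_mvt (f := k) (z := w) (v := l z *: e)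
  (fun t ht => Cinf_differentiable kC (H _ (wB t ht)).1).
have /andP[t0 t1] := t01.
rewrite subrK => E.
have Ow : O w by have [] := H _ (wB 0 _); rewrite ?lexx ?ler01// scale0r addr0.
have kw : k w = 0 by exact: k0.
rewrite kw subr0 diffZ_dir in E; rewrite E normrM exprS mulrCA ler_wpM2l//.
have [_ /le_trans] := H _ (wB t t01); apply.
rewrite coordD lw add0r !coordZ coord_delta mulr1 normrM exprMn.
(* [C] may be negative; the bound taken at [z] then forces [|l z| ^+ N = 0], and both sides
   vanish. *)
have C0 : 0 <= C * `|l z| ^+ N \/ C < 0.
  by have [C0|C0] := ltrP C 0; [right|left; rewrite mulr_ge0].
case: C0 => [C0|C0].
  rewrite mulrCA ler_piMl//.
  by rewrite exprn_ile1// ger0_norm.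
have : 0 <= C * `|l (w + 1 *: (l z *: e))| ^+ N.
  by have [_] := H _ (wB 1 (introT andP (conj ler01 (lexx 1)))); apply: le_trans.
rewrite scale1r subrK nmulr_rge0// => h.
have h0 : `|l z| ^+ N = 0 by apply/eqP; rewrite eq_le h exprn_ge0.
by rewrite h0 !mulr0.
Qed.

Fixpoint dnorm k j : V -> R := if j is j'.+1 then dnorm (fun z => 'd k z e) j' else k.

(** Taylor's formula in the normal direction alone: each vanishing normal derivative raises the
    order by one through [decaysS]. *)
Lemma flat_decays O k N : open O -> Cinf O k ->
  (forall j z, O z -> l z = 0 -> dnorm k j z = 0) -> decays O k N.
Proof.
move=> oO; elim: N k => [|N IH] k kC k0.
  move=> z0 Oz0 lz0; exists (`|k z0| + 1).
  apply: filterS (bounded_near_pt (Cinf_continuous kC Oz0)) => z.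
  by rewrite expr0 mulr1.
apply: decaysS => //; first by move=> z; exact: (k0 0%N).
by apply: IH => [|j]; [exact: Cinf_dir|exact: (k0 j.+1)].
Qed.

(** [b] is the directional derivative wanted at a point, [a] its value at the intermediate point of
    a difference quotient of step [h], and [X] a second derivative between the two points. *)
Lemma interpolation_bound (a b t h X C B : R) : `|a| <= C * h -> a - b = t * (h * X) ->
  `|X| <= B -> 0 <= t -> t <= 1 -> 0 <= h -> `|b| <= (C + B) * h.
Proof.
move=> aC E XB t0 t1 h0; have -> : b = a - t * (h * X) by rewrite -E opprB addrC subrK.
rewrite (le_trans (ler_normB _ _))// mulrDl lerD// !normrM (ger0_norm t0) (ger0_norm h0).
rewrite mulrCA [leRHS]mulrC ler_wpM2l// (le_trans _ XB)// ler_piMl//.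
Qed.

(* Interpolation: d_v k is within O(h) of a difference quotient of step
   h = |l z|^N, whose numerator is O(h^2). *)
Lemma decays_d O k v N : open O -> Cinf O k -> (forall N, decays O k N) ->
  decays O (fun z => 'd k z v) N.
Proof.
move=> oO kC H z0 Oz0 lz0.
wlog N0 : N / (0 < N)%N.
  move=> W; case: N => [|N]; last exact: W.
  exists (`|'d k z0 v| + 1); apply: filterS (bounded_near_pt (Cinf_continuous (Cinf_dir v kC) Oz0)) => z.
  by rewrite expr0 mulr1.
pose B := `|'d (fun x => 'd k x v) z0 v| + 1.
have [C HC] := H (N + N)%N z0 Oz0 lz0.
have := bounded_near_pt (Cinf_continuous (Cinf_dir v (Cinf_dir v kC)) Oz0); rewrite -/B => HB.
have /near_normP[r r0 {HC HB}HH] : \forall z \near z0,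
    [/\ O z, `|k z| <= C * `|l z| ^+ (N + N) & `|'d (fun x => 'd k x v) z v| <= B].
  apply: filterS3 (open_nbhs_nbhs (conj oO Oz0)) HC HB => z h1 h2 h3; split=> //.
have C0 : 0 <= `|C| by [].
exists (`|C| * (1 + `|v|) ^+ (N + N) + `|C| + B).
pose v1 := 1 + `|v|; have v1p : 1 <= v1 by rewrite lerDl.
have r1 : 0 < r / 2 / v1 by rewrite !divr_gt0// (lt_le_trans ltr01).
have c : {for z0, continuous l} by exact: coord_cont.
have lm : 0 < Num.min 1 (r / 2 / v1) by rewrite lt_min ltr01.
move/cvgrPdist_lt/(_ _ lm): c; rewrite lz0 => c.
have r2 : \forall z \near z0, `|z - z0| < r / 2.
  by apply/near_normP; exists (r / 2) => //; rewrite divr_gt0.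
apply: filterS2 c r2 => z; rewrite sub0r normrN lt_min => /andP[lz1 lz2] zz0.
have [|Oz kz Bz] := HH z.
  by rewrite (lt_trans zz0)// ltr_pdivrMr// ltr_pMr// ltr1n.
have [h hE] : exists h : R, h = `|l z| ^+ N by exists (`|l z| ^+ N).
have h0 : 0 <= h by rewrite hE exprn_ge0.
(* Here [0 < N] enters: the step does not exceed [|l z|], so [|l|] grows at most by the factor
   [1 + |v|] along it. *)
have hl : h <= `|l z| by rewrite hE -(prednK N0) exprS ler_piMr// exprn_ile1// ltW.
have [lz00|lzn0] := eqVneq (l z) 0.
  have k00 x : O x -> l x = 0 -> k x = 0.
    move=> Ox lx; have [D] := H 1%N x Ox lx => /nbhs_singleton.
    by rewrite lx normr0 expr0n/= mulr0 normr_le0 => /eqP.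
  (* where l vanishes so does the step; there k = O(l^2) kills the derivative *)
  suff -> : 'd k z v = 0 by rewrite normr0 mulr_ge0 ?exprn_ge0// !addr_ge0// ?mulr_ge0// exprn_ge0// ltW// (lt_le_trans ltr01).
  have [C2 HC2] := H 2%N z Oz lz00.
  have kd := Cinf_differentiable kC Oz.
  rewrite -deriveE//; apply/eqP/negPn/negP => d0.
  have dp : 0 < `|'D_v k z| / 2 by rewrite divr_gt0// normr_gt0.
  have /cvgrPdist_lt/(_ _ dp) D := diff_derivable (v := v) kd.
  have zt : (fun t : R => t *: v + z) @ 0^' --> z.
    rewrite -[X in _ --> X]add0r -[X in X + z](scale0r v).
    by apply: cvgD; [apply: cvg_within_filter; exact: scalel_continuous|exact: cvg_cst].
  have zt2 := zt _ HC2.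
  have t1 : \forall t \near (0 : R)^', `|t| < `|'D_v k z| / 2 / (`|C2| * v1 ^+ 2 + 1).
    apply: (@dnbhs0_lt R R).
    by rewrite divr_gt0// ltr_wpDl// mulr_ge0// exprn_ge0// (le_trans ler01).
  have t2 : \forall t \near (0 : R)^', t != 0 by exact: nbhs_dnbhs_neq.
  have [t [[[Dt Zt] T1] T2]] := filter_ex (filterI (filterI (filterI D zt2) t1) t2).
  have {}Dt : `|'D_v k z - t^-1 *: (k (t *: v + z) - k z)| < `|'D_v k z| / 2 := Dt.
  rewrite (k00 z)// subr0 in Dt.
  have : `|'D_v k z| / 2 <= `|t^-1 *: k (t *: v + z)|.
    have := ler_distD (t^-1 *: k (t *: v + z)) ('D_v k z) 0.
    rewrite !subr0 => hh; move: Dt hh; lra.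
  apply/negP; rewrite -ltNge normrM normfV.
  rewrite mulrC ltr_pdivrMr ?normr_gt0//.
  apply: le_lt_trans Zt _; rewrite /= coordD lz00 addr0 coordZ normrM exprMn.
  have : `|t| * (`|C2| * v1 ^+ 2 + 1) < `|'D_v k z| / 2.
    by rewrite -ltr_pdivlMr// ltr_wpDl// mulr_ge0// exprn_ge0// (le_trans ler01).
  have tp : 0 < `|t| by rewrite normr_gt0.
  move=> hh; rewrite -(ltr_pM2r tp) in hh; apply: le_lt_trans hh.
  have l1 : `|l v| ^+ 2 <= v1 ^+ 2.
    have lv : `|l v| <= v1 by apply: le_trans (coord_norm v) _; rewrite lerDr.
    by apply: lerXn2r => //; rewrite nnegrE ?normr_ge0// (le_trans _ lv).
  have tt : 0 <= `|t| ^+ 2 by rewrite exprn_ge0.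
  apply: (@le_trans _ _ (`|C2| * (`|t| ^+ 2 * v1 ^+ 2))).
    apply: (@le_trans _ _ (`|C2| * (`|t| ^+ 2 * `|l v| ^+ 2))).
      by rewrite ler_wpM2r ?ler_norm// mulr_ge0// exprn_ge0.
    by rewrite ler_wpM2l// ler_wpM2l.
  by rewrite expr2; nra.
have hp : 0 < h by rewrite hE exprn_gt0// normr_gt0.
have sB (t : R) : 0 <= t <= 1 -> `|z + t *: (h *: v) - z0| < r.
  move=> /andP[t0 t1].
  rewrite addrAC (le_lt_trans (ler_normD _ _))// (splitr r) ltr_leD//.
  rewrite !normrZ (ger0_norm t0) (ger0_norm h0).
  have : h * `|v| <= r / 2.
    move: lz2; rewrite ltr_pdivlMr ?(lt_le_trans ltr01)// => /ltW; apply: le_trans.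
    by apply: ler_pM => //; rewrite lerDr.
  by apply: le_trans; rewrite ler_piMl// mulr_ge0.
have [t t01] := seg_mvt (f := k) (z := z) (v := h *: v)
  (fun t ht => Cinf_differentiable kC (let: And3 a _ _ := HH _ (sB t ht) in a)).
have /andP[t0 t1] := t01.
move=> E1; have {}E1 := etrans E1 (diffZ_dir k (z + t *: (h *: v)) v h).
have sB2 (s : R) : 0 <= s <= 1 -> 0 <= s * t <= 1.
  by move=> /andP[s0 s1]; rewrite mulr_ge0//= mulr_ile1.
have [s s01] := seg_mvt (f := fun x => 'd k x v) (z := z) (v := t *: (h *: v))
  (fun s hs => Cinf_differentiable (Cinf_dir v kC)
    (let: And3 a _ _ := HH _ (sB (s * t) (sB2 s hs)) in
     eq_ind_r (fun y => O (z + y)) a (scalerA s t (h *: v)))).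
move=> E2; have {}E2 := etrans E2 (etrans (diffZ_dir (fun x => 'd k x v) _ (h *: v) t) (congr1 ( *%R t) (diffZ_dir (fun x => 'd k x v) _ v h))).
have [_ _ B2] := HH _ (sB _ (sB2 s s01)).
have [_ K2 _] := HH _ (sB 1 (introT andP (conj ler01 (lexx 1)))).
rewrite scale1r in K2.
have lzv : `|l (z + h *: v)| <= `|l z| * v1.
  rewrite coordD coordZ (le_trans (ler_normD _ _))// /v1 mulrDr mulr1 lerD2l.
  by rewrite normrM (ger0_norm h0) ler_pM// coord_norm.
have K2' : `|k (z + h *: v)| <= `|C| * v1 ^+ (N + N) * (h * h).
  apply: (le_trans K2); apply: (@le_trans _ _ (`|C| * `|l (z + h *: v)| ^+ (N + N))).
    by rewrite ler_wpM2r ?exprn_ge0// ler_norm.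
  have -> : h * h = `|l z| ^+ (N + N) by rewrite hE exprD.
  rewrite -mulrA ler_wpM2l// mulrC -exprMn lerXn2r ?nnegrE//.
  by rewrite mulr_ge0// (le_trans ler01).
have K1' : `|k z| <= `|C| * (h * h).
  by apply: (le_trans kz); rewrite hE -exprD ler_wpM2r ?exprn_ge0// ler_norm.
have E1' : h * `|'d k (z + t *: (h *: v)) v| <= (`|C| * v1 ^+ (N + N) + `|C|) * (h * h).
  rewrite -{1}(ger0_norm h0) -normrM.
  have -> : h * 'd k (z + t *: (h *: v)) v = k (z + h *: v) - k z by rewrite E1.
  by rewrite (le_trans (ler_normB _ _))// mulrDl lerD.
have E1'' : `|'d k (z + t *: (h *: v)) v| <= (`|C| * v1 ^+ (N + N) + `|C|) * h.
  by rewrite -(ler_pM2l hp) (le_trans E1')// mulrCA.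
have sE : z + s *: (t *: (h *: v)) = z + (s * t) *: (h *: v) by rewrite scalerA.
have B2' := eq_ind_r (fun y : V => `|'d (fun x => 'd k x v) y v| <= B) B2 sE.
by rewrite -hE; exact: interpolation_bound E1'' E2 B2' t0 t1 h0.
Qed.
End Decay.

Section Glue.
Context {R : realType} {m : nat} (i : 'I_m).
Notation V := 'rV[R]_m.
Notation l := (coordlin (R := R) (ord0 : 'I_1) i).
Let e : V := delta_mx ord0 i.
Implicit Types (O : set V) (f k : V -> R).

(** The quadratic bound makes a function that is zero for [l <= 0] differentiable on the hyperplane,
    with zero differential there. It is asked only on the side [0 < l]. *)
Definition glue_base O f := [/\ forall z, O z -> 0 < l z -> {for z, continuous f},
  forall z, O z -> l z <= 0 -> f z = 0 &
  forall z0, O z0 -> l z0 = 0 -> exists C, \forall z \near z0, 0 < l z -> `|f z| <= C * `|l z| ^+ 2].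
(** Derivatives are cut off to 0 for [l <= 0] before the recursion, so differentiability is only
    ever assumed for [0 < l]; smoothness across the hyperplane is the conclusion. *)
Fixpoint gluable n O f : Prop := glue_base O f /\
  if n is n'.+1 then (forall z, O z -> 0 < l z -> differentiable f z) /\
    forall v, gluable n' O (fun z => if 0 < l z then 'd f z v else 0)
  else True.

Lemma glue_diff0 O f z : open O -> glue_base O f -> O z -> l z <= 0 ->
  differentiable f z /\ ('d f z = cst 0 :> (V -> R)).
Proof.
move=> oO [_ f0 fb] Oz lz.
have fz := f0 z Oz lz.
have NO := open_nbhs_nbhs (conj oO Oz).
have [lz0|lz0] := eqVneq (l z) 0.
  have [C HC] := fb z Oz lz0.
  apply: (@quadratic_diff0 _ _ f z `|C|) => //; apply: filterS2 NO HC => y Oy Hy.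
  have [ly|ly] := ltrP 0 (l y); last by rewrite f0// normr0 mulr_ge0// exprn_ge0.
  apply: (le_trans (Hy ly)); apply: (@le_trans _ _ (`|C| * `|l y| ^+ 2)).
    by rewrite ler_wpM2r ?exprn_ge0// ler_norm.
  rewrite ler_wpM2l// lerXn2r ?nnegrE//.
  by have := coord_norm i (y - z); rewrite coordB lz0 subr0.
have {lz lz0} lz : l z < 0 by rewrite lt_neqAle lz0.
apply: (@quadratic_diff0 _ _ f z 0) => //.
by apply: filterS2 NO (coord_lt_near lz) => y Oy ly; rewrite mul0r f0 ?normr0// ltW.
Qed.

Lemma gluable_Cn n O f : open O -> gluable n O f -> Cn n O f.
Proof.
move=> oO; elim: n f => [|n IH] f /= [fb].
  move=> _ z Oz; have [lz|lz] := ltrP 0 (l z); first by case: fb => /(_ z Oz lz).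
  by have [d _] := glue_diff0 oO fb Oz lz; exact: differentiable_continuous.
move=> [fd fD]; split=> [z Oz|v].
  by have [lz|lz] := ltrP 0 (l z); [exact: fd|have [] := glue_diff0 oO fb Oz lz].
apply: Cn_eq (IH _ (fD v)) => // z Oz.
by case: ltrP => // lz; have [_ ->] := glue_diff0 oO fb Oz lz.
Qed.

(* Pulling f back along l |-> l^2 turns it into a smooth function k flat on l = 0;
   the derivatives of f then pull back to k' / l^p with k' again flat. *)
Definition sqcoord (z : V) : V := z + (l z ^+ 2 - l z) *: e.
Lemma coord_sq z : l (sqcoord z) = l z ^+ 2.
Proof. by rewrite coordD coordZ coord_delta mulr1 addrC subrK. Qed.

Lemma sqcoord_Cinf (U : set V) : open U -> Cinf U sqcoord.
Proof.
move=> oU n; apply: CnD => //.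
  by apply: (@Cn_lin _ _ _ n U idfun) => x; exact: cvg_id.
have lC : Cn n U l by apply: Cn_lin; exact: coord_cont.
apply: (CnZ (a := fun z => l z ^+ 2 - l z)) => //; last exact: Cn_cst.
have sC : Cn n U (fun z => l z * l z) by exact: (CnZ oU lC lC).
have nC : Cn n U (fun z => -1 * l z) by apply: (CnZ oU _ lC); exact: (Cn_cst n U (-1 : R)).
by apply: Cn_eq (CnD oU sC nC) => // z _; rewrite /= mulN1r expr2.
Qed.

Lemma sq_preim_open O : open O -> open (sqcoord @^-1` O).
Proof.
move=> oO; rewrite -[X in open X]setTI; apply: (open_preim openT oO).
exact: sqcoord_Cinf openT.
Qed.

Lemma decaysD O f k N : decays i O f N -> decays i O k N -> decays i O (fun z => f z + k z) N.
Proof.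
move=> Hf Hk z Oz lz; have [C HC] := Hf z Oz lz; have [D HD] := Hk z Oz lz.
exists (C + D); apply: filterS2 HC HD => y h1 h2.
by rewrite (le_trans (ler_normD _ _))// mulrDl lerD.
Qed.
Lemma decaysM O f k N : (forall z, O z -> {for z, continuous f}) -> decays i O k N ->
  decays i O (fun z => f z * k z) N.
Proof.
move=> fc Hk z Oz lz; have [C HC] := Hk z Oz lz.
exists ((`|f z| + 1) * C); apply: filterS2 HC (bounded_near_pt (fc z Oz)) => y h1 h2.
by rewrite normrM -mulrA ler_pM.
Qed.

(** For [0 < l] the map [sqcoord] is inverted by [r], which replaces [l] by its square root, so
    [f z] is [k (r z)] divided by the [p]-th power of that root. *)
Lemma root_base O f k p : open O -> Cinf (O `&` [set z | 0 < l z]) f ->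
  (forall z, O z -> l z <= 0 -> f z = 0) ->
  (forall N, decays i (sqcoord @^-1` O) k N) ->
  (forall z, O (sqcoord z) -> 0 < l z -> l z ^+ p * f (sqcoord z) = k z) ->
  glue_base O f.
Proof.
move=> oO fC f0 kd fk; split=> //; first by move=> z Oz lz; apply: (fC 0%N).
move=> z0 Oz0 lz0.
have Sz0 : sqcoord z0 = z0 by rewrite /sqcoord lz0 expr0n subrr scale0r addr0.
(* Order [p + 4]: at [r z] the coordinate is the square root of [l z]; after division by its [p]-th
   power the remaining fourth power is [l z ^+ 2], the bound asked by [glue_base]. *)
have [C HC] : exists C, \forall z \near z0, `|k z| <= C * `|l z| ^+ (p + 4).
  by apply: kd => //=; rewrite Sz0.
exists C; pose r (z : V) : V := z + (Num.sqrt (l z) - l z) *: e.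
have rc : r z @[z --> z0] --> r z0.
  have lc : l z @[z --> z0] --> l z0 by exact: coord_cont.
  have c1 : {for z0, continuous (fun z : V => Num.sqrt (l z) - l z : R)}.
    apply: continuousB => //.
    by apply: continuous_comp => //; exact: sqrt_continuous.
  have c2 : {for z0, continuous (fun z : V => (Num.sqrt (l z) - l z) *: e)}.
    by apply: continuousZ => //; exact: cst_continuous.
  have c3 : {for z0, continuous (idfun \+ (fun z : V => (Num.sqrt (l z) - l z) *: e))}.
    by apply: continuousD; [exact: cvg_id|exact: c2].
  exact: c3.
have rz0 : r z0 = z0 by rewrite /r lz0 sqrtr0 subrr scale0r addr0.
rewrite rz0 in rc; have := rc _ HC => /=.
apply: filterS2 (open_nbhs_nbhs (conj oO Oz0)) => z Oz + lz.
have lr : l (r z) = Num.sqrt (l z).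
  by rewrite coordD coordZ coord_delta mulr1 addrC subrK.
have sp : 0 < Num.sqrt (l z) by rewrite sqrtr_gt0.
have Sr : sqcoord (r z) = z.
  rewrite /sqcoord lr sqr_sqrtr ?ltW// /r -addrA -scalerDl.
  by rewrite addrC -[X in X *: _]/(_ + _) addrA subrK subrr scale0r add0r.
have : Num.sqrt (l z) ^+ p * f z = k (r z).
  by have := fk (r z); rewrite lr Sr; apply.
rewrite /= lr => <-; rewrite normrM normrX exprD ger0_norm ?sqrtr_ge0// mulrCA.
rewrite ler_pM2l ?exprn_gt0// => /le_trans; apply.
by rewrite (exprM _ 2 2) sqr_sqrtr ?(ltW lz)// (ger0_norm (ltW lz)).
Qed.

(** The algebra of [root_step], separated from the calculus: [x] is [l z], [C] and [B] are the value
    and the normal derivative of [f] at [sqcoord z], [K] and [A] those of [k] at [z]. *)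
Lemma root_step_alg (x K A B C : R) p : x ^+ p * C = K ->
  x ^+ p * (B * (2 * x)) + C * (p%:R * x ^+ p.-1) = A ->
  p%:R * K + 2 * x ^+ p.+2 * B = x * A.
Proof. by move=> <- <-; case: p => [|p]; rewrite ?mul0r/= ?exprS; ring. Qed.
Lemma root_step_alg2 (x y K A A0 B B0 D : R) p : D = B0 + y * B -> x ^+ p * B0 = A0 ->
  p%:R * K + 2 * x ^+ p.+2 * B = x * A ->
  x ^+ p.+2 * D = x ^+ 2 * A0 + y / 2 * (x * A - p%:R * K).
Proof. by move=> -> <- <-; rewrite !exprS; field. Qed.

(** The vector [v] splits into [v0] with [l v0 = 0], along which [sqcoord] is a translation, and a
    multiple of [e], along which it squares the coordinate. The chain rule in the normal direction
    produces the factor [2 * l z]; clearing it and the derivative of [l ^+ p] costs two powers of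
    [l]. *)
Lemma root_step f k p z v : 0 < l z -> differentiable f (sqcoord z) -> differentiable k z ->
  (\forall y \near z, l y ^+ p * f (sqcoord y) = k y) ->
  l z ^+ p.+2 * 'd f (sqcoord z) v =
  l z ^+ 2 * 'd k z (v - l v *: e) + l v / 2 * (l z * 'd k z e - p%:R * k z).
Proof.
move=> lz fd kd N.
have line (u : V) : (fun t : R => z + t *: u) @ (0 : R) --> z.
  rewrite -[X in _ --> X]addr0 -[X in z + X](scale0r u).
  by apply: cvgD; [exact: cvg_cst|exact: scalel_continuous].
have kD (u : V) : is_derive (0 : R) 1 (fun t : R => k (z + t *: u)) ('d k z u).
  by apply: line_derive kd; rewrite scale0r addr0.
have fD (y : V) (s : R) (u : V) : sqcoord z = y + s *: u ->
    is_derive s 1 (fun t : R => f (y + t *: u)) ('d f (sqcoord z) u).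
  by move=> E; exact: line_derive.
pose v0 := v - l v *: e.
have lv0 : l v0 = 0 by rewrite coordB coordZ coord_delta mulr1 subrr.
have E0 : l z ^+ p * 'd f (sqcoord z) v0 = 'd k z v0.
  have := fD (sqcoord z) 0 v0; rewrite scale0r addr0 => /(_ erefl) D.
  have D1 : is_derive (0 : R) 1 (fun t : R => l z ^+ p * f (sqcoord z + t *: v0)) (l z ^+ p * 'd f (sqcoord z) v0).
    by have := is_deriveM (is_derive_cst (l z ^+ p) (0 : R) (1 : R)) D; rewrite scaler0 addr0.
  have Ne : \forall t \near (0 : R), l z ^+ p * f (sqcoord z + t *: v0) = k (z + t *: v0).
    have N' : \forall t \near (0 : R), l (z + t *: v0) ^+ p * f (sqcoord (z + t *: v0)) = k (z + t *: v0) := line v0 _ N.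
    apply: filterS N' => t <-.
    rewrite /sqcoord; have -> : l (z + t *: v0) = l z by rewrite coordD coordZ lv0 mulr0 addr0.
    by rewrite addrAC.
  exact: derive_near_unique D1 (kD v0) Ne.
have E1 : p%:R * k z + 2 * l z ^+ p.+2 * 'd f (sqcoord z) e = l z * 'd k z e.
  pose q (t : R) := (l z + t) ^+ 2.
  pose y := sqcoord z - l z ^+ 2 *: e.
  have D := fD y (q 0) e; rewrite /q addr0 /y subrK in D.
  have {}D := D erefl.
  have Dt : is_derive (0 : R) 1 (fun t : R => l z + t) 1.
    by have := is_deriveD (is_derive_cst (l z) (0 : R) 1) (is_derive_id (0 : R) 1); rewrite add0r.
  have Dq : is_derive (0 : R) 1 q (2 * l z).
    by have := is_derive_pow 2 Dt; rewrite addr0 /= expr1 mulr1.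
  have D2 : is_derive (0 : R) 1 (fun t : R => f (y + q t *: e)) ('d f (sqcoord z) e * (2 * l z)).
    apply: (@is_derive1_comp _ (fun s => f (y + s *: e)) q) => //.
    by rewrite /q addr0.
  have Dp : is_derive (0 : R) 1 (fun t : R => (l z + t) ^+ p) (p%:R * l z ^+ p.-1).
    by have := is_derive_pow p Dt; rewrite addr0 mulr1.
  have D3 : is_derive (0 : R) 1 (fun t : R => (l z + t) ^+ p * f (y + q t *: e))
      (l z ^+ p * ('d f (sqcoord z) e * (2 * l z)) + f (sqcoord z) * (p%:R * l z ^+ p.-1)).
    by have := is_deriveM Dp D2; rewrite /q !addr0 /y subrK.
  have Ne : \forall t \near (0 : R), (l z + t) ^+ p * f (y + q t *: e) = k (z + t *: e).
    have N' : \forall t \near (0 : R), l (z + t *: e) ^+ p * f (sqcoord (z + t *: e)) = k (z + t *: e) := line e _ N.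
    apply: filterS N' => t <-.
    have lt : l (z + t *: e) = l z + t by rewrite coordD coordZ coord_delta mulr1.
    rewrite lt; congr (_ * f _); rewrite /sqcoord lt /y /sqcoord /q.
    apply/rowP => j; rewrite !mxE; ring.
  exact: root_step_alg (nbhs_singleton N) (derive_near_unique D3 (kD e) Ne).
have E2 : 'd f (sqcoord z) v = 'd f (sqcoord z) v0 + l v * 'd f (sqcoord z) e.
  by rewrite -diffZ_dir -linearD subrK.
exact: root_step_alg2 E2 E0 E1.
Qed.

(** The functions that become decaying and smooth after pullback and multiplication by a power of
    [l] are stable under differentiation: [root_step] replaces [p] by [p.+2] and [k] by a
    combination of [k] and its derivatives, which decays by [decays_d]. *)
Lemma root_gluable n O f k p : open O -> Cinf (O `&` [set z | 0 < l z]) f ->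
  (forall z, O z -> l z <= 0 -> f z = 0) ->
  Cinf (sqcoord @^-1` O) k -> (forall N, decays i (sqcoord @^-1` O) k N) ->
  (forall z, O (sqcoord z) -> 0 < l z -> l z ^+ p * f (sqcoord z) = k z) ->
  gluable n O f.
Proof.
move=> oO; elim: n f k p => [|n IH] f k p fC f0 kC kd fk; split=> //; try exact: root_base fk.
have oP : open (O `&` [set z | 0 < l z]).
  apply: openI => //.
  exact: coord_gt_open.
have oO' := sq_preim_open oO.
split=> [z Oz lz|v]; first by apply: (Cinf_differentiable fC).
pose k' z := l z ^+ 2 * 'd k z (v - l v *: e) + l v / 2 * (l z * 'd k z e - p%:R * k z).
have lC N (U : set V) : Cn N U l by apply: Cn_lin; exact: coord_cont.
have lc z : {for z, continuous l} by exact: coord_cont.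
apply: (IH _ k' p.+2).
- move=> N; apply: Cn_eq (Cinf_dir v fC N) => // z [_ /= ->] //.
- by move=> z _ lz; rewrite ltNge lz.
- move=> N; apply: CnD => //.
    apply: (CnZ (a := fun z => l z ^+ 2)) => //; last exact: Cinf_dir.
    exact: (CnZ oO' (lC N _) (lC N _)).
  apply: (CnZ (a := cst (l v / 2))) => //; first exact: Cn_cst.
  apply: (CnD oO' (f := fun z => l z * 'd k z e) (g := fun z => - (p%:R * k z))).
    by apply: (CnZ (a := l)) => //; exact: Cinf_dir.
  have := CnZ oO' (Cn_cst N (sqcoord @^-1` O) (- p%:R : R)) (kC N).
  by apply: Cn_eq => // z _; rewrite [_ *: _]mulNr.
- move=> N; apply: decaysD.
    apply: decaysM; last exact: decays_d.
    by move=> z _; exact: (CnZ openT (lC 0%N setT) (lC 0%N setT) z I).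
  apply: decaysM; first by move=> z _; exact: cst_continuous.
  apply: decaysD; first by apply: decaysM; [move=> z _; exact: coord_cont|exact: decays_d].
  have := @decaysM (sqcoord @^-1` O) (fun=> - p%:R) k N (fun z _ => @cst_continuous _ _ _ z) (kd N).
  by rewrite /decays /= => H z Oz lz; have [C HC] := H z Oz lz; exists C; apply: filterS HC => y; rewrite mulNr.
move=> z Oz lz; rewrite coord_sq exprn_gt0//.
rewrite (@root_step f k p)//.
- by apply: (Cinf_differentiable fC); split=> //=; rewrite coord_sq exprn_gt0.
- by apply: (Cinf_differentiable kC).
have N1 := coord_gt_near lz.
have N2 : \forall y \near z, O (sqcoord y) by exact: (open_nbhs_nbhs (conj oO' Oz)).
by apply: filterS2 N1 N2 => y ly Oy; exact: fk.
Qed.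

Lemma flat_glue O f k : open O -> Cinf (O `&` [set z | 0 < l z]) f ->
  (forall z, O z -> l z <= 0 -> f z = 0) ->
  Cinf (sqcoord @^-1` O) k ->
  (forall j z, O z -> l z = 0 -> dnorm i k j z = 0) ->
  (forall z, O (sqcoord z) -> 0 < l z -> f (sqcoord z) = k z) ->
  Cinf O f.
Proof.
move=> oO fC f0 kC k0 fk n; have oO' := sq_preim_open oO.
apply: gluable_Cn => //; apply: (@root_gluable n O f k 0) => // [N|z Oz lz].
  apply: flat_decays => // j z Oz lz; apply: k0 => //.
  by move: Oz; rewrite /= /sqcoord lz expr0n subrr scale0r addr0.
by rewrite expr0 mul1r fk.
Qed.
End Glue.

(** * Smooth functions of one variable and reflection *)

Section CinfLemmas.
Context {R : realType}.
Lemma Cinf_eq (V W : normedModType R) (U : set V) (f g : V -> W) : open U ->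
  (forall x, U x -> f x = g x) -> Cinf U f -> Cinf U g.
Proof. by move=> oU fg fC n; exact: Cn_eq fg (fC n). Qed.
Lemma Cinf_sub (V W : normedModType R) (U U' : set V) (f : V -> W) : U' `<=` U ->
  Cinf U f -> Cinf U' f.
Proof. by move=> UU fC n; exact: Cn_sub UU (fC n). Qed.
Lemma Cinf_comp (V W : normedModType R) m (U : set V) (O : set 'rV[R]_m)
    (g : V -> 'rV[R]_m) (f : 'rV[R]_m -> W) :
  open U -> (forall x, U x -> O (g x)) -> Cinf U g -> Cinf O f -> Cinf U (fun x => f (g x)).
Proof. by move=> oU gO gC fC n; exact: Cn_comp gO (gC n) (fC n). Qed.
End CinfLemmas.

Section OneVariable.
Context {R : realType}.

Lemma Cn_compR (V W : normedModType R) n (U : set V) (O : set R) (f : V -> R) (g : R -> W) :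
  open U -> (forall x, U x -> O (f x)) -> Cn n U f -> Cn n O g -> Cn n U (fun x => g (f x)).
Proof.
move=> oU fO; elim: n g => [|n IH] g.
  by move=> fc gc x Ux; apply: (@continuous_comp _ _ _ f g); [exact: fc|exact/gc/fO].
move=> fC gC; have [fd fD] := fC; have [gd gD] := gC.
split=> [x Ux|v]; first by apply: (@differentiable_comp _ _ _ _ f g); [exact: fd|exact/gd/fO].
have S : Cn n U (fun x => 'd f x v *: 'd g (f x) 1).
  exact: (CnZ oU (fD v) (IH (fun y => 'd g y 1) (CnS fC) (gD 1))).
apply: Cn_eq S => // x Ux.
have dE := diff_comp (fd x Ux) (gd _ (fO x Ux)).
rewrite [RHS](congr1 (fun h : V -> W => h v) dE) /=.
move: ('d f x v) => c; rewrite -[c in RHS](mulr1 c); exact/esym/linearZ.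
Qed.

Lemma Cinf_compR (V W : normedModType R) (U : set V) (O : set R) (f : V -> R) (g : R -> W) :
  open U -> (forall x, U x -> O (f x)) -> Cinf U f -> Cinf O g -> Cinf U (fun x => g (f x)).
Proof. by move=> oU fO fC gC n; exact: Cn_compR (fC n) (gC n). Qed.

Lemma Cinf_idR (U : set R) : Cinf U (fun x : R => x).
Proof. by move=> k; apply: (@Cn_lin _ _ _ k U idfun) => x; exact: cvg_id. Qed.

Lemma Cinf_sq (U : set R) : open U -> Cinf U (fun x : R => x ^+ 2).
Proof. by move=> oU k; exact: (CnZ oU (Cinf_idR U k) (Cinf_idR U k)). Qed.

Lemma sq_open (W : set R) : open W -> open [set t : R | W (t ^+ 2)].
Proof.
have c : continuous (fun t : R => t ^+ 2) by move=> t; exact: (Cinf_sq openT 0%N t I).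
by move=> oW; exact: ((continuousP (fun t : R => t ^+ 2)).1 c W oW).
Qed.

Lemma derive1_is (V : normedModType R) (f : R -> V) (x : R) (df : V) :
  is_derive x 1 f df -> derive1 f x = df.
Proof. by move=> [_ <-]; rewrite derive1E. Qed.

Lemma diff_is_derive (V : normedModType R) (f : R -> V) (x : R) :
  differentiable f x -> is_derive x 1 f (derive1 f x).
Proof. by move=> fd; apply: DeriveDef; [exact: diff_derivable|rewrite derive1E]. Qed.

(** The multiplier [a] closes the induction: the derivative of [a t * g (t ^+ 2)] is a sum of two
    terms of the same form, with multipliers [a'] and [2 t a] and with [g] and [g']. *)
Lemma derive1n_sq0 (W : set R) (g a : R -> R) j : open W -> W 0 -> Cinf W g ->
  Cinf [set t | W (t ^+ 2)] a -> (forall k, derive1n k g 0 = 0) ->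
  derive1n j (fun t : R => a t * g (t ^+ 2)) 0 = 0.
Proof.
move=> oW W0; pose W' := [set t : R | W (t ^+ 2)].
have oW' : open W' by exact: sq_open.
have W'0 : W' 0 by rewrite /W' /= expr0n.
elim: j g a => [|j IH] g a gC aC g0.
  by have /= := g0 0%N; rewrite expr0n/= => ->; rewrite mulr0.
have g'C := Cinf_derive1 oW gC; have a'C := Cinf_derive1 oW' aC.
have sqC : Cinf W' (fun t : R => t ^+ 2) by exact: Cinf_sq.
have gsC (h : R -> R) : Cinf W h -> Cinf W' (fun t : R => h (t ^+ 2)) by exact: Cinf_compR.
have a2C : Cinf W' (fun t => a t * (2 * t)).
  move=> n; apply: (CnZ oW' (aC n)).
  exact: (CnZ oW' (Cn_cst n W' (2 : R)) (Cinf_idR W' n)).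
rewrite derive1Sn.
rewrite (derive1n_eq (g := (fun t => derive1 a t * g (t ^+ 2)) \+ (fun t => a t * (2 * t) * derive1 g (t ^+ 2))) j oW')//.
  rewrite (derive1nD _ oW')//.
  - rewrite (IH _ _ gC a'C g0) (IH _ _ g'C a2C) ?addr0// => k.
    by rewrite -derive1Sn.
  - by move=> n; exact: (CnZ oW' (a'C n) (gsC _ gC n)).
  - by move=> n; exact: (CnZ oW' (a2C n) (gsC _ g'C n)).
move=> t Wt; apply: derive1_is.
have Da := diff_is_derive (Cinf_diff aC Wt).
have Dg := diff_is_derive (Cinf_diff gC (Wt : W (t ^+ 2))).
have Ds := is_derive_pow 2 (is_derive_id t (1 : R)).
have Dgs : is_derive t 1 (fun t : R => g (t ^+ 2)) _ := @is_derive1_comp R g (fun t : R => t ^+ 2) t _ _ Dg Ds.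
apply: (is_derive_eq (is_deriveM Da Dgs)); rewrite /= expr1 mulr1.
move: (derive1 g _) (derive1 a t) (a t) (g _) => A B C D; rewrite /GRing.scale /=; ring.
Qed.

Lemma flat_sq (W : set R) (h : R -> R) j : open W -> W 0 -> Cinf W h ->
  (forall k, derive1n k.+1 h 0 = 0) -> derive1n j.+1 (fun t : R => h (t ^+ 2)) 0 = 0.
Proof.
move=> oW W0 hC h0; pose W' := [set t : R | W (t ^+ 2)].
have oW' : open W' by exact: sq_open.
have W'0 : W' 0 by rewrite /W' /= expr0n.
rewrite derive1Sn (derive1n_eq (g := fun t => 2 * t * derive1 h (t ^+ 2)) j oW')//.
  apply: (derive1n_sq0 (W := W)) => //; first exact: Cinf_derive1.
    by move=> n; exact: (CnZ oW' (Cn_cst n W' (2 : R)) (Cinf_idR W' n)).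
  by move=> k; rewrite -derive1Sn.
move=> t Wt; apply: derive1_is.
have Dh := diff_is_derive (Cinf_diff hC (Wt : W (t ^+ 2))).
have Ds := is_derive_pow 2 (is_derive_id t (1 : R)).
apply: (is_derive_eq (@is_derive1_comp R h (fun t : R => t ^+ 2) t _ _ Dh Ds)).
by rewrite /= expr1 mulr1 mulrC.
Qed.

Lemma derive1n_reflect (V : normedModType R) (W : set R) (h : R -> V) (c s : R) k : open W ->
  Cinf W h -> W (c - s) ->
  derive1n k (fun x => h (c - x)) s = (-1) ^+ k *: derive1n k h (c - s).
Proof.
move=> oW; elim: k h s => [|k IH] h s hC Ws; first by rewrite expr0 scale1r.
pose W' := [set x : R | W (c - x)].
have oW' : open W'.
  have cc : continuous (fun t : R => c - t).
    by move=> t; apply: continuousB; [exact: cst_continuous|exact: cvg_id].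
  exact: ((continuousP (fun t : R => c - t)).1 cc W oW).
have E x : W' x -> derive1 (fun x => h (c - x)) x = -1 *: derive1 h (c - x).
  move=> Wx; apply: derive1_is.
  have hd := Cinf_diff hC (Wx : W (c - x)).
  have e : c + x *: (-1) = c - x by rewrite /GRing.scale /= mulrN1.
  have := line_derive e hd.
  have -> : (fun s : R => h (c + s *: -1)) = (fun x => h (c - x)).
    by apply/funext => y; rewrite /GRing.scale /= mulrN1.
  move=> D; apply: (is_derive_eq D).
  by rewrite (derive1E' hd) linearN scaleN1r.
rewrite !derive1Sn (derive1n_eq (g := fun x => -1 *: derive1 h (c - x)) k oW')//.
have h'C := Cinf_derive1 oW hC.
have L := derive1n_lin (L := ( *:%R (-1 : R) : {linear V -> V})) k oW' _ (f := fun x => derive1 h (c - x)).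
have Lc : continuous ( *:%R (-1 : R) : V -> V) by exact: scaler_continuous.
have C : Cinf W' (fun x => derive1 h (c - x)).
  apply: (Cinf_compR (O := W)) => // n; apply: CnD => //; first exact: Cn_cst.
  by apply: (Cn_eq oW' _ (CnZ oW' (Cn_cst n W' (-1 : R)) (Cinf_idR W' n))) => x _; rewrite /GRing.scale /= mulN1r.
apply: (etrans (L Lc C s Ws)); rewrite IH// exprS -scalerA; reflexivity.
Qed.
End OneVariable.

Section FlatReflect.
Context {R : realType} {X : diffType R}.
Lemma flat_reflect (f : R -> X) (c t : R) : smooth f -> flat_at f (c - t) ->
  flat_at (fun x => f (c - x)) t.
Proof.
move=> sf ff n U phi psi ch Ut k; have [oU sphi _ _] := ch.
have oW := open_curve sf oU.
have hC : Cinf (f @^-1` U) (phi \o f) by exact: (Cinf_curve sf oU sphi oW).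
have := derive1n_reflect k.+1 oW hC (Ut : (f @^-1` U) (c - t)).
by rewrite (ff _ _ _ _ ch Ut) scaler0.
Qed.

Lemma smooth_reflect (f : R -> X) (c : R) : smooth f -> smooth (fun x : R => f (c - x)).
Proof.
move=> sf n U p Up; apply: (sf n U (fun u => c - p u)).
by apply: plotRD; [exact: plot_cst (plot_open Up)|exact: plotRN].
Qed.

Lemma flat_const_left (f : R -> X) (t e : R) : smooth f -> 0 < e ->
  (forall s, t - e < s < t -> f s = f t) -> flat_at f t.
Proof.
move=> sf e0 fc; have -> : f = fun x => (fun y => f (t - y)) (t - x).
  by apply/funext => x; rewrite opprB addrC subrK.
apply: (flat_reflect (f := fun y => f (t - y)) (c := t)); first exact: smooth_reflect.
rewrite subrr; apply: (flat_const_right (e := e)) => //; first exact: smooth_reflect.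
by move=> s /andP[s1 s2]; rewrite subr0 fc//; apply/andP; lra.
Qed.
End FlatReflect.

Section NormalLine.
Context {R : realType} {m : nat} (i : 'I_m).
Lemma dnorm_line (O : set 'rV[R]_m) (k : 'rV[R]_m -> R) z j : open O -> Cinf O k -> O z ->
  dnorm i k j z = derive1n j (fun t : R => k (z + t *: delta_mx ord0 i)) 0.
Proof.
move=> oO kC Oz; pose g (t : R) : 'rV[R]_m := z + t *: delta_mx ord0 i.
have gc : continuous g.
  move=> t; have : (fun t : R => z + t *: (delta_mx ord0 i : 'rV[R]_m)) @ t --> z + t *: delta_mx ord0 i; last by [].
  by apply: cvgD; [exact: cvg_cst|exact: scalel_continuous].
have oW : open (g @^-1` O) by exact: ((continuousP g).1 gc O oO).
suff H t : O (g t) -> dnorm i k j (g t) = derive1n j (fun t => k (g t)) t.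
  by have := H 0; rewrite /g scale0r addr0; exact.
elim: j k kC t => [//|j IH] k kC t Ot; rewrite derive1Sn /= IH//; last exact: Cinf_dir.
apply: (derive1n_eq _ oW) => // s Os; apply/esym/derive1_is.
exact: (line_derive erefl (Cinf_differentiable kC Os)).
Qed.
End NormalLine.

Section RowBlocks.
Context {R : realType}.
Lemma row_norm n m (z : 'rV[R]_(n + m)) u v (r : R) : 0 < r ->
  `|lsubmx z - u| < r -> `|rsubmx z - v| < r -> `|z - row_mx u v| < r.
Proof.
move=> r0 h1 h2; rewrite -[ltLHS]/(mx_norm _) mx_normrE; apply/bigmax_ltP; split=> // -[i j] _ /=.
rewrite ord1; case: (split_ordP j) => k ->.
  apply: le_lt_trans h1; have := coord_norm k (lsubmx z - u); apply: le_trans; rewrite coordE.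
  have -> : (z - row_mx u v) ord0 (lshift m k) = (lsubmx z - u) ord0 k; last by [].
  by rewrite [LHS]mxE [RHS]mxE [(- row_mx u v) _ _]mxE [(- u) _ _]mxE [lsubmx z _ _]mxE row_mxEl.
apply: le_lt_trans h2; have := coord_norm k (rsubmx z - v); apply: le_trans; rewrite coordE.
have -> : (z - row_mx u v) ord0 (rshift n k) = (rsubmx z - v) ord0 k; last by [].
by rewrite [LHS]mxE [RHS]mxE [(- row_mx u v) _ _]mxE [(- v) _ _]mxE [rsubmx z _ _]mxE row_mxEr.
Qed.

Lemma lsub_Cinf n m (A : set 'rV[R]_(n + m)) : open A -> Cinf A (fun y : 'rV[R]_(n + m) => lsubmx y).
Proof.
move=> oA; apply: Cinf_coord => // i l.
rewrite (_ : (fun _ => _) = coordlin ord0 (lshift m i)).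
  by apply: Cn_lin; exact: coord_continuous.
by apply/funext => y; rewrite mxE.
Qed.
Lemma rsub_Cinf n m (A : set 'rV[R]_(n + m)) : open A -> Cinf A (fun y : 'rV[R]_(n + m) => rsubmx y).
Proof.
move=> oA; apply: Cinf_coord => // i l.
rewrite (_ : (fun _ => _) = coordlin ord0 (rshift n i)).
  by apply: Cn_lin; exact: coord_continuous.
by apply/funext => y; rewrite mxE.
Qed.
End RowBlocks.

(** * Extension of flat families of paths by constants *)

Section FlatExtension.
Context {R : realType} {G : lieType R}.

Section Coordinates.
Context {n : nat}.
Definition last_ix : 'I_(n + 1) := rshift n (ord0 : 'I_1).
Definition init_part (z : 'rV[R]_(n + 1)) : 'rV[R]_n := lsubmx z.
Definition last_part (z : 'rV[R]_(n + 1)) : R := z ord0 last_ix.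
Definition append (u : 'rV[R]_n) (s : R) : 'rV[R]_(n + 1) := row_mx u (s%:M : 'rV[R]_1).

Lemma init_append u s : init_part (append u s) = u.
Proof. exact: row_mxKl. Qed.
Lemma last_append u s : last_part (append u s) = s.
Proof. by rewrite /last_part row_mxEr mxE eqxx mulr1n. Qed.
Lemma append_parts z : append (init_part z) (last_part z) = z.
Proof.
apply/rowP => j; case: (split_ordP j) => i ->; first by rewrite row_mxEl mxE.
by rewrite row_mxEr mxE !ord1 eqxx mulr1n.
Qed.
Lemma init_Cinf (A : set 'rV[R]_(n + 1)) : open A -> Cinf A init_part.
Proof. exact: lsub_Cinf. Qed.
Lemma last_plot (A : set 'rV[R]_(n + 1)) : open A -> plot A last_part.
Proof. exact: plot_coord. Qed.
Lemma append_Cinf (A : set 'rV[R]_n) (b : 'rV[R]_n -> R) : plot A b -> Cinf A (fun u => append u (b u)).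
Proof.
move=> [oA bC]; apply: Cinf_coord => // j l; case: (split_ordP j) => i ->.
  rewrite (_ : (fun _ => _) = coordlin ord0 i).
    by apply: Cn_lin; exact: coord_continuous.
  by apply/funext => y; rewrite row_mxEl.
apply: Cn_eq (bC l) => // y _.
by rewrite row_mxEr mxE !ord1 eqxx mulr1n.
Qed.
Lemma init_sq z : init_part (sqcoord last_ix z) = init_part z.
Proof.
apply/rowP => j; rewrite !mxE eqxx /= (_ : (_ == _) = false) ?mulr0 ?addr0//.
by apply/negbTE; rewrite eq_lrshift.
Qed.
Lemma last_sq z : last_part (sqcoord last_ix z) = last_part z ^+ 2.
Proof. exact: coord_sq. Qed.
Lemma init_line z (t : R) : init_part (z + t *: delta_mx ord0 last_ix) = init_part z.
Proof.
apply/rowP => j; rewrite !mxE eqxx /= (_ : (_ == _) = false) ?mulr0 ?addr0//.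
by apply/negbTE; rewrite eq_lrshift.
Qed.
Lemma last_line z (t : R) : last_part (z + t *: delta_mx ord0 last_ix) = last_part z + t.
Proof. by rewrite /last_part !mxE !eqxx mulr1. Qed.
Lemma append_norm z u s r : 0 < r -> `|init_part z - u| < r -> `|last_part z - s| < r ->
  `|z - append u s| < r.
Proof.
move=> r0 h1 h2; apply: row_norm => //; apply: le_lt_trans h2.
rewrite -[leLHS]/(mx_norm _) mx_normrE; apply/bigmax_leP; split=> // -[i j] _ /=.
by rewrite !ord1 !mxE eqxx mulr1n.
Qed.
End Coordinates.

Lemma plot_continuous n (U : set 'rV[R]_n) (f : 'rV[R]_n -> R) u (A : set R) :
  plot U f -> U u -> open A -> A (f u) -> exists2 V, open V & V u /\ V `<=` U `&` f @^-1` A.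
Proof.
move=> [oU fC] Uu oA Au; exists (U `&` f @^-1` A); last by split.
rewrite openE => v [Uv Av]; apply: filterI; first exact: open_nbhs_nbhs.
by apply: (fC 0%N v Uv); exact: open_nbhs_nbhs.
Qed.

(** As for paths, smoothness is tested only on plots [b] with values in the closed interval. Near 0
    the function [t ^+ 2] is one, whereas [t] is not, so no derivative of [c] at 0 is available
    directly. *)
Definition smooth_family n (V : set 'rV[R]_n) (a0 : R) (c : 'rV[R]_n -> R -> G) :=
  forall m (W : set 'rV[R]_m) (a : 'rV[R]_m -> 'rV[R]_n) (b : 'rV[R]_m -> R),
    open W -> Cinf W a -> (forall w, W w -> V (a w)) -> plot W b ->
    (forall w, W w -> 0 <= b w <= a0) -> plot W (fun w => c (a w) (b w)).

Section Local.
Variables (n : nat) (V : set 'rV[R]_n) (a0 : R) (c : 'rV[R]_n -> R -> G).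
Hypotheses (oV : open V) (a0p : 0 < a0) (csm : smooth_family V a0 c).
Hypothesis c1 : forall v, V v -> c v 0 = 1%g.
Hypothesis cflat : forall v, V v -> exists f : R -> G,
  [/\ smooth f, forall x : R, 0 <= x <= a0 -> f x = c v x & flat_at f 0].
Variables (U : set G) (phi : G -> 'rV[R]_(ldim G)) (psi : 'rV[R]_(ldim G) -> G).
Hypotheses (ch : chart U phi psi) (U1 : U 1%g).

(** The pullback of the family along the square of the last coordinate is a plot, and it stays in
    the chart near the given point; [flat_glue] then applies to each chart coordinate. *)
Lemma flat_extend_chart (v0 : 'rV[R]_n) : V v0 -> exists O : set 'rV[R]_(n + 1),
  [/\ open O, O (append v0 0),
    forall z, O z -> V (init_part z) /\ U (c (init_part z) (Num.max (last_part z) 0)) &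
    Cinf O (fun z => phi (c (init_part z) (Num.max (last_part z) 0)))].
Proof.
move=> Vv0; have [oU sphi Ppsi K] := ch.
pose O1 := [set z : 'rV[R]_(n + 1) | V (init_part z)] `&` [set z | last_part z ^+ 2 < a0].
have oI : open [set z : 'rV[R]_(n + 1) | V (init_part z)].
  have := open_preim openT oV (init_Cinf (n := n) openT); by rewrite setTI.
have sqP (A : set 'rV[R]_(n + 1)) : open A -> plot A (fun z : 'rV[R]_(n + 1) => last_part z ^+ 2).
  by move=> oA; apply: plotRM; exact: last_plot.
have oO1 : open O1.
  apply: openI => //; rewrite openE => z /= za.
  have [B oB [Bz BA]] := plot_continuous (sqP _ openT) (I : setT z) (@open_lt R a0) za.
  by apply: filterS (open_nbhs_nbhs (conj oB Bz)) => y /BA[].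
pose p (z : 'rV[R]_(n + 1)) := c (init_part z) (last_part z ^+ 2).
have pP : plot O1 p.
  apply: (csm (a := init_part) (b := fun z => last_part z ^+ 2)) => //.
  - exact: init_Cinf.
  - by move=> z [].
  - exact: sqP.
  - by move=> z [_ /= /ltW ->]; rewrite sqr_ge0.
have oO2 := oU _ _ _ pP; set O2 := _ `&` _ in oO2.
have O20 : O2 (append v0 0).
  split; first by split; rewrite /= ?init_append ?last_append ?expr0n.
  by rewrite /p /= init_append last_append expr0n /= c1.
have [r r0 rO2] := (near_normP _ _).1 (open_nbhs_nbhs (conj oO2 O20)).
(* The term [r ^+ 2] bounds the square root of the last coordinate by [r], so that the point of the
   pullback over it lies in [O2]; the term [a0] keeps the parameter inside the interval. *)
pose r' := Num.min r (Num.min (r ^+ 2) a0).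
have r'0 : 0 < r' by rewrite !lt_min r0 exprn_gt0// a0p.
pose O := [set z : 'rV[R]_(n + 1) | `|init_part z - v0| < r] `&` ([set z | last_part z < r'] `&` [set z | - r' < last_part z]).
have oO : open O.
  apply: openI; last by apply: openI; [exact: coord_lt_open|exact: coord_gt_open].
  rewrite openE => z zr.
  have cz : {for z, continuous (fun y => init_part y)} := init_Cinf (n := n) openT 0%N z I.
  exact: cz _ (norm_lt_near zr).
have key u s : `|u - v0| < r -> 0 <= s -> s < r' -> [/\ V u, s < a0 & U (c u s)].
  move=> ur s0; rewrite !lt_min => /and3P[sr sr2 sa].
  have /rO2 : `|append u (Num.sqrt s) - append v0 0| < r.
    apply: append_norm => //; first by rewrite init_append.
    rewrite last_append subr0 ger0_norm ?sqrtr_ge0// -(ger0_norm (ltW r0)) -sqrtr_sqr.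
    by rewrite ltr_sqrt// exprn_gt0.
  by move=> [[/=]]; rewrite /p /= init_append last_append sqr_sqrtr.
have keyO z : O z -> [/\ V (init_part z), Num.max (last_part z) 0 < a0 & U (c (init_part z) (Num.max (last_part z) 0))].
  move=> [/= h1 [h2 h3]]; apply: key => //; first by rewrite le_max lexx orbT.
  by rewrite gt_max h2.
have O'O2 z : O (sqcoord last_ix z) -> O2 z.
  move=> [/=]; rewrite init_sq last_sq => h1 [h2 _]; rewrite -(append_parts z); apply: rO2.
  apply: append_norm; rewrite ?init_append ?last_append// subr0.
  move: h2; rewrite !lt_min => /and3P[_ h2 _].
  by rewrite -(@ltr_pXn2r _ 2) ?nnegrE ?(ltW r0)// real_normK// num_real.
exists O; split=> //.
- by split; [rewrite /= init_append subrr normr0|split; rewrite /= last_append// oppr_lt0].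
- by move=> z /keyO[].
(* [flat_glue] wants a function that is 0 on the side where the family is constantly 1, so the chart
   coordinate of 1 is subtracted. *)
apply: Cinf_coord => // j; pose one := phi 1%g ord0 j.
suff C : Cinf O (fun z => phi (c (init_part z) (Num.max (last_part z) 0)) ord0 j - one).
  move=> N; apply: Cn_eq (CnD oO (C N) (Cn_cst N O one)) => // z _ /=.
  by rewrite subrK.
have oO' := @sq_preim_open R _ last_ix O oO.
pose k z := phi (p z) ord0 j - one.
have sub1 (A : set 'rV[R]_(n + 1)) (f : 'rV[R]_(n + 1) -> G) : plot A f ->
    (forall z, A z -> U (f z)) -> Cinf A (fun z => phi (f z) ord0 j - one).
  move=> fP fU; have [oA C] := sphi _ _ _ fP fU.
  move=> N; apply: CnD => //; last exact: Cn_cst.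
  exact: (Cn_post (L := coordlin ord0 j) oA (@coord_continuous _ _ _ ord0 j) (C N)).
have kC : Cinf O2 k.
  by apply: sub1 => [|z []//]; apply: plot_sub pP => // z [].
apply: (flat_glue (i := last_ix) (k := k)) => //.
- apply: (Cinf_eq (f := fun z => phi (c (init_part z) (last_part z)) ord0 j - one)) => //.
  + by apply: openI => //; exact: coord_gt_open.
  + by move=> z [_ /= z0]; rewrite (max_idPl (ltW z0)).
  + have oP : open (O `&` [set z | 0 < last_part z]) by apply: openI => //; exact: coord_gt_open.
    apply: sub1.
      apply: (csm (a := init_part) (b := last_part)) => //; first exact: init_Cinf.
      * by move=> z [/keyO[]].
      * exact: last_plot.
      * by move=> z [/keyO[_ + _] /= z0]; rewrite (max_idPl (ltW z0)) => /ltW ->; rewrite ltW.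
    by move=> z [/keyO[_ _ +] /= z0]; rewrite (max_idPl (ltW z0)).
- move=> z Oz; rewrite coordE => z0; have [Vz _ _] := keyO z Oz.
  by rewrite (max_idPr z0) c1// subrr.
- by move=> N; apply: Cn_sub (kC N) => z; exact: O'O2.
- move=> q z Oz; rewrite coordE -/(last_part z) => z0.
  have sz : sqcoord last_ix z = z by rewrite /sqcoord coordE -/(last_part z) z0 expr0n subrr scale0r addr0.
  have O2z : O2 z by apply: O'O2; rewrite sz.
  have [Vz _ _] := keyO z Oz.
  rewrite (dnorm_line _ q oO2 kC O2z).
  have [f [fsm fc ff]] := cflat Vz.
  have f0 : f 0 = 1%g by rewrite fc ?lexx ?ltW// c1.
  have oW := open_curve fsm oU.
  have W0 : (f @^-1` U) 0 by rewrite /= f0.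
  have hC : Cinf (f @^-1` U) (phi \o f) by exact: (Cinf_curve fsm oU sphi oW).
  pose h (s : R) := phi (f s) ord0 j - one.
  have hC' : Cinf (f @^-1` U) h.
    move=> N; apply: CnD => //; last exact: Cn_cst.
    exact: (Cn_post (L := coordlin ord0 j) oW (@coord_continuous _ _ _ ord0 j) (hC N)).
  have h0 i : derive1n i h 0 = 0.
    case: i => [|i]; first by rewrite /= /h f0 subrr.
    have hjC : Cinf (f @^-1` U) (fun s => (phi \o f) s ord0 j : R).
      by move=> N; exact: (Cn_post (L := coordlin ord0 j) oW (@coord_continuous _ _ _ ord0 j) (hC N)).
    rewrite (derive1nD i.+1 oW hjC (fun N => Cn_cst N _ (- one)) W0).
    rewrite (derive1n_coord i.+1 j oW W0 hC).
    by rewrite (ff _ _ _ _ ch) ?f0// mxE derive1n_cst addr0.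
  (* On the normal line through a point of the hyperplane, [k] is [h (t ^+ 2)] with [h] built from
     the smooth extension of a single path; flatness of that path suffices. *)
  transitivity (derive1n q (fun t : R => h (t ^+ 2)) 0).
    have oB : open [set t : R | t ^+ 2 < a0] by exact: (sq_open (@open_lt R a0)).
    apply: (derive1n_eq q oB); last by rewrite /= expr0n.
    move=> t /= ta; rewrite /k /p init_line last_line z0 add0r /h fc//.
    by rewrite sqr_ge0 ltW.
  case: q => [|q]; first by rewrite /= expr0n; exact: (h0 0%N).
  by apply: (flat_sq q oW W0 hC') => i; exact: h0.
by move=> z Oz z0; rewrite init_sq last_sq (max_idPl (sqr_ge0 _)).
Qed.
End Local.

(** Where [b] is negative the result is locally 1, and where it is positive it is locally the family
    itself. Only the points with [b v0 = 0] need the chart argument. *)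
Lemma flat_extend n (V : set 'rV[R]_n) (a0 : R) (c : 'rV[R]_n -> R -> G) (b : 'rV[R]_n -> R) :
  0 < a0 -> smooth_family V a0 c -> (forall v, V v -> c v 0 = 1%g) ->
  (forall v, V v -> exists f : R -> G,
    [/\ smooth f, forall x : R, 0 <= x <= a0 -> f x = c v x & flat_at f 0]) ->
  plot V b -> (forall v, V v -> b v < a0) ->
  plot V (fun v => c v (Num.max (b v) 0)).
Proof.
move=> a0p csm c1 cflat bP ba; have oV := plot_open bP.
apply: plot_local => // v0 Vv0.
have [b0|b0|b0] := ltrgtP (b v0) 0.
- have [A oA [Av AV]] := plot_continuous bP Vv0 (@open_lt R 0) b0.
  exists A, (cst 1%g); split=> //; first exact: plot_cst.
  by move=> v Vv /AV[_ /= h]; rewrite (max_idPr (ltW h)) c1.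
- have [A oA [Av AV]] := plot_continuous bP Vv0 (@open_gt R 0) b0.
  exists A, (fun v => c v (b v)); split=> //.
    apply: (csm _ _ (fun v => v)) => //; first exact: Cinf_id.
    + by move=> v /AV[].
    + by apply: plot_sub bP => // v /AV[].
    + by move=> v /AV[Vv /= /ltW ->] /=; exact/ltW/ba.
  by move=> v Vv /AV[_ /= h]; rewrite (max_idPl (ltW h)).
have [U [phi [psi [ch U1]]]] := lie_chart (1%g : G).
have [oU sphi Ppsi K] := ch.
have [Q [oQ Q0 QU FC]] := @flat_extend_chart n V a0 c oV a0p csm c1 cflat U phi psi ch U1 v0 Vv0.
have aC := append_Cinf bP.
have oA := open_preim oV oQ aC.
exists (V `&` (fun v => append v (b v)) @^-1` Q).
exists (fun v => psi (phi (c v (Num.max (b v) 0)))); split=> //.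
- by split=> //=; rewrite b0.
- have E v : phi (c v (Num.max (b v) 0)) =
      phi (c (init_part (append v (b v))) (Num.max (last_part (append v (b v))) 0)).
    by rewrite init_append last_append.
  apply: (plot_comp Ppsi) => //.
    apply: (Cinf_eq (f := fun v => phi (c (init_part (append v (b v))) (Num.max (last_part (append v (b v))) 0)))) => //.
    apply: (Cinf_comp (O := Q) (g := fun v => append v (b v))) FC => //; first by move=> v [].
    by apply: Cinf_sub aC => v [].
  move=> v [_ /QU[_]]; rewrite init_append last_append => Uc.
  by exists (c v (Num.max (b v) 0)).
by move=> v Vv [_ /QU[_]]; rewrite init_append last_append => Uc; rewrite K.
Qed.
End FlatExtension.

(** * Paths and loops with flat end points *)

Section HatPaths.
Context {R : realType} {G : lieType R}.
Let p0 : 0 < (pi : R) := pi_gt0 R.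

Lemma clamp_eq (s t : R) : sval (clamp s) = sval (clamp t) -> clamp s = clamp t.
Proof. by apply: eq_sig_hprop => y; exact: Prop_irrelevance. Qed.
Lemma clamp_le0 (s : R) : s <= 0 -> clamp s = clamp 0.
Proof. by move=> s0; apply: clamp_eq; rewrite /= maxxx (max_idPr s0). Qed.
Lemma clamp_gepi (s : R) : pi <= s -> clamp s = clamp pi.
Proof.
move=> s0; apply: clamp_eq; rewrite /= !(max_idPl _) ?(ltW p0) ?(le_trans (ltW p0))//.
by rewrite minxx (min_idPr s0).
Qed.

Lemma pe_start (g : PeG G) : pe_path g (clamp 0) = 1%g.
Proof.
have [g1 _ _] := sgvalP g; apply: g1.
by rewrite sval_clamp// lexx ltW.
Qed.

Lemma path_family n (V : set 'rV[R]_n) (q : 'rV[R]_n -> gpath G pi) : plot V q ->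
  smooth_family V pi (fun v x => q v (clamp x)).
Proof.
move=> [oV Hq] m W a b oW aC aV bP b0; apply: (Hq _ W a (fun w => clamp (b w))) => //.
by apply: plot_eq bP => w Ww; rewrite sval_clamp// b0.
Qed.

Lemma hat_plot n (V : set 'rV[R]_n) (q : 'rV[R]_n -> PeG G) (b : 'rV[R]_n -> R) :
  plot V q -> plot V b -> plot V (fun v => pe_path (q v) (clamp (b v))).
Proof.
move=> qP bP; have oV := plot_open bP.
have qP' : plot V (fun v => pe_path (q v)) by exact: qP.
have fam := path_family qP'.
have famE m (W : set 'rV[R]_m) (a : 'rV[R]_m -> 'rV[R]_n) (x : R) : open W -> Cinf W a ->
    (forall w, W w -> V (a w)) -> 0 <= x <= pi -> plot W (fun w => pe_path (q (a w)) (clamp x)).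
  move=> oW aC aV x0; apply: (fam m W a (fun=> x)) => //.
  exact: plot_cst.
apply: plot_local => // v0 Vv0; have [b0|b0] := ltrP (b v0) pi.
  have [A oA [Av AV]] := plot_continuous bP Vv0 (@open_lt R pi) b0.
  exists A, (fun v => pe_path (q v) (clamp (Num.max (b v) 0))); split=> //.
    apply: (flat_extend (V := A) (a0 := pi) (c := fun v x => pe_path (q v) (clamp x))) => //.
    - by move=> m W a b' oW aC aA; apply: fam => // w /aA /AV[].
    - by move=> v _; exact: pe_start.
    - move=> v /AV[Vv _]; have [_ [f [sf fE ff]] _] := sgvalP (q v).
      exists f; split=> // x x0; rewrite -fE; congr f; rewrite sval_clamp//.
    - by apply: plot_sub bP => // v /AV[].
    - by move=> v /AV[].
  move=> v Vv Av'; congr (pe_path (q v) _); have [bv|/ltW bv] := lerP 0 (b v); first by [].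
  by rewrite clamp_le0.
have b0' : 0 < b v0 by exact: lt_le_trans b0.
have [A oA [Av AV]] := plot_continuous bP Vv0 (@open_gt R 0) b0'.
(* At the other end the path is run backwards and translated so that it starts at 1, which is the
   situation of [flat_extend]. *)
pose c' v x := ((pe_path (q v) (clamp pi))^-1 * pe_path (q v) (clamp (pi - x)))%g.
exists A, (fun v => pe_path (q v) (clamp pi) * c' v (Num.max (pi - b v) 0))%g; split=> //.
  apply: plotM.
    apply: (famE _ _ (fun v => v)) => //; first exact: Cinf_id.
      by move=> v /AV[].
    by rewrite ltW/=.
  apply: (flat_extend (V := A) (a0 := pi) (c := c')) => //.
  - move=> m W a b' oW aC aA b'P b'0; apply: plotM.
      apply: plotV; apply: famE => //; first by move=> w /aA/AV[].
      by rewrite ltW/=.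
    apply: (fam m W a (fun w => pi - b' w)) => //; first by move=> w /aA/AV[].
      by apply: plotRD; [exact: plot_cst|exact: plotRN].
    by move=> w /b'0 /andP[h1 h2]; rewrite subr_ge0 h2 lerBlDr lerDl.
  - by move=> v _; rewrite /c' subr0 mulVg.
  - move=> v /AV[Vv _]; have [_ _ [f [sf fE ff]]] := sgvalP (q v).
    exists (fun x => (pe_path (q v) (clamp pi))^-1 * f (pi - x))%g; split=> //.
    + by apply: smoothM; [exact: smooth_cst|exact: smooth_reflect].
    + move=> x /andP[x0 x1]; congr (_ * _)%g; rewrite -fE; congr f; rewrite sval_clamp//.
      by rewrite subr_ge0 x1 lerBlDr lerDl.
    + apply: flatM; [exact: smooth_cst|exact: smooth_reflect|exact: flat_cst|].
      by apply: flat_reflect => //; rewrite subr0.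
  - by apply: plotRD; [exact: plot_cst|apply: plotRN; apply: plot_sub bP => // v /AV[]].
  - by move=> v /AV[_ /= h]; rewrite ltrBlDr ltrDl.
move=> v Vv _; rewrite /c' mulVKg; congr (pe_path (q v) _).
have [bv|/ltW bv] := leP (b v) pi; first by rewrite (max_idPl _) ?subr_ge0// opprB addrC subrK.
by rewrite (max_idPr _) ?subr_le0// subr0 clamp_gepi.
Qed.

Lemma hat_fun_smooth (g : PeG G) : smooth (fun s : R => pe_path g (clamp s)).
Proof.
move=> n U p Up; apply: (@hat_plot n U (fun=> g) p) => //.
exact: plot_cst (plot_open Up).
Qed.
Definition hat (g : PeG G) : cmap R G := CMap (hat_fun_smooth g).
Lemma hat_smooth : smooth hat.
Proof.
move=> n U q Uq; split; first exact: plot_open Uq.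
move=> m V a b oV aC aU Vb; apply: (@hat_plot m V (fun v => q (a v)) b) => //.
exact: (plot_comp Uq).
Qed.
Lemma hat_le0 g (s : R) : s <= 0 -> hat g s = 1%g.
Proof. by move=> s0; rewrite /= clamp_le0// pe_start. Qed.
Lemma hat_gepi g (s : R) : pi <= s -> hat g s = hat g pi.
Proof. by move=> s0; rewrite /= clamp_gepi. Qed.
Lemma hatM g h : hat (g * h)%g = (hat g * hat h)%g. Proof. exact: cmapP. Qed.
Lemma hat_flat0 g : flat_at (hat g) 0.
Proof.
apply: (flat_const_left (e := 1)) => //; first exact: cmap_smooth.
by move=> s /andP[_ /ltW s0]; rewrite !hat_le0.
Qed.
Lemma hat_flatpi g : flat_at (hat g) pi.
Proof.
apply: (flat_const_right (e := 1)) => //; first exact: cmap_smooth.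
by move=> s /andP[/ltW s0 _]; rewrite hat_gepi.
Qed.
End HatPaths.

Section Wrap.
Context {R : realType} {G : lieType R}.
Let p0 : 0 < (pi : R) := pi_gt0 R.
Notation L := (pi *+ 2 : R).
Let L0 : 0 < L. Proof. by rewrite mulrn_wgt0. Qed.

Definition wsupp (f : cmap R G) := forall s : R, s <= 0 \/ L <= s -> f s = 1%g.
Lemma wsupp1 : wsupp 1%g. Proof. by []. Qed.
Lemma wsuppM f g : wsupp f -> wsupp g -> wsupp (f * g)%g.
Proof. by move=> f1 g1 s Hs /=; rewrite f1// g1// mulg1. Qed.
Lemma wsuppV f : wsupp f -> wsupp (f^-1)%g.
Proof. by move=> f1 s Hs /=; rewrite f1// invg1. Qed.
Definition wsupp_sg : subgroup (cmap R G) :=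
  @Subgroup R (cmap R G) (fun f => wsupp f) wsupp1 wsuppM wsuppV.

Definition wrap_fun (f : R -> G) (s : R) : G := f (s - L *~ Num.floor (s / L)).

Lemma floor_divL (m : int) (s : R) : L *~ m <= s < L *~ m + L -> Num.floor (s / L) = m.
Proof.
move=> /andP[h1 h2]; apply/Num.Theory.floor_def/andP; split.
  by rewrite ler_pdivlMr// mulrzl.
by rewrite ltr_pdivrMr// intrD mulrDl mul1r mulrzl.
Qed.

Lemma floor_bounds (s : R) : L *~ Num.floor (s / L) <= s /\ s < L *~ Num.floor (s / L) + L.
Proof.
have /andP[h1 h2] := Num.Theory.floor_itv (s / L).
by rewrite ler_pdivlMr// mulrzl in h1; rewrite ltr_pdivrMr// intrD mulrDl mul1r mulrzl in h2.
Qed.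

Lemma wrap_per (f : R -> G) s : wrap_fun f (s + L) = wrap_fun f s.
Proof.
rewrite /wrap_fun; have [h1 h2] := floor_bounds s; set m := Num.floor (s / L) in h1 h2 *.
rewrite (@floor_divL (m + 1)).
  by rewrite mulrzDr mulr1z opprD addrACA [L - L]subrr addr0.
by rewrite mulrzDr mulr1z lerD2r h1/= ltrD2r.
Qed.

(** On an open interval of two periods around [L *~ m] the periodic function is a product of two
    translates, at most one of them different from 1. A product of smooth maps is smooth, so no case
    distinction at the multiples of [L] remains. *)
Lemma wrapE (f : cmap R G) (m : int) s : wsupp f -> L *~ m - L < s < L *~ m + L ->
  wrap_fun f s = (f (s - L *~ m) * f (s - L *~ m + L))%g.
Proof.
move=> fs /andP[h1 h2]; rewrite /wrap_fun; have [ms|ms] := lerP (L *~ m) s.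
  rewrite (@floor_divL m) ?ms//=.
  by rewrite (fs (_ + L)) ?mulg1//; right; rewrite lerDr subr_ge0.
rewrite (@floor_divL (m - 1)).
  rewrite (fs (s - L *~ m)) ?mul1g; last by left; rewrite subr_le0 ltW.
  by rewrite mulrzDr mulrN1z opprD opprK addrA.
by rewrite mulrzDr mulrN1z subrK ms (ltW h1).
Qed.

Lemma plot_shift n (V : set 'rV[R]_n) (b : 'rV[R]_n -> R) (c : R) : plot V b -> plot V (fun v => b v + c).
Proof. by move=> bP; apply: plotRD => //; exact: plot_cst (plot_open bP). Qed.

Lemma cmap_plot_ev (X Y : diffType R) n (V : set 'rV[R]_n) (q : 'rV[R]_n -> cmap X Y) (b : 'rV[R]_n -> X) :
  plot V q -> plot V b -> plot V (fun v => q v (b v)).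
Proof.
move=> [oV Hq] bP; apply: (Hq n V (fun v => v)) => //; exact: Cinf_id.
Qed.

Lemma wrap_plot n (V : set 'rV[R]_n) (q : 'rV[R]_n -> cmap R G) (b : 'rV[R]_n -> R) :
  plot V q -> (forall v, V v -> wsupp (q v)) -> plot V b -> plot V (fun v => wrap_fun (q v) (b v)).
Proof.
move=> qP qs bP; apply: plot_local => [|v0 Vv0]; first exact: plot_open bP.
pose m := Num.floor (b v0 / L).
have [h1 h2] := floor_bounds (b v0); rewrite -/m in h1 h2.
have oI : open [set y : R | L *~ m - L < y < L *~ m + L].
  by rewrite -[X in open X]set_itvoo; exact: itv_open.
have b0 : [set y : R | L *~ m - L < y < L *~ m + L] (b v0).
  by rewrite /= h2 andbT (lt_le_trans _ h1)// ltrBlDr ltrDl.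
have [A oA [Av AV]] := plot_continuous bP Vv0 oI b0.
exists A, (fun v => q v (b v - L *~ m) * q v (b v - L *~ m + L))%g; split=> //.
  have bA : plot A b by apply: plot_sub bP => // v /AV[].
  have qA : plot A q by apply: plot_sub qP => // v /AV[].
  by apply: plotM; apply: cmap_plot_ev => //; repeat apply: plot_shift.
by move=> v Vv /AV[_ /= h]; rewrite (wrapE (m := m))//; exact: qs.
Qed.

Lemma wrap_smooth1 (f : sub_of wsupp_sg) : smooth (wrap_fun (sgval f)).
Proof.
move=> n U p Up; apply: (@wrap_plot n U (fun=> sgval f) p) => //.
  exact: plot_cst (plot_open Up).
by move=> v _; exact: (sgvalP f).
Qed.
Lemma wrap_loop (f : sub_of wsupp_sg) : loop_sg G (CMap (wrap_smooth1 f)).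
Proof. by move=> s; exact: wrap_per. Qed.
Definition wrap_LG (f : sub_of wsupp_sg) : LG G := SubOf (wrap_loop f).

Lemma wrap_ev (f : sub_of wsupp_sg) (s : R) : 0 <= s <= L -> ev (wrap_LG f) s = sgval f s.
Proof.
move=> /andP[s0 s1]; have fs : wsupp (sgval f) := sgvalP f.
have [sL|sL] := ltrP s L.
  rewrite [LHS](wrapE (m := 0) fs) ?mulr0z ?subr0 ?add0r; last by apply/andP; lra.
  by rewrite (fs (s + L)) ?mulg1//; right; rewrite lerDr.
have -> : s = L by apply/eqP; rewrite eq_le s1.
rewrite [LHS](wrapE (m := 1) fs) ?mulr1z; last by rewrite subrr L0 ltrDl.
by rewrite subrr add0r (fs 0) ?mul1g//; left.
Qed.

Lemma wrap_Omega (f : sub_of wsupp_sg) : Omega_sg G (wrap_LG f).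
Proof.
have fs : wsupp (sgval f) := sgvalP f.
split; first by rewrite wrap_ev ?lexx ?ltW// fs//; left.
have sf := cmap_smooth (sgval f).
have shift_smooth : smooth (fun s : R => sgval f (s + L)).
  by move=> n U p Up; apply: sf; exact: plot_shift.
(* Near 0 the loop is this product; the first factor is constant on the left of 0 and the second on
   the right, so each is flat. *)
have ff : flat_at (fun s => sgval f s * sgval f (s + L))%g 0.
  apply: flatM => //.
    apply: (flat_const_left (e := 1)) => //.
    by move=> s /andP[_ /ltW s0]; rewrite !fs//; left.
  apply: (flat_const_right (e := 1)) => //.
  by move=> s /andP[/ltW s0 _]; rewrite !fs//; right; rewrite lerDr.
move=> n U phi psi ch Ut k.
have oI : open [set y : R | - L < y < L].
  by rewrite -[X in open X]set_itvoo; exact: itv_open.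
have E s : - L < s < L -> wrap_fun (sgval f) s = (sgval f s * sgval f (s + L))%g.
  by move=> h; rewrite (wrapE (m := 0) fs) mulr0z ?subr0// sub0r add0r.
have h0 : - L < 0 < L by rewrite oppr_lt0 L0.
have -> := derive1n_eq (g := phi \o (fun s => sgval f s * sgval f (s + L))%g) k.+1 oI _ h0.
  by apply: ff ch _ k => /=; rewrite -E.
by move=> s hs; rewrite /= E.
Qed.
Definition wrap (f : sub_of wsupp_sg) : OmegaG G := SubOf (wrap_Omega f).
Lemma wrapM f g : wrap (f * g)%g = (wrap f * wrap g)%g.
Proof. by apply: sub_ofP; apply: sub_ofP; apply: cmapP. Qed.
Lemma wrap_smooth : smooth wrap.
Proof.
move=> n U q Uq; split; first exact: plot_open Uq.
move=> m V a b oV aC aU Vb; apply: (@wrap_plot m V (fun v => sgval (q (a v))) b) => //.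
  exact: (@plot_comp _ _ _ _ _ _ (fun u => sgval (q u)) a Uq).
by move=> v _; exact: (sgvalP (q (a v))).
Qed.

Lemma loop_ext (f h : LG G) : (forall s : R, 0 <= s <= L -> ev f s = ev h s) -> f = h.
Proof.
move=> E; apply: sub_ofP; apply: cmapP => s.
have [h1 h2] := floor_bounds s; set m := Num.floor (s / L) in h1 h2 *.
rewrite -[LHS](ev_period f s (- m)) -[RHS](ev_period h s (- m)); apply: E.
by rewrite mulrNz subr_ge0 h1 lerBlDl ltW.
Qed.
Lemma cup_uniq g1 g2 (f h : LG G) : is_cup g1 g2 f -> is_cup g1 g2 h -> f = h.
Proof.
move=> [f1 f2] [h1 h2]; apply: loop_ext => s /andP[s0 s1].
have [sp|sp] := lerP s pi.
  have sP : 0 <= s <= pi by rewrite s0.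
  by have := f1 (exist _ s sP); have := h1 (exist _ s sP) => /= -> ->.
have sP : 0 <= L - s <= pi by apply/andP; move: s1 sp; rewrite !mulr2n; lra.
pose x : segment (pi : R) := exist (fun x : R => is_true (0 <= x <= pi)) _ sP.
have := f2 x; have := h2 x; rewrite /= opprB addrC subrK.
by move=> -> ->.
Qed.
End Wrap.

Section Loops.
Context {R : realType} {G : lieType R}.
Let p0 : 0 < (pi : R) := pi_gt0 R.
Notation L := (pi *+ 2 : R).

Lemma plot_sub_of (E : diffGroupType R) (K : subgroup E) n (U : set 'rV[R]_n) (q : 'rV[R]_n -> sub_of K) :
  plot U (fun u => sgval (q u)) -> plot U q.
Proof. by []. Qed.

(** On [[0, pi]] the last two factors cancel and on [[pi, 2 pi]] the first two, because [hat g] is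
    constant after [pi]. Written as a product, the doubled path is smooth at [pi] and in [g] without
    gluing. *)
Definition dbl_fun (g : PeG G) (s : R) : G := (hat g s * (hat g pi)^-1 * hat g (L - s))%g.
Lemma dbl_fun_l g s : s <= pi -> dbl_fun g s = hat g s.
Proof.
by move=> sp; rewrite /dbl_fun (hat_gepi g (s := L - s)) ?mulgVK// mulr2n; lra.
Qed.
Lemma dbl_fun_r g s : pi <= s -> dbl_fun g s = hat g (L - s).
Proof. by move=> sp; rewrite /dbl_fun hat_gepi// mulgV mul1g. Qed.
Lemma dbl_fun_smooth g : smooth (dbl_fun g).
Proof.
have hs := cmap_smooth (hat g).
apply: smoothM; last exact: smooth_reflect.
by apply: smoothM => //; exact: smooth_cst.
Qed.
Definition dbl_cmap g : cmap R G := CMap (@dbl_fun_smooth g).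
Lemma dbl_supp g : wsupp_sg (dbl_cmap g).
Proof.
move=> s [s0|s1] /=; first by rewrite dbl_fun_l ?hat_le0// (le_trans s0)// ltW.
by rewrite dbl_fun_r ?hat_le0 ?subr_le0// (le_trans _ s1)// mulr2n lerDl ltW.
Qed.
Definition dblW g : sub_of (@wsupp_sg R G) := SubOf (dbl_supp g).
Lemma dblW_smooth : smooth dblW.
Proof.
move=> n U q Uq; split; first exact: plot_open Uq.
move=> m V a b oV aC aU Vb.
have qa : plot V (fun v => hat (q (a v))) by apply: hat_smooth; exact: (plot_comp Uq).
apply: plotM; last first.
  apply: cmap_plot_ev => //; apply: plotRD; last exact: plotRN.
  exact: plot_cst.
apply: plotM; first exact: cmap_plot_ev.
by apply: plotV; apply: cmap_plot_ev => //; exact: plot_cst.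
Qed.
Lemma dblWM g h : dblW (g * h)%g = (dblW g * dblW h)%g.
Proof.
apply: sub_ofP; apply: cmapP => s /=; have [sp|/ltW sp] := lerP s pi.
  by rewrite !dbl_fun_l// hatM.
by rewrite !dbl_fun_r// hatM.
Qed.
Lemma dbl_smooth : smooth (fun g => wrap (dblW g)).
Proof. exact: smooth_comp dblW_smooth (@wrap_smooth R G). Qed.
Lemma dblM g h : wrap (dblW (g * h)%g) = (wrap (dblW g) * wrap (dblW h))%g.
Proof. by rewrite dblWM wrapM. Qed.
Definition dbl : diffHom (PeG G) (OmegaG G) := DiffHom dbl_smooth dblM.
Lemma dbl_cup g : is_cup (pe_path g) (pe_path g) (oloop (dbl g)).
Proof.
have H (x : segment (pi : R)) : 0 <= sval x <= pi by exact: (svalP x).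
split=> x; have /andP[x0 x1] := H x.
  rewrite [LHS]wrap_ev /= ?dbl_fun_l//= ?clamp_sval// x0 (le_trans x1)// mulr2n lerDl ltW//.
rewrite [LHS]wrap_ev /= ?dbl_fun_r//=.
- by rewrite opprB addrC subrK clamp_sval.
- by rewrite lerBrDr mulr2n lerD2l.
- by rewrite subr_ge0 lerBlDr lerDl x0 andbT (le_trans x1)// mulr2n lerDl ltW.
Qed.

Lemma arc1 : ends_at_1 (pe_path (1%g : PeG G)). Proof. by []. Qed.
Lemma arcM (g h : PeG G) : ends_at_1 (pe_path g) -> ends_at_1 (pe_path h) -> ends_at_1 (pe_path (g * h)%g).
Proof. by move=> g1 h1 x xp; rewrite [LHS]/= -/(pe_path g) -/(pe_path h) g1// h1// mulg1. Qed.
Lemma arcV (g : PeG G) : ends_at_1 (pe_path g) -> ends_at_1 (pe_path (g^-1)%g).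
Proof. by move=> g1 x xp; rewrite [LHS]/= -/(pe_path g) g1// invg1. Qed.
Definition arc_sg : subgroup (PeG G) :=
  @Subgroup R (PeG G) (fun g => ends_at_1 (pe_path g)) arc1 arcM arcV.

Lemma arc_supp (g : sub_of arc_sg) : wsupp_sg (hat (sgval g)).
Proof.
move=> s [s0|s1]; first by rewrite hat_le0.
rewrite hat_gepi; last by rewrite (le_trans _ s1)// mulr2n lerDl ltW.
by apply: (sgvalP g); rewrite sval_clamp// lexx ltW.
Qed.
Definition arcW g : sub_of (@wsupp_sg R G) := SubOf (arc_supp g).
Lemma in_arc0pi (f : LG G) : (forall s : R, s = 0 \/ pi <= s <= L -> ev f s = 1%g) -> in_L arc0pi f.
Proof.
move=> f1 s Hs.
have [h1 h2] := floor_bounds s; set m := Num.floor (s / L) in h1 h2 *.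
rewrite -[LHS](ev_period f s (- m)) mulrNz.
have r0 : 0 <= s - L *~ m by rewrite subr_ge0.
have [rp|rp] := ltrP (s - L *~ m) pi; last first.
  by apply: f1; right; rewrite rp/= lerBlDl ltW.
have [re|re] := eqVneq (s - L *~ m) 0; first by rewrite re; apply: f1; left.
by exfalso; apply: Hs; exists (- m); rewrite mulrNz rp andbT lt_def re.
Qed.
Lemma arc_half g : half_sg G (wrap (arcW g)).
Proof.
apply: in_arc0pi => s [->|/andP[s1 s2]].
  rewrite [LHS]wrap_ev; first exact: pe_start.
  by rewrite lexx mulrn_wge0// ltW.
rewrite [LHS]wrap_ev /= ?s2 ?andbT ?(le_trans (ltW p0))//.
rewrite clamp_gepi//; apply: (sgvalP g).
by rewrite sval_clamp// lexx ltW.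
Qed.
Definition arc_fun g : sub_of (half_sg G) := SubOf (arc_half g).
Lemma arc_smooth : smooth arc_fun.
Proof.
move=> n U q Uq; apply: plot_sub_of; apply: wrap_smooth; apply: plot_sub_of.
exact: hat_smooth.
Qed.
Lemma arc_funM g h : arc_fun (g * h)%g = (arc_fun g * arc_fun h)%g.
Proof.
apply: sub_ofP; rewrite /= -wrapM; congr wrap; apply: sub_ofP.
exact: hatM.
Qed.
Definition arc : diffHom (sub_of arc_sg) (sub_of (half_sg G)) := DiffHom arc_smooth arc_funM.
Lemma arc_cup g : is_cup (pe_path (sgval g)) 1%g (oloop (sgval (arc g))).
Proof.
have H (x : segment (pi : R)) : 0 <= sval x <= pi by exact: (svalP x).
split=> x; have /andP[x0 x1] := H x.
  by rewrite [LHS]wrap_ev /= ?clamp_sval// x0 (le_trans x1)// mulr2n lerDl ltW.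
rewrite [LHS](sgvalP (arc g))//; apply: not_arc.
by rewrite mulr2n lerBrDr lerD2l x1/= lerBlDr lerDl.
Qed.
Lemma half_loop_cup (f : sub_of (half_sg G)) :
  is_cup (restr pi (oloop (sgval f))) 1%g (oloop (sgval f)).
Proof.
have H (x : segment (pi : R)) : 0 <= sval x <= pi by exact: (svalP x).
split=> x //; have /andP[x0 x1] := H x.
rewrite [LHS](sgvalP f)//; apply: not_arc.
by rewrite mulr2n lerBrDr lerD2l x1/= lerBlDr lerDl.
Qed.
Lemma Omega_cup_uniq g1 g2 (f h : OmegaG G) :
  is_cup g1 g2 (oloop f) -> is_cup g1 g2 (oloop h) -> f = h.
Proof. by move=> H1 H2; apply: sub_ofP; exact: cup_uniq H1 H2. Qed.
Lemma half_eq (f h : sub_of (half_sg G)) :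
  (forall x : segment (pi : R), ev (oloop (sgval f)) (sval x) = ev (oloop (sgval h)) (sval x)) -> f = h.
Proof.
move=> E; apply: sub_ofP; apply: (Omega_cup_uniq (half_loop_cup f)).
have [_ h2] := half_loop_cup h; split=> // x.
by rewrite /= E.
Qed.
End Loops.

(** * Local sections and central extensions *)

Section LocalSections.
Context {R : realType}.

(** The part of local triviality that lifts plots. For group homomorphisms it also suffices to
    rebuild the bundle, once the kernel is under control. *)
Definition local_sections (X Y : diffType R) (p : X -> Y) := forall y : Y, exists (W : set Y) (s : Y -> X),
  [/\ Dopen W, W y, smooth_on W s & forall y', W y' -> p (s y') = y'].

Lemma local_lift (X Y : diffType R) (p : X -> Y) n (U : set 'rV[R]_n) (q : 'rV[R]_n -> Y) u :
  local_sections p -> plot U q -> U u -> exists (V : set 'rV[R]_n) (q' : 'rV[R]_n -> X),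
  [/\ V u, V `<=` U, plot V q' & forall v, V v -> p (q' v) = q v].
Proof.
move=> ls qP Uu; have [W [s [oW Wq sW ps]]] := ls (q u).
have oV := oW _ _ _ qP.
exists (U `&` q @^-1` W), (s \o q); split=> //.
- apply: sW; last by move=> v [].
  by apply: plot_sub qP => // v [].
- by move=> v [_ /= Wv]; exact: ps.
Qed.

Lemma Dopen_preim (X Y : diffType R) (f : X -> Y) (U : set Y) : smooth f -> Dopen U -> Dopen (f @^-1` U).
Proof. by move=> sf oU n V q qP; exact: (oU _ _ _ (sf _ _ _ qP)). Qed.

Lemma ls_surj (X Y : diffType R) (p : X -> Y) : local_sections p -> forall y, exists x, p x = y.
Proof. by move=> ls y; have [W [s [_ Wy _ ps]]] := ls y; exists (s y); exact: ps. Qed.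

Lemma descend (E H F : diffGroupType R) (p : diffHom E H) (chi : diffHom E F) :
  local_sections p -> (forall x, p x = 1%g -> chi x = 1%g) ->
  exists chi' : diffHom H F, forall x, chi' (p x) = chi x.
Proof.
move=> ls chi1; have [s ps] := choice (ls_surj ls).
have inv x y : p x = p y -> chi x = chi y.
  move=> xy; have : chi (x * y^-1)%g = 1%g by apply: chi1; rewrite dhM dhV xy mulgV.
  by rewrite dhM dhV => /(congr1 (fun z => z * chi y)%g); rewrite mulgVK mul1g.
have f_smooth : smooth (fun h => chi (s h)).
  move=> n U q Uq; apply: plot_local => [|u Uu]; first exact: plot_open Uq.
  have [V [q' [Vu VU Vq E1]]] := local_lift ls Uq Uu.
  exists V, (chi \o q'); split=> //; first exact: dh_smooth.
  by move=> v Uv Vv /=; apply: inv; rewrite ps E1.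
have fM h k : chi (s (h * k)%g) = (chi (s h) * chi (s k))%g.
  by rewrite -dhM; apply: inv; rewrite dhM !ps.
by exists (DiffHom f_smooth fM) => x /=; apply: inv; rewrite ps.
Qed.
End LocalSections.

Section CentralExtensions.
Context {R : realType} {H : diffGroupType R} (E : centralExt H).

Lemma sub_map_plot (X : diffType R) (W : set X) n (U : set 'rV[R]_n) (q : 'rV[R]_n -> X) (w0 : {x | W x}) :
  plot U q -> (forall u, U u -> W (q u)) -> exists r : 'rV[R]_n -> {x | W x},
  plot U r /\ forall u, U u -> sval (r u) = q u.
Proof.
move=> qP qW.
(* Plots are total functions, so a value is needed off [U] as well; [w0] fills in. *)
pose r u : {x | W x} := match pselect (W (q u)) with left h => exist _ (q u) h | right _ => w0 end.
have rE u : U u -> sval (r u) = q u by move=> Uu; rewrite /r; case: pselect => // /(_ (qW u Uu)).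
by exists r; split=> //; apply: plot_eq qP => u Uu; rewrite rE.
Qed.

Lemma ce_local_sections : local_sections (ce_proj E).
Proof.
move=> y; have [W [oW Wy [phi [psi [sphi _ pphi _ _]]]]] := pb_triv (ce_bundle E) y.
pose s y' := match pselect (W y') with left h => phi (exist _ y' h, 1%g) | right _ => 1%g end.
exists W, s; split=> //; last by move=> y' Wy'; rewrite /s; case: pselect => // h; rewrite pphi.
move=> n U q qP qW; have [r [rP rE]] := sub_map_plot (exist _ y Wy) qP qW.
apply: (@plot_eq _ _ _ _ (fun u => phi (r u, 1%g))); last first.
  by apply: (sphi _ _ (fun u => (r u, 1%g))); split => //; exact: plot_cst (plot_open qP).
move=> u Uu; rewrite /= /s; case: pselect => [h|/(_ (qW u Uu))//].
by congr (phi (_, _)); apply: (eq_sig_hprop (fun y : H => @Prop_irrelevance _)); rewrite /= rE.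
Qed.

(** The fibre U(1) carries the subset diffeology of the extension: a trivialization over 1 reads the
    U(1)-coordinate off smoothly. *)
Lemma ce_inc_plot n (U : set 'rV[R]_n) (z : 'rV[R]_n -> U1 R) :
  plot U (fun u => ce_inc E (z u)) -> plot U z.
Proof.
move=> zP; have [W [oW W1 [phi [psi [sphi spsi pphi phiM [psiK phiK]]]]]] := pb_triv (ce_bundle E) 1%g.
pose w : {y | W y} := exist _ 1%g W1.
have E1 u : z u = psi (w, (phi (w, 1%g) * ce_inc E (z u))%g).
  by rewrite -phiM mul1g psiK.
apply: (@plot_eq _ _ _ _ (fun u => psi (w, (phi (w, 1%g) * ce_inc E (z u))%g))); first by move=> u _; rewrite -E1.
apply: (spsi _ _ (fun u => (w, (phi (w, 1%g) * ce_inc E (z u))%g))).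
  split; first exact: plot_cst (plot_open zP).
  by apply: plotM => //; exact: plot_cst (plot_open zP).
by move=> u _; rewrite /= dhM pphi /= (_ : ce_proj E (ce_inc E (z u)) = 1%g) ?mulg1//; apply/ce_exact; exists (z u).
Qed.

Lemma ce_proj_inc z : ce_proj E (ce_inc E z) = 1%g.
Proof. by apply/ce_exact; exists z. Qed.

(** The device that turns an identity in a central extension into the triviality of a character: the
    quotient of the two sides projects to 1. *)
Lemma ce_char (D : diffGroupType R) (f : D -> E) : smooth f ->
  (forall x, ce_proj E (f x) = 1%g) -> (forall x y, f (x * y)%g = (f x * f y)%g) ->
  exists chi : diffHom D (U1 R), forall x, f x = ce_inc E (chi x).
Proof.
move=> sf f1 fM; have [c cE] := choice (fun x : D => (ce_exact (f x)).1 (f1 x)).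
have cs : smooth c.
  move=> n U q Uq; apply: ce_inc_plot; apply: (plot_eq _ (sf _ _ _ Uq)) => u _ /=.
  by rewrite cE.
have cM x y : c (x * y)%g = (c x * c y)%g.
  by apply: (@ce_inj _ _ E); rewrite dhM -!cE.
by exists (DiffHom cs cM).
Qed.

Definition ker_central (A B : diffGroupType R) (p : A -> B) :=
  forall x y : A, p x = 1%g -> (x * y)%g = (y * x)%g.
Lemma ce_ker_central : ker_central (ce_proj E).
Proof. by move=> x y /ce_exact[z ->]; exact: ce_central. Qed.

Lemma ker_conj (A B : diffGroupType R) (p : diffHom A B) (a b x : A) : ker_central p ->
  p a = p b -> (a * x * a^-1)%g = (b * x * b^-1)%g.
Proof.
move=> kc ab; have [c pc ->] : exists2 c, p c = 1%g & a = (b * c)%g.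
  by exists (b^-1 * a)%g; rewrite ?mulVKg// dhM dhV ab mulVg.
by rewrite invgM -[(b * c * x)%g]mulgA (kc c x pc) !mulgA mulgK.
Qed.
End CentralExtensions.

(** * Crossed modules and butterflies *)

Section XOmegaCrossed.
Context {R : realType} {G : lieType R} {E : diffGroupType R} (p : diffHom E (OmegaG G)).
Hypotheses (kc : ker_central p) (ls : local_sections p).
Let p0 : 0 < (pi : R) := pi_gt0 R.

(** Exactly the commutation that the Peiffer identity consumes. Disjoint commutativity provides it
    in (a); in (b) it has to be proved. *)
Definition halves_commute := forall x y : E, half_sg G (p x) ->
  (forall s : R, 0 <= s <= pi -> ev (oloop (p y)) s = 1%g) -> (x * y)%g = (y * x)%g.

Lemma lift_doubleE g : p (lift_double p g) = dbl g.
Proof.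
have [a pa] := ls_surj ls (dbl g).
apply: (Omega_cup_uniq (g1 := pe_path g) (g2 := pe_path g)); last exact: dbl_cup.
have ex : [set Phi | is_cup (pe_path g) (pe_path g) (oloop (p Phi))] a.
  by rewrite /= pa; exact: dbl_cup.
exact: (xgetPex 1%g (ex_intro _ a ex)).
Qed.

Lemma X_act_lift g (Phi : Ehalf p) (a : E) : p a = dbl g ->
  eh_val (X_act g Phi) = (a * eh_val Phi * a^-1)%g.
Proof.
move=> pa; rewrite -[LHS]/(lift_double p g * eh_val Phi * (lift_double p g)^-1)%g.
by apply: (ker_conj _ kc); rewrite lift_doubleE.
Qed.

Lemma ehalf_eq (x y : Ehalf p) : eh_val x = eh_val y -> x = y.
Proof. exact: sub_ofP. Qed.

Lemma X_tE (Phi : Ehalf p) (x : segment (pi : R)) :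
  pe_path (X_t Phi) x = ev (oloop (p (eh_val Phi))) (sval x).
Proof. by []. Qed.

Lemma X_t_smooth : smooth (@X_t R G E p).
Proof.
move=> n U q Uq; have Uq' : plot U (fun u => p (eh_val (q u))) by apply: dh_smooth; exact: Uq.
have [oU Hq] := (Uq' : plot U (fun u => ev (oloop (p (eh_val (q u)))))).
split=> // m V a b oV aC aU Vb.
exact: (Hq m V a (fun v => sval (b v) : R)).
Qed.

(** [lift_double] is a pointwise choice without any smoothness. Locally it is replaced by a smooth
    lift of the smooth homomorphism [dbl], which gives the same conjugation because the kernel is
    central. *)
Lemma X_act_smooth : smooth (fun z : PeG G * Ehalf p => X_act z.1 z.2).
Proof.
move=> n U q [q1 q2]; apply: plot_local => [|u Uu]; first exact: plot_open q1.
have dq : plot U (fun u => dbl (q u).1) by exact: (dh_smooth dbl q1).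
have [V [a [Vu VU Va pa]]] := local_lift ls dq Uu.
have hP v : preim_sg p (half_sg G) (a v * eh_val (q v).2 * (a v)^-1)%g by exact: half_conj.
exists V, (fun v => SubOf (hP v)); split=> //.
  have q2' : plot V (fun v => eh_val (q v).2) by apply: (plot_sub (plot_open Va) VU); exact: q2.
  by apply: plot_sub_of; exact: (@plotM R E n V _ _ (@plotM R E n V _ _ Va q2') (@plotV R E n V _ Va)).
by move=> v Uv Vv; apply: ehalf_eq; rewrite [LHS](X_act_lift _ (pa v Vv)).
Qed.

Lemma X_Omega_crossed_module : halves_commute -> crossed_module (X_Omega p).
Proof.
move=> hc; split.
- split; first exact: X_t_smooth.
  by move=> x y; apply: sub_ofP; apply: cmapP => s; rewrite -[LHS]/(ev (oloop (p (eh_val x * eh_val y)%g)) (sval s)) dhM.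
- exact: X_act_smooth.
- move=> h; apply: ehalf_eq; rewrite (@X_act_lift _ _ 1%g) ?dh1//.
  by rewrite mul1g invg1 mulg1.
- move=> g g' h; have [a pa] := ls_surj ls (dbl g); have [b pb] := ls_surj ls (dbl g').
  apply: ehalf_eq; rewrite (@X_act_lift _ _ (a * b)%g); last by rewrite !dhM pa pb.
  by rewrite (X_act_lift _ pa) (X_act_lift _ pb) invgM !mulgA.
- move=> g h h'; have [a pa] := ls_surj ls (dbl g).
  apply: ehalf_eq; rewrite (X_act_lift _ pa).
  rewrite -[RHS]/(eh_val (X_act g h) * eh_val (X_act g h'))%g !(X_act_lift _ pa).
  by rewrite -[eh_val (h * h')%g]/(eh_val h * eh_val h')%g !mulgA mulgVK.
- move=> g h; have [a pa] := ls_surj ls (dbl g).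
  apply: sub_ofP; apply: cmapP => x.
  rewrite -[LHS]/(ev (oloop (p (eh_val (X_act g h)))) (sval x)) (X_act_lift _ pa) !dhM dhV pa.
  by rewrite -[RHS]/(pe_path g x * ev (oloop (p (eh_val h))) (sval x) * (pe_path g x)^-1)%g -(dbl_cup g).1.
- move=> h k; have [a pa] := ls_surj ls (dbl (X_t h)).
  apply: ehalf_eq; rewrite (X_act_lift _ pa).
  rewrite -[RHS]/(eh_val h * eh_val k * (eh_val h)^-1)%g.
  (* The loop under [h] and the double of its restriction agree on [[0, pi]], so the quotient of
     their lifts lies over a loop trivial there and commutes with [k]. *)
  have C : (eh_val k * ((eh_val h)^-1 * a) = (eh_val h)^-1 * a * eh_val k)%g.
    apply: hc; first exact: (sgvalP k).
    move=> s s0; rewrite dhM dhV pa.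
    pose x : segment (pi : R) := exist (fun x : R => is_true (0 <= x <= pi)) s s0.
    rewrite -[LHS]/((ev (oloop (p (eh_val h))) s)^-1 * ev (oloop (dbl (X_t h))) (sval x))%g.
    by rewrite (dbl_cup (X_t h)).1 X_tE /= mulVg.
  have -> : a = (eh_val h * ((eh_val h)^-1 * a))%g by rewrite mulVKg.
  move: ((eh_val h)^-1 * a)%g C => c C.
  by rewrite invgM -[(eh_val h * c * eh_val k)%g]mulgA -C !mulgA mulgK.
Qed.

Lemma X_t_arc (Phi : Ehalf p) g : p (eh_val Phi) = sgval (arc g) -> X_t Phi = sgval g.
Proof.
move=> E1; apply: sub_ofP; apply: cmapP => x.
by rewrite -[LHS]/(ev (oloop (p (eh_val Phi))) (sval x)) E1 (arc_cup g).1.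
Qed.
End XOmegaCrossed.

Section WeakEquivalence.
Context {R : realType} (X Y : xmod_data R) (F1 : xH X -> xH Y) (F0 : xK X -> xK Y).
Hypotheses (cX : crossed_module X) (cY : crossed_module Y) (sh : strict_hom F1 F0).

Lemma F1V h : F1 (h^-1)%g = ((F1 h)^-1)%g.
Proof. exact: (dhV (DiffHom (sh1 sh).1 (sh1 sh).2)). Qed.
Lemma F0V h : F0 (h^-1)%g = ((F0 h)^-1)%g.
Proof. exact: (dhV (DiffHom (sh0 sh).1 (sh0 sh).2)). Qed.
Lemma F0_1 : F0 1%g = 1%g.
Proof. exact: (dh1 (DiffHom (sh0 sh).1 (sh0 sh).2)). Qed.
Lemma xtV (h : xH Y) : xt (h^-1)%g = ((xt h)^-1)%g.
Proof. exact: (dhV (DiffHom (xm_t cY).1 (xm_t cY).2)). Qed.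
Lemma xact1 (g : xK Y) : xact g 1%g = 1%g :> xH Y.
Proof. by apply: (mulgI (xact g 1%g)); rewrite -(xm_morph cY) !mulg1. Qed.
Lemma xactK (g : xK Y) (h : xH Y) : xact g (xact g^-1%g h) = h.
Proof. by rewrite -(xm_actM cY) mulgV (xm_act1 cY). Qed.

Local Notation mul := (sdmul F0).
Definition sdinv (z : xH Y * xK X) : xH Y * xK X := (xact (F0 z.2^-1%g) z.1^-1%g, z.2^-1%g).
Lemma sdmulA x y z : mul x (mul y z) = mul (mul x y) z.
Proof.
rewrite /sdmul /= !mulgA; congr (_, _).
by rewrite (xm_morph cY) (sh0 sh).2 (xm_actM cY) mulgA.
Qed.
Lemma sdmul1 z : mul z (1%g, 1%g) = z.
Proof.
rewrite /sdmul /= mulg1; case: z => a g /=; congr (_, _).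
by rewrite xact1 mulg1.
Qed.
Lemma sd1mul z : mul (1%g, 1%g) z = z.
Proof. by rewrite /sdmul /= !mul1g F0_1 (xm_act1 cY); case: z. Qed.
Lemma sdmulV z : mul z (sdinv z) = (1%g, 1%g).
Proof. by rewrite /sdmul /sdinv /= F0V xactK !mulgV. Qed.
Lemma sdVmul z : mul (sdinv z) z = (1%g, 1%g).
Proof. by rewrite /sdmul /sdinv /= -(xm_morph cY) !mulVg xact1. Qed.

Lemma bkappaM h h' : bkappa F1 (h * h')%g = mul (bkappa F1 h) (bkappa F1 h').
Proof.
rewrite /bkappa /sdmul /= (xm_t cX).2; congr (_, _).
rewrite -(sh_t sh) (xm_peiffer cY) !mulgA mulVg mul1g.
by rewrite (sh1 sh).2 invgM.
Qed.
Lemma bjM z w : bj F0 (mul z w) = (bj F0 z * bj F0 w)%g.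
Proof.
rewrite /bj /sdmul /= (xm_t cY).2 (xm_equiv cY) (sh0 sh).2 !mulgA.
by rewrite mulgVK.
Qed.
Lemma bj_kappa h : bj F0 (bkappa F1 h) = 1%g.
Proof. by rewrite /bj /bkappa /= xtV (sh_t sh) mulVg. Qed.

Lemma bj_smooth : smooth (bj (Y := Y) F0).
Proof.
move=> n U q [q1 q2]; apply: plotM; first exact: ((xm_t cY).1 _ _ _ q1).
exact: ((sh0 sh).1 _ _ _ q2).
Qed.
Lemma plot_pair (A B : diffType R) n (U : set 'rV[R]_n) (f : 'rV[R]_n -> A) (g : 'rV[R]_n -> B) :
  plot U f -> plot U g -> plot U (fun u => (f u, g u)).
Proof. by []. Qed.
Lemma xact_plot n (U : set 'rV[R]_n) (g : 'rV[R]_n -> xK Y) (h : 'rV[R]_n -> xH Y) :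
  plot U g -> plot U h -> plot U (fun u => xact (g u) (h u)).
Proof. by move=> gP hP; exact: (xm_smooth cY (plot_pair gP hP)). Qed.
Lemma sdmul_plot n (U : set 'rV[R]_n) (z w : 'rV[R]_n -> xH Y * xK X) :
  plot U z -> plot U w -> plot U (fun u => mul (z u) (w u)).
Proof.
move=> [z1 z2] [w1 w2]; apply: plot_pair; last exact: plotM.
by apply: plotM => //; apply: xact_plot => //; exact: ((sh0 sh).1 _ _ _ z2).
Qed.
Lemma sdinv_plot n (U : set 'rV[R]_n) (z : 'rV[R]_n -> xH Y * xK X) :
  plot U z -> plot U (fun u => sdinv (z u)).
Proof.
move=> [z1 z2]; apply: plot_pair; last exact: plotV.
by apply: xact_plot; [apply: (sh0 sh).1; exact: plotV|exact: plotV].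
Qed.
Lemma bkappa_smooth : smooth (bkappa F1).
Proof.
move=> n U q Uq; apply: plot_pair; last exact: ((xm_t cX).1 _ _ _ Uq).
by apply: plotV; exact: ((sh1 sh).1 _ _ _ Uq).
Qed.

Lemma weak_equivalence_of_sections (delta : xH Y * xK X -> xH X) :
  local_sections (bj (Y := Y) F0) ->
  smooth_on [set z | bj F0 z = 1%g] delta ->
  (forall z, bj F0 z = 1%g -> bkappa F1 (delta z) = z) ->
  injective (bkappa F1) -> weak_equivalence F1 F0.
Proof.
move=> ls ds dK kI; split=> //.
- exact: bkappaM.
- exact: bjM.
- move=> z; split; first by move=> /dK <-; exists (delta z).
  by move=> [h ->]; exact: bj_kappa.
- exact: ls_surj.
split.
- exact: bj_smooth.
- move=> n U q [q1 q2]; apply: sdmul_plot => //; exact: (bkappa_smooth q2).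
- move=> y; have -> : bkappa F1 1%g = (1%g, 1%g).
    rewrite /bkappa; congr (_, _).
      by have := F1V 1%g; rewrite invg1 => <-; exact: (dh1 (DiffHom (sh1 sh).1 (sh1 sh).2)).
    exact: (dh1 (DiffHom (xm_t cX).1 (xm_t cX).2)).
  exact: sdmul1.
- by move=> y s s'; rewrite bkappaM sdmulA.
- by move=> y s; rewrite bjM bj_kappa mulg1.
move=> x; have [W [sig [oW Wx sW sE]]] := ls x.
exists W; split=> //.
(* A section trivializes the bundle: the point over [v] with coordinate [h] is the section times
   [bkappa h], and [delta] recovers [h] from the quotient by the section. *)
exists (fun v => mul (sig (sval v.1)) (bkappa F1 v.2)).
exists (fun v => delta (mul (sdinv (sig (sval v.1))) v.2)).
have sP n (U : set 'rV[R]_n) (q : 'rV[R]_n -> {y | W y}) : plot U q -> plot U (fun u => sig (sval (q u))).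
  move=> Uq; apply: (sW n U (fun u => sval (q u))); first exact: Uq.
  by move=> u _; exact: (svalP (q u)).
have jV z : bj F0 (sdinv z) = ((bj F0 z)^-1)%g.
  apply: (mulgI (bj F0 z)); rewrite -bjM sdmulV mulgV.
  by rewrite /bj /= F0_1 mulg1; exact: (dh1 (DiffHom (xm_t cY).1 (xm_t cY).2)).
split.
- move=> n U q [q1 q2]; apply: sdmul_plot; last exact: (bkappa_smooth q2).
  exact: sP.
- move=> n U q [q1 q2] qE; apply: (ds n U (fun u => mul (sdinv (sig (sval (q u).1))) (q u).2)).
    by apply: sdmul_plot => //; apply: sdinv_plot; exact: sP.
  move=> u Uu /=; rewrite bjM jV sE; last exact: (svalP (q u).1).
  by rewrite (qE u Uu) mulVg.
- by move=> v s /=; rewrite bjM bj_kappa mulg1 sE//; exact: (svalP v).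
- by move=> v s s' /=; rewrite bkappaM sdmulA.
split=> [v s|v y vy] /=.
  rewrite sdmulA sdVmul sd1mul; apply: kI; apply: dK; exact: bj_kappa.
rewrite dK; first by rewrite sdmulA sdmulV sd1mul.
rewrite bjM jV sE; last exact: (svalP v).
by rewrite vy mulVg.
Qed.
End WeakEquivalence.

(** * A smooth step function *)

Section SmoothStep.
Context {R : realType}.

Lemma inv_derive (x : R) : x != 0 -> is_derive x 1 (fun y : R => y^-1) (- x ^- 2).
Proof.
move=> xn; apply: (is_derive_eq (is_deriveV xn (is_derive_id x (1 : R)))).
by rewrite [_ *: 1]mulr1.
Qed.

(** The powers of [x^-1] are included because the derivative of one such function is a combination
    of two others; smoothness of all of them then follows by a single induction. *)
Definition flatexp m (x : R) : R := if 0 < x then x^-1 ^+ m * expR (- x^-1) else 0.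

Lemma flatexp_ge0 m x : 0 <= flatexp m x.
Proof.
by rewrite /flatexp; case: ltrP => // x0; rewrite mulr_ge0 ?expR_ge0// exprn_ge0// invr_ge0 ltW.
Qed.
Lemma flatexp0_gt0 x : 0 < x -> 0 < flatexp 0 x.
Proof. by move=> x0; rewrite /flatexp x0 mul1r expR_gt0. Qed.
Lemma flatexp_le0 m x : x <= 0 -> flatexp m x = 0.
Proof. by move=> x0; rewrite /flatexp ltNge x0. Qed.

Lemma pow_expR_bound m : exists C : R, forall y, 0 < y -> y ^+ m * expR (- y) <= C.
Proof.
exists m`!%:R => y y0; rewrite expRN ler_pdivrMr ?expR_gt0//.
case: m => [|m]; first by rewrite expr0 mul1r (le_trans _ (expR_ge1Dx y))// lerDl ltW.
have := expR_ge1Dxn m (ltW y0); rewrite -lerBrDl => h.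
have : y ^+ m.+1 / m.+1`!%:R <= expR y by rewrite (le_trans h)// lerBlDr lerDl.
by rewrite ler_pdivrMr ?ltr0n ?fact_gt0// mulrC.
Qed.

Lemma flatexp_deriv m (x : R) :
  is_derive x 1 (flatexp m) (flatexp m.+2 x - m%:R * flatexp m.+1 x).
Proof.
have [x0|x0|x0] := ltrgtP 0 x.
- have xn : x != 0 by rewrite gt_eqF.
  have Dv := inv_derive xn.
  have Dp := is_derive_pow m Dv.
  have Dn : is_derive x 1 (fun y : R => - y^-1) (x ^- 2).
    by have := is_deriveN Dv; rewrite opprK.
  have De : is_derive x 1 (fun y : R => expR (- y^-1)) _ := @is_derive1_comp R expR (fun y : R => - y^-1) x _ _ (is_derive_expR _) Dn.
  have D := is_deriveM Dp De.
  have N : \forall y \near x, (fun y => y^-1 ^+ m * expR (- y^-1)) y = flatexp m y.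
    by apply: filterS (lt_nbhsr x0) => y y0; rewrite /flatexp y0.
  have [d dE] := near_eq_diff N ((derivable1_diffP _ _).1 (ex_derive (is_derive := D))).
  apply: DeriveDef; first exact: diff_derivable.
  rewrite deriveE// dE -deriveE; last exact: ((derivable1_diffP _ _).1 (ex_derive (is_derive := D))).
  case: D => _ ->; rewrite /flatexp x0 /GRing.scale /= -exprVn.
  by case: (m) => [|m']; rewrite ?mul0r/= ?exprS; ring.
- rewrite !flatexp_le0 ?(ltW x0)// mulr0 subr0.
  have N : \forall y \near x, (cst 0 : R -> R) y = flatexp m y.
    by apply: filterS (lt_nbhsl x0) => y /ltW y0; rewrite flatexp_le0.
  have [d dE] := near_eq_diff N (differentiable_cst _ _).
  by apply: DeriveDef; [exact: diff_derivable|rewrite deriveE// dE diff_cst].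
rewrite -x0 !flatexp_le0// mulr0 subr0.
(* With [y] in place of [x^-1], the bound on [y ^+ m.+2 * expR (- y)] says that [flatexp m x] is at
   most [C * x ^+ 2], which gives derivative 0 at 0. *)
have [C HC] := pow_expR_bound m.+2.
have [d dE] : differentiable (flatexp m) 0 /\ ('d (flatexp m) 0 = cst 0 :> (R -> R)).
  apply: (@quadratic_diff0 _ _ _ _ C); first by rewrite flatexp_le0.
  apply/near_normP; exists 1 => // y _; rewrite subr0 ger0_norm ?flatexp_ge0//.
  have C0 : 0 <= C.
    by apply: le_trans (HC 1 ltr01); rewrite mulr_ge0 ?expR_ge0// expr1n.
  have [y0|y0] := ltrP 0 y; last by rewrite flatexp_le0// mulr_ge0// exprn_ge0.
  have yi : 0 < y^-1 by rewrite invr_gt0.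
  rewrite /flatexp y0 (ger0_norm (ltW y0)).
  have := HC _ yi; rewrite -(ler_pM2r (exprn_gt0 2 y0)); apply: le_trans.
  rewrite mulrAC; apply: ler_wpM2r; first exact: expR_ge0.
  by rewrite -addn2 exprD -mulrA -exprMn mulVf ?gt_eqF// expr1n mulr1.
by apply: DeriveDef; [exact: diff_derivable|rewrite deriveE// dE].
Qed.

Lemma derive_Cn (f f' : R -> R) n (U : set R) : open U -> (forall x, U x -> is_derive x 1 f (f' x)) ->
  Cn n U f' -> Cn n.+1 U f.
Proof.
move=> oU D C; have fd x : U x -> differentiable f x.
  by move=> /D h; apply/derivable1_diffP; exact: (ex_derive (is_derive := h)).
split=> [//|v]; apply: (Cn_eq oU _ (CnZ oU (Cn_cst n U v) C)) => x Ux.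
have -> : 'd f x v = v *: 'd f x 1 by rewrite -[v in LHS]mulr1; exact: linearZ.
congr (_ *: _); have [_ <-] := D x Ux; exact: deriveE (fd x Ux).
Qed.

Lemma flatexp_Cinf m : Cinf setT (flatexp m).
Proof.
move=> n; elim: n m => [|n IH] m.
  move=> x _; apply/differentiable_continuous/derivable1_diffP.
  exact: (ex_derive (is_derive := flatexp_deriv m x)).
apply: (derive_Cn openT (fun x _ => flatexp_deriv m x)).
have N : Cn n setT (fun x => - (m%:R * flatexp m.+1 x)).
  apply: (Cn_eq openT _ (CnZ openT (Cn_cst n setT (- m%:R : R)) (IH m.+1))) => x _.
  exact: mulNr.
exact: (CnD openT (IH m.+2) N).
Qed.

Lemma inv_Cinf : Cinf [set x : R | 0 < x] (fun x : R => x^-1).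
Proof.
have D (x : R) : 0 < x -> is_derive x 1 (fun y : R => y^-1) (- x ^- 2).
  by move=> x0; apply: inv_derive; rewrite gt_eqF.
have oP : open [set x : R | 0 < x] by exact: open_gt.
elim=> [|n IH].
  move=> x x0; apply/differentiable_continuous/derivable1_diffP.
  exact: (ex_derive (is_derive := D x x0)).
apply: (derive_Cn oP D).
have C := CnZ oP (Cn_cst n [set x : R | 0 < x] (-1 : R)) (CnZ oP IH IH).
by apply: (Cn_eq oP _ C) => x _; rewrite /GRing.scale /= mulN1r -exprVn.
Qed.

Definition step (x : R) : R := flatexp 0 x * (flatexp 0 x + flatexp 0 (1 - x))^-1.
Lemma step_den x : 0 < flatexp 0 x + flatexp 0 (1 - x).
Proof.
have [x0|x0] := ltrP 0 x; first by rewrite ltr_wpDr ?flatexp_ge0// flatexp0_gt0.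
by rewrite ltr_wpDl ?flatexp_ge0// flatexp0_gt0// subr_gt0 (le_lt_trans x0).
Qed.
Lemma step_le0 x : x <= 0 -> step x = 0.
Proof. by move=> x0; rewrite /step flatexp_le0// mul0r. Qed.
Lemma step_ge1 x : 1 <= x -> step x = 1.
Proof.
move=> x1; rewrite /step (@flatexp_le0 0 (1 - x)) ?subr_le0// addr0 divff// gt_eqF//.
by rewrite flatexp0_gt0// (lt_le_trans ltr01).
Qed.
Lemma step_01 x : 0 <= step x <= 1.
Proof.
rewrite mulr_ge0 ?flatexp_ge0 ?invr_ge0 ?(ltW (step_den x))//=.
by rewrite ler_pdivrMr ?step_den// mul1r lerDl flatexp_ge0.
Qed.
Lemma step_Cinf : Cinf setT step.
Proof.
move=> n; apply: (CnZ (a := flatexp 0) openT); first exact: flatexp_Cinf.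
apply: (Cn_compR (O := [set x : R | 0 < x]) (f := fun x => flatexp 0 x + flatexp 0 (1 - x)) openT) => //.
- by move=> x _; exact: step_den.
- apply: (CnD openT (flatexp_Cinf 0 n)).
  apply: (Cn_compR (O := setT) (f := fun x : R => 1 - x) openT) => //; last exact: flatexp_Cinf.
  apply: (Cn_eq openT _ (CnD openT (Cn_cst n setT (1 : R)) (CnZ openT (Cn_cst n setT (-1 : R)) (Cinf_idR setT n)))) => x _.
  by rewrite /GRing.scale /= mulN1r.
- exact: inv_Cinf.
Qed.

Lemma plot_compR n (U : set 'rV[R]_n) (f : 'rV[R]_n -> R) (W : normedModType R) (g : R -> W) :
  Cinf setT g -> plot U f -> euplot U (fun u => g (f u)).
Proof. by move=> gC [oU fC]; split=> //; exact: (Cinf_compR (O := setT)). Qed.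

Lemma step_plot n (U : set 'rV[R]_n) (f : 'rV[R]_n -> R) : plot U f -> plot U (fun u => step (f u)).
Proof. exact: plot_compR step_Cinf. Qed.
End SmoothStep.

(** * Paths with sitting instants *)

Section PartA.
Context {R : realType} {G : lieType R}.
Let p0 : 0 < (pi : R) := pi_gt0 R.

(** The constants confine the motion to the middle third of [[0, pi]]. The end value [a] is [pi] for
    paths on [[0, pi]] and [2 pi] for paths on [[0, 2 pi]]. *)
Definition sitting_reparam (a s : R) : R := a * step (3 * s / pi - 1).
Lemma sitting_reparam_plot a n (U : set 'rV[R]_n) (b : 'rV[R]_n -> R) :
  plot U b -> plot U (fun u => sitting_reparam a (b u)).
Proof.
move=> bP; have oU := plot_open bP; apply: plotRM; first exact: plot_cst.
apply: step_plot; apply: plotRD; last exact: plot_cst.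
by apply: plotRM; [apply: plotRM => //; exact: plot_cst|exact: plot_cst].
Qed.
Lemma sitting_reparam0 a s : s <= pi / 3 -> sitting_reparam a s = 0.
Proof.
move=> sp; rewrite /sitting_reparam step_le0 ?mulr0// subr_le0 ler_pdivrMr// mul1r.
by rewrite mulrC -ler_pdivlMr.
Qed.
Lemma sitting_reparam1 a s : 2 * pi / 3 <= s -> sitting_reparam a s = a.
Proof.
move=> sp; rewrite /sitting_reparam step_ge1 ?mulr1// lerBrDr ler_pdivlMr//.
by move: sp; lra.
Qed.
Lemma sitting_reparam_itv a s : 0 <= a -> 0 <= sitting_reparam a s <= a.
Proof.
move=> a0; have /andP[h1 h2] := step_01 (3 * s / pi - 1).
by rewrite mulr_ge0//= ler_piMr.
Qed.

Definition sit_cmap (g : PeG G) : gpath G pi.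
Proof.
apply: (@CMap R _ G (fun x : segment (pi : R) => hat g (sitting_reparam pi (sval x)))).
move=> n U q Uq; apply: (cmap_smooth (hat g) (p := fun u => sitting_reparam pi (sval (q u)))).
exact: sitting_reparam_plot.
Defined.
Lemma sit_Psi g : Psi_sg G (sit_cmap g).
Proof.
split=> [x x0|].
  by rewrite /= sitting_reparam0 ?x0 ?divr_ge0 ?(ltW p0)//; exact: pe_start.
exists (pi / 3); split=> [|x y xp yp|x y xp yp] /=; first by rewrite divr_gt0.
  by rewrite !sitting_reparam0.
by rewrite !sitting_reparam1//; [move: yp|move: xp]; lra.
Qed.
Definition sit (g : PeG G) : PeG_si G := SubOf (sit_Psi g).
Lemma sit_smooth : smooth sit.
Proof.
move=> n U q Uq; apply: plot_sub_of; split; first exact: plot_open Uq.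
move=> m V a b oV aC aU Vb; apply: (hat_plot (q := fun v => q (a v)) (b := fun v => sitting_reparam pi (sval (b v)))).
  exact: (plot_comp Uq).
exact: sitting_reparam_plot.
Qed.
Lemma sit_end g : hat (incl0 (sit g)) pi = hat g pi.
Proof.
rewrite -[LHS]/(hat g (sitting_reparam pi (sval (clamp pi)))) sval_clamp ?lexx ?ltW//.
by rewrite sitting_reparam1//; move: p0; lra.
Qed.
Lemma incl0_smooth : smooth (@incl0 R G). Proof. by []. Qed.
Lemma incl0M g h : incl0 (g * h)%g = (incl0 g * incl0 h)%g :> PeG G.
Proof. exact: sub_ofP. Qed.

Variable E : centralExt (LG G).

Lemma preim_local_sections (A B : diffGroupType R) (p : diffHom A B) (K : subgroup B) :
  local_sections p -> local_sections (preim_hom p K).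
Proof.
move=> ls y; have [W [s [oW Wy sW ps]]] := ls (sgval y).
pose W' := [set z : sub_of K | W (sgval z)].
have H (z : sub_of K) : W (sgval z) -> preim_sg p K (s (sgval z)).
  by move=> Wz; rewrite -[sg_set _ _]/(K (p (s (sgval z)))) ps//; exact: sgvalP.
pose s' (z : sub_of K) : sub_of (preim_sg p K) :=
  match pselect (W (sgval z)) with left h => SubOf (H z h) | right _ => 1%g end.
have s'E z : W' z -> sgval (s' z) = s (sgval z).
  by rewrite /W' /s' /=; case: pselect.
exists W', s'; split=> //.
- by move=> n U q Uq; exact: oW Uq.
- move=> n U q Uq qW; apply: plot_sub_of; apply: (plot_eq (p := fun u => s (sgval (q u)))).
    by move=> u Uu; rewrite s'E//; exact: qW.
  by apply: (sW n U (fun u => sgval (q u))) => //; exact: Uq.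
- by move=> z Wz; apply: sub_ofP; rewrite /= s'E// ps.
Qed.
Lemma preim_ker_central (A B : diffGroupType R) (p : diffHom A B) (K : subgroup B) :
  ker_central p -> ker_central (preim_hom p K).
Proof.
move=> kc x y /(congr1 (@sgval _ _ _)) /= px; apply: sub_ofP.
exact: (kc (sgval x) (sgval y)).
Qed.

Let kc : ker_central (OmegaE_proj E) := preim_ker_central (@ce_ker_central _ _ E).
Let ls : local_sections (OmegaE_proj E) := preim_local_sections (@ce_local_sections _ _ E).

Lemma arc_periodic : periodic_set (arc0pi : set R).
Proof.
move=> s; split=> -[m Hm].
  by exists (m + 1); rewrite mulrzDr mulr1z [_ *~ m + _]addrC addrA.
by exists (m - 1); rewrite mulrzDr mulrN1z -addrA [pi *+ 2 + _]addrC addrNK.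
Qed.

(** The complement of the open arc is again a periodic set, and a loop that is trivial on [[0, pi]]
    has its support in it. *)
Lemma disjoint_halves (x y : E) : disjoint_commutative E -> in_L arc0pi (ce_proj E x) ->
  (forall s : R, 0 <= s <= pi -> ev (ce_proj E y) s = 1%g) -> (x * y)%g = (y * x)%g.
Proof.
move=> dc xh y1; apply: (dc arc0pi (~` arc0pi)) => //.
- exact: arc_periodic.
- by move=> s; split=> H K; apply: H; move: K => /arc_periodic.
- exact: setICr.
move=> s /contrapT [m /andP[h1 h2]].
by rewrite -(ev_period (ce_proj E y) s m) y1// (ltW h1) ltW.
Qed.

Variables (i : diffHom (PeG_si G) E) (hi : doubles (E := E) i).

Lemma XW_sgval (g : PeG_si G) (z : dflg_half E) :
  sgval (sgval (XW_act hi g z)) =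
  (g * (sgval (sgval z)).1.1 * g^-1, g * (sgval (sgval z)).1.2 * g^-1, i g * (sgval (sgval z)).2 * (i g)^-1)%g.
Proof. by []. Qed.
Lemma dflg_eq (z w : dflg_half E) : sgval (sgval z) = sgval (sgval w) -> z = w.
Proof. by move=> H; apply: sub_ofP; apply: sub_ofP. Qed.
Lemma dflg_s1 (z : dflg_half E) : (sgval (sgval z)).1.2 = 1%g.
Proof. exact: (sgvalP z). Qed.

Lemma X_W_crossed_module : disjoint_commutative E -> crossed_module (X_W hi).
Proof.
move=> dc; split.
- by split; [move=> n U q [[]]|].
- move=> n U q [q1 q2]; have q2' : plot U (fun u => sgval (sgval (q u).2)) by exact: q2.
  have [[z1 z2] z3] := q2'.
  split; first split.
  + exact: (@plotM R (PeG_si G) n U _ _ (@plotM R (PeG_si G) n U _ _ q1 z1) (@plotV R (PeG_si G) n U _ q1)).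
  + exact: (@plotM R (PeG_si G) n U _ _ (@plotM R (PeG_si G) n U _ _ q1 z2) (@plotV R (PeG_si G) n U _ q1)).
  + have iP : plot U (fun u => i (q u).1) by exact: (dh_smooth i q1).
    exact: (@plotM R E n U _ _ (@plotM R E n U _ _ iP z3) (@plotV R E n U _ iP)).
- move=> h; apply: dflg_eq; rewrite XW_sgval dh1 !invg1 !mulg1 !mul1g.
  by case: (sgval (sgval h)) => -[].
- by move=> g g' h; apply: dflg_eq; rewrite !XW_sgval /= dhM !invgM !mulgA.
- move=> g h h'; apply: dflg_eq.
  rewrite -[RHS]/(sgval (sgval (XW_act hi g h)) * sgval (sgval (XW_act hi g h')))%g !XW_sgval.
  by rewrite -[RHS]/(_, _, _)/= !mulgA !mulgVK.
- by [].
move=> h k; apply: dflg_eq.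
rewrite XW_sgval -[RHS]/(sgval (sgval h) * sgval (sgval k) * (sgval (sgval h))^-1)%g.
rewrite -[RHS]/((sgval (sgval h)).1.1 * (sgval (sgval k)).1.1 * (sgval (sgval h)).1.1^-1,
  (sgval (sgval h)).1.2 * (sgval (sgval k)).1.2 * (sgval (sgval h)).1.2^-1,
  (sgval (sgval h)).2 * (sgval (sgval k)).2 * (sgval (sgval h)).2^-1)%g.
congr (_, _, _); first by rewrite (dflg_s1 h) (dflg_s1 k) !mulg1 !mulgV.
set a := (sgval (sgval h)).2; set b := (sgval (sgval k)).2; set g := xt h.
(* [i g] lies over the double of [g], so [(i g)^-1 * a] lies over a loop trivial on [[0, pi]] and
   commutes with [b]; conjugation by [a] thus reduces to conjugation by [i g]. *)
have C : (b * ((i g)^-1 * a) = (i g)^-1 * a * b)%g.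
  apply: disjoint_halves => //; first exact: half_arc.
  move=> s s0; pose x : segment (pi : R) := exist (fun x : R => is_true (0 <= x <= pi)) s s0.
  rewrite dhM dhV evM evV -[s]/(sval x) (hi g).1 (half_cup_l h x).
  by rewrite mulVg.
have -> : a = (i g * ((i g)^-1 * a))%g by rewrite mulVKg.
move: ((i g)^-1 * a)%g C => c C.
by rewrite invgM -[(i g * c * b)%g]mulgA -C !mulgA mulgK.
Qed.

Lemma disjoint_commutative_crossed_module : disjoint_commutative E -> crossed_module (X_Omega (OmegaE_proj E)).
Proof.
move=> dc; apply: X_Omega_crossed_module => // x y xh y1.
by apply: sub_ofP; exact: disjoint_halves.
Qed.

Lemma incl1M z w : @incl1 R G E (z * w)%g = (incl1 z * incl1 w)%g.
Proof. by apply: sub_ofP; apply: sub_ofP. Qed.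

Lemma i_dbl (g : PeG_si G) : ce_proj E (i g) = oloop (dbl (incl0 g)).
Proof. exact: cup_uniq (hi g) (dbl_cup (incl0 g)). Qed.

Lemma incl_strict_hom : strict_hom (X := X_W hi) (Y := X_Omega (OmegaE_proj E)) (@incl1 R G E) (@incl0 R G).
Proof.
split.
- by split; [move=> n U q [_ z3]|exact: incl1M].
- by split; [exact: incl0_smooth|exact: incl0M].
- move=> h; apply: sub_ofP; apply: cmapP => x.
  exact: (half_cup_l h x).
move=> g h; apply: ehalf_eq.
have dg := i_dbl g.
have iO : preim_sg (ce_proj E) (Omega_sg G) (i g).
  by rewrite -[sg_set _ _]/(isOmega (ce_proj E (i g))) dg; exact: (sgvalP (dbl (incl0 g))).
rewrite (X_act_lift kc ls (a := SubOf iO) (incl1 h)); first exact: sub_ofP.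
by apply: sub_ofP; exact: dg.
Qed.

Lemma sit_arc_end (k : PeG G) : arc_sg (k * (incl0 (sit k))^-1)%g.
Proof.
move=> x xp; have := sit_end k; rewrite /= => E1.
have -> : x = clamp pi.
  by apply: (eq_sig_hprop (fun y : R => @Prop_irrelevance _)); rewrite xp sval_clamp// lexx ltW.
by rewrite -[LHS]/(hat k pi * (hat (incl0 (sit k)) pi)^-1)%g sit_end mulgV.
Qed.
Definition sit_arc (k : PeG G) : sub_of (@arc_sg R G) := SubOf (sit_arc_end k).
Lemma sit_arc_smooth : smooth sit_arc.
Proof.
move=> n U q Uq; apply: plot_sub_of; apply: plotM => //; apply: plotV.
exact: (sit_smooth Uq).
Qed.

Lemma ls_pullback (A B K : diffType R) (p : A -> B) (f : K -> B) k : local_sections p -> smooth f ->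
  exists (W : set K) (s : K -> A), [/\ Dopen W, W k, smooth_on W s & forall y, W y -> p (s y) = f y].
Proof.
move=> lsp sf; have [W [s [oW Wk sW ps]]] := lsp (f k).
exists (f @^-1` W), (fun y => s (f y)); split=> //.
- exact: Dopen_preim.
- by move=> n U q Uq qW; exact: (sW n U (fun u => f (q u)) (sf _ _ _ Uq) qW).
- by move=> y Wy; exact: ps.
Qed.

Notation XW := (X_W hi).
Notation XO := (X_Omega (OmegaE_proj E)).

Lemma bj_incl_local_sections : local_sections (bj (X := XW) (Y := XO) (@incl0 R G)).
Proof.
move=> k; pose f (y : PeG G) := arc (sit_arc y).
have sf : smooth f by exact: smooth_comp sit_arc_smooth (dh_smooth arc).
have [W [s [oW Wk sW sE]]] := ls_pullback k (@preim_local_sections _ _ _ (half_sg G) ls) sf.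
exists W, (fun y => (s y, sit y)); split=> //.
  by move=> n U q Uq qW; apply: plot_pair; [exact: sW|exact: sit_smooth].
move=> y Wy; rewrite /bj /= (@X_t_arc _ _ _ _ _ (sit_arc y)).
  by rewrite /= mulgVK.
by have := congr1 (@sgval _ _ _) (sE y Wy).
Qed.

(** In the kernel of [bj] the first component lies over a loop that is [g^-1] on [[0, pi]] and 1
    afterwards. Its inverse lies over [(g, 1)], in accordance with the inverse in the first
    component of [bkappa]. *)
Lemma kappa_inv_incl_P (z : xH XO * xK XW) : bj (X := XW) (Y := XO) (@incl0 R G) z = 1%g ->
  dflg_sg E (z.2, 1%g, (sgval (eh_val z.1))^-1)%g.
Proof.
case: z => Phi g /= H.
have E1 (x : segment (pi : R)) : ev (ce_proj E (sgval (eh_val Phi))) (sval x) = ((psi_path g x)^-1)%g.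
  have := congr1 (fun h : PeG G => pe_path h x) H.
  rewrite -[LHS]/(ev (ce_proj E (sgval (eh_val Phi))) (sval x) * psi_path g x)%g /= => E1.
  by apply: (mulIg (psi_path g x)); rewrite mulVg.
have HP s : ~ arc0pi s -> ev (ce_proj E (sgval (eh_val Phi))) s = 1%g := sgvalP Phi s.
split.
  move=> x xp; rewrite -[psi_path g x]invgK -E1 HP ?invg1// xp; apply: not_arc.
  by rewrite lexx mulr2n lerDl ltW.
split=> x; rewrite /= dhV evV; first by rewrite E1 invgK.
have /andP[x0 x1] := svalP x.
by rewrite HP ?invg1//; apply: not_arc; rewrite mulr2n lerBrDr lerD2l x1/= lerBlDr lerDl.
Qed.
Definition kappa_inv_incl (z : xH XO * xK XW) : xH XW :=
  match pselect (bj (X := XW) (Y := XO) (@incl0 R G) z = 1%g) with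
  | left h => SubOf (erefl : ker_sg (dflg_s E) (SubOf (kappa_inv_incl_P h)))
  | right _ => 1%g
  end.

Lemma incl_weak_equivalence : disjoint_commutative E ->
  weak_equivalence (X := XW) (Y := XO) (@incl1 R G E) (@incl0 R G).
Proof.
move=> dc; have deltaE z : bj (X := XW) (Y := XO) (@incl0 R G) z = 1%g ->
    sgval (sgval (kappa_inv_incl z)) = (z.2, 1%g, (sgval (eh_val z.1))^-1)%g.
  by move=> H; rewrite /kappa_inv_incl; case: pselect.
apply: (weak_equivalence_of_sections (X_W_crossed_module dc) (disjoint_commutative_crossed_module dc)
  incl_strict_hom (delta := kappa_inv_incl)).
- exact: bj_incl_local_sections.
- move=> n U q [q1 q2] qj; apply: plot_sub_of; apply: plot_sub_of.
  apply: (plot_eq (p := fun u => ((q u).2, 1%g, (sgval (eh_val (q u).1))^-1)%g)).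
    by move=> u Uu; rewrite deltaE//; exact: qj.
  split; first split => //.
    exact: plot_cst (plot_open q2).
  by apply: (@plotV R E n U); exact: q1.
- move=> z zj; have H := deltaE z zj; case: z zj H => Phi g zj H; congr (_, _).
    by apply: ehalf_eq; apply: sub_ofP; rewrite /= H /= invgK.
  by rewrite /= /XW_t /= H.
move=> h h' [H1 H2]; apply: dflg_eq.
have H1' : (sgval (sgval h)).2 = (sgval (sgval h')).2.
  by apply: invg_inj; exact: H1.
have H2' : (sgval (sgval h)).1.1 = (sgval (sgval h')).1.1 by exact: H2.
have s1 := dflg_s1 h; have s2 := dflg_s1 h'.
case: (sgval (sgval h)) H1' H2' s1 => -[a b] c /= -> -> ->.
by case: (sgval (sgval h')) s2 => -[a' b'] c' /= ->.
Qed.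
End PartA.

(** * Loops in a simply connected group *)

Section LieTopology.
Context {R : realType} {G : lieType R}.

Lemma Dopen_chart_ball n (U : set G) (phi : G -> 'rV[R]_n) u r : Dopen U -> smooth_on U phi ->
  Dopen (U `&` [set g | `|phi g - u| < r]).
Proof.
move=> oU sphi m V p Vp.
have oVU := oU _ _ _ Vp.
have [_ C] : plot (V `&` p @^-1` U) (phi \o p).
  by apply: sphi => [|v []//]; apply: plot_sub Vp => // v [].
rewrite openE => v [Vv [Uv vr]].
have cz : {for v, continuous (phi \o p)} := C 0%N v (conj Vv Uv).
by apply: filterS2 (open_nbhs_nbhs (conj oVU (conj Vv Uv))) (cz _ (norm_lt_near vr)) => y [Vy Uy] Ny.
Qed.

Lemma Dopen_inv (W : set G) : Dopen W -> Dopen [set g : G | W (g^-1)%g].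
Proof. by move=> oW n U p Up; exact: (oW n U (fun u => (p u)^-1)%g (@plotV R G n U p Up)). Qed.

(** Continuity of division for the product topology. The D-topology of a product may be finer than
    the product topology, so the statement is obtained in charts, where both are Euclidean. *)
Lemma div_near (x y : G) (W : set G) : Dopen W -> W (x^-1 * y)%g ->
  exists U1 U2 : set G, [/\ Dopen U1, Dopen U2, U1 x, U2 y &
    forall a b, U1 a -> U2 b -> W (a^-1 * b)%g].
Proof.
move=> oW Wxy.
have [A [f [g [ch Ax]]]] := lie_chart x; have [B [f' [g' [ch' By]]]] := lie_chart y.
have [oA sf Pg K] := ch; have [oB sf' Pg' K'] := ch'.
pose d := ldim G.
pose q (z : 'rV[R]_(d + d)) := ((g (lsubmx z))^-1 * g' (rsubmx z))%g.
pose O' := (setT `&` (fun y : 'rV[R]_(d + d) => lsubmx y) @^-1` (f @` A)) `&`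
           (setT `&` (fun y : 'rV[R]_(d + d) => rsubmx y) @^-1` (f' @` B)).
have oO' : open O'.
  apply: openI; apply: open_preim; try exact: openT.
  - exact: plot_open Pg.
  - exact: lsub_Cinf openT.
  - exact: plot_open Pg'.
  - exact: rsub_Cinf openT.
have Pq : plot O' q.
  apply: plotM; last by apply: (plot_comp Pg') => //; [exact: rsub_Cinf|move=> z [_ []]].
  by apply: plotV; apply: (plot_comp Pg) => //; [exact: lsub_Cinf|move=> z [[]]].
have oQ := oW _ _ _ Pq.
have Q0 : (O' `&` q @^-1` W) (row_mx (f x) (f' y)).
  split; first by split; split=> //=; rewrite ?row_mxKl ?row_mxKr; [exists x|exists y].
  by rewrite /q /= row_mxKl row_mxKr K// K'.
have [r r0 rQ] := (near_normP _ _).1 (open_nbhs_nbhs (conj oQ Q0)).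
exists (A `&` [set a | `|f a - f x| < r]), (B `&` [set b | `|f' b - f' y| < r]); split.
- exact: Dopen_chart_ball.
- exact: Dopen_chart_ball.
- by split=> //=; rewrite subrr normr0.
- by split=> //=; rewrite subrr normr0.
move=> a b [Aa /= ar] [Bb /= br].
have [] := rQ (row_mx (f a) (f' b)); first by apply: row_norm; rewrite ?row_mxKl ?row_mxKr.
by move=> _; rewrite /q /= row_mxKl row_mxKr K// K'.
Qed.

(** The shape [a^-1 * (v * b)] is that of the quotient of two neighbouring grid paths on one cell:
    [a] and [b] are grid factors and [v] compares two grid points. *)
Lemma sandwich_near (W : set G) : Dopen W -> W 1%g -> exists V : set G, [/\ Dopen V, V 1%g &
  forall a v b, V a -> V v -> V b -> W (a^-1 * (v * b))%g].
Proof.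
move=> oW W1; have W1' : W (1^-1 * 1)%g by rewrite invg1 mulg1.
have [U1 [U2 [oU1 oU2 U11 U21 H1]]] := div_near oW W1'.
have U21' : U2 (1^-1 * 1)%g by rewrite invg1 mulg1.
have [V1 [V2 [oV1 oV2 V11 V21 H2]]] := div_near oU2 U21'.
exists (U1 `&` ([set v : G | V1 (v^-1)%g] `&` V2)); split.
- apply: (@DopI R G U1) => //; apply: (@DopI R G _ V2) => //; exact: Dopen_inv.
- by split=> //; split=> //=; rewrite invg1.
move=> a v b [U1a _] [_ [V1v _]] [_ [_ V2b]]; apply: H1 => //.
by rewrite -[v]invgK; exact: H2.
Qed.
End LieTopology.

Section UniformContinuity.
Context {R : realType} {G : lieType R}.
Let K : set (R * R) := `[0%R, 1%R] `*` `[0%R, 1%R].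

(** The Heine-Cantor argument on the compact square, with closeness in the group measured by left
    quotients. *)
Lemma square_uniform (H : R * R -> Dtop G) (V : set G) : {within K, continuous H} ->
  Dopen V -> V 1%g -> exists2 e : R, 0 < e & forall p q : R * R, K p -> K q ->
    `|p.1 - q.1| < e -> `|p.2 - q.2| < e -> V ((H p : G)^-1 * H q)%g.
Proof.
move=> Hc oV V1; have cK : compact K by apply: compact_setX; exact: (@segment_compact R 0 1).
pose P (e : R) (p : R * R) := forall q : R * R, K p -> K q ->
    `|p.1 - q.1| < e -> `|p.2 - q.2| < e -> V ((H p : G)^-1 * H q)%g.
have : \forall e \near (0 : R)^'+, K `<=` P e.
  move/compact_near_coveringP : cK; apply => p0 Kp0.
  have V1' : V ((H p0 : G)^-1 * H p0)%g by rewrite mulVg.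
  have [U1 [U2 [oU1 oU2 U11 U21 HU]]] := div_near oV V1'.
  have oU : open (U1 `&` U2 : set (Dtop G)) by exact: (@DopI R G).
  have N : nbhs (H p0) (U1 `&` U2 : set (Dtop G)) by apply: open_nbhs_nbhs; split.
  have /subspace_continuousP /(_ p0 Kp0) Hp0 := Hc.
  have {}N := Hp0 _ N.
  have [/= r r0 rH] : exists2 r : R, 0 < r & forall q : R * R, K q -> `|p0.1 - q.1| < r -> `|p0.2 - q.2| < r -> (U1 `&` U2) (H q).
    have /nbhs_ballP[r r0 rB] : nbhs p0 (fun q => K q -> (U1 `&` U2) (H q)) by exact: N.
    exists r => // q Kq q1 q2; apply: rB => //; split=> //.
  have N2 : \forall e \near (0 : R)^'+, e < r / 2 by apply: nbhs_right_lt; rewrite divr_gt0.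
  exists (ball p0 (r / 2), [set e : R | e < r / 2]).
    by split; [apply: nbhsx_ballx; rewrite divr_gt0|exact: N2].
  move=> [p e] /= [[b1 b2] er] q Kp Kq q1 q2; rewrite /ball /= in b1 b2.
  have [] := rH p Kp.
  - by rewrite (lt_trans b1)// ltr_pdivrMr// ltr_pMr// ltr1n.
  - by rewrite (lt_trans b2)// ltr_pdivrMr// ltr_pMr// ltr1n.
  move=> U1p _.
  have [] := rH q Kq.
  - rewrite (le_lt_trans (ler_distD p.1 _ _))// (splitr r) ltrD// (lt_trans q1)//.
  - rewrite (le_lt_trans (ler_distD p.2 _ _))// (splitr r) ltrD// (lt_trans q2)//.
  by move=> _ U2q; exact: HU.
move=> N; near (0 : R)^'+ => e.
have He : K `<=` P e by near: e; exact: N.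
by exists e => // p q Kp Kq; exact: He.
Unshelve. all: by end_near. Qed.
End UniformContinuity.

Section BasedLoops.
Context {R : realType} {G : lieType R}.
Let p0 : 0 < (pi : R) := pi_gt0 R.
Notation L := (pi *+ 2 : R).
Let L0 : 0 < L. Proof. by rewrite mulrn_wgt0. Qed.

Definition obv (f : OmegaG_B G) (x : segment L) : G := pb_path (ob_path f) x.
Lemma obv_ext (f h : OmegaG_B G) : (forall x, obv f x = obv h x) -> f = h.
Proof. by move=> E; apply: sub_ofP; apply: sub_ofP; apply: cmapP. Qed.
Lemma obvM f h x : obv (f * h)%g x = (obv f x * obv h x)%g. Proof. by []. Qed.
Lemma obvV f x : obv (f^-1)%g x = ((obv f x)^-1)%g. Proof. by []. Qed.
Lemma obv_end f (x : segment L) : sval x = 0 \/ sval x = L -> obv f x = 1%g.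
Proof. by case=> xe; [exact: (sgvalP (ob_path f) x xe)|exact: (sgvalP f x xe)]. Qed.
Lemma obv_smooth f : smooth (obv f).
Proof. exact: cmap_smooth. Qed.

Lemma mkOB_P1 (g : gpath G L) : (forall x : segment L, sval x = 0 \/ sval x = L -> g x = 1%g) ->
  PB_sg G g.
Proof. by move=> H x x0; apply: H; left. Qed.
Lemma mkOB_P2 (g : gpath G L) (H : forall x : segment L, sval x = 0 \/ sval x = L -> g x = 1%g) :
  OB_sg G (SubOf (mkOB_P1 H) : PeG_B G).
Proof. by move=> x xL; apply: H; right. Qed.
Definition mkOB (g : gpath G L) (H : forall x : segment L, sval x = 0 \/ sval x = L -> g x = 1%g) :
  OmegaG_B G := SubOf (mkOB_P2 H).

Lemma OB_plot n (U : set 'rV[R]_n) (q : 'rV[R]_n -> OmegaG_B G) : open U ->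
  (forall m (V : set 'rV[R]_m) (a : 'rV[R]_m -> 'rV[R]_n) (b : 'rV[R]_m -> segment L),
    open V -> Cinf V a -> (forall v, V v -> U (a v)) -> plot V b ->
    plot V (fun v => obv (q (a v)) (b v))) -> plot U q.
Proof. by move=> oU H; split. Qed.
Lemma OB_plot_ev n (U : set 'rV[R]_n) (q : 'rV[R]_n -> OmegaG_B G) m (V : set 'rV[R]_m)
    (a : 'rV[R]_m -> 'rV[R]_n) (b : 'rV[R]_m -> segment L) : plot U q ->
    open V -> Cinf V a -> (forall v, V v -> U (a v)) -> plot V b ->
    plot V (fun v => obv (q (a v)) (b v)).
Proof. by move=> [oU H]; exact: H. Qed.


Lemma OB_curve (c : R -> OmegaG_B G) :
  (forall m (V : set 'rV[R]_m) (a : 'rV[R]_m -> R) (b : 'rV[R]_m -> segment L),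
    plot V a -> plot V b -> plot V (fun v => obv (c (a v)) (b v))) -> smooth c.
Proof.
move=> H n U f fP; apply: OB_plot; first exact: plot_open fP.
move=> m V a b oV aC aU bP; apply: (H m V (fun v => f (a v)) b) => //.
exact: (plot_comp fP).
Qed.
Lemma OB_curve_ev (c : R -> OmegaG_B G) m (V : set 'rV[R]_m) (a : 'rV[R]_m -> R)
  (b : 'rV[R]_m -> segment L) : smooth c -> plot V a -> plot V b ->
  plot V (fun v => obv (c (a v)) (b v)).
Proof.
move=> sc aP bP; apply: (OB_plot_ev (U := V) (q := fun v => c (a v)) (a := fun v => v)) => //.
- exact: sc aP.
- exact: plot_open aP.
- exact: Cinf_id.
Qed.

Lemma smooth_translate (X : diffType R) (c : R -> X) (t0 : R) : smooth c -> smooth (fun t => c (t0 + t)).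
Proof.
move=> sc n U f fP; apply: (sc n U (fun u => t0 + f u)).
by apply: plotRD => //; exact: plot_cst (plot_open fP).
Qed.
Lemma smooth_curve_shift (X : diffGroupType R) (c : R -> X) (t0 : R) : smooth c ->
  smooth (fun t => (c t0)^-1 * c (t0 + t))%g.
Proof.
by move=> sc; apply: smoothM; [exact: smooth_cst|exact: smooth_translate].
Qed.
End BasedLoops.

Section Generation.
Context {R : realType} {G : lieType R} (C : id_chart G).
Let p0 : 0 < (pi : R) := pi_gt0 R.
Notation L := (pi *+ 2 : R).
Let L0 : 0 < L. Proof. by rewrite mulrn_wgt0. Qed.
Notation U := (ic_dom C). Notation phi := (ic_phi C). Notation psi := (ic_psi C).

Lemma ic_Dopen : Dopen U. Proof. by case: (ic_chart C). Qed.
Lemma ic_smooth : smooth_on U phi. Proof. by case: (ic_chart C). Qed.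
Lemma ic_plot : plot (phi @` U) psi. Proof. by case: (ic_chart C). Qed.
Lemma ic_phiK g : U g -> psi (phi g) = g. Proof. by case: (ic_chart C) => _ _ _; exact. Qed.
Lemma ic_psi0 : psi 0 = 1%g. Proof. by rewrite -(ic_0 C) ic_phiK//; exact: ic_1. Qed.

Lemma ic_radius : exists2 r : R, 0 < r & forall x, `|x| < r -> (phi @` U) x.
Proof.
have oI := plot_open ic_plot.
have I0 : (phi @` U) 0 by exists 1%g; [exact: ic_1|exact: ic_0].
have [r r0 H] := (near_normP _ _).1 (open_nbhs_nbhs (conj oI I0)).
by exists r => // x xr; apply: H; rewrite subr0.
Qed.
Definition small_set (r : R) : set G := U `&` [set g | `|phi g| < r].
Lemma small_Dopen r : Dopen (small_set r).
Proof.
have := @Dopen_chart_ball _ _ _ U phi 0 r ic_Dopen ic_smooth.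
by congr Dopen; congr (_ `&` _); apply/seteqP; split=> g /=; rewrite subr0.
Qed.
Lemma small_1 r : 0 < r -> small_set r 1%g.
Proof. by move=> r0; split; [exact: ic_1|rewrite /= ic_0 normr0]. Qed.

Lemma scaled_small (r s : R) g : small_set r g -> 0 <= s <= 1 -> `|s *: phi g| < r.
Proof.
move=> [_ /= gr] /andP[s0 s1]; rewrite normrZ ger0_norm//; apply: le_lt_trans gr.
by rewrite ler_piMl.
Qed.

Lemma psi_scaled_plot r n (V : set 'rV[R]_n) (a : 'rV[R]_n -> R) (b : 'rV[R]_n -> G) :
  (forall x, `|x| < r -> (phi @` U) x) ->
  plot V a -> (forall v, V v -> 0 <= a v <= 1) -> plot V b -> (forall v, V v -> small_set r (b v)) ->
  plot V (fun v => psi (a v *: phi (b v))).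
Proof.
move=> rU aP a01 bP bs; have [oV aC] := aP.
have [_ fC] : plot V (phi \o b) by apply: ic_smooth => // v /bs[].
apply: (plot_comp ic_plot) => //; first by move=> N; exact: (CnZ oV (aC N) (fC N)).
by move=> v Vv; apply: rU; apply: scaled_small; [exact: bs|exact: a01].
Qed.

(** Radial contraction in the chart. The factor is [step t] and not [t], so it stays in [[0, 1]] for
    every real [t] and the curve never leaves the chart. *)
Lemma small_loop_curve r (f : OmegaG_B G) : (forall x, `|x| < r -> (phi @` U) x) ->
  (forall x, small_set r (obv f x)) -> exists c : R -> OmegaG_B G,
  [/\ smooth c, c 0 = 1%g & c 1 = f].
Proof.
move=> rU fs.
have sm t : smooth (fun x : segment L => psi (step t *: phi (obv f x))).
  move=> n V q Vq; have oV := plot_open Vq; apply: (psi_scaled_plot rU).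
  - exact: plot_cst.
  - by move=> v _; exact: step_01.
  - exact: (obv_smooth f Vq).
  - by [].
pose g t : gpath G L := CMap (sm t).
have gE t (x : segment L) : sval x = 0 \/ sval x = L -> g t x = 1%g.
  by move=> xe; rewrite /= obv_end// ic_0 scaler0 ic_psi0.
exists (fun t => mkOB (gE t)); split.
- apply: OB_curve => m V a b aP bP; apply: (psi_scaled_plot rU).
  + exact: step_plot.
  + by move=> v _; exact: step_01.
  + exact: (obv_smooth f bP).
  + by [].
- by apply: obv_ext => x; rewrite /obv /= step_le0// scale0r ic_psi0.
- by apply: obv_ext => x; rewrite /obv /= step_ge1// scale1r ic_phiK//; case: (fs x).
Qed.

Section Reparam.
Variable f : OmegaG_B G.
Lemma sit_seg_P (x : R) : 0 <= sitting_reparam L (x / 2) <= L.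
Proof. exact: sitting_reparam_itv (ltW L0). Qed.
Definition Lseg (x : R) (h : 0 <= x <= L) : segment L := exist (fun x : R => is_true (0 <= x <= L)) x h.
Lemma Lseg_eq (x y : segment L) : sval x = sval y -> x = y.
Proof. by apply: eq_sig_hprop => z; exact: Prop_irrelevance. Qed.
(** The division by 2 adapts [sitting_reparam], made for [[0, pi]], to [[0, 2 pi]]. Its domain is
    the whole line, so [f] composed with it is a smooth map on [R], as the notion of homotopy used
    here requires of its loops. *)
Definition theta (x : R) : segment L := Lseg (sit_seg_P x).
Lemma theta_smooth : smooth theta.
Proof.
move=> n V q Vq; apply: sitting_reparam_plot; apply: plotRM => //.
exact: plot_cst (plot_open Vq).
Qed.
Lemma theta_0 (x : R) : x <= 0 -> sval (theta x) = 0.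
Proof.
move=> x0; rewrite /= sitting_reparam0//; apply: (@le_trans _ _ 0); last by rewrite divr_ge0// ltW.
by rewrite pmulr_lle0// invr_gt0.
Qed.
Lemma theta_L (x : R) : L <= x -> sval (theta x) = L.
Proof. by move=> xL; rewrite /= sitting_reparam1//; move: xL p0; rewrite -mulr_natl; lra. Qed.

Definition whole (x : R) : G := obv f (theta x).
Lemma whole_smooth : smooth whole.
Proof. exact: smooth_comp theta_smooth (obv_smooth f). Qed.

Lemma convex_itv (s x y a : R) : 0 <= s <= 1 -> 0 <= x <= a -> 0 <= y <= a ->
  0 <= (1 - s) * x + s * y <= a.
Proof. by move=> /andP[s0 s1] /andP[x0 x1] /andP[y0 y1]; apply/andP; split; nra. Qed.
Lemma interp_P (t : R) (x : segment L) :
  0 <= (1 - step t) * sval x + step t * sval (theta (sval x)) <= L.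
Proof. exact: convex_itv (step_01 t) (svalP x) (svalP (theta (sval x))). Qed.
Lemma interp_plot n (V : set 'rV[R]_n) (a : 'rV[R]_n -> R) (b : 'rV[R]_n -> segment L) :
  plot V a -> plot V b -> plot V (fun v => obv f (Lseg (interp_P (a v) (b v)))).
Proof.
move=> aP bP; apply: (obv_smooth f (p := fun v => Lseg (interp_P (a v) (b v)))).
have bP' : plot V (fun v => sval (b v) : R) by exact: bP.
have sP := step_plot aP; have oV := plot_open aP.
apply: plotRD; apply: plotRM => //.
  by apply: plotRD; [exact: plot_cst|exact: plotRN].
exact: (theta_smooth bP').
Qed.

Lemma whole_end (x : segment L) : sval x = 0 \/ sval x = L -> whole (sval x) = 1%g.
Proof.
move=> xe; apply: obv_end; case: xe => ->; [left|right].
  exact: theta_0.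
exact: theta_L.
Qed.
Lemma whole_gsmooth : smooth (fun x : segment L => whole (sval x)).
Proof. by move=> n V q Vq; exact: (whole_smooth (p := fun u => sval (q u))). Qed.
Definition whole_loop : OmegaG_B G := mkOB (g := CMap whole_gsmooth) whole_end.

(** Linear interpolation between a parameter and its reparametrization joins the loop to the
    reparametrized one; it stays in the segment by convexity and fixes both ends. *)
Lemma reparam_curve : exists c : R -> OmegaG_B G,
  [/\ smooth c, c 0 = 1%g & f = (whole_loop * (c 1%R)^-1)%g].
Proof.
have sm t : smooth (fun x : segment L => (obv f x)^-1 * obv f (Lseg (interp_P t x)))%g.
  move=> n V q Vq; apply: plotM; first exact: plotV (obv_smooth f Vq).
  by apply: interp_plot => //; exact: plot_cst (plot_open Vq).
pose g t : gpath G L := CMap (sm t).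
have gE t (x : segment L) : sval x = 0 \/ sval x = L -> g t x = 1%g.
  move=> xe; rewrite /= (obv_end f xe) invg1 mul1g; apply: obv_end.
  have -> : sval (Lseg (interp_P t x)) = (1 - step t) * sval x + step t * sval (theta (sval x)) by [].
  case: xe => xe; [left|right]; rewrite xe; first by rewrite theta_0// !mulr0 addr0.
  by rewrite theta_L// -mulrDl subrK mul1r.
exists (fun t => mkOB (gE t)); split.
- apply: OB_curve => m V a b aP bP; apply: plotM; first exact: plotV (obv_smooth f bP).
  exact: interp_plot.
- apply: obv_ext => x; rewrite /obv /= (_ : Lseg _ = x) ?mulVg//.
  by apply: Lseg_eq; rewrite /= step_le0// subr0 mul1r mul0r addr0.
apply: obv_ext => x; rewrite obvM obvV /obv /= (_ : Lseg _ = theta (sval x)); last first.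
  by apply: Lseg_eq; rewrite /= step_ge1// subrr mul0r mul1r add0r.
by rewrite invgM invgK mulgA /whole /obv mulgV mul1g.
Qed.
End Reparam.
End Generation.

Section Grid.
Context {R : realType} {G : lieType R} (C : id_chart G).
Let p0 : 0 < (pi : R) := pi_gt0 R.
Notation L := (pi *+ 2 : R).
Let L0 : 0 < L. Proof. by rewrite mulrn_wgt0. Qed.
Notation U := (ic_dom C). Notation phi := (ic_phi C). Notation psi := (ic_psi C).

Variables (r : R) (N : nat).
Hypotheses (rU : forall x, `|x| < r -> (phi @` U) x) (N0 : (0 < N)%N).

(* The smooth path through the points P j at the parameters j L / N. *)
Definition grid_factor (P : nat -> G) (j : nat) (x : R) : G :=
  psi (step (N%:R * x / L - j%:R) *: phi ((P j)^-1 * P j.+1)%g).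
Fixpoint grid_path (P : nat -> G) (m : nat) (x : R) : G :=
  if m is m'.+1 then (grid_path P m' x * grid_factor P m' x)%g else 1%g.

Section OnePath.
Variable P : nat -> G.
Hypothesis Ps : forall j, (j < N)%N -> small_set C r ((P j)^-1 * P j.+1)%g.

Lemma grid_smooth m : (m <= N)%N -> smooth (grid_path P m).
Proof.
elim: m => [|m IH] mN; first exact: smooth_cst.
apply: smoothM; first by apply: IH; exact: ltnW.
move=> n V q Vq; have oV := plot_open Vq; apply: (psi_scaled_plot rU (b := fun=> ((P m)^-1 * P m.+1)%g)).
- apply: step_plot; apply: plotRD; last exact: plot_cst.
  by apply: plotRM; [apply: plotRM => //|]; exact: plot_cst.
- by move=> v _; exact: step_01.
- exact: plot_cst.
- by move=> v _; exact: Ps.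
Qed.

(** Past the parameter [m L / N] the factors below [m] have all reached their final values
    [(P j)^-1 * P j.+1], and their product telescopes. *)
Lemma grid_before m (x : R) : (m <= N)%N -> m%:R * L / N%:R <= x -> grid_path P m x = ((P 0)^-1 * P m)%g.
Proof.
elim: m => [|m IH] mN mx /=; first by rewrite mulVg.
have NR : 0 < N%:R :> R by rewrite ltr0n.
rewrite IH ?(ltnW mN)//; last first.
  by rewrite (le_trans _ mx)// ler_pM2r ?invr_gt0// ler_pM2r// ler_nat.
rewrite /grid_factor step_ge1.
  by rewrite scale1r ic_phiK ?mulgA ?mulgK//; case: (Ps mN).
by rewrite lerBrDr nat1r ler_pdivlMr// [N%:R * x]mulrC -ler_pdivrMr.
Qed.

Lemma grid_after m k (x : R) : (k <= m)%N -> (m <= N)%N -> x <= k%:R * L / N%:R -> grid_path P m x = grid_path P k x.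
Proof.
have NR : 0 < N%:R :> R by rewrite ltr0n.
move=> km mN xk; elim: m km mN => [|m IH]; first by rewrite leqn0 => /eqP ->.
rewrite leq_eqVlt => /orP[/eqP -> //|]; rewrite ltnS => km mN.
rewrite /= IH ?(ltnW mN)// /grid_factor step_le0 ?scale0r ?ic_psi0 ?mulg1//.
rewrite subr_le0 ler_pdivrMr// mulrC -ler_pdivlMr// (le_trans xk)//.
by rewrite ler_pM2r ?invr_gt0// ler_pM2r// ler_nat.
Qed.

Lemma grid_cell (j : nat) (x : R) : (j < N)%N -> j%:R * L / N%:R <= x <= j.+1%:R * L / N%:R ->
  grid_path P N x = ((P 0)^-1 * P j * grid_factor P j x)%g.
Proof.
move=> jN /andP[x1 x2]; rewrite (@grid_after N j.+1)//=.
by rewrite (grid_before (ltnW jN) x1).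
Qed.

Lemma grid_start : grid_path P N 0 = 1%g.
Proof. by rewrite (@grid_after N 0%N) ?mul0r. Qed.
Lemma grid_stop : grid_path P N L = ((P 0)^-1 * P N)%g.
Proof. by rewrite grid_before// [N%:R * L]mulrC mulfK// pnatr_eq0 -lt0n. Qed.
End OnePath.

Lemma cell_exists (x : R) : 0 <= x <= L -> exists2 j, (j < N)%N & j%:R * L / N%:R <= x <= j.+1%:R * L / N%:R.
Proof.
have NR : 0 < N%:R :> R by rewrite ltr0n.
move=> /andP[x0 xL]; have [xe|xn] := eqVneq x L.
  exists N.-1; rewrite ?prednK// xe; apply/andP; split.
    by rewrite ler_pdivrMr// mulrC ler_pM2l// ler_nat leq_pred.
  by rewrite [N%:R * L]mulrC mulfK// gt_eqF.
have xl : x < L by rewrite lt_neqAle xn.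
pose y := N%:R * x / L.
have y0 : 0 <= y by rewrite divr_ge0 ?mulr_ge0 ?(ltW L0).
have /andP[h1 h2] := Num.Theory.floor_itv y.
have f0 : 0 <= Num.floor y by rewrite floor_ge0.
have E1 : Num.floor y = `|Num.floor y|%N :> int by rewrite gez0_abs.
set j := `|Num.floor y|%N in E1; rewrite E1 in h1 h2.
have h1' : j%:R <= y by exact: h1.
have h2' : y < j.+1%:R by rewrite -addn1 natrD; move: h2; rewrite intrD.
exists j.
  have : (j%:R < N%:R :> R); last by rewrite ltr_nat.
  by apply: (le_lt_trans h1'); rewrite ltr_pdivrMr// ltr_pM2l.
apply/andP; split.
  by rewrite ler_pdivrMr// [x * _]mulrC -ler_pdivlMr.
by rewrite ler_pdivlMr// [x * _]mulrC -ler_pdivrMr// ltW.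
Qed.
End Grid.

Section SimplyConnected.
Context {R : realType} {G : lieType R} (C : id_chart G).
Let p0 : 0 < (pi : R) := pi_gt0 R.
Notation L := (pi *+ 2 : R).
Let L0 : 0 < L. Proof. by rewrite mulrn_wgt0. Qed.
Notation U := (ic_dom C). Notation phi := (ic_phi C). Notation psi := (ic_psi C).

Lemma smooth_Dcontinuous (f : R -> G) : smooth f -> continuous (f : R -> Dtop G).
Proof. by move=> sf; apply/continuousP => A oA; exact: (open_curve sf). Qed.

(* A fine grid on a null-homotopy writes a loop as a product of loops close to 1,
   and these contract in a chart. *)
Lemma loops_generated (P : OmegaG_B G -> Prop) : simply_connected R (Dtop G) ->
  (forall x y, P x -> P y -> P (x * y)%g) ->
  (forall c : R -> OmegaG_B G, smooth c -> c 0 = 1%g -> P (c 1)) -> forall f, P f.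
Proof.
move=> [_ sc] PM Pc f.
have [c [sm c0 ->]] := reparam_curve f.
apply: (PM _ _ _ (Pc (fun t => (c t)^-1)%g (smoothV sm) _)); last by rewrite c0 invg1.
pose F (t : R) : Dtop G := whole f (L * t).
have Fc : {within `[0%R, 1%R], continuous F}.
  apply: continuous_subspaceT; apply: smooth_Dcontinuous => n V q Vq.
  by apply: (whole_smooth f); apply: plotRM => //; exact: plot_cst (plot_open Vq).
have F0 : F 0 = 1%g :> G by rewrite /F mulr0 /whole obv_end//; left; exact: theta_0.
have F1 : F 1 = 1%g :> G by rewrite /F mulr1 /whole obv_end//; right; exact: theta_L.
have [H [Hc HF H1 HE]] := sc F Fc (etrans F0 (esym F1)).
(* Loops in the ball of radius [r] contract in the chart; [V0] is so small that [a^-1 * (v * b)]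
   with entries in [V0] lies in that ball; [r1] is so small that grid factors lie in [V0]. *)
have [r r0 rU] := ic_radius C.
have [V0 [oV0 V01 HV0]] := sandwich_near (@small_Dopen _ _ C r) (@small_1 _ _ C r r0).
have oI := oV0 _ _ _ (ic_plot C).
have I0 : (phi @` U `&` psi @^-1` V0) 0.
  by split; [exists 1%g; [exact: ic_1|exact: ic_0]|rewrite /= ic_psi0].
have [r1 r10 rV] := (near_normP _ _).1 (open_nbhs_nbhs (conj oI I0)).
have rU1 (x : 'rV[R]_(ldim G)) : `|x| < r1 -> (phi @` U) x by move=> xr; have [] := rV x; rewrite ?subr0.
pose V := V0 `&` small_set C r1.
have oV : Dopen V by apply: (@DopI R G V0) => //; exact: small_Dopen.
have V1 : V 1%g by split => //; exact: small_1.
have [e e0 He] := square_uniform Hc oV V1.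
pose N := (Num.truncn (e^-1)).+1.
have NR : 0 < N%:R :> R by rewrite ltr0n.
have Ne : N%:R^-1 < e.
  by rewrite invf_plt ?posrE//; exact: truncnS_gt.
pose t_ (j : nat) : R := j%:R / N%:R.
have t01 j : (j <= N)%N -> 0 <= t_ j <= 1.
  by move=> jN; rewrite divr_ge0 ?ler0n//= ler_pdivrMr// mul1r ler_nat.
have tS j : t_ j.+1 - t_ j = N%:R^-1.
  by rewrite /t_ -mulrBl -natrB// subSnn mul1r.
have dist_t j : `|t_ j - t_ j.+1| < e by rewrite distrC tS gtr0_norm ?invr_gt0.
have itvR (t : R) : 0 <= t <= 1 -> `[0%R, 1%R]%classic t by rewrite set_itvcc.
have itv j : (j <= N)%N -> `[0%R, 1%R]%classic (t_ j) by move=> /t01; exact: itvR.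
pose Q i j : G := H (t_ i, t_ j).
have Q0 i : (i <= N)%N -> Q i 0%N = 1%g.
  by move=> iN; rewrite /Q; have [] := HE (t_ i) (t01 i iN); rewrite /t_ mul0r F0.
have tN : t_ N = 1 by rewrite /t_ divff// gt_eqF.
have t0 : t_ 0%N = 0 by rewrite /t_ mul0r.
have QN i : (i <= N)%N -> Q i N = 1%g.
  by move=> iN; rewrite /Q tN; have [_] := HE (t_ i) (t01 i iN); rewrite F0.
have Qs i j : (i <= N)%N -> (j < N)%N -> V ((Q i j)^-1 * Q i j.+1)%g.
  move=> iN jN; apply: He.
  - by split; apply: itv => //; exact: ltnW.
  - by split; apply: itv.
  - by rewrite subrr normr0.
  - exact: dist_t.
have Qs' i j : (i < N)%N -> (j <= N)%N -> V ((Q i.+1 j)^-1 * Q i j)%g.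
  move=> iN jN; apply: He.
  - by split; apply: itv.
  - by split; apply: itv => //; exact: ltnW.
  - by rewrite distrC; exact: dist_t.
  - by rewrite subrr normr0.
have small i : (i <= N)%N -> forall j, (j < N)%N -> small_set C r1 ((Q i j)^-1 * Q i j.+1)%g.
  by move=> iN j jN; have [] := Qs i j iN jN.
pose gm i (x : R) : G := grid_path C N (Q i) N x.
have gms i : (i <= N)%N -> smooth (gm i) by move=> iN; exact: (grid_smooth rU1 (small i iN)).
have gmE i j x : (i <= N)%N -> (j < N)%N -> j%:R * L / N%:R <= x <= j.+1%:R * L / N%:R ->
    gm i x = (Q i j * grid_factor C N (Q i) j x)%g.
  by move=> iN jN xj; rewrite /gm (grid_cell (ltn0Sn _) (small i iN) jN xj) Q0// invg1 mul1g.
have facV i j x : (i <= N)%N -> (j < N)%N -> V0 (grid_factor C N (Q i) j x).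
  move=> iN jN; have [] := rV (step (N%:R * x / L - j%:R) *: phi ((Q i j)^-1 * Q i j.+1)%g); last by [].
  by rewrite subr0; apply: scaled_small; [exact: small|exact: step_01].
have gend i (x : segment L) : (i <= N)%N -> sval x = 0 \/ sval x = L -> gm i (sval x) = 1%g.
  move=> iN [->|->]; first exact: grid_start.
  by rewrite /gm (grid_stop (ltn0Sn _) (small i iN)) Q0// QN// mulVg.
have gsm i : (i <= N)%N -> smooth (fun x : segment L => gm i (sval x)).
  by move=> iN n W q Wq; exact: (gms i iN _ _ (fun u => sval (q u))).
pose ga i (iN : (i <= N)%N) : OmegaG_B G := mkOB (g := CMap (gsm i iN)) (fun x => gend i x iN).
have smallP g : (forall x, small_set C r (obv g x)) -> P g.
  by move=> /(small_loop_curve rU)[d [ds d0 <-]]; exact: Pc.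
(* [k] counts rows back from the last one, where the homotopy is constant. Each row differs from the
   next by a small loop, by [sandwich_near] on every cell. *)
have Pg k : (k <= N)%N -> forall iN : (N - k <= N)%N, P (ga (N - k)%N iN).
  elim: k => [|k IH] kN iN.
    have -> : ga (N - 0)%N iN = 1%g.
      apply: obv_ext => x; rewrite /obv /= subn0.
      have [j jN xj] := cell_exists (ltn0Sn _ : (0 < N)%N) (svalP x).
      have Q1 q : (q <= N)%N -> Q N q = 1%g.
        by move=> qN; rewrite /Q tN H1 ?F0//; exact: t01.
      rewrite (gmE _ _ _ (leqnn N) jN xj) /grid_factor !Q1// ?(ltnW jN)//.
      by rewrite mulVg ic_0 scaler0 ic_psi0 mulg1.
    by have := Pc (fun=> 1%g) (smooth_cst _) erefl.
  have iN' : (N - k <= N)%N by exact: leq_subr.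
  have E1 : (N - k)%N = (N - k.+1).+1 by rewrite subnSK.
  have -> : ga (N - k.+1)%N iN = (ga (N - k)%N iN' * ((ga (N - k)%N iN')^-1 * ga (N - k.+1)%N iN))%g.
    by rewrite mulVKg.
  apply: PM; first by apply: IH; exact: ltnW.
  apply: smallP => x; rewrite obvM obvV /obv /=.
  have [j jN xj] := cell_exists (ltn0Sn _ : (0 < N)%N) (svalP x).
  rewrite (gmE _ _ _ iN' jN xj) (gmE _ _ _ iN jN xj).
  rewrite invgM -!mulgA [X in small_set _ _ (_ * X)%g]mulgA; apply: HV0.
  - exact: facV.
  - have iN2 : (N - k.+1 < N)%N by rewrite -E1.
    by have [+ _] := Qs' _ j iN2 (ltnW jN); rewrite -E1.
  - exact: facV.
have NN : (N - N <= N)%N by rewrite subnn.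
(* Row 0 agrees with the loop at the grid points, and inside a cell both remain close to the common
   grid value, so their quotient is small as well. *)
have -> : whole_loop f = (ga (N - N)%N NN * ((ga (N - N)%N NN)^-1 * whole_loop f))%g by rewrite mulVKg.
apply: PM; first exact: Pg.
apply: smallP => x; rewrite obvM obvV /obv /=.
have [j jN xj] := cell_exists (ltn0Sn _ : (0 < N)%N) (svalP x).
rewrite (gmE _ _ _ NN jN xj) invgM -mulgA -[((Q _ j)^-1 * _)%g]mulg1; apply: HV0 => //.
  exact: facV.
have /andP[x0 x1] := svalP x; have /andP[y0 y1] := xj.
have wE : whole f (sval x) = H (0, sval x / L).
  rewrite HF; last by rewrite divr_ge0 ?(ltW L0)//= ler_pdivrMr// mul1r.
  by rewrite /F mulrCA divff ?mulr1// gt_eqF.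
have y0' : t_ j <= sval x / L by rewrite ler_pdivlMr// /t_ mulrAC.
have y1' : sval x / L <= t_ j.+1 by rewrite ler_pdivrMr// /t_ mulrAC.
have tx : 0 <= sval x / L <= 1.
  by rewrite divr_ge0 ?(ltW L0)//= ler_pdivrMr// mul1r.
rewrite wE /Q subnn t0.
have [] := He (0, t_ j) (0, sval x / L); last by [].
- by split; apply: itvR; [rewrite lexx ler01|exact: t01 (ltnW jN)].
- by split; apply: itvR => //; rewrite lexx ler01.
- by rewrite /= subrr normr0.
- rewrite /= distrC ger0_norm ?subr_ge0//; apply: le_lt_trans Ne.
  by rewrite -(tS j) lerB.
Qed.
End SimplyConnected.

(** * Velocities of curves of loops *)

Section Line.
Context {R : realType} {V W : normedModType R}.
Lemma line_derive0 (f : V -> W) (z v : V) : differentiable f z ->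
  is_derive (0 : R) 1 (fun s : R => f (z + s *: v)) ('d f z v).
Proof. by apply: line_derive; rewrite scale0r addr0. Qed.
End Line.

Lemma last_axpy (R : realType) n (x y : 'rV[R]_(n + 1)) (t : R) :
  last_part (x + t *: y) = last_part x + t * last_part y.
Proof. by rewrite /last_part !mxE. Qed.

Section Velocity.
Context {R : realType} {G : lieType R} (C : id_chart G).
Notation d := (ldim G).
Notation U := (ic_dom C). Notation phi := (ic_phi C). Notation psi := (ic_psi C).
Notation vel := (vel C).

Lemma vel_derive (a : R -> G) : smooth a -> a 0 = 1%g -> is_derive (0 : R) 1 (phi \o a) (vel a).
Proof.
move=> sa a0; apply: diff_is_derive.
have oW := open_curve sa (@ic_Dopen _ _ C).
have aC : Cinf (a @^-1` U) (phi \o a) := Cinf_curve sa (@ic_Dopen _ _ C) (@ic_smooth _ _ C) oW (@subset_refl _ _).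
by apply: (Cinf_diff aC); rewrite /= a0; exact: ic_1.
Qed.

Lemma velE (f : R -> 'rV[R]_d) (a : R -> G) df : is_derive (0 : R) 1 f df -> (forall t, f t = phi (a t)) -> vel a = df.
Proof. by move=> fD fa; rewrite /Defs.vel; apply: derive1_is; rewrite (_ : _ \o _ = f)//; apply/funext => t; rewrite /= fa. Qed.

Lemma vel_near (a b : R -> G) : (\forall t \near (0 : R), a t = b t) -> vel a = vel b.
Proof.
move=> ab; rewrite /Defs.vel !derive1E; apply: near_eq_derive.
by apply: filterS ab => t /= ->.
Qed.

Lemma vel_cst (g : G) : vel (fun=> g) = 0.
Proof. by rewrite /Defs.vel (_ : _ \o _ = cst (phi g))// derive1_cst. Qed.

(** The velocity is the partial derivative, in the last coordinate, of a map that is smooth in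
    parameter and time together; hence it is smooth in the parameter. *)
Lemma vel_family n (V : set 'rV[R]_n) (D : set 'rV[R]_(n + 1)) (A : 'rV[R]_n -> R -> G) :
  open V -> plot D (fun z => A (init_part z) (last_part z)) ->
  (forall u, V u -> D (append u 0)) -> (forall u, V u -> A u 0 = 1%g) ->
  Cinf V (fun u => vel (A u)).
Proof.
move=> oV AP VD A0.
have oD' := @ic_Dopen _ _ C _ _ _ AP; set D' := _ `&` _ in oD'.
pose F z := phi (A (init_part z) (last_part z)).
have [_ FC] : plot D' F.
  by apply: ic_smooth => [|z []//]; apply: plot_sub AP => // z [].
pose e : 'rV[R]_(n + 1) := delta_mx ord0 last_ix.
have D'u u : V u -> D' (append u 0).
  move=> Vu; split; first exact: VD.
  by rewrite /= init_append last_append A0//; exact: ic_1.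
have E u : V u -> 'd F (append u 0) e = vel (A u).
  move=> Vu; symmetry; apply: (velE (line_derive0 e (Cinf_differentiable FC (D'u u Vu)))) => t.
  by rewrite /F /= init_line last_line init_append last_append add0r.
apply: (Cinf_eq oV E); apply: (Cinf_comp (O := D') (f := fun z => 'd F z e) (g := fun u => append u 0)) => //.
  apply: append_Cinf; exact: plot_cst.
exact: Cinf_dir.
Qed.

Lemma smooth_coord2 (a : R -> G) (j : 'I_2) : smooth a -> plot setT (fun z : 'rV[R]_2 => a (z ord0 j)).
Proof. by move=> sa; apply: (sa 2 setT (fun z : 'rV[R]_2 => z ord0 j : R)); exact: plot_coord openT. Qed.

(** The two-variable map [a s * b t], differentiated along the diagonal, gives the sum of its
    partial derivatives. *)
Lemma velM (a b : R -> G) : smooth a -> smooth b -> a 0 = 1%g -> b 0 = 1%g ->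
  vel (fun t => a t * b t)%g = vel a + vel b.
Proof.
move=> sa sb a0 b0.
have AP : plot setT (fun z : 'rV[R]_2 => a (z ord0 ord0) * b (z ord0 ord_max))%g.
  by apply: plotM; exact: smooth_coord2.
have oD := @ic_Dopen _ _ C _ _ _ AP; set D := _ `&` _ in oD.
pose F (z : 'rV[R]_2) := phi (a (z ord0 ord0) * b (z ord0 ord_max))%g.
have [_ FC] : plot D F by apply: ic_smooth => [|z []//]; apply: plot_sub AP => // z [].
have D0 : D 0 by split=> //=; rewrite !mxE a0 b0 mulg1; exact: ic_1.
have line (v : 'rV[R]_2) : is_derive (0 : R) 1 (fun t : R => F (0 + t *: v)) ('d F 0 v).
  by apply: line_derive0; exact: Cinf_differentiable FC D0.
pose e0 : 'rV[R]_2 := delta_mx ord0 ord0; pose e1 : 'rV[R]_2 := delta_mx ord0 ord_max.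
have -> : vel a = 'd F 0 e0.
  apply: (velE (line e0)) => t.
  by rewrite /F /= !mxE /= mulr1 mulr0 !add0r b0 mulg1.
have -> : vel b = 'd F 0 e1.
  apply: (velE (line e1)) => t.
  by rewrite /F /= !mxE /= mulr1 mulr0 !add0r a0 mul1g.
rewrite -linearD; apply: (velE (line (e0 + e1))) => t.
by rewrite /F /= !mxE /= !(mulr1, mulr0, addr0, add0r).
Qed.

Lemma velV (a : R -> G) : smooth a -> a 0 = 1%g -> vel (fun t => (a t)^-1)%g = - vel a.
Proof.
move=> sa a0; apply/eqP; rewrite -addr_eq0 addrC -velM ?a0 ?invg1//; last exact: smoothV.
rewrite (_ : (fun _ => _) = fun=> 1%g) ?vel_cst//.
by apply/funext => t; rewrite mulgV.
Qed.

Definition conj_chart (b : G) (x : 'rV[R]_d) : 'rV[R]_d := phi (b * psi x * b^-1)%g.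
Definition Ad (b : G) (v : 'rV[R]_d) : 'rV[R]_d := 'd (conj_chart b) 0 v.

Lemma conj_chart_Cinf b : exists D : set 'rV[R]_d, [/\ open D, D 0 & Cinf D (conj_chart b)].
Proof.
have AP : plot (phi @` U) (fun x => b * psi x * b^-1)%g.
  have oI := plot_open (@ic_plot _ _ C).
  by apply: plotM; [apply: plotM; [exact: plot_cst|exact: ic_plot]|exact: plot_cst].
have oD := @ic_Dopen _ _ C _ _ _ AP; set D := _ `&` _ in oD.
exists D; split=> //.
  split; first by exists 1%g; [exact: ic_1|exact: ic_0].
  by rewrite /= ic_psi0 mulg1 mulgV; exact: ic_1.
have [//] : plot D (conj_chart b).
by apply: ic_smooth => [|z []//]; apply: plot_sub AP => // z [].
Qed.

Lemma AdZ b (c : R) v : Ad b (c *: v) = c *: Ad b v. Proof. exact: linearZ. Qed.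

Lemma vel_conj (b : G) (a : R -> G) : smooth a -> a 0 = 1%g ->
  vel (fun t => b * a t * b^-1)%g = Ad b (vel a).
Proof.
move=> sa a0; have [D [oD D0 FC]] := conj_chart_Cinf b.
have vd := vel_derive sa a0.
have gd : differentiable (phi \o a) 0 by apply/derivable1_diffP; exact: (ex_derive (is_derive := vd)).
have g0 : (phi \o a) 0 = 0 by rewrite /= a0 ic_0.
have Fd : differentiable (conj_chart b) ((phi \o a) 0) by rewrite g0; exact: Cinf_differentiable FC D0.
have dE := congr1 (fun h : R -> 'rV[R]_d => h 1) (diff_comp gd Fd).
rewrite /= a0 ic_0 in dE.
rewrite /Ad (_ : vel a = 'd (phi \o a) 0 1); last first.
  by case: vd => _ <-; rewrite deriveE.
rewrite -dE -deriveE; last exact: (differentiable_comp gd Fd).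
rewrite /Defs.vel derive1E; apply: near_eq_derive.
have oW := open_curve sa (@ic_Dopen _ _ C).
have W0 : (a @^-1` U) 0 by rewrite /= a0; exact: ic_1.
apply: filterS (open_nbhs_nbhs (conj oW W0)) => t Ut.
by rewrite /= /conj_chart ic_phiK.
Qed.

Lemma vel_conj_psi (b : G) (v : 'rV[R]_d) :
  vel (fun t => b * psi (t *: v) * b^-1)%g = Ad b v.
Proof.
have [D [oD D0 FC]] := conj_chart_Cinf b.
apply: (velE (line_derive0 v (Cinf_differentiable FC D0))) => t.
by rewrite /conj_chart add0r.
Qed.

(** The conjugation map is smooth jointly in [s] and in the chart coordinate, and [Ad] is one of its
    partial derivatives. *)
Lemma Ad_psi_Cinf (u v : 'rV[R]_d) : exists W : set R, [/\ open W, W 0 & Cinf W (fun s => Ad (psi (s *: u)) v)].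
Proof.
pose q (z : 'rV[R]_(d + 1)) := (psi (last_part z *: u) * psi (init_part z) * (psi (last_part z *: u))^-1)%g.
have luC (A : set 'rV[R]_(d + 1)) : open A -> Cinf A (fun z => last_part z *: u).
  by move=> oA N; have [_ lC] := last_plot oA; exact: (CnZ oA (lC N) (Cn_cst N A u)).
pose O' := (setT `&` (fun z : 'rV[R]_(d + 1) => last_part z *: u) @^-1` (phi @` U)) `&`
           (setT `&` (fun z : 'rV[R]_(d + 1) => init_part z) @^-1` (phi @` U)).
have oI := plot_open (@ic_plot _ _ C).
have oO' : open O'.
  by apply: openI; apply: open_preim => //; [exact: openT|exact: luC openT|exact: openT|exact: init_Cinf openT].
have Pq : plot O' q.
  have P1 : plot O' (fun z => psi (last_part z *: u)).
    by apply: (plot_comp (@ic_plot _ _ C)) => //; [exact: luC|move=> z [[]]].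
  apply: plotM; last exact: plotV.
  apply: plotM => //.
  by apply: (plot_comp (@ic_plot _ _ C)) => //; [exact: init_Cinf|move=> z [_ []]].
have oD := @ic_Dopen _ _ C _ _ _ Pq; set D := _ `&` _ in oD.
have [_ FC] : plot D (phi \o q) by apply: ic_smooth => [|z []//]; apply: plot_sub Pq => // z [].
have I0 : (phi @` U) 0 by exists 1%g; [exact: ic_1|exact: ic_0].
have D0 : D 0.
  have i0 : init_part (0 : 'rV[R]_(d + 1)) = 0 by apply/rowP => j; rewrite !mxE.
  have l0 : last_part (0 : 'rV[R]_(d + 1)) = 0 by rewrite /last_part mxE.
  split; first by split; split=> //=; rewrite ?l0 ?i0 ?scale0r.
  by rewrite /q /= l0 i0 scale0r ic_psi0 mulg1 mulgV; exact: ic_1.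
pose g (s : R) : 'rV[R]_(d + 1) := s *: delta_mx ord0 last_ix.
have gC (A : set R) : open A -> Cinf A g.
  by move=> oA N; exact: (CnZ oA (Cinf_idR A N) (Cn_cst N A _)).
have gc : continuous g by move=> s; exact: (gC setT openT 0%N s I).
have oW : open (g @^-1` D) by exact: ((continuousP g).1 gc D oD).
exists (g @^-1` D); split=> //; first by rewrite /= /g scale0r.
have gE s : g s = append 0 s.
  rewrite -[LHS]append_parts; congr append; last by rewrite /last_part !mxE !eqxx mulr1.
  by apply/rowP => j; rewrite !mxE eq_lrshift andbF mulr0.
have E s : (g @^-1` D) s -> 'd (phi \o q) (g s) (append v 0) = Ad (psi (s *: u)) v.
  move=> Ds; rewrite -vel_conj_psi; symmetry; apply: (velE (line_derive0 (append v 0) (Cinf_differentiable FC Ds))) => t.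
  have i1 : init_part (g s + t *: append v 0) = t *: v.
    apply/rowP => j; rewrite !mxE eq_lrshift andbF mulr0 add0r; congr (_ * _).
    by transitivity (init_part (append v 0) ord0 j); [rewrite /init_part /append !mxE|rewrite init_append].
  have l1 : last_part (g s + t *: append v 0) = s.
    by rewrite last_axpy gE !last_append mulr0 addr0.
  by rewrite /= /q i1 l1.
apply: (Cinf_eq oW E).
apply: (Cinf_comp (O := D) (f := fun z => 'd (phi \o q) z (append v 0)) (g := g)) => //.
  exact: gC.
exact: Cinf_dir.
Qed.

(** Modulo the row space of [A] the curve [Ad (psi (s *: u)) v] is constant near [s = 0], so its
    derivative there, the bracket, lies in that row space. *)
Lemma lie_br_sub (m : nat) (A : 'M[R]_(m, d)) (W0 : set G) u v : Dopen W0 -> W0 1%g ->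
  (forall b x, W0 b -> (Ad b x - x <= A)%MS) -> (lie_br C u v <= A)%MS.
Proof.
move=> oW0 W01 HA; have [W [oW W_0 LC]] := Ad_psi_Cinf u v.
pose Lf s := Ad (psi (s *: u)) v.
have -> : lie_br C u v = derive1 Lf 0.
  by rewrite /lie_br; congr (derive1 _ 0); apply/funext => s; exact: vel_conj_psi.
have oI := plot_open (@ic_plot _ _ C).
have oJ := oW0 _ _ _ (@ic_plot _ _ C).
have lc : continuous (fun t : R => t *: u) by exact: scalel_continuous.
have oJ' := (continuousP (fun t : R => t *: u)).1 lc _ oJ.
have J0 : ((fun t : R => t *: u) @^-1` ((phi @` U) `&` psi @^-1` W0)) 0.
  by split; rewrite /= scale0r; [exists 1%g; [exact: ic_1|exact: ic_0]|rewrite ic_psi0].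
apply/negPn/negP => nA; move: nA; rewrite submxE => /negP; apply.
apply/eqP/rowP => j; rewrite mxE [RHS]mxE.
have Di k : is_derive (0 : R) 1 (fun s => Lf s ord0 k : R) (derive1 Lf 0 ord0 k).
  have LkC : Cinf W (fun s => Lf s ord0 k : R).
    by move=> N; exact: (Cn_post (L := coordlin ord0 k) oW (@coord_continuous _ _ _ ord0 k) (LC N)).
  have := diff_is_derive (Cinf_diff LkC W_0).
  by have := derive1n_coord 1 k oW W_0 LC; rewrite !derive1n1 => ->.
(* Membership in the row space is the vanishing of the product with [K], hence a condition on scalar
   functions that can be differentiated. *)
pose K := cokermx A.
have S : is_derive (0 : R) 1 (fun s => \sum_k Lf s ord0 k * K k j) (\sum_k derive1 Lf 0 ord0 k * K k j).
  have Dk k : is_derive (0 : R) 1 (fun s => Lf s ord0 k * K k j) (derive1 Lf 0 ord0 k * K k j).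
    apply: (is_derive_eq (is_deriveM (Di k) (is_derive_cst (K k j) (0 : R) (1 : R)))).
    by rewrite scaler0 add0r; exact: mulrC.
  have := is_derive_sum Dk.
  by rewrite (_ : \sum_(i < d) _ = (fun s => \sum_k Lf s ord0 k * K k j))//; apply/funext => s; rewrite fct_sumE.
apply: (derive_near_unique S (is_derive_cst ((v *m K) ord0 j) (0 : R) (1 : R))).
apply: filterS (open_nbhs_nbhs (conj oJ' J0)) => s [_ Ws].
have := HA _ v Ws; rewrite submxE mulmxBl subr_eq0 => /eqP E.
by rewrite /cst -E mxE.
Qed.
End Velocity.

(** * Spanning a simple Lie algebra *)

Section Spanning.
Context {R : realType} {G : lieType R} (C : id_chart G).
Notation d := (ldim G).

(** Adjoining an element of [S] outside the row space raises the rank, so the process ends; [k]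
    bounds the remaining codimension. *)
Lemma spanning_rows (F : fieldType) n (S : 'rV[F]_n -> Prop) : exists m (M : 'M[F]_(m, n)),
  (forall i, S (row i M)) /\ forall s, S s -> (s <= M)%MS.
Proof.
suff H k : forall m (M : 'M[F]_(m, n)), (n - \rank M <= k)%N -> (forall i, S (row i M)) ->
    exists m' (M' : 'M[F]_(m', n)), (forall i, S (row i M')) /\ forall s, S s -> (s <= M')%MS.
  by apply: (H n 0%N (0 : 'M[F]_(0, n))) => [|[]//]; exact: leq_subr.
elim: k => [|k IH] m M Mk MS.
  exists m, M; split=> // s _; apply: (submx_trans (submx1 s)).
  by rewrite sub1mx /row_full eqn_leq rank_leq_col -subn_eq0 -leqn0.
have [H|/existsNP[s /not_implyP[Ss sM]]] := pselect (forall s, S s -> (s <= M)%MS).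
  by exists m, M.
apply: (IH _ (col_mx M s)); last first.
  move=> i; case: (split_ordP i) => j ->; first by rewrite rowKu.
  by rewrite rowKd row_id.
have lt : (M < col_mx M s)%MS.
  rewrite ltmxE; have := submx_refl (col_mx M s); rewrite col_mx_sub => /andP[-> _] /=.
  by rewrite col_mx_sub submx_refl /=; apply/negP.
have := rank_ltmx lt; move: Mk (rank_leq_col (col_mx M s)); lia.
Qed.

(** The span of the vectors [Ad b v - v] contains every bracket by [lie_br_sub]. It is therefore a
    nonzero ideal, hence everything. Elements [b] near 1 suffice, which are the only ones for which
    invariance of a character is established. *)
Lemma simple_spanning (W0 : set G) : Dopen W0 -> W0 1%g -> simple_lie C ->
  exists m (M : 'M[R]_(m, d)) (b : 'I_m -> G) (v : 'I_m -> 'rV[R]_d),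
  [/\ forall i, W0 (b i), forall i, row i M = Ad C (b i) (v i) - v i & row_full M].
Proof.
move=> oW0 W01 [[u [w uw0]] si].
have [m [M [MS HM]]] := spanning_rows (fun x => exists b v, W0 b /\ x = Ad C b v - v).
have [b0 Hb] := choice MS; have [v0 Hv] := choice Hb.
exists m, M, b0, v0; split=> [i|i|]; try by have [] := Hv i.
have H b x : W0 b -> (Ad C b x - x <= M)%MS by move=> Wb; apply: HM; exists b, x.
have br x y := lie_br_sub x y oW0 W01 H.
have gi : forall x y : 'rV[R]_d, (y <= genmx M)%MS -> (lie_br C x y <= genmx M)%MS.
  by move=> x y _; rewrite genmxE; exact: br.
have [A0|] := si (genmx M) gi.
  exfalso; apply: uw0; apply/eqP; rewrite -submx0 -A0 genmxE; exact: br.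
by rewrite /row_full genmxE.
Qed.
End Spanning.

(** * Curves and their local lifts *)

Section RealCurves.
Context {R : realType}.

Lemma smooth_Cinf (f : R -> R) : smooth f -> Cinf setT f.
Proof.
move=> sf; have [_ fC] := plot_line sf.
have eC : Cinf setT (line_emb : R -> 'rV[R]_1) by move=> k; apply: Cn_lin; exact: line_emb_cont.
apply: (Cinf_eq openT _ (Cinf_comp (O := setT) openT _ eC fC)) => // x _.
by rewrite line_embE.
Qed.

Lemma smooth_is_derive (f : R -> R) (t : R) : smooth f -> is_derive t 1 f (derive1 f t).
Proof. by move=> /smooth_Cinf fC; apply: diff_is_derive; exact: (Cinf_diff fC). Qed.

Lemma derive1_near (W : normedModType R) (f g : R -> W) (a : R) : (\forall t \near a, f t = g t) -> derive1 f a = derive1 g a.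
Proof. by move=> fg; rewrite !derive1E; exact: near_eq_derive. Qed.

Lemma smooth_near0 (X : diffType R) (c : R -> X) (U : set X) : smooth c -> Dopen U -> U (c 0) ->
  \forall t \near (0 : R), U (c t).
Proof. by move=> sc oU Uc; apply: open_nbhs_nbhs; split=> //; exact: open_curve. Qed.

Lemma cos_sin_Cn n : Cn n setT (@cos R) /\ Cn n setT (@sin R).
Proof.
elim: n => [|n [IHc IHs]].
  by split=> x _; [exact: continuous_cos|exact: continuous_sin].
split; last exact: (derive_Cn openT (fun x _ => is_derive_sin x)).
apply: (derive_Cn openT (fun x _ => is_derive_cos x)).
apply: (Cn_eq openT _ (CnZ openT (Cn_cst n setT (-1 : R)) IHs)) => x _.
exact: mulN1r.
Qed.
Lemma cis_smooth : smooth (@cis R).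
Proof.
move=> n U f fP; split; apply: plot_compR => // N; by have [] := cos_sin_Cn N.
Qed.
Lemma cis0 : cis 0 = 1%g :> U1 R.
Proof. by apply: U1P; rewrite /= cos0 sin0. Qed.

Lemma U1_eq (z w : U1 R) : complex.Re z = complex.Re w -> complex.Im z = complex.Im w -> z = w.
Proof. by case: z w => [[a b] za] [[c d] wc] /= E1 E2; apply: U1P; rewrite /= E1 E2. Qed.

Lemma short_time (e : R) : 0 < e -> exists tau : R -> R,
  [/\ smooth tau, forall t, `|tau t| < e & \forall t \near (0 : R), tau t = t].
Proof.
(* The constants give [step (b t) = 0] for [|t| >= e] and [step (b t) = 1] for [|t| <= e / 2]; the
   square avoids the absolute value, which is not smooth. *)
move=> e0; pose b t : R := 2 - 2 * (t / e) ^+ 2.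
have mulP (c : R) : smooth (fun t : R => c * t).
  by move=> n U f fP; apply: plotRM => //; exact: plot_cst (plot_open fP).
exists (fun t => t * step (b t)); split.
- move=> n U f fP; have oU := plot_open fP; apply: plotRM => //; apply: step_plot.
  apply: plotRD; first exact: plot_cst.
  apply: plotRN; apply: plotRM; first exact: plot_cst.
  have dP : plot U (fun u => f u / e) by apply: plotRM => //; exact: plot_cst.
  exact: (plotRM dP dP).
- move=> t; have /andP[s0 s1] := step_01 (b t).
  have [te|te] := ltrP `|t| e.
    by rewrite normrM (ger0_norm s0); apply: le_lt_trans te; rewrite ler_piMr.
  rewrite step_le0 ?mulr0 ?normr0// /b subr_le0 ler_peMr// -real_normK ?num_real//.
  by rewrite exprn_ege1// normrM normfV (gtr0_norm e0) ler_pdivlMr// mul1r.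
apply/near_normP; exists (e / 2); first by rewrite divr_gt0.
move=> t; rewrite subr0 => te; rewrite step_ge1 ?mulr1// /b.
have : (t / e) ^+ 2 <= 2^-1 ^+ 2.
  rewrite -[leLHS]real_normK ?num_real//; apply: lerXn2r; rewrite ?nnegrE ?invr_ge0//.
  by rewrite normrM normfV (gtr0_norm e0) ler_pdivrMr// mulrC ltW.
by rewrite !expr2; lra.
Qed.

(** A section is only local, so time is first slowed down by [short_time] to keep the curve in its
    domain. The lift covers the curve near 0, and derivatives at 0 see no more. *)
Lemma curve_lift (A B : diffGroupType R) (p : diffHom A B) (g : R -> B) : local_sections p ->
  curve_at_1 g -> exists c : R -> A, curve_at_1 c /\ \forall t \near (0 : R), p (c t) = g t.
Proof.
move=> ls [sg g0]; have [W [s [oW W1 sW ps]]] := ls 1%g.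
have N : \forall t \near (0 : R), W (g t) by apply: smooth_near0 => //; rewrite g0.
have [e e0 He] := (near_normP _ _).1 N.
have [tau [st te tn]] := short_time e0.
have Wg t : W (g (tau t)) by apply: He; rewrite subr0.
have tau0 : tau 0 = 0 by exact: nbhs_singleton tn.
exists (fun t => s (g (tau t)) * (s 1)^-1)%g; split.
  split; last by rewrite tau0 g0 mulgV.
  apply: smoothM; last exact: smooth_cst.
  by move=> n U f fP; apply: (sW n U (fun u => g (tau (f u)))) => //; apply: sg; exact: st.
by apply: filterS tn => t E; rewrite dhM dhV !ps// invg1 mulg1 E.
Qed.
End RealCurves.

Section LoopVelocity.
Context {R : realType} {G : lieType R} (C : id_chart G).
Notation d := (ldim G). Notation L := (pi *+ 2 : R).

Lemma obv_curve_smooth (c : R -> OmegaG_B G) x : smooth c -> smooth (fun t => obv (c t) x).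
Proof. by move=> sc n U f fP; apply: (OB_curve_ev (b := fun=> x)) => //; exact: plot_cst (plot_open fP). Qed.

Lemma lvelE (c : R -> OmegaG_B G) x : lvel C c x = vel C (fun t => obv (c t) x).
Proof. by []. Qed.

Lemma lvel_near (c c' : R -> OmegaG_B G) : (\forall t \near (0 : R), c t = c' t) -> lvel C c = lvel C c'.
Proof. by move=> cc; apply/funext => x; apply: vel_near; apply: filterS cc => t ->. Qed.

Lemma lvelM (c c' : R -> OmegaG_B G) x : curve_at_1 c -> curve_at_1 c' ->
  lvel C (fun t => c t * c' t)%g x = lvel C c x + lvel C c' x.
Proof.
move=> [sc c0] [sc' c'0]; rewrite !lvelE -velM//; try exact: obv_curve_smooth.
  by rewrite c0.
by rewrite c'0.
Qed.
Lemma lvelV (c : R -> OmegaG_B G) x : curve_at_1 c -> lvel C (fun t => (c t)^-1)%g x = - lvel C c x.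
Proof. by move=> [sc c0]; rewrite !lvelE -velV//; [exact: obv_curve_smooth|rewrite c0]. Qed.

Lemma lvel_Omega_g (c : R -> OmegaG_B G) : curve_at_1 c -> Omega_g (lvel C c).
Proof.
move=> [sc c0]; split=> [n U q Uq|x xe].
  have oU := plot_open Uq; split=> //.
  have oD := open_preim openT oU (init_Cinf (n := n) openT).
  apply: (@vel_family R G C n U (setT `&` init_part @^-1` U) (fun u t => obv (c t) (q u)) oU).
  - apply: (OB_curve_ev (b := fun z => q (init_part z)) sc (last_plot oD)).
    by apply: (plot_comp Uq) => //; [exact: init_Cinf|move=> z []].
  - by move=> u Uu; split=> //=; rewrite init_append.
  - by move=> u Uu; rewrite c0.
rewrite lvelE (_ : (fun t => _) = fun=> 1%g) ?vel_cst//.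
by apply/funext => t; rewrite obv_end.
Qed.

Lemma bconj_P (b : G) (f : OmegaG_B G) (x : segment L) : sval x = 0 \/ sval x = L ->
  (b * obv f x * b^-1)%g = 1%g.
Proof. by move=> xe; rewrite obv_end// mulg1 mulgV. Qed.
Lemma bconj_sm (b : G) (f : OmegaG_B G) : smooth (fun x : segment L => (b * obv f x * b^-1)%g).
Proof. by apply: smoothM; [apply: smoothM; [exact: smooth_cst|exact: obv_smooth]|exact: smooth_cst]. Qed.
Definition bconj (b : G) (f : OmegaG_B G) : OmegaG_B G := mkOB (g := CMap (bconj_sm b f)) (bconj_P b f).
Lemma bconjE b f x : obv (bconj b f) x = (b * obv f x * b^-1)%g. Proof. by []. Qed.

Lemma bconj_curve b (c : R -> OmegaG_B G) : curve_at_1 c -> curve_at_1 (fun t => bconj b (c t)).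
Proof.
move=> [sc c0]; split; last by apply: obv_ext => x; rewrite bconjE c0 mulg1 mulgV.
apply: OB_curve => m V a x aP xP; have oV := plot_open aP.
by apply: plotM; [apply: plotM; [exact: plot_cst|exact: OB_curve_ev]|exact: plot_cst].
Qed.
Lemma lvel_bconj b (c : R -> OmegaG_B G) x : curve_at_1 c ->
  lvel C (fun t => bconj b (c t)) x = Ad C b (lvel C c x).
Proof. by move=> [sc c0]; rewrite lvelE -vel_conj//; [exact: obv_curve_smooth|rewrite c0]. Qed.

Lemma curveM (A : diffGroupType R) (c c' : R -> A) : curve_at_1 c -> curve_at_1 c' ->
  curve_at_1 (fun t => c t * c' t)%g.
Proof. by move=> [sc c0] [sc' c0']; split; [exact: smoothM|rewrite c0 c0' mulg1]. Qed.
Lemma curveV (A : diffGroupType R) (c : R -> A) : curve_at_1 c -> curve_at_1 (fun t => (c t)^-1)%g.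
Proof. by move=> [sc c0]; split; [exact: smoothV|rewrite c0 invg1]. Qed.
Lemma curve_hom (A B : diffGroupType R) (p : diffHom A B) (c : R -> A) : curve_at_1 c ->
  curve_at_1 (fun t => p (c t)).
Proof. by move=> [sc c0]; split; [exact: smooth_comp sc (@dh_smooth _ _ _ p)|rewrite c0 dh1]. Qed.
Lemma curve_shift (A : diffGroupType R) (c : R -> A) t0 : smooth c -> curve_at_1 (fun t => (c t0)^-1 * c (t0 + t))%g.
Proof. by move=> sc; split; [exact: smooth_curve_shift|rewrite addr0 mulVg]. Qed.
End LoopVelocity.

Lemma is_derive_shift (R : realType) (f : R -> R) (t0 df : R) :
  is_derive (0 : R) 1 (fun t => f (t0 + t)) df -> is_derive t0 1 f df.
Proof.
move=> D; have Ds : is_derive t0 1 (fun t : R => t - t0) 1.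
  apply: (is_derive_eq (is_deriveB (is_derive_id t0 (1 : R)) (is_derive_cst t0 t0 (1 : R)))).
  by rewrite subr0.
have E0 : t0 - t0 = 0 by rewrite subrr.
have D' : is_derive (t0 - t0) 1 (fun t => f (t0 + t)) df by rewrite E0.
have := is_derive1_comp (f := fun t => f (t0 + t)) (g := fun t : R => t - t0) (x := t0) D' Ds.
rewrite mulr1 (_ : _ \o _ = f)//.
by apply/funext => t /=; rewrite addrC subrK.
Qed.

(** * Derivatives of U(1)-valued characters *)

Section U1Characters.
Context {R : realType} {H : diffGroupType R} (chi : diffHom H (U1 R)).

(** The tangent line of U(1) at 1 is the imaginary axis, so the imaginary part carries the whole
    derivative. *)
Definition dchi (g : R -> H) : R := derive1 (fun t => complex.Im (chi (g t))) 0.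

Lemma Im_smooth : smooth (fun z : U1 R => complex.Im z : R). Proof. by move=> n U p []. Qed.
Lemma Re_smooth : smooth (fun z : U1 R => complex.Re z : R). Proof. by move=> n U p []. Qed.
Lemma chi_Im (g : R -> H) : smooth g -> smooth (fun t => complex.Im (chi (g t)) : R).
Proof. by move=> sg; apply: smooth_comp Im_smooth; exact: smooth_comp sg (@dh_smooth _ _ _ chi). Qed.
Lemma chi_Re (g : R -> H) : smooth g -> smooth (fun t => complex.Re (chi (g t)) : R).
Proof. by move=> sg; apply: smooth_comp Re_smooth; exact: smooth_comp sg (@dh_smooth _ _ _ chi). Qed.

Lemma dchiM (g h : R -> H) : curve_at_1 g -> curve_at_1 h -> dchi (fun t => g t * h t)%g = dchi g + dchi h.
Proof.
move=> [sg g0] [sh h0]; apply: derive1_is.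
have Dm (a b : R -> R) (da db : R) : is_derive (0 : R) 1 a da -> is_derive (0 : R) 1 b db ->
    is_derive (0 : R) 1 (fun t => a t * b t) (a 0 * db + b 0 * da).
  by move=> Da Db; exact: is_deriveM Da Db.
have D1 := smooth_is_derive 0 (chi_Re sg); have D2 := smooth_is_derive 0 (chi_Im sg).
have D3 := smooth_is_derive 0 (chi_Re sh); have D4 := smooth_is_derive 0 (chi_Im sh).
have := is_deriveD (Dm _ _ _ _ D1 D4) (Dm _ _ _ _ D2 D3).
rewrite g0 h0 dh1 /= !mul0r !mul1r add0r addr0 => D.
rewrite [dchi g + _]addrC (_ : (fun t => _) = (fun t => complex.Re (chi (g t)) * complex.Im (chi (h t)) ) \+ (fun t => complex.Im (chi (g t)) * complex.Re (chi (h t)))).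
  exact: D.
by apply/funext => t; rewrite dhM U1_ImM.
Qed.
Lemma dchi_cst1 : dchi (fun=> 1%g) = 0.
Proof. by rewrite /dchi derive1_cst. Qed.
Lemma dchiV (g : R -> H) : curve_at_1 g -> dchi (fun t => (g t)^-1)%g = - dchi g.
Proof.
move=> cg; apply/eqP; rewrite -addr_eq0 addrC -dchiM//; last exact: curveV.
by rewrite (_ : (fun _ => _) = fun=> 1%g) ?dchi_cst1//; apply/funext => t; rewrite mulgV.
Qed.

(** Left translation moves the derivative at any time to the identity. There the hypothesis handles
    the imaginary part, and differentiating [Re^2 + Im^2 = 1] handles the real part. *)
Lemma char_const (c : R -> H) : smooth c -> (forall g, curve_at_1 g -> dchi g = 0) ->
  chi (c 1) = chi (c 0).
Proof.
move=> sc d0.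
have key (t0 : R) : is_derive t0 1 (fun t => complex.Re (chi (c t)) : R) 0 /\
    is_derive t0 1 (fun t => complex.Im (chi (c t)) : R) 0.
  pose g t := ((c t0)^-1 * c (t0 + t))%g.
  have cg : curve_at_1 g by exact: curve_shift.
  have [sg g0] := cg.
  have DI := smooth_is_derive 0 (chi_Im sg); rewrite -/(dchi g) d0// in DI.
  have DR := smooth_is_derive 0 (chi_Re sg); set r := derive1 _ _ in DR.
  have r0 : r = 0.
    have D2 := is_deriveD (is_derive_pow 2 DR) (is_derive_pow 2 DI).
    have := derive_near_unique D2 (is_derive_cst (1 : R) (0 : R) (1 : R)).
    rewrite g0 dh1 /= expr1n !mulr1 mulr0 addr0 => E.
    have {}E : 2 * r = 0 by apply: E; near=> t; rewrite /cst; exact: U1_sum.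
    by move: E; lra.
  rewrite r0 in DR.
  have E t : chi (c (t0 + t)) = (chi (c t0) * chi (g t))%g by rewrite -dhM mulVKg.
  have Dz (a : R) (f : R -> R) : is_derive (0 : R) 1 f 0 -> is_derive (0 : R) 1 (fun t => a * f t) 0.
    move=> Df; apply: (is_derive_eq (is_deriveM (is_derive_cst a (0 : R) (1 : R)) Df)).
    by rewrite !scaler0 addr0.
  split; apply: is_derive_shift.
    have := is_deriveB (Dz (complex.Re (chi (c t0))) _ DR) (Dz (complex.Im (chi (c t0))) _ DI).
    rewrite subr0 => D.
    rewrite (_ : (fun t => _) = (fun t => complex.Re (chi (c t0)) * complex.Re (chi (g t))) \- (fun t => complex.Im (chi (c t0)) * complex.Im (chi (g t)))).
      exact: D.
    by apply/funext => t; rewrite E U1_ReM.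
  have := is_deriveD (Dz (complex.Re (chi (c t0))) _ DI) (Dz (complex.Im (chi (c t0))) _ DR).
  rewrite addr0 => D.
  rewrite (_ : (fun t => _) = (fun t => complex.Re (chi (c t0)) * complex.Im (chi (g t))) \+ (fun t => complex.Im (chi (c t0)) * complex.Re (chi (g t)))).
    exact: D.
  by apply/funext => t; rewrite E U1_ImM.
by apply: U1_eq; [apply: (is_derive_0_is_cst (f := fun t => complex.Re (chi (c t)) : R))|apply: (is_derive_0_is_cst (f := fun t => complex.Im (chi (c t)) : R))] => t; have [] := key t.
Unshelve. all: by end_near. Qed.
End U1Characters.

(** * Characters of loop groups *)

Section Tangents.
Context {R : realType} {G : lieType R} (C : id_chart G) (k : int) (b : 'M[R]_(ldim G)).
Context (EB : centralExt (OmegaG_B G)) (cen : (R -> EB) -> R).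
Hypothesis la : lie_algebra_ext C b k cen.
Notation d := (ldim G). Notation L := (pi *+ 2 : R).

Lemma center_curve (r : R) : curve_at_1 (fun t => ce_inc EB (cis (r * t))).
Proof.
split; last by rewrite mulr0 cis0 dh1.
apply: smooth_comp (@dh_smooth _ _ _ (ce_inc EB)) => n U f fP.
by apply: cis_smooth; apply: plotRM => //; exact: plot_cst (plot_open fP).
Qed.

(* The central component of a lift is adjusted so that two loops of equal
   velocity have tangent lifts. *)
Lemma lvel_tangent (g h : R -> OmegaG_B G) : curve_at_1 g -> curve_at_1 h ->
  lvel C g = lvel C h -> tangent_at_1 g h.
Proof.
move=> cg ch gh; have ls := ce_local_sections EB.
have [c [cc cE]] := curve_lift ls cg; have [c' [cc' cE']] := curve_lift ls ch.
pose z t := ce_inc EB (cis ((cen c' - cen c) * t)).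
have cz : curve_at_1 z := center_curve (cen c' - cen c).
have zcen : cen z = cen c' - cen c.
  have c1 : curve_at_1 (fun t => ce_inc EB (cis t)).
    by have := center_curve 1; under eq_fun do rewrite mul1r.
  by have := la_scale la (cen c' - cen c) c1; rewrite (la_center la) mulr1.
have cE1 : \forall t \near (0 : R), ce_proj EB (c t * z t)%g = g t.
  by apply: filterS cE => t; rewrite dhM ce_proj_inc mulg1.
have T : tangent_at_1 (fun t => c t * z t)%g c'.
  apply: (la_tangent la (curveM cc cz) cc').1; split; last first.
    by rewrite (la_add la cc cz) zcen addrC subrK.
  transitivity (lvel C g); first exact: lvel_near.
  by rewrite gh; symmetry; exact: lvel_near.
move=> U u oU U1 su.
have oV : Dopen (ce_proj EB @^-1` U) by apply: Dopen_preim => //; exact: dh_smooth.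
have sV : smooth_on (ce_proj EB @^-1` U) (fun x => u (ce_proj EB x)).
  by move=> n V q qP qU; exact: (su _ _ _ (@dh_smooth _ _ _ (ce_proj EB) _ _ _ qP)).
have V1 : (ce_proj EB @^-1` U) 1%g by rewrite /= dh1.
have := T _ _ oV V1 sV => E.
transitivity (derive1 ((fun x => u (ce_proj EB x)) \o (fun t => c t * z t)%g : R -> R) 0).
  by symmetry; apply: derive1_near; apply: filterS cE1 => t /= ->.
by rewrite E; apply: derive1_near; apply: filterS cE' => t /= ->.
Qed.

Section Character.
Variables (chi : diffHom (OmegaG_B G) (U1 R)) (W0 : set G).
Hypotheses (oW0 : Dopen W0) (W01 : W0 1%g) (chib : forall b f, W0 b -> chi (bconj b f) = chi f).

Lemma dchi_lvel (g h : R -> OmegaG_B G) : curve_at_1 g -> curve_at_1 h ->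
  lvel C g = lvel C h -> dchi chi g = dchi chi h.
Proof.
move=> cg ch gh; apply: (lvel_tangent cg ch gh (U := setT) (u := fun x => complex.Im (chi x))) => //.
  by move=> n U q qP; rewrite preimage_setT setIT; exact: plot_open qP.
by move=> n U q qP _; have [] := @dh_smooth _ _ _ chi _ _ _ qP.
Qed.

(** Each term is the velocity of [bconj (B i) h * h^-1], where [h] has velocity [X i]; invariance of
    [chi] under [bconj] makes its two contributions cancel. *)
Lemma dchi_conj_sum m (B : 'I_m -> G) (X : 'I_m -> segment L -> 'rV[R]_d) (s : seq 'I_m) :
  (forall i, W0 (B i)) -> (forall i, Omega_g (X i)) ->
  exists g, [/\ curve_at_1 g, forall x, lvel C g x = \sum_(i <- s) (Ad C (B i) (X i x) - X i x) & dchi chi g = 0].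
Proof.
move=> WB OX; elim: s => [|i s [g [cg gE g0]]].
  exists (fun=> 1%g); split; last exact: dchi_cst1.
    by split=> //; exact: smooth_cst.
  by move=> x; rewrite big_nil lvelE vel_cst.
have [c [cc cX _]] := la_surj la 0 (OX i).
have ch := curve_hom (ce_proj EB) cc; set h := (fun t => ce_proj EB (c t)) in ch.
have cb := bconj_curve (B i) ch; have cV := curveV ch.
exists (fun t => (bconj (B i) (h t) * (h t)^-1) * g t)%g; split.
- by apply: curveM => //; exact: curveM.
- move=> x; rewrite lvelM//; last exact: curveM.
  by rewrite lvelM// lvel_bconj// lvelV// big_cons -gE -(congr1 (@^~ x) cX).
rewrite dchiM//; last exact: curveM.
rewrite dchiM// dchiV// g0 addr0 (_ : dchi chi (fun t => bconj (B i) (h t)) = dchi chi h) ?subrr//.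
by rewrite /dchi; congr (derive1 _ 0); apply/funext => t; rewrite chib.
Qed.

(* As g is simple, every velocity is a sum of terms Ad (B i) (X i) - X i, and the
   derivative of chi vanishes on such sums by invariance. *)
Lemma invariant_character_trivial : simply_connected R (Dtop G) -> simple_lie C -> forall f, chi f = 1%g.
Proof.
move=> sc si; have [m [M [B [v [WB MB full]]]]] := simple_spanning oW0 W01 si.
apply: (loops_generated C sc) => [x y x1 y1|c sm c0]; first by rewrite dhM x1 y1 mulg1.
rewrite (char_const sm) ?c0 ?dh1// => g cg.
have [gS gE] := lvel_Omega_g C cg.
(* The coefficients in terms of the rows of [M] depend linearly on the velocity, so the loops [X i]
   inherit its smoothness and its zeros at the end points. *)
pose Y x := lvel C g x *m pinvmx M.
pose X i x := Y x ord0 i *: v i.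
have OX i : Omega_g (X i).
  split=> [n U q Uq|x xe]; last by rewrite /X /Y gE// mul0mx mxE scale0r.
  have [oU LC] := gS _ _ _ Uq; split=> // N; apply: CnZ => //; last exact: Cn_cst.
  have C1 : Cn N U (fun u => \sum_j lvel C g (q u) ord0 j * pinvmx M j i).
    apply: Cn_sum => // j; apply: CnZ => //; last exact: Cn_cst.
    exact: (Cn_post (L := coordlin ord0 j) oU (@coord_continuous _ _ _ ord0 j) (LC N)).
  by apply: (Cn_eq oU _ C1) => u _; rewrite /Y mxE.
have [g' [cg' gE' g0]] := dchi_conj_sum (index_enum _) WB OX.
rewrite (dchi_lvel cg cg')//; apply/funext => x; rewrite gE'.
have -> : lvel C g x = Y x *m M by rewrite mulmxKpV// submx_full.
rewrite mulmx_sum_row; apply: eq_bigr => i _.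
by rewrite MB /X AdZ scalerBr.
Qed.
End Character.
End Tangents.

(** * Half loops as stretched and shrunk based loops *)

Section HalfLoops.
Context {R : realType} {G : lieType R}.
Let p0 : 0 < (pi : R) := pi_gt0 R.
Notation L := (pi *+ 2 : R).
Let L0 : 0 < L. Proof. by rewrite mulrn_wgt0. Qed.
Notation half := (sub_of (half_sg G)).

Section CompactArc.
Variables (g : gpath G pi) (e : R).
Hypotheses (e0 : 0 < e)
  (g1 : forall x : segment (pi : R), sval x <= e \/ pi - e <= sval x -> g x = 1%g).
Lemma compact_Psi : Psi_sg G g.
Proof.
split=> [x x0|]; first by apply: g1; left; rewrite x0 ltW.
by exists e; split=> // x y xe ye; rewrite !g1; auto.
Qed.
Lemma compact_end : arc_sg (incl0 (SubOf compact_Psi)).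
Proof. by move=> x xp; apply: g1; right; rewrite xp gerBl ltW. Qed.
Definition compact_arc : half := arc (SubOf compact_end).
End CompactArc.

Definition hev (f : half) (s : R) : G := ev (oloop (sgval f)) s.
Lemma hevM f h s : hev (f * h)%g s = (hev f s * hev h s)%g. Proof. by []. Qed.
Lemma hevV f s : hev (f^-1)%g s = ((hev f s)^-1)%g. Proof. by []. Qed.
Lemma hev_ext f h : (forall x : segment (pi : R), hev f (sval x) = hev h (sval x)) -> f = h.
Proof. exact: half_eq. Qed.
Lemma hev_arc g (x : segment (pi : R)) : hev (arc g) (sval x) = pe_path (sgval g) x.
Proof. exact: (arc_cup g).1. Qed.
Lemma hev_compact g e (e0 : 0 < e) g1 x : hev (@compact_arc g e e0 g1) (sval x) = g x.
Proof. exact: hev_arc. Qed.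
Lemma hevpi f : hev f pi = 1%g.
Proof. by apply: (sgvalP f); apply: not_arc; rewrite lexx/= mulr2n lerDl ltW. Qed.

Definition ramp (c s : R) : R := step (2 * s / c - 1).
Lemma ramp_plot c n (U : set 'rV[R]_n) (f : 'rV[R]_n -> R) : plot U f -> plot U (fun u => ramp c (f u)).
Proof.
move=> fP; have oU := plot_open fP; apply: step_plot; apply: plotRD; last exact: plot_cst.
by apply: plotRM; [apply: plotRM => //|]; exact: plot_cst.
Qed.
Lemma ramp0 c s : 0 < c -> s <= c / 2 -> ramp c s = 0.
Proof. by move=> c0 sc; rewrite /ramp step_le0// subr_le0 ler_pdivrMr// mul1r mulrC -ler_pdivlMr. Qed.
Lemma ramp1 c s : 0 < c -> c <= s -> ramp c s = 1.
Proof.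
move=> c0 sc; rewrite /ramp step_ge1// lerBrDr ler_pdivlMr//; lra.
Qed.
Lemma ramp01 c s : 0 <= ramp c s <= 1. Proof. exact: step_01. Qed.

Section Stretch.
Variable c : R.
Hypotheses (c0 : 0 < c) (cp : c <= pi / 2).
(** Equal to [2 s] on [[c, pi - c]], where it undoes [halved], and constant near both ends; a based
    loop composed with it is a half loop, flatness being automatic. *)
Definition stretch (s : R) : R :=
  (1 - ramp c (pi - s)) * L + ramp c (pi - s) * (ramp c s * (s *+ 2)).
Lemma stretch_itv (x : segment (pi : R)) : 0 <= stretch (sval x) <= L.
Proof.
have /andP[x0 x1] : 0 <= sval x <= pi := svalP x.
apply: convex_itv; [exact: ramp01|by rewrite lexx ltW|].
have /andP[r0 r1] := ramp01 c (sval x); apply/andP; split.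
  by rewrite mulr_ge0// mulrn_wge0.
apply: (@le_trans _ _ (sval x *+ 2)); last by rewrite lerMn2r x1 orbT.
by rewrite ler_piMl// mulrn_wge0.
Qed.
Definition stretch_seg x : segment L := Lseg (stretch_itv x).
Lemma stretch_smooth : smooth stretch_seg.
Proof.
move=> n U q Uq; have qP : plot U (fun u => sval (q u) : R) by exact: Uq.
have oU := plot_open Uq.
have rP : plot U (fun u => ramp c (pi - sval (q u))).
  by apply: ramp_plot; apply: plotRD; [exact: plot_cst|exact: plotRN].
apply: plotRD; apply: plotRM => //.
- by apply: plotRD; [exact: plot_cst|exact: plotRN].
- exact: plot_cst.
- by apply: plotRM; [exact: ramp_plot|exact: plotRD].
Qed.
Lemma stretch_l (x : segment (pi : R)) : sval x <= c / 2 -> sval (stretch_seg x) = 0.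
Proof.
move=> xc; rewrite /= /stretch (ramp0 c0 xc) mul0r mulr0 addr0 ramp1 ?subrr ?mul0r//.
by move: c0 cp; lra.
Qed.
Lemma stretch_r (x : segment (pi : R)) : pi - c / 2 <= sval x -> sval (stretch_seg x) = L.
Proof.
by move=> xc; rewrite /= /stretch ramp0 ?subr0 ?mul1r ?mul0r ?addr0//; move: xc; lra.
Qed.
Lemma stretch_m (x : segment (pi : R)) : c <= sval x <= pi - c -> sval (stretch_seg x) = sval x *+ 2.
Proof.
by move=> /andP[x1 x2]; rewrite /= /stretch !ramp1 ?subrr ?mul0r ?add0r ?mul1r//; move: x2; lra.
Qed.
Lemma stretch_lower (x : segment (pi : R)) : sval x <= c -> sval (stretch_seg x) <= sval x *+ 2.
Proof.
move=> xc; have /andP[x0 x1] : 0 <= sval x <= pi := svalP x.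
rewrite /= /stretch (@ramp1 c (pi - sval x))//; last by move: xc cp; lra.
rewrite subrr mul0r add0r mul1r; have /andP[r0 r1] := ramp01 c (sval x).
by rewrite ler_piMl// mulrn_wge0.
Qed.
Lemma stretch_upper (x : segment (pi : R)) : pi - c <= sval x -> sval x *+ 2 <= sval (stretch_seg x).
Proof.
move=> xc; have /andP[x0 x1] : 0 <= sval x <= pi := svalP x.
rewrite /= /stretch (@ramp1 c (sval x))//; last by move: xc cp; lra.
rewrite mul1r; have /andP[r0 r1] := ramp01 c (pi - sval x).
rewrite -subr_ge0 (_ : _ - _ = (1 - ramp c (pi - sval x)) * (L - sval x *+ 2)); last by ring.
by rewrite mulr_ge0 ?subr_ge0// lerMn2r x1 orbT.
Qed.

Lemma stretched_sm (f : OmegaG_B G) : smooth (fun x : segment (pi : R) => obv f (stretch_seg x)).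
Proof. exact: smooth_comp stretch_smooth (obv_smooth f). Qed.
Lemma stretched_1 (f : OmegaG_B G) (x : segment (pi : R)) :
  sval x <= c / 2 \/ pi - c / 2 <= sval x -> obv f (stretch_seg x) = 1%g.
Proof. by case=> xc; apply: obv_end; [left; exact: stretch_l|right; exact: stretch_r]. Qed.
Lemma half_width_gt0 : 0 < c / 2. Proof. by rewrite divr_gt0. Qed.
Definition stretched_fun (f : OmegaG_B G) : half :=
  compact_arc (g := CMap (stretched_sm f)) half_width_gt0 (stretched_1 f).
Lemma hev_stretched f x : hev (stretched_fun f) (sval x) = obv f (stretch_seg x).
Proof. exact: hev_compact. Qed.
Lemma stretched_smooth : smooth stretched_fun.
Proof.
move=> n U q Uq; apply: arc_smooth; apply: plot_sub_of; apply: plot_sub_of; split.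
  exact: plot_open Uq.
move=> m V a b oV aC aU Vb; apply: (OB_plot_ev (b := fun v => stretch_seg (b v)) Uq) => //.
exact: stretch_smooth.
Qed.
Lemma stretchedM f h : stretched_fun (f * h)%g = (stretched_fun f * stretched_fun h)%g.
Proof. by apply: hev_ext => x; rewrite hevM !hev_stretched. Qed.
Definition stretched : diffHom (OmegaG_B G) half := DiffHom stretched_smooth stretchedM.

Lemma stretched_rmap (f : half) :
  (forall x : segment (pi : R), sval x <= c \/ pi - c <= sval x -> hev f (sval x) = 1%g) ->
  stretched (rmap G f) = f.
Proof.
move=> f1; apply: hev_ext => x; rewrite hev_stretched.
have -> : obv (rmap G f) (stretch_seg x) = hev f (sval (halved (stretch_seg x))) by [].
have hE : sval (halved (stretch_seg x)) = sval (stretch_seg x) / 2 by [].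
have [xc|xc] := lerP (sval x) c.
  rewrite !f1//; first by left.
  by left; rewrite hE ler_pdivrMr//; have := stretch_lower xc; rewrite -mulr_natr; move: xc; lra.
have [xc'|xc'] := lerP (pi - c) (sval x).
  rewrite !f1//; first by right.
  by right; rewrite hE ler_pdivlMr//; have := stretch_upper xc'; rewrite -mulr_natr; move: xc'; lra.
by congr (hev f _); rewrite hE stretch_m ?(ltW xc) ?(ltW xc')//; lra.
Qed.

Variables (C : id_chart G) (r : R) (b : G).
Hypotheses (rU : forall x, `|x| < r -> (ic_phi C @` ic_dom C) x) (br : small_set C r b).
(** A path equal to [b] on [[c / 2, pi - c / 2]], where the stretched loops have their support, and
    equal to 1 near both ends: the half loop that replaces the constant [b]. *)
Definition bump_val (x : segment (pi : R)) : G :=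
  ic_psi C ((ramp (c / 2) (sval x) * ramp (c / 2) (pi - sval x)) *: ic_phi C b).
Lemma bump_sm : smooth bump_val.
Proof.
move=> n U q Uq; have qP : plot U (fun u => sval (q u) : R) by exact: Uq.
have oU := plot_open Uq; apply: (psi_scaled_plot rU (b := fun=> b)).
- apply: plotRM; first exact: ramp_plot.
  by apply: ramp_plot; apply: plotRD; [exact: plot_cst|exact: plotRN].
- move=> v _; have /andP[h1 h2] := ramp01 (c / 2) (sval (q v)).
  by have /andP[h3 h4] := ramp01 (c / 2) (pi - sval (q v)); rewrite mulr_ge0//= mulr_ile1.
- exact: plot_cst.
- by [].
Qed.
Lemma bump_1 (x : segment (pi : R)) : sval x <= c / 2 / 2 \/ pi - c / 2 / 2 <= sval x -> bump_val x = 1%g.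
Proof.
case=> xc; rewrite /bump_val.
  by rewrite (ramp0 half_width_gt0 xc) mul0r scale0r ic_psi0.
by rewrite [X in _ * X]ramp0 ?half_width_gt0 ?mulr0 ?scale0r ?ic_psi0//; move: xc; lra.
Qed.
Lemma quarter_width_gt0 : 0 < c / 2 / 2. Proof. by rewrite !divr_gt0. Qed.
Definition bump : half := compact_arc (g := CMap bump_sm) quarter_width_gt0 bump_1.
Lemma stretched_bconj f : stretched (bconj b f) = (bump * stretched f * bump^-1)%g.
Proof.
apply: hev_ext => x; rewrite !hevM hevV !hev_stretched hev_compact /= bconjE.
have [xc|xc] := lerP (sval x) (c / 2).
  by rewrite stretched_1 ?mulg1 ?mulgV//; left.
have [xc'|xc'] := lerP (pi - c / 2) (sval x).
  by rewrite stretched_1 ?mulg1 ?mulgV//; right.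
have -> : bump_val x = b; last by [].
rewrite /bump_val !ramp1 ?half_width_gt0 ?mulr1 ?scale1r ?ic_phiK//; last by rewrite ltW.
  by case: br.
by move: xc'; lra.
Qed.
End Stretch.

Section Shrink.
Variable f : half.
Definition id_hom : diffHom (OmegaG G) (OmegaG G) := DiffHom (@smooth_id _ _) (fun x y => erefl).
Definition half_path : PeG G := X_t (p := id_hom) (SubOf (sgvalP f : preim_sg id_hom (half_sg G) (sgval f))).
Lemma half_hat s : 0 <= s <= pi -> hat half_path s = hev f s.
Proof. by move=> sp; rewrite -[in RHS](sval_clamp sp). Qed.
Lemma half_hat1 s : s <= 0 \/ pi <= s -> hat half_path s = 1%g.
Proof.
case=> sp; first exact: hat_le0.
by rewrite hat_gepi// half_hat ?lexx ?ltW// hevpi.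
Qed.

(** The expansion about [pi / 2] by [1 + e ^+ 2]. The square keeps the factor at least 1 for all
    real [e], so the family is smooth through [e = 0], where it is the identity, and moves both ends
    out of [[0, pi]] otherwise. *)
Definition lin (e s : R) : R := pi / 2 + (1 + e ^+ 2) * (s - pi / 2).
Lemma lin_plot n (U : set 'rV[R]_n) (a s : 'rV[R]_n -> R) : plot U a -> plot U s -> plot U (fun u => lin (a u) (s u)).
Proof.
move=> aP sP; have oU := plot_open aP; apply: plotRD; first exact: plot_cst.
by apply: plotRM; apply: plotRD => //; try exact: plot_cst; exact: plotRM.
Qed.
Lemma lin_id s : lin 0 s = s.
Proof. by rewrite /lin expr0n /= addr0 mul1r addrC subrK. Qed.
Lemma lin_pi e : pi <= lin e pi.
Proof. by have := sqr_ge0 e; rewrite /lin; move: p0; nra. Qed.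

Definition shrink_ext e (s : R) : G := hat half_path (lin e s).
Lemma shrink_ext_smooth e : smooth (shrink_ext e).
Proof.
move=> n U q Uq; apply: (cmap_smooth (hat half_path) (p := fun u => lin e (q u))).
by apply: lin_plot => //; exact: plot_cst (plot_open Uq).
Qed.
Lemma shrink_gsm e : smooth (fun x : segment (pi : R) => shrink_ext e (sval x)).
Proof. by move=> n U q Uq; exact: (shrink_ext_smooth e (p := fun u => sval (q u))). Qed.
Lemma shrink_Pe e : Pe_sg G (CMap (shrink_gsm e) : gpath G pi).
Proof.
have cont : continuous (lin e).
  have lC : smooth (lin e : R -> R) by move=> n U q Uq; apply: lin_plot => //; exact: plot_cst (plot_open Uq).
  by move=> s; have H := smooth_Cinf lC 0%N; exact: (H s I).
have [e0|e0] := eqVneq e 0.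
  have fE : shrink_ext e = hat half_path by apply/funext => s; rewrite /shrink_ext e0 lin_id.
  split=> [x x0||].
  - by rewrite /= x0 fE hat_le0.
  - by exists (shrink_ext e); split=> //; [exact: shrink_ext_smooth|rewrite fE; exact: hat_flat0].
  - by exists (shrink_ext e); split=> //; [exact: shrink_ext_smooth|rewrite fE; exact: hat_flatpi].
have e2 : 0 < e ^+ 2 by rewrite exprn_even_gt0.
have l0 : lin e 0 < 0 by rewrite /lin; move: p0; nra.
have lp : pi < lin e pi by rewrite /lin; move: p0; nra.
split=> [x x0||].
- by rewrite /= x0 /shrink_ext half_hat1//; left; exact: ltW.
- exists (shrink_ext e); split=> //; first exact: shrink_ext_smooth.
  apply: (flat_locally_constant (W := lin e @^-1` [set y | y < 0])) => //.
    by apply: ((continuousP (lin e)).1 cont); exact: open_lt.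
  by move=> s /= s0; rewrite /shrink_ext !half_hat1//; left; exact: ltW.
- exists (shrink_ext e); split=> //; first exact: shrink_ext_smooth.
  apply: (flat_locally_constant (W := lin e @^-1` [set y | pi < y])) => //.
    by apply: ((continuousP (lin e)).1 cont); exact: open_gt.
  by move=> s /= s0; rewrite /shrink_ext !half_hat1//; right; exact: ltW.
Qed.
Definition shrink_path e : PeG G := SubOf (shrink_Pe e).
Lemma shrink_end e : arc_sg (shrink_path e).
Proof. by move=> x xp; rewrite /= xp /shrink_ext half_hat1//; right; exact: lin_pi. Qed.
Definition shrink e : half := arc (SubOf (shrink_end e)).
Lemma hev_shrink e (x : segment (pi : R)) : hev (shrink e) (sval x) = hat half_path (lin e (sval x)).
Proof. exact: hev_arc. Qed.
Lemma shrink0 : shrink 0 = f.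
Proof. by apply: hev_ext => x; rewrite hev_shrink lin_id half_hat//; exact: (svalP x). Qed.
Lemma shrink_smooth : smooth shrink.
Proof.
move=> n U q Uq; apply: arc_smooth; apply: plot_sub_of; apply: plot_sub_of; split.
  exact: plot_open Uq.
move=> m V a b oV aC aU Vb; have bP : plot V (fun v => sval (b v) : R) by exact: Vb.
apply: (cmap_smooth (hat half_path) (p := fun v => lin (q (a v)) (sval (b v)))).
by apply: lin_plot => //; exact: (plot_comp Uq).
Qed.
Lemma shrink_compact e : e != 0 -> exists c, [/\ 0 < c, c <= pi / 2 &
  forall x : segment (pi : R), sval x <= c \/ pi - c <= sval x -> hev (shrink e) (sval x) = 1%g].
Proof.
move=> e0; have e2 : 0 < e ^+ 2 by rewrite exprn_even_gt0.
have d0 : 0 < 1 + e ^+ 2 by lra.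
(* The solution of [lin e c = 0]; by symmetry [lin e (pi - c) = pi]. *)
pose c := pi / 2 * (e ^+ 2 / (1 + e ^+ 2)).
have cE : (1 + e ^+ 2) * c = pi / 2 * e ^+ 2.
  by rewrite /c mulrCA; congr (_ * _); rewrite mulrCA mulfV ?mulr1// gt_eqF.
exists c; split.
- by rewrite /c mulr_gt0 ?divr_gt0.
- by rewrite /c ler_piMr ?divr_ge0 ?(ltW p0)// ler_pdivrMr// mul1r lerDr.
move=> x xc; rewrite hev_shrink half_hat1// /lin; case: xc => xc; [left|right].
  by move: p0; nra.
by move: p0; nra.
Qed.
End Shrink.
End HalfLoops.

Section Perfect.
Context {R : realType} {G : lieType R} (C : id_chart G) (k : int) (b : 'M[R]_(ldim G)).
Context (EB : centralExt (OmegaG_B G)) (cen : (R -> EB) -> R).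

(* Loops supported away from the ends are stretched images of based loops, where
   conjugation by a constant becomes conjugation by a half loop; the other half
   loops are limits of these. *)
Lemma half_character_trivial (chi : diffHom (sub_of (half_sg G)) (U1 R)) :
  lie_algebra_ext C b k cen -> simply_connected R (Dtop G) -> simple_lie C ->
  forall f, chi f = 1%g.
Proof.
move=> la sc si f; have [r r0 rU] := ic_radius C.
have st c (c0 : 0 < c) (cp : c <= pi / 2) x : chi (stretched c0 cp x) = 1%g.
  have cs : smooth (fun x => chi (stretched c0 cp x)).
    exact: smooth_comp (@dh_smooth _ _ _ (stretched c0 cp)) (@dh_smooth _ _ _ chi).
  have cM x1 y1 : chi (stretched c0 cp (x1 * y1)%g) = (chi (stretched c0 cp x1) * chi (stretched c0 cp y1))%g.
    by rewrite dhM dhM.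
  apply: (invariant_character_trivial la (chi := DiffHom cs cM) (W0 := small_set C r)) => //.
  - exact: small_Dopen.
  - exact: small_1.
  - move=> g h gr; rewrite -[LHS]/(chi (stretched c0 cp (bconj g h))) -[RHS]/(chi (stretched c0 cp h)).
    rewrite (stretched_bconj c0 cp rU gr) dhM dhM dhV.
    by apply: U1P; rewrite /= mulrAC mulfV ?mul1r// U1_neq0.
have E e : e != 0 -> chi (shrink f e) = 1%g.
  by move=> /(shrink_compact f)[c [c0 cp /(stretched_rmap c0 cp) <-]]; exact: st.
(* The passage to the limit [e = 0], where [shrink f] is [f]. The real part is enough, as 1 is the
   only element of U(1) with real part 1. *)
have sR : smooth (fun e => complex.Re (chi (shrink f e)) - 1 : R).
  move=> n U q qP; apply: plotRD; last exact: plot_cst (plot_open qP).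
  exact: (chi_Re chi (shrink_smooth f) (p := q)).
have cR : {for 0, continuous (fun e => complex.Re (chi (shrink f e)) - 1 : R)} := smooth_Cinf sR 0%N 0 I.
have R1 : complex.Re (chi f) = 1.
  apply/eqP; rewrite -subr_eq0; apply: contrapT => /negP N.
  have : \forall s \near (0 : R), complex.Re (chi (shrink f s)) - 1 != 0.
    by apply: (cvgr_neq0 _ cR); rewrite shrink0.
  move=> /near_normP[e e0 /(_ (e / 2))]; rewrite subr0 ger0_norm ?divr_ge0 ?(ltW e0)//.
  rewrite E ?subrr ?eqxx; last by rewrite gt_eqF// divr_gt0.
  by move=> H; suff : false by []; apply: H; move: e0; lra.
apply: U1_eq => //; have := U1_sum (chi f); rewrite R1 expr1n => /eqP.
by rewrite addrC -subr_eq0 addrK sqrf_eq0 => /eqP.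
Qed.
End Perfect.

(** * The crossed module of Baez, Crans, Stevenson and Schreiber *)

Section CentralTangents.
Context {R : realType} {G : lieType R} (C : id_chart G) (k : int) (b : 'M[R]_(ldim G)).
Context (EB : centralExt (OmegaG_B G)) (cen : (R -> EB) -> R).
Hypothesis la : lie_algebra_ext C b k cen.

Lemma curve_cst1 (A : diffGroupType R) : curve_at_1 (fun _ : R => 1%g : A).
Proof. by split=> //; exact: smooth_cst. Qed.
Lemma cen_cst1 : cen (fun=> 1%g) = 0.
Proof.
have := la_add la (curve_cst1 EB) (curve_cst1 EB); under eq_fun do rewrite mulg1.
by lra.
Qed.
Lemma cenV (c : R -> EB) : curve_at_1 c -> cen (fun t => (c t)^-1)%g = - cen c.
Proof.
move=> cc; apply/eqP; rewrite -addr_eq0 addrC -(la_add la cc (curveV cc)).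
by under eq_fun do rewrite mulgV; rewrite cen_cst1.
Qed.

(* A local section through 1 gives a smooth U(1)-valued coordinate near 1. *)
Lemma cen0_derive (z : R -> U1 R) : curve_at_1 z -> cen (fun t => ce_inc EB (z t)) = 0 ->
  derive1 (fun t => complex.Im (z t)) 0 = 0.
Proof.
move=> cz z0; have ci := curve_hom (ce_inc EB) cz.
have T : tangent_at_1 (fun t => ce_inc EB (z t)) (fun=> 1%g).
  apply: (la_tangent la ci (curve_cst1 EB)).1; split; last by rewrite z0 cen_cst1.
  by congr (lvel C); apply/funext => t; rewrite /= ce_proj_inc dh1.
have [W [s [oW W1 sW ps]]] := ce_local_sections EB 1%g.
(* The section is normalized to be 1 at 1, so that the U(1)-coordinate [w] relative to it is the
   identity on the image of U(1). *)
pose s' y := (s y * (s 1)^-1)%g.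
have ps' y : W y -> ce_proj EB (s' y) = y by move=> Wy; rewrite dhM dhV !ps// invg1 mulg1.
have ex y : exists w, W (ce_proj EB y) -> (y * (s' (ce_proj EB y))^-1)%g = ce_inc EB w.
  have [Wy|nW] := pselect (W (ce_proj EB y)); last by exists 1%g.
  have /ce_exact[w wE] : ce_proj EB (y * (s' (ce_proj EB y))^-1)%g = 1%g.
    by rewrite dhM dhV ps'// mulgV.
  by exists w.
have [w wE] := choice ex.
have wi x : w (ce_inc EB x) = x.
  apply: (@ce_inj _ _ EB); rewrite -wE ce_proj_inc//.
  by rewrite /s' mulgV invg1 mulg1.
have oV : Dopen (ce_proj EB @^-1` W) by apply: Dopen_preim => //; exact: dh_smooth.
have sV : smooth_on (ce_proj EB @^-1` W) (fun y => complex.Im (w y) : R).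
  move=> n V q qP qW.
  have wP : plot V (fun v => w (q v)).
    apply: ce_inc_plot; apply: (plot_eq (p := fun v => (q v * (s' (ce_proj EB (q v)))^-1)%g)).
      by move=> v Vv; rewrite wE//; exact: qW.
    have sP : plot V (fun v => s' (ce_proj EB (q v))).
      apply: plotM; last exact: plot_cst (plot_open qP).
      by apply: (sW n V (fun v => ce_proj EB (q v))) => //; exact: dh_smooth.
    exact: (@plotM R EB n V _ _ qP (@plotV R EB n V _ sP)).
  by case: wP.
have V1 : (ce_proj EB @^-1` W) 1%g by rewrite /= dh1.
have := T _ _ oV V1 sV; rewrite [RHS]derive1_cst => E; rewrite -[RHS]E.
by congr (derive1 _ 0); apply/funext => t /=; rewrite wi.
Qed.
End CentralTangents.

Section BCSSPeiffer.
Context {R : realType} {G : lieType R} (C : id_chart G) (k : int) (b : 'M[R]_(ldim G)).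
Context (EB : centralExt (OmegaG_B G)) (cen : (R -> EB) -> R) (al : PeG_B G -> EB -> EB).
Hypotheses (la : lie_algebra_ext C b k cen) (ba : bcss_action C b k cen al)
  (sc : simply_connected R (Dtop G)).
Notation p := (ce_proj EB).
Notation tB x := (ob_path (p x)).

Lemma tBM x y : tB (x * y)%g = (tB x * tB y)%g.
Proof. by rewrite dhM. Qed.
Lemma al_plot n (U : set 'rV[R]_n) (g : 'rV[R]_n -> PeG_B G) (x : 'rV[R]_n -> EB) :
  plot U g -> plot U x -> plot U (fun u => al (g u) (x u)).
Proof. by move=> gP xP; exact: (ba_smooth ba (plot_pair gP xP)). Qed.
Lemma al_smooth g : smooth (al g).
Proof. by move=> n U q qP; apply: al_plot => //; exact: plot_cst (plot_open qP). Qed.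
Definition al_hom g : diffHom EB EB := DiffHom (@al_smooth g) (ba_morph ba g).
Lemma conj_smooth (x : EB) : smooth (fun y => x * y * x^-1)%g.
Proof. by apply: smoothM; [apply: smoothM => //|]; exact: smooth_cst. Qed.
Lemma conj_hom_M (x y z : EB) : (x * (y * z) * x^-1 = (x * y * x^-1) * (x * z * x^-1))%g.
Proof. by rewrite !mulgA mulgVK. Qed.
Definition conj_hom (x : EB) : diffHom EB EB := DiffHom (@conj_smooth x) (conj_hom_M x).
Lemma al_proj x y : p (al (tB x) y) = (p x * p y * (p x)^-1)%g.
Proof. by apply: sub_ofP; exact: (ba_cover ba). Qed.
Lemma conj_proj x y : p (x * y * x^-1)%g = (p x * p y * (p x)^-1)%g.
Proof. by rewrite !dhM dhV. Qed.

(* The difference of two curves with the same projection is central, hence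
   fixed by the action. *)
Lemma al_same_proj g (c c' : R -> EB) : curve_at_1 c -> curve_at_1 c' ->
  (forall t, p (c t) = p (c' t)) ->
  cen (fun t => al g (c t)) - cen (fun t => al g (c' t)) = cen c - cen c'.
Proof.
move=> cc cc' cE.
have z1 t : p (c t * (c' t)^-1)%g = 1%g by rewrite dhM dhV cE mulgV.
have cz := curveM cc (curveV cc').
have alz t : al g (c t * (c' t)^-1)%g = (c t * (c' t)^-1)%g.
  by have /ce_exact[z ->] := z1 t; exact: (ba_U1 ba).
have ca := curve_hom (al_hom g) cc'.
have E1 : (fun t => al g (c t)) = (fun t => (c t * (c' t)^-1) * al g (c' t))%g.
  by apply/funext => t; rewrite -{1}alz -(ba_morph ba) mulgVK.
rewrite E1 (la_add la cz ca) (la_add la cc (curveV cc')) (cenV la cc').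
lra.
Qed.

(** The action of [tB x] and conjugation by [x] agree after projection, so on tangent vectors they
    can differ only in the central component; the defect is this difference. *)
Definition defect (x : EB) (c : R -> EB) : R :=
  cen (fun t => al (tB x) (c t)) - cen (fun t => x * c t * x^-1)%g.
(** Replacing [al (tB y)] by conjugation by [y] inside [al (tB x)] changes the curve by a central
    one, which the action fixes; [al_same_proj] accounts for it. *)
Lemma defectM x y c : curve_at_1 c -> defect (x * y)%g c = defect y c + defect x (fun t => y * c t * y^-1)%g.
Proof.
move=> cc; have cy := curve_hom (conj_hom y) cc; have ca := curve_hom (al_hom (tB y)) cc.
have := al_same_proj (tB x) ca cy (fun t => etrans (al_proj y (c t)) (esym (conj_proj y (c t)))).
rewrite /defect tBM.
rewrite (_ : (fun t => al (tB x * tB y)%g (c t)) = (fun t => al (tB x) (al (tB y) (c t)))); last first.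
  by apply/funext => t; rewrite (ba_actM ba).
rewrite (_ : (fun t => x * y * c t * (x * y)^-1)%g = (fun t => x * (y * c t * y^-1) * x^-1)%g); last first.
  by apply/funext => t; rewrite invgM !mulgA.
rewrite /=; lra.
Qed.
Lemma defect1 x c : p x = 1%g -> defect x c = 0.
Proof.
move=> x1; rewrite /defect x1 (_ : ob_path 1%g = 1%g)//.
rewrite (_ : (fun t => x * c t * x^-1)%g = (fun t => al 1%g (c t))) ?subrr//.
by apply/funext => t; rewrite (ba_act1 ba) (ce_ker_central _ x1) mulgK.
Qed.
Lemma defect_proj x y c : curve_at_1 c -> p x = p y -> defect x c = defect y c.
Proof.
move=> cc xy; rewrite -(mulgVK y x) (defectM (x * y^-1)%g y cc) (@defect1 (x * y^-1)%g) ?addr0//.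
by rewrite dhM dhV xy mulgV.
Qed.

Lemma defect_derive (y c : R -> EB) : curve_at_1 y -> curve_at_1 c ->
  is_derive (0 : R) 1 (fun s => defect (y s) c) 0.
Proof.
move=> cy cc.
have cP : curve_at_1 (fun s => tB (y s)).
  by have [s1 y1] := curve_hom p cy; split=> //; rewrite y1.
have [_ D1] := ba_inf ba cP cc; have [_ D2] := la_bracket la cy cc.
have := is_deriveB D1 D2; rewrite subrr; exact.
Qed.

(* The derivatives prescribed by ba_inf and la_bracket are the same cocycle, so
   the defect is locally constant along curves in x. *)
Lemma defect0 x c : curve_at_1 c -> defect x c = 0.
Proof.
move=> cc.
suff H f : forall x c, p x = f -> curve_at_1 c -> defect x c = 0 by exact: (H (p x)).
apply: (loops_generated C sc (P := fun f => forall x c, p x = f -> curve_at_1 c -> defect x c = 0)).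
  move=> f1 g Hf Hg {}x {}c xE {}cc.
  have [x1 x1E] := ls_surj (ce_local_sections EB) f1.
  have cy := curve_hom (conj_hom (x1^-1 * x)%g) cc.
  rewrite -(mulVKg x1 x) (defectM x1 _ cc) (Hf _ _ x1E cy) addr0.
  by rewrite Hg// dhM dhV x1E xE mulKg.
move=> g sg g0 {}x {}c xE {}cc.
(* An arbitrary pointwise lift is enough here: by [defect_proj] the defect depends on the projection
   only, so near each time [l] may be exchanged for a smooth lift. *)
have [l lE] := choice (ls_surj (ce_local_sections EB)).
pose h t := defect (l (g t)) c.
have D t0 : is_derive (t0 : R) 1 h 0.
  have cg : curve_at_1 (fun t => g (t0 + t) * (g t0)^-1)%g.
    split; last by rewrite addr0 mulgV.
    by apply: smoothM; [exact: smooth_translate|exact: smooth_cst].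
  have [y [cy yE]] := curve_lift (ce_local_sections EB) cg.
  pose c' t := (l (g t0) * c t * (l (g t0))^-1)%g.
  have cc' : curve_at_1 c' := curve_hom (conj_hom (l (g t0))) cc.
  have Dy := is_deriveD (is_derive_cst (h t0) (0 : R) (1 : R)) (defect_derive cy cc').
  rewrite addr0 in Dy.
  have E : \forall t \near (0 : R), h (t0 + t) = h t0 + defect (y t) c'.
    apply: filterS yE => t yt; rewrite /h -defectM//; apply: defect_proj => //.
    by rewrite dhM yt !lE mulgVK.
  apply: is_derive_shift; apply: near_eq_is_derive Dy => //.
  by apply: filterS E => t ->.
rewrite (@defect_proj x (l (g 1))) ?lE// -/(h 1).
rewrite (is_derive_0_is_cst (f := h) 1 0 D) /h defect1// lE; exact: g0.
Qed.

(** For fixed [x] the quotient of the two sides is a character of the extension that is trivial on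
    U(1), hence a character of based loops. Its derivative at 1 is the defect, which vanishes. *)
Lemma bcss_peiffer x y : al (tB x) y = (x * y * x^-1)%g.
Proof.
pose f y := (al (tB x) y * (x * y * x^-1)^-1)%g.
have f1 z : p (f z) = 1%g by rewrite dhM dhV al_proj conj_proj mulgV.
have fM z w : f (z * w)%g = (f z * f w)%g.
  have E : f (z * w)%g = (al (tB x) z * f w * (x * z * x^-1)^-1)%g.
    by rewrite /f (ba_morph ba) conj_hom_M invgM !mulgA.
  by rewrite E -mulgA (ce_ker_central _ (f1 w)) mulgA.
have sf : smooth f.
  by apply: smoothM; [exact: al_smooth|apply: smoothV; exact: conj_smooth].
have [chi chiE] := ce_char sf f1 fM.
have [chi' chi'E] : exists chi' : diffHom (OmegaG_B G) (U1 R), forall z, chi' (p z) = chi z.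
  apply: descend; first exact: ce_local_sections.
  move=> z /ce_exact[w ->]; apply: (@ce_inj _ _ EB).
  by rewrite -chiE dh1 /f (ba_U1 ba) -ce_central mulgK mulgV.
suff H g : chi' g = 1%g.
  have := chiE y; rewrite -chi'E H dh1 /f => E.
  by rewrite -[LHS](mulgVK (x * y * x^-1)%g) E mul1g.
apply: (loops_generated C sc (P := fun g => chi' g = 1%g)) => [u v u1 v1|c sm c0]; first by rewrite dhM u1 v1 mulg1.
rewrite (char_const sm) ?c0 ?dh1// => h ch.
have [d [cd dE]] := curve_lift (ce_local_sections EB) ch.
rewrite -(cen0_derive la (z := fun t => chi (d t))).
- by apply: derive1_near; apply: filterS dE => t <-; rewrite chi'E.
- exact: curve_hom.
have := defect0 x cd; rewrite /defect.
have cI := curve_hom (ce_inc EB) (curve_hom chi cd).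
rewrite (_ : (fun t => al (tB x) (d t)) = (fun t => ce_inc EB (chi (d t)) * (x * d t * x^-1))%g).
  by rewrite (la_add la cI (curve_hom (conj_hom x) cd)) addrK.
by apply/funext => t; rewrite -chiE /f mulgVK.
Qed.

Lemma X_BCSS_crossed_module : crossed_module (X_BCSS al).
Proof.
split.
- split; last by move=> x y; exact: tBM.
  by move=> n U q qP; exact: (@dh_smooth _ _ _ p _ _ _ qP).
- exact: (ba_smooth ba).
- exact: (ba_act1 ba).
- exact: (ba_actM ba).
- exact: (ba_morph ba).
- exact: (ba_cover ba).
- exact: bcss_peiffer.
Qed.
End BCSSPeiffer.

(** * Extensions of a given level *)

Section PartB.
Context {R : realType} {G : lieType R} (C : id_chart G) (k : int) (b : 'M[R]_(ldim G)).
Context (EB : centralExt (OmegaG_B G)) (cen : (R -> EB) -> R) (al : PeG_B G -> EB -> EB).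
Context (E : centralExt (OmegaG G)) (L : level_iso E EB).
Hypotheses (la : lie_algebra_ext C b k cen) (ba : bcss_action C b k cen al)
  (sc : simply_connected R (Dtop G)) (si : simple_lie C).
Let p0 : 0 < (pi : R) := pi_gt0 R.
Notation l := (pi *+ 2 : R).
Let l0 : 0 < l. Proof. by rewrite mulrn_wgt0. Qed.
Notation pE := (ce_proj E). Notation p := (ce_proj EB).
Notation XO := (X_Omega pE). Notation XB := (X_BCSS al).
Notation under := (preim_hom pE (half_sg G)).

Let kcE : ker_central pE := @ce_ker_central _ _ E.
Let lsE : local_sections pE := @ce_local_sections _ _ E.

Lemma Ehalf_character_trivial (chi : diffHom (Ehalf pE) (U1 R)) :
  (forall h z, eh_val h = ce_inc E z -> chi h = 1%g) -> forall h, chi h = 1%g.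
Proof.
move=> chi1 h.
have [chi' <-] : exists chi' : diffHom (sub_of (half_sg G)) (U1 R), forall h, chi' (under h) = chi h.
  apply: (@descend _ _ _ _ under); first exact: preim_local_sections.
  by move=> x /(congr1 (@sgval _ _ _)) /= /ce_exact[z zE]; exact: chi1 zE.
exact: (half_character_trivial chi' la sc si).
Qed.

(** The commutator of a half lift with [y] projects to 1, since on each half of the circle one of
    the two loops is trivial. Being central it is multiplicative in the half lift, so it is a
    character that kills U(1). *)
Lemma level_halves_commute : halves_commute pE.
Proof.
move=> x y xh y1.
pose f (h : Ehalf pE) : E := (eh_val h * y * (eh_val h)^-1 * y^-1)%g.
have f1 h : pE (f h) = 1%g.
  rewrite !dhM !dhV; apply: sub_ofP; apply: loop_ext => s /andP[s0 s1].
  have [sp|sp] := lerP s pi.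
    have Y : ev (oloop (pE y)) s = 1%g by apply: y1; rewrite s0.
    transitivity (ev (oloop (pE (eh_val h))) s * ev (oloop (pE y)) s * (ev (oloop (pE (eh_val h))) s)^-1 * (ev (oloop (pE y)) s)^-1)%g => //.
    by rewrite Y mulg1 mulgV invg1 mulg1.
  have H : ev (oloop (pE (eh_val h))) s = 1%g by apply: (sgvalP h); apply: not_arc; rewrite (ltW sp).
  transitivity (ev (oloop (pE (eh_val h))) s * ev (oloop (pE y)) s * (ev (oloop (pE (eh_val h))) s)^-1 * (ev (oloop (pE y)) s)^-1)%g => //.
  by rewrite H mul1g invg1 mulg1 mulgV.
have fM h h' : f (h * h')%g = (f h * f h')%g.
  have E1 : f (h * h')%g = (eh_val h * (f h' * y) * (eh_val h)^-1 * y^-1)%g.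
    by rewrite /f -[eh_val (h * h')%g]/(eh_val h * eh_val h')%g invgM !mulgA mulgVK.
  rewrite E1 -(kcE _ (f1 h')) !mulgA (kcE _ (f1 h')).
  by rewrite /f !mulgA.
have sf : smooth f.
  move=> n U q qP; have qP' : plot U (fun u => eh_val (q u)) by exact: qP.
  have yP := plot_cst y (plot_open qP).
  have yV := plot_cst (y^-1)%g (plot_open qP).
  exact: (@plotM R E n U _ _ (@plotM R E n U _ _ (@plotM R E n U _ _ qP' yP) (@plotV R E n U _ qP')) yV).
have [chi chiE] := ce_char sf f1 fM.
pose h : Ehalf pE := SubOf (xh : preim_sg pE (half_sg G) x).
have := chiE h; rewrite Ehalf_character_trivial ?dh1 => [|h' z zE].
  rewrite /f -[eh_val h]/x => E1; have := congr1 (fun w => w * y * x)%g E1.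
  by rewrite mulgVK mulgVK mul1g.
by apply: (@ce_inj _ _ E); rewrite -chiE /f zE ce_central mulgK mulgV dh1.
Qed.

Lemma level_crossed_module : crossed_module XO.
Proof. by apply: X_Omega_crossed_module => //; exact: level_halves_commute. Qed.

Lemma rtilde_proj h : p (rtilde L h) = rmap G (under h).
Proof. by rewrite -(lv_cover L h); exact/esym/(sgvalP (lv_fun L h)). Qed.
Lemma rtildeM x y : rtilde L (x * y)%g = (rtilde L x * rtilde L y)%g.
Proof. by rewrite /rtilde dhM. Qed.
Lemma rtilde_smooth : smooth (rtilde L).
Proof. by move=> n U q qP; have [] : plot U (fun u => sgval (lv_fun L (q u))) := @dh_smooth _ _ _ (lv_fun L) _ _ _ qP. Qed.
Lemma rep_smooth : smooth (@rep R G).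
Proof. by move=> n U q qP; apply: plot_sub_of; exact: (reparam_smooth (p := fun u => pe_path (q u))). Qed.
Lemma repM g h : rep (g * h)%g = (rep g * rep h)%g :> PeG_B G.
Proof. by apply: sub_ofP; apply: cmapP. Qed.
Lemma rep_t h : ob_path (p (rtilde L h)) = rep (X_t h).
Proof. by rewrite rtilde_proj; apply: sub_ofP; apply: cmapP. Qed.

(** Both sides lie over the same based loop, so their quotient is central and multiplicative in [h]:
    a character of half lifts, trivial on U(1) because both actions fix central elements. *)
Lemma rtilde_act g h : rtilde L (X_act g h) = al (rep g) (rtilde L h).
Proof.
have cX := level_crossed_module.
pose f h := (rtilde L (X_act g h) * (al (rep g) (rtilde L h))^-1)%g.
have f1 x : p (f x) = 1%g.
  rewrite dhM dhV; have -> : p (al (rep g) (rtilde L x)) = p (rtilde L (X_act g x)).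
    apply: sub_ofP; rewrite [LHS](ba_cover ba) rep_t [RHS]rep_t.
    by rewrite [X_t (X_act g x)](xm_equiv cX g x) repM repM; congr (_ * _ * _)%g; exact/esym/(dhV (DiffHom rep_smooth repM)).
  by rewrite mulgV.
have fM x y : f (x * y)%g = (f x * f y)%g.
  have E1 : f (x * y)%g = (rtilde L (X_act g x) * f y * (al (rep g) (rtilde L x))^-1)%g.
    by rewrite /f [X_act g (x * y)%g](xm_morph cX) !rtildeM (ba_morph ba) invgM !mulgA.
  by rewrite E1 -mulgA (ce_ker_central _ (f1 y)) mulgA.
have sf : smooth f.
  have s1 : smooth (fun x => rtilde L (X_act g x)).
    apply: smooth_comp rtilde_smooth => n U q qP.
    exact: (xm_smooth cX (plot_pair (plot_cst g (plot_open qP)) qP)).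
  have s2 : smooth (fun x => al (rep g) (rtilde L x)) by exact: smooth_comp rtilde_smooth (al_smooth ba _).
  exact: smoothM s1 (smoothV s2).
have [chi chiE] := ce_char sf f1 fM.
have := chiE h; rewrite Ehalf_character_trivial ?dh1 => [E1|x z zE].
  by rewrite /f in E1; rewrite -[LHS](mulgVK (al (rep g) (rtilde L h))) E1 mul1g.
apply: (@ce_inj _ _ EB); rewrite -chiE /f dh1.
(* Over U(1) the lift is central, and conjugation by any lift of [dbl g] fixes it. *)
have -> : X_act g x = x.
  apply: ehalf_eq; have [a pa] := ls_surj lsE (dbl g).
  by rewrite (X_act_lift kcE lsE x pa) zE -ce_central mulgK.
by rewrite [rtilde L x](lv_U1 L zE) (ba_U1 ba) mulgV.
Qed.

Lemma rtilde_strict_hom : strict_hom (X := XO) (Y := XB) (rtilde L) (@rep R G).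
Proof.
split.
- by split; [exact: rtilde_smooth|exact: rtildeM].
- by split; [exact: rep_smooth|exact: repM].
- exact: rep_t.
- exact: rtilde_act.
Qed.

Lemma flatten_itv (x : segment (pi : R)) : 0 <= sitting_reparam l (sval x) <= l.
Proof. exact: sitting_reparam_itv (ltW l0). Qed.
Definition flatten_seg x : segment l := Lseg (flatten_itv x).
Lemma flatten_smooth : smooth flatten_seg.
Proof.
by move=> n U q qP; have qP' : plot U (fun u => sval (q u) : R) := qP; exact: (sitting_reparam_plot l qP').
Qed.
Lemma flatten_gsm (g : PeG_B G) : smooth (fun x : segment (pi : R) => pb_path g (flatten_seg x)).
Proof. exact: smooth_comp flatten_smooth (cmap_smooth (pb_path g)). Qed.
Lemma flatten_Psi (g : PeG_B G) : Psi_sg G (CMap (flatten_gsm g)).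
Proof.
split=> [x x0|].
  by apply: (sgvalP g); rewrite /= sitting_reparam0// x0 divr_ge0// ltW.
exists (pi / 3); split=> [|x y xp yp|x y xp yp] /=; first by rewrite divr_gt0.
  by congr (pb_path g _); apply: Lseg_eq; rewrite /= !sitting_reparam0.
by congr (pb_path g _); apply: Lseg_eq; rewrite /= !sitting_reparam1//; [move: yp|move: xp]; lra.
Qed.
Definition flatten_path (g : PeG_B G) : PeG G := incl0 (SubOf (flatten_Psi g)).
Lemma flatten_path_smooth : smooth flatten_path.
Proof.
move=> n U q [oU Hq]; apply: plot_sub_of; split=> // m V a c oV aC aU Vc.
by apply: (Hq m V a (fun v => flatten_seg (c v))) => //; exact: flatten_smooth.
Qed.
Lemma flatten_end (g : PeG_B G) : OB_sg G (g * (rep (flatten_path g))^-1)%g.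
Proof.
move=> x xl; rewrite [LHS]/= -/(pb_path g).
have -> : flatten_seg (halved x) = x.
  by apply: Lseg_eq; rewrite /= xl sitting_reparam1//; move: p0; rewrite -mulr_natl; lra.
by rewrite mulgV.
Qed.
Definition flatten_loop g : OmegaG_B G := SubOf (flatten_end g).
Lemma flatten_loop_smooth : smooth flatten_loop.
Proof.
move=> n U q qP; apply: plot_sub_of; apply: plotM => //; apply: plotV.
by apply: rep_smooth; exact: flatten_path_smooth.
Qed.

Lemma bj_rep_local_sections : local_sections (bj (X := XO) (Y := XB) (@rep R G)).
Proof.
move=> g; have [W [s [oW Wg sW sE]]] := ls_pullback g (@ce_local_sections _ _ EB) flatten_loop_smooth.
exists W, (fun g => (s g, flatten_path g)); split=> //.
  by move=> n U q Uq qW; apply: plot_pair; [exact: sW|exact: flatten_path_smooth].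
by move=> y Wy; rewrite /bj /= sE//= mulgVK.
Qed.

Notation ker_j z := (bj (X := XO) (Y := XB) (@rep R G) z = 1%g).

Lemma ker_j_rep (z : xH XB * xK XO) : ker_j z -> rep z.2 = ob_path (p (z.1^-1)%g).
Proof.
rewrite dhV -[LHS]/(ob_path (p z.1) * rep z.2)%g => H.
by rewrite -[LHS](mulKg (ob_path (p z.1))) H mulg1.
Qed.
Lemma ker_j_end (z : xH XB * xK XO) : ker_j z -> arc_sg z.2.
Proof.
move=> /ker_j_rep H x xp.
have lP : 0 <= l <= l by rewrite lexx ltW.
have := congr1 (fun g : PeG_B G => pb_path g (Lseg lP)) H.
rewrite -[LHS]/(pe_path z.2 (halved (Lseg lP))) -[RHS]/(obv (p (z.1^-1)%g) (Lseg lP)) obv_end; last by right.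
by move=> <-; congr (pe_path z.2 _); apply: eq_sig_hprop => [y|/=]; [exact: Prop_irrelevance|by rewrite xp; lra].
Qed.
Definition ker_j_arc z : sub_of (@arc_sg R G) :=
  match pselect (ker_j z) with left h => SubOf (ker_j_end h) | right _ => 1%g end.
Lemma ker_j_arcE z : ker_j z -> sgval (ker_j_arc z) = z.2.
Proof. by rewrite /ker_j_arc; case: pselect. Qed.
(** In the kernel of [bj] the path component ends at 1 and so defines a half loop, and the inverse
    of the other component lies over its reparametrization. Such a pair is a point of the pullback
    extension, where the inverse of the level isomorphism can be applied. *)
Lemma ker_j_pullback z : ker_j z -> pullback_sg (rmap G) p (arc (ker_j_arc z), (z.1^-1)%g).
Proof.
move=> zj; rewrite -[sg_set _ _]/(rmap G (arc (ker_j_arc z)) = p (z.1^-1)%g).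
apply: sub_ofP; rewrite -[RHS](ker_j_rep zj) -(ker_j_arcE zj); apply: sub_ofP; apply: cmapP => x.
exact: (hev_arc (ker_j_arc z) (halved x)).
Qed.
Definition kappa_inv_level (z : xH XB * xK XO) : xH XO :=
  match pselect (ker_j z) with left h => lv_inv L (SubOf (ker_j_pullback h)) | right _ => 1%g end.
Lemma kappa_inv_levelE z : ker_j z -> sgval (lv_fun L (kappa_inv_level z)) = (arc (ker_j_arc z), (z.1^-1)%g).
Proof. by rewrite /kappa_inv_level; case: pselect => // h _; rewrite lv_invK. Qed.

Lemma rtilde_weak_equivalence : weak_equivalence (X := XO) (Y := XB) (rtilde L) (@rep R G).
Proof.
apply: (weak_equivalence_of_sections level_crossed_module (X_BCSS_crossed_module la ba sc)
  rtilde_strict_hom (delta := kappa_inv_level)).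
- exact: bj_rep_local_sections.
- move=> n U q [q1 q2] qj.
  have fP : plot U (fun u => lv_fun L (kappa_inv_level (q u))).
    apply: plot_sub_of; apply: (plot_eq (p := fun u => (arc (ker_j_arc (q u)), ((q u).1^-1)%g))).
      by move=> u Uu; rewrite kappa_inv_levelE//; exact: qj.
    apply: plot_pair; last exact: (@plotV R EB n U _ q1).
    apply: (@dh_smooth _ _ _ (arc : diffHom _ _)); apply: plot_sub_of.
    by apply: (plot_eq _ q2) => u Uu /=; rewrite ker_j_arcE//; exact: qj.
  apply: (plot_eq _ (@dh_smooth _ _ _ (lv_inv L) _ _ _ fP)) => u _ /=.
  exact: lv_funK.
- move=> z zj; have H := kappa_inv_levelE zj; case: z zj H => a g zj H; congr (_, _).
    by rewrite /rtilde H invgK.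
  rewrite [LHS](@X_t_arc _ _ _ _ _ (ker_j_arc (a, g))) ?ker_j_arcE//.
  by have := lv_cover L (kappa_inv_level (a, g)); rewrite H => /(congr1 (@sgval _ _ _)) /= ->.
move=> h h' [H1 H2].
have U : under h = under h'.
  apply: half_eq => x; exact: (congr1 (fun g => g x) H2).
rewrite -(lv_funK L h) -(lv_funK L h'); congr (lv_inv L _); apply: sub_ofP.
have F1 := lv_cover L h; have F2 := lv_cover L h'; rewrite -U -F1 in F2.
have G1 : (sgval (lv_fun L h)).2 = (sgval (lv_fun L h')).2 by exact: invg_inj H1.
by move: F2 G1; case: (sgval (lv_fun L h)) => x y; case: (sgval (lv_fun L h')) => x' y' /= -> ->.
Qed.
End PartB.

Theorem theorem1p3 (R : realType) :
  (forall (G : lieType R) (E : centralExt (LG G))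
      (lam : PeG_si G -> PeG_si G -> PeG_si G -> E -> E -> E)
      (i : diffHom (PeG_si G) E) (hi : doubles (E := E) i),
    connected [set: Dtop G] ->
    disjoint_commutative E ->
    fusion_product lam -> multiplicative_fusion lam -> neutral_for lam i ->
    [/\ crossed_module (X_W hi),
        crossed_module (X_Omega (OmegaE_proj E)),
        strict_hom (X := X_W hi) (Y := X_Omega (OmegaE_proj E))
          (@incl1 R G E) (@incl0 R G) &
        weak_equivalence (X := X_W hi) (Y := X_Omega (OmegaE_proj E))
          (@incl1 R G E) (@incl0 R G)]) /\
  (forall (G : lieType R) (C : id_chart G) (k : int) (b : 'M[R]_(ldim G))
      (EB : centralExt (OmegaG_B G)) (cen : (R -> EB) -> R)
      (al : PeG_B G -> EB -> EB)
      (E : centralExt (OmegaG G)) (L : level_iso E EB),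
    compact [set: Dtop G] -> connected [set: Dtop G] ->
    simple_lie C -> simply_connected R (Dtop G) ->
    basic_form C b ->
    lie_algebra_ext C b k cen ->
    bcss_action C b k cen al ->
    [/\ crossed_module (X_Omega (ce_proj E)),
        crossed_module (X_BCSS al),
        strict_hom (X := X_Omega (ce_proj E)) (Y := X_BCSS al)
          (rtilde L) (@rep R G) &
        weak_equivalence (X := X_Omega (ce_proj E)) (Y := X_BCSS al)
          (rtilde L) (@rep R G)]).
Proof.
split=> [G E lam i hi _ dc _ _ _|G C k b EB cen al E L _ _ si sc _ la ba].
  split.
  - exact: X_W_crossed_module.
  - exact: disjoint_commutative_crossed_module.
  - exact: incl_strict_hom.
  - exact: incl_weak_equivalence.
split.
- exact: level_crossed_module la sc si.
- exact: X_BCSS_crossed_module la ba sc.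
- exact: rtilde_strict_hom la ba sc si.
- exact: rtilde_weak_equivalence la ba sc si.
Qed.
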